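(* Let the standing hypotheses stated in the context hold, together with Assumptions A, B and C of the context. Then the error on the approximate drift and diffusion coefficients decreases faster than any negative power of $d$, uniformly in $x$: for every $s\in\mathbf N$ there exists a constant $D(s)$ such that, for all integers $d\ge1$, $$\sup_{x\in\mathbf R^m}\ |\boldsymbol F_d(x)-\boldsymbol F(x)|\ \vee\ |\boldsymbol A_d(x)\boldsymbol A_d(x)^T-\boldsymbol A(x)\boldsymbol A(x)^T|\ \le\ D(s)\,d^{-s},$$ where $a\vee b=\max(a,b)$.
   Context: Setting. Consider the fast/slow system $dX^\varepsilon_t=\frac1\varepsilon \boldsymbol f(X^\varepsilon_t,Y^\varepsilon_t)\,dt+\boldsymbol\alpha(X^\varepsilon_t,Y^\varepsilon_t)\,dW_{xt}$, $dY^\varepsilon_t=-\frac1{\varepsilon^2}\nabla V(Y^\varepsilon_t)\,dt+\frac{\sqrt2}{\varepsilon}\,dW_{yt}$, with $\boldsymbol f:\mathbf R^m\times\mathbf R^n\to\mathbf R^m$, $\boldsymbol\alpha:\mathbf R^m\times\mathbf R^n\to\mathbf R^{m\times p}$, $V:\mathbf R^n\to\mathbf R$. $|\cdot|$ is the Euclidean norm for vectors and the Frobenius norm for matrices. $\mathbf N$ contains $0$. Standing hypotheses. (i) $V\in C^\infty(\mathbf R^n)$, $\lim_{|y|\to\infty}V(y)=\infty$, $e^{-V}\in L^1(\mathbf R^n)$, normalized so that $\int e^{-V}dy=1$. (ii) $\lim_{|y|\to\infty}\nabla V(y)\cdot y=\infty$ and $\lim_{|y|\to\infty}W(y)=\infty$,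 where $W:=\frac14|\nabla V|^2-\frac12\Delta V$. (iii) $\boldsymbol f\in(C^\infty(\mathbf R^m\times\mathbf R^n))^m$; $\int_{\mathbf R^n}\boldsymbol f(x,y)e^{-V(y)}dy=0$ for all $x$; and there is a polynomial $q$ with $|\boldsymbol f(x,y)|\le q(y)$ for all $x,y$. (iv) $|\boldsymbol f(x,y)-\boldsymbol f(x',y)|+|\boldsymbol\alpha(x,y)-\boldsymbol\alpha(x',y)|\le C(y)|x-x'|$ for some function $C(y)$. (v) $|\boldsymbol f(x,y)|\le K(1+|x|)(1+|y|^{m_1})$, $|\nabla_x\boldsymbol f(x,y)|+|\nabla_x^2\boldsymbol f(x,y)|\le K(1+|y|^{m_2})$, $|\boldsymbol\alpha(x,y)|\le K(1+|x|^{1/2})(1+|y|^{m_3})$ for some positive integers $m_1,m_2,m_3$ and $K>0$. Assumption A. $W$ is bounded from above by a polynomial of degree $4k$ for some $k\in\mathbf N$, and for every multi-index $\alpha$ there exist $c_\alpha>0$, $\mu_\alpha\in\mathbf R$ with $|\partial_y^\alpha V(y)|\le c_\alpha e^{\mu_\alpha|y|}$. Assumption B. Let $E(\mathbf R^n)$ be the set of $g\in L^2(\mathbf R^n)\cap C^\infty(\mathbf R^n)$ with $\int g(y)^2e^{\nu|y|}dy<\infty$ for all $\nu\in\mathbf R$. For all $\alpha\in\mathbf N^n$ and $x\in\mathbf R^m$, $e^{-V/2}\partial_y^\alpha\boldsymbol f(x,\cdot)\in(E(\mathbf R^n))^m$ and $e^{-V/2}\partial_y^\alpha\nabla_x\boldsymbol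 f(x,\cdot)\in(E(\mathbf R^n))^{m\times m}$. Assumption C. For all $\alpha\in\mathbf N^n$ there exist $C_\alpha>0$ and $\ell_\alpha\in\mathbf N$ (independent of $x$) with $|\partial_y^\alpha\boldsymbol f|+|\partial_y^\alpha\nabla_x\boldsymbol f|\le C_\alpha(1+|y|^{\ell_\alpha})$; and $|\boldsymbol\alpha(x,y)|\le K(1+|y|^{m_3})$ with $K,m_3$ independent of $x$. Poisson equation. Write $\boldsymbol f^x=\boldsymbol f(x,\cdot)$. For each $x$, $\boldsymbol\phi^x=\boldsymbol\phi(x,\cdot)$ is the unique smooth-in-$y$ solution, locally bounded and growing at most polynomially in $y$, of $-(\Delta_y-\nabla_yV\cdot\nabla_y)\phi_i(x,y)=f_i(x,y)$, $i=1,\dots,m$, with $\int\boldsymbol\phi(x,y)e^{-V(y)}dy=0$. Exact coefficients. $\boldsymbol F(x)=\int_{\mathbf R^n}\nabla_x\boldsymbol\phi(x,y)\,\boldsymbol f(x,y)\,e^{-V(y)}dy$ (i.e. $F_i=\sum_j\int\partial_{x_j}\phi_i\,f_j\,e^{-V}dy$), $\boldsymbol D(x)=\int_{\mathbf R^n}\left(\boldsymbol\alpha\boldsymbol\alpha^T+\boldsymbol f\otimes\boldsymbol\phi+\boldsymbol\phi\otimes\boldsymbol f\right)(x,y)\,e^{-V(y)}dy$, and $\boldsymbol A(x)$ is a matrix with $\boldsymbol A(x)\boldsymbol A(x)^T=\boldsymbol D(x)$. Galerkin approximation. On $H^1(\mathbf R^n,\mathcal H)=\{u\in H^1(\mathbf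 R^n):\int|W|u^2dy<\infty\}$ set $a(u,v)=\int\nabla u\cdot\nabla v+W\,u\,v\,dy$. Fix $\mu\in\mathbf R^n$ and a symmetric positive definite $\Sigma=QDQ^T$ ($D$ diagonal, $Q$ orthogonal), $S=QD^{1/2}$. Let $H_r(s)=\frac{(-1)^r}{\sqrt{r!}}e^{s^2/2}\frac{d^r}{ds^r}e^{-s^2/2}$, $H_\alpha(y;\mu,\Sigma)=\prod_{k=1}^nH_{\alpha_k}\big((S^{-1}(y-\mu))_k\big)$ and $e_\alpha(y)=h_\alpha(y;\mu,\Sigma)=\sqrt{G_{(\mu,\Sigma)}(y)}\,H_\alpha(y;\mu,\Sigma)$, where $G_{(\mu,\Sigma)}$ is the Gaussian density with mean $\mu$ and covariance $\Sigma$; the $e_\alpha$ are orthonormal in $L^2(\mathbf R^n)$. Let $\hat S_d=\mathrm{span}\{e_\alpha\}_{|\alpha|\le d}$. $\boldsymbol\psi_d^x=\sum_{|\alpha|\le d}\boldsymbol\psi^x_\alpha e_\alpha$ is a solution of $a(\psi^x_{di},v_d)=\int f_i^x\,v_d\,e^{-V/2}dy$ for all $v_d\in\hat S_d$, $i=1,\dots,m$; and $\nabla_x\boldsymbol\psi^x_d=\sum_{|\alpha|\le d}(\nabla_x\boldsymbol\psi^x)_\alpha e_\alpha$ denotes the matrix-valued function with entries in $\hat S_d$ obtained by solving the same problem with $f_i^x$ replaced by the entries of $\nabla_x\boldsymbol f^x$. Solutions are possibly unique only up to elements of the kernel of $a$, which does not affect the coefficients below. Approximate coefficients. With $\boldsymbol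 f^x_\alpha=\int\boldsymbol f^x\,e_\alpha\,e^{-V/2}dy$ and $\langle\cdot,\cdot\rangle_0$ the $L^2(\mathbf R^n)$ inner product: $\boldsymbol F_d(x)=\sum_{|\alpha|\le d}\sum_{|\beta|\le d}\langle e_\alpha,e_\beta\rangle_0\,(\nabla_x\boldsymbol\psi^x)_\alpha\cdot\boldsymbol f^x_\beta$ (matrix–vector product), $\boldsymbol A_{0d}(x)=\sum_{|\alpha|\le d}\sum_{|\beta|\le d}\langle e_\alpha,e_\beta\rangle_0\,\boldsymbol\psi^x_\alpha\otimes\boldsymbol f^x_\beta$, $\boldsymbol D_d(x)=\int\boldsymbol\alpha\boldsymbol\alpha^T(x,y)e^{-V(y)}dy+\boldsymbol A_{0d}(x)+\boldsymbol A_{0d}(x)^T$, and $\boldsymbol A_d(x)$ is a matrix with $\boldsymbol A_d(x)\boldsymbol A_d(x)^T=\boldsymbol D_d(x)$. *)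

(* Defs.v *)
From HB Require Import structures.
From mathcomp Require Import all_boot all_order all_algebra.
From mathcomp Require Import all_classical all_reals all_analysis.
Set Implicit Arguments.
Unset Strict Implicit.
Unset Printing Implicit Defensive.
Import Order.TTheory GRing.Theory Num.Theory.
Import numFieldNormedType.Exports.
Local Open Scope classical_set_scope.
Local Open Scope ring_scope.

(* The n-dimensional Lebesgue measure is the iterated product of the
   one-dimensional one. The library puts the product sigma-algebra on tuples,
   while calculus lives on column vectors: measures are therefore taken on
   n-tuples and functions on R^n are transported along [tuple_col]. *)

Section lebesgue_tuple.
Variable R : realType.
Local Notation RM := (measurableTypeR R).

Definition tcons n (z : RM * n.-tuple RM) : n.+1.-tuple RM :=
  [tuple of z.1 :: z.2].

Lemma measurable_tcons n : measurable_fun setT (@tcons n).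
Proof. exact: measurable_cons. Qed.

Section step.
Variables (n : nat) (mu : {sigma_finite_measure set (n.-tuple RM) -> \bar R}).

Definition lebesgue_succ : set (n.+1.-tuple RM) -> \bar R :=
  pushforward (@lebesgue_measure R \x mu)%E (@tcons n).

Let lebesgue_succ0 : lebesgue_succ set0 = 0%E.
Proof. by rewrite /lebesgue_succ /pushforward preimage_set0 measure0. Qed.

Let lebesgue_succ_ge0 A : (0 <= lebesgue_succ A)%E.
Proof. by apply: integral_ge0 => x _; exact: measure_ge0. Qed.

Let lebesgue_succ_sigma_additive : semi_sigma_additive lebesgue_succ.
Proof.
move=> F mF tF mUF; rewrite /lebesgue_succ /pushforward preimage_bigcup.
apply: measure_semi_sigma_additive.
- by move=> k; rewrite -[X in measurable X]setTI; exact: measurable_tcons.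
- apply/trivIsetP => /= i j _ _ ij; rewrite -preimage_setI.
  by move/trivIsetP : tF => /(_ _ _ _ _ ij) ->//; rewrite preimage_set0.
- rewrite -preimage_bigcup -[X in measurable X]setTI.
  exact: measurable_tcons.
Qed.

HB.instance Definition _ := isMeasure.Build _ _ _ lebesgue_succ
  lebesgue_succ0 lebesgue_succ_ge0 lebesgue_succ_sigma_additive.

Let lebesgue_succ_sigma_finite : sigma_finite setT lebesgue_succ.
Proof.
have /sigma_finiteP[F [TF ndF Foo]] := sigma_finiteT (@lebesgue_measure R).
have /sigma_finiteP[G [TG ndG Goo]] := sigma_finiteT mu.
pose g (t : n.+1.-tuple RM) : RM * n.-tuple RM := (thead t, [tuple of behead t]).
have mg : measurable_fun setT g.
  apply/measurable_fun_pairP; split; first exact: measurable_tnth.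
  exact: measurable_behead.
have gK : cancel (@tcons n) g.
  move=> [a t]; rewrite /g /tcons theadE; congr pair; exact: val_inj.
exists (fun k => g @^-1` (F k `*` G k)).
  apply/esym/seteqP; split=> // t _.
  have : setT (g t).1 by [].
  rewrite TF => -[i _ Fi].
  have : setT (g t).2 by [].
  rewrite TG => -[j _ Gj].
  exists (maxn i j) => //; split.
    by move: Fi; exact/subsetPset/ndF/leq_maxl.
  by move: Gj; exact/subsetPset/ndG/leq_maxr.
move=> k; have [mF Fk] := Foo k; have [mG Gk] := Goo k; split.
  by rewrite -[X in measurable X]setTI; apply: mg => //; exact: measurableX.
rewrite /lebesgue_succ /pushforward -comp_preimage.
rewrite (_ : g \o _ = id); last by apply/funext => z /=; rewrite gK.
by rewrite preimage_id product_measure1E// lte_mul_pinfty// ge0_fin_numE.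
Qed.

HB.instance Definition _ := Measure_isSigmaFinite.Build _ _ _ lebesgue_succ
  lebesgue_succ_sigma_finite.

End step.

Fixpoint lebesgue_tuple n :
    {sigma_finite_measure set (n.-tuple RM) -> \bar R} :=
  match n with
  | 0 => @dirac _ (0.-tuple RM) [tuple] R
  | k.+1 => lebesgue_succ (lebesgue_tuple k)
  end.

Definition tuple_col n (t : n.-tuple RM) : 'cV[R]_n := \col_i tnth t i.

Definition intRn n (g : 'cV[R]_n -> R) : R :=
  \int[lebesgue_tuple n]_(t in setT) g (tuple_col t).

Definition integrableRn n (g : 'cV[R]_n -> R) : Prop :=
  (lebesgue_tuple n).-integrable setT (fun t => (g (tuple_col t))%:E).

Definition measurableRn n (g : 'cV[R]_n -> R) : Prop :=
  measurable_fun setT ((fun t => g (tuple_col t)) : n.-tuple RM -> RM).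

Definition intmxRn n p q (G : 'cV[R]_n -> 'M[R]_(p, q)) : 'M[R]_(p, q) :=
  \matrix_(i, j) intRn (fun y => G y i j).

End lebesgue_tuple.

Section calculus.
Variable R : realType.

(* Euclidean norm of vectors and Frobenius norm of matrices (the canonical norm
   of the library on matrices is the max norm). *)
Definition mnorm p q (M : 'M[R]_(p, q)) : R :=
  Num.sqrt (\sum_i \sum_j M i j ^+ 2).

(* The filter of neighbourhoods of infinity in R^n, i.e. |y| -> oo. *)
Definition at_infty n : set_system 'cV[R]_n :=
  filter_from setT (fun r : R => [set y | r < mnorm y]).

Definition pderiv n (i : 'I_n) (g : 'cV[R]_n -> R) : 'cV[R]_n -> R :=
  fun y => 'D_(delta_mx i 0) g y.

Definition smooth n (g : 'cV[R]_n -> R) : Prop :=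
  forall s : seq 'I_n, let h := foldr (@pderiv n) g s in
    continuous h /\ forall i y, derivable h y (delta_mx i 0).

Definition multi n := {ffun 'I_n -> nat}.

Definition mderiv n (a : multi n) (g : 'cV[R]_n -> R) : 'cV[R]_n -> R :=
  foldr (fun i h => iter (a i) (pderiv i) h) g (enum 'I_n).

Definition mxderiv n p q (a : multi n) (G : 'cV[R]_n -> 'M[R]_(p, q))
    (y : 'cV[R]_n) : 'M[R]_(p, q) :=
  \matrix_(i, j) mderiv a (fun y' => G y' i j) y.

(* The multi-indices a with |a| <= d; each entry of such an a is at most d. *)
Definition midx n d : seq (multi n) :=
  [seq [ffun i => nat_of_ord (a i)]
     | a : {ffun 'I_n -> 'I_d.+1} <- enum {ffun 'I_n -> 'I_d.+1}
     & (\sum_i a i <= d)%N].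

(* Polynomial of degree at most N on R^n, with coefficients c. *)
Definition mpoly_fun n N (c : multi n -> R) (y : 'cV[R]_n) : R :=
  \sum_(a <- midx n N) c a * \prod_i y i 0 ^+ a i.

Definition laplacian n (g : 'cV[R]_n -> R) (y : 'cV[R]_n) : R :=
  \sum_i pderiv i (pderiv i g) y.

Definition grad n (g : 'cV[R]_n -> R) (y : 'cV[R]_n) : 'cV[R]_n :=
  \col_i pderiv i g y.

Definition dot n (u v : 'cV[R]_n) : R := \sum_i u i 0 * v i 0.

Definition gradx m n (g : 'cV[R]_m -> 'cV[R]_n -> 'cV[R]_m)
    (x : 'cV[R]_m) (y : 'cV[R]_n) : 'M[R]_m :=
  \matrix_(i, j) pderiv j (fun x' => g x' y i 0) x.

Definition norm_gradx2 m n (g : 'cV[R]_m -> 'cV[R]_n -> 'cV[R]_m)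
    (x : 'cV[R]_m) (y : 'cV[R]_n) : R :=
  Num.sqrt (\sum_i \sum_j \sum_k
    pderiv k (pderiv j (fun x' => g x' y i 0)) x ^+ 2).

End calculus.

Arguments at_infty {R n}.

Section hypotheses.
Variables (R : realType) (m n p : nat).
Variables (V : 'cV[R]_n -> R).
Variables (f : 'cV[R]_m -> 'cV[R]_n -> 'cV[R]_m).
Variables (alpha : 'cV[R]_m -> 'cV[R]_n -> 'M[R]_(m, p)).

Definition Wpot (y : 'cV[R]_n) : R :=
  mnorm (grad V y) ^+ 2 / 4 - laplacian V y / 2.

Definition hyp_potential : Prop :=
  [/\ smooth V,
      V @ at_infty --> +oo,
      integrableRn (fun y => expR (- V y)) &
      intRn (fun y => expR (- V y)) = 1].

Definition hyp_confining : Prop :=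
  ((fun y => dot (grad V y) y) @ at_infty --> +oo) /\
  (Wpot @ at_infty --> +oo).

Definition hyp_drift : Prop :=
  [/\ forall i, smooth (fun z : 'cV[R]_(m + n) => f (usubmx z) (dsubmx z) i 0),
      forall x, intmxRn (fun y => expR (- V y) *: f x y) = 0 &
      exists N (c : multi n -> R), forall x y, mnorm (f x y) <= mpoly_fun N c y].

(* Borel measurability of alpha(x, .) is what the integral of alpha alpha^T
   against e^{-V} in the effective diffusion presupposes. *)
Definition hyp_diffusion_measurable : Prop :=
  forall x i j, measurableRn (fun y => alpha x y i j).

Definition hyp_lipschitz : Prop :=
  exists C : 'cV[R]_n -> R, forall x x' y,
    mnorm (f x y - f x' y) + mnorm (alpha x y - alpha x' y)
      <= C y * mnorm (x - x').

Definition hyp_growth : Prop :=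
  exists (m1 m2 m3 : nat) (K : R),
    [/\ (0 < m1)%N, (0 < m2)%N, (0 < m3)%N & 0 < K] /\
    forall x y,
    [/\ mnorm (f x y) <= K * (1 + mnorm x) * (1 + mnorm y ^+ m1),
        mnorm (gradx f x y) + norm_gradx2 f x y <= K * (1 + mnorm y ^+ m2) &
        mnorm (alpha x y)
          <= K * (1 + Num.sqrt (mnorm x)) * (1 + mnorm y ^+ m3)].

Definition standing_hypotheses : Prop :=
  [/\ hyp_potential, hyp_confining & hyp_drift] /\
  [/\ hyp_diffusion_measurable, hyp_lipschitz & hyp_growth].

Definition assumptionA : Prop :=
  (exists (k : nat) (c : multi n -> R), forall y, Wpot y <= mpoly_fun (4 * k) c y)
  /\ forall a : multi n, exists c mu : R, 0 < c /\
       forall y, `|mderiv a V y| <= c * expR (mu * mnorm y).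

Definition spaceE (g : 'cV[R]_n -> R) : Prop :=
  [/\ smooth g,
      integrableRn (fun y => g y ^+ 2) &
      forall nu : R, integrableRn (fun y => g y ^+ 2 * expR (nu * mnorm y))].

Definition assumptionB : Prop :=
  forall (a : multi n) (x : 'cV[R]_m),
  (forall i, spaceE (fun y => expR (- V y / 2) * mxderiv a (f x) y i 0)) /\
  (forall i j, spaceE (fun y => expR (- V y / 2) * mxderiv a (gradx f x) y i j)).

Definition assumptionC : Prop :=
  (forall a : multi n, exists (C : R) (l : nat), 0 < C /\
     forall x y, mnorm (mxderiv a (f x) y) + mnorm (mxderiv a (gradx f x) y)
       <= C * (1 + mnorm y ^+ l)) /\
  (exists (K : R) (m3 : nat), [/\ 0 < K, (0 < m3)%N &
     forall x y, mnorm (alpha x y) <= K * (1 + mnorm y ^+ m3)]).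

Definition generator (g : 'cV[R]_n -> R) (y : 'cV[R]_n) : R :=
  laplacian g y - dot (grad V y) (grad g y).

(* h is f(x, .) and u is phi(x, .), for a fixed x. *)
Definition poisson_solution (h u : 'cV[R]_n -> 'cV[R]_m) : Prop :=
  [/\ forall i, smooth (fun y => u y i 0),
      forall y0 : 'cV[R]_n, exists M : R, \forall y \near y0, mnorm (u y) <= M,
      exists (C : R) (l : nat), forall y, mnorm (u y) <= C * (1 + mnorm y ^+ l),
      forall i y, - generator (fun y' => u y' i 0) y = h y i 0 &
      intmxRn (fun y => expR (- V y) *: u y) = 0].

End hypotheses.

Section exact_coefficients.
Variables (R : realType) (m n p : nat).
Variables (V : 'cV[R]_n -> R).
Variables (f phi : 'cV[R]_m -> 'cV[R]_n -> 'cV[R]_m).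
Variables (alpha : 'cV[R]_m -> 'cV[R]_n -> 'M[R]_(m, p)).

Definition drift (x : 'cV[R]_m) : 'cV[R]_m :=
  intmxRn (fun y => expR (- V y) *: (gradx phi x y *m f x y)).

Definition diffusion (x : 'cV[R]_m) : 'M[R]_m :=
  intmxRn (fun y => expR (- V y) *:
    (alpha x y *m (alpha x y)^T + f x y *m (phi x y)^T + phi x y *m (f x y)^T)).

End exact_coefficients.

Section hermite.
Variable R : realType.

Definition hermite (r : nat) (s : R) : R :=
  (-1) ^+ r / Num.sqrt (r`!%:R) * expR (s ^+ 2 / 2)
  * derive1n r (fun s' : R => expR (- s' ^+ 2 / 2)) s.

Definition gaussian_density n (mu : 'cV[R]_n) (Sigma : 'M[R]_n)
    (y : 'cV[R]_n) : R :=
  expR (- dot (y - mu) (invmx Sigma *m (y - mu)) / 2)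
  / Num.sqrt ((2 * pi) ^+ n * \det Sigma).

(* Sigma = Q L Q^T with L diagonal, and S = Q L^{1/2}; as L is diagonal, its
   square root is entrywise. *)
Definition hermite_fun n (mu : 'cV[R]_n) (Sigma Q L : 'M[R]_n) (a : multi n)
    (y : 'cV[R]_n) : R :=
  let S := Q *m map_mx Num.sqrt L in
  Num.sqrt (gaussian_density mu Sigma y)
  * \prod_k hermite (a k) ((invmx S *m (y - mu)) k 0).

Definition is_covariance n (Sigma Q L : 'M[R]_n) : Prop :=
  [/\ Sigma^T = Sigma,
      forall v : 'cV[R]_n, v != 0 -> 0 < dot v (Sigma *m v),
      is_diag_mx L,
      Q *m Q^T = 1%:M &
      Sigma = Q *m L *m Q^T].

End hermite.

Section galerkin.
Variables (R : realType) (m n p : nat).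
Variables (V : 'cV[R]_n -> R).
Variables (f : 'cV[R]_m -> 'cV[R]_n -> 'cV[R]_m).
Variables (alpha : 'cV[R]_m -> 'cV[R]_n -> 'M[R]_(m, p)).
Variable e : multi n -> 'cV[R]_n -> R.

(* The form is only evaluated on spans of Hermite functions, which are smooth:
   their weak gradient is the classical one. *)
Definition aform (u v : 'cV[R]_n -> R) : R :=
  intRn (fun y => dot (grad u y) (grad v y) + Wpot V y * u y * v y).

Definition lincomb d (c : multi n -> R) (y : 'cV[R]_n) : R :=
  \sum_(a <- midx n d) c a * e a y.

Definition Shat d : set ('cV[R]_n -> R) :=
  [set v | exists c, v = lincomb d c].

(* c gives the coefficients of a Galerkin solution with right-hand side h. *)
Definition galerkin_solution d (h : 'cV[R]_n -> R) (c : multi n -> R) : Prop :=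
  forall v, Shat d v ->
    aform (lincomb d c) v = intRn (fun y => h y * v y * expR (- V y / 2)).

Definition L2inner (u v : 'cV[R]_n -> R) : R := intRn (fun y => u y * v y).

Definition fcoef (x : 'cV[R]_m) (a : multi n) : 'cV[R]_m :=
  intmxRn (fun y => (e a y * expR (- V y / 2)) *: f x y).

Definition drift_approx (d : nat) (dpsi : multi n -> 'M[R]_m)
    (x : 'cV[R]_m) : 'cV[R]_m :=
  \sum_(a <- midx n d) \sum_(b <- midx n d)
    L2inner (e a) (e b) *: (dpsi a *m fcoef x b).

Definition A0_approx (d : nat) (psi : multi n -> 'cV[R]_m)
    (x : 'cV[R]_m) : 'M[R]_m :=
  \sum_(a <- midx n d) \sum_(b <- midx n d)
    L2inner (e a) (e b) *: (psi a *m (fcoef x b)^T).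

Definition diffusion_approx (d : nat) (psi : multi n -> 'cV[R]_m)
    (x : 'cV[R]_m) : 'M[R]_m :=
  intmxRn (fun y => expR (- V y) *: (alpha x y *m (alpha x y)^T))
  + A0_approx d psi x + (A0_approx d psi x)^T.

End galerkin.

(* Main.v *)
(* Conjugation by the ground state gs = e^{-V/2} turns the generator into the
   Schroedinger operator H = - Laplacian + W, and psi = gs phi solves
   H psi = gs f. As V and W tend to infinity, a maximum principle makes gs decay
   faster than any exponential, an Agmon estimate transfers this to psi, and
   Caccioppoli's inequality to all derivatives of psi, uniformly in x. Applying
   the ladder operators repeatedly, the Hermite coefficients of such a function
   decay faster than any power of |alpha|; hence so do the truncation errors in
   L2 and, W being of polynomial growth, in the form a.

   If u_d is the Galerkin solution with right-hand side h, then summing over the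
   orthonormal basis gives <u_d, gs g> = a(u_d, psi) for H psi = gs g. With v the
   truncated expansion of psi this is <gs h, v> + a(u_d, psi - v), which tends to
   <gs h, psi> at the rate of the truncation; the spectral gap of H bounds
   a(u_d, u_d) uniformly. For the drift, h is a derivative of f in x, and the limit
   is the exact drift by self-adjointness of H applied to difference quotients
   in x, which converge because the Poisson estimates are uniform in x. *)

Require Import Defs.
From mathcomp Require Import all_boot all_order all_algebra.
From mathcomp Require Import all_classical all_reals all_analysis.
From mathcomp Require Import measurable_realfun ring lra zify.
Set Implicit Arguments.
Unset Strict Implicit.
Unset Printing Implicit Defensive.
Import Order.TTheory GRing.Theory Num.Theory.
Import numFieldNormedType.Exports.
Local Open Scope classical_set_scope.
Local Open Scope ring_scope.

(** * Partial derivatives and families of functions *)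

(** Uniformity in [x] dictates the form of the estimates: they concern families over an arbitrary
    index type, which is later the set of points [x], of increments [t] of a difference quotient, or
    of pairs of increments. The solution phi is given for one [x] at a time, so its
    differentiability in [x] has to be proved: the Poisson estimate is applied to difference
    quotients, whose right-hand sides form one bounded family.

    The form a has the ground state in its kernel, so the Galerkin solution is not compared with psi
    in norm: only its energy and one pairing enter, and the energy is bounded because the right-hand
    sides are orthogonal to the ground state. The gap has two sources: W exceeds 1 outside a cube,
    and inside it a Poincare inequality applies to quotients by the ground state.

    All exponential weights occur because the derivatives of V may grow exponentially. Only W itself
    must be polynomial, so that H maps the Hermite functions to functions whose norms grow
    polynomially in |a|. Pointwise convergence of the expansions rests on completeness of the
    Hermite functions, proved by the Laplace method. *)

Section directional.
Variable R : realType.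
Variable V : normedModType R.
Implicit Types (g : V -> R) (v y : V).

(** Both difference quotients are the same function of the increment. Thus the one-variable chain
    rule and mean value theorem apply to functions that have partial derivatives without being known
    to be differentiable. *)
Lemma is_derive_line g y v t dg :
  is_derive (t *: v + y) v g dg <->
  is_derive (t : R) (1 : R) (fun h : R => g (h *: v + y)) dg.
Proof.
have E : (fun h : R => h^-1 *: ((g \o shift (t *: v + y)) (h *: v)
    - g (t *: v + y))) =
  (fun h : R => h^-1 *: (((fun h : R => g (h *: v + y)) \o shift t) (h *: 1)
    - g (t *: v + y))).
  by apply/funext => h /=; rewrite scalerDl addrA [h *: 1]mulr1.
by split=> -[d1 d2]; apply: DeriveDef; move: d1 d2;
  rewrite /derivable /derive E.
Qed.

Lemma is_derive_line0 g y v dg :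
  is_derive y v g dg <-> is_derive (0 : R) (1 : R) (fun h : R => g (h *: v + y)) dg.
Proof.
by have := is_derive_line g y v 0 dg; rewrite scale0r add0r.
Qed.

Lemma is_derive_compR (F : R -> R) g y v dF dg :
  is_derive (g y : R) (1 : R) F dF -> is_derive y v g dg ->
  is_derive y v (fun z => F (g z)) (dF * dg).
Proof.
move=> hF /is_derive_line0 hg; apply/is_derive_line0.
have hF' : is_derive (g (0 *: v + y)) 1 F dF by rewrite scale0r add0r.
exact: (is_derive1_comp (f := F) (g := fun h : R => g (h *: v + y))).
Qed.

Lemma is_derive_continuous_line g y v :
  (forall z, derivable g z v) -> continuous (fun h : R => g (h *: v + y)).
Proof.
move=> dg t; apply/differentiable_continuous/derivable1_diffP.
by have /derivableP/is_derive_line[] := dg (t *: v + y).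
Qed.

Lemma is_derive_scale g y v (t dg : R) :
  is_derive y v g dg -> is_derive y (t *: v) g (t * dg).
Proof.
move=> /is_derive_line0 h; apply/is_derive_line0.
have -> : (fun h : R => g (h *: (t *: v) + y)) =
    (fun h : R => g (h *: v + y)) \o (fun h : R => t *: h).
  by apply/funext => h' /=; rewrite scalerA mulrC.
rewrite mulrC; apply: is_derive1_comp; first by rewrite scaler0.
have h' : is_derive (0 : R) (1 : R) (t \*: (id : R -> R)) (t *: (1 : R)).
  exact: is_deriveZ.
by apply: (is_derive_eq h'); rewrite [_ *: _]mulr1.
Qed.

(** The mean value theorem is used on [[0, 1]] in the direction [t *: v], rather than on an interval
    with endpoint [t], so that [t] may have any sign or vanish. *)
Lemma MVT_line g y v (t : R) : (forall z, derivable g z v) ->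
  exists th, [/\ 0 <= th, th <= 1 &
    g (t *: v + y) - g y = t * 'D_v g ((th * t) *: v + y)].
Proof.
move=> dg.
have dg' z : is_derive z (t *: v) g (t * 'D_v g z).
  by apply: is_derive_scale; exact: derivableP.
have dl s : s \in `]0, 1[%R -> is_derive (s : R) (1 : R)
    (fun h : R => g (h *: (t *: v) + y)) (t * 'D_v g ((s * t) *: v + y)).
  by move=> _; apply/is_derive_line; rewrite scalerA; rewrite -scalerA; exact: dg'.
have ct : {within `[0, 1], continuous (fun h : R => g (h *: (t *: v) + y))}.
  apply: continuous_subspaceT; apply: is_derive_continuous_line => z.
  by have [] := dg' z.
have [th] := MVT_segment ler01 dl ct.
rewrite in_itv /= => /andP[th0 th1] E; exists th; split => //.
by move: E; rewrite scale1r scale0r add0r subr0 mulr1.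
Qed.

End directional.

Section cV_norm.
Variables (R : realType) (n : nat).
Implicit Types (y : 'cV[R]_n).

Lemma cV_norm_le y (c : R) : 0 <= c -> (forall i, `|y i 0| <= c) -> `|y| <= c.
Proof.
move=> c0 h; rewrite [leLHS]/Num.norm /= mx_normrE.
by apply/bigmax_leP; split => // -[i k] _ /=; rewrite ord1.
Qed.

Lemma coord_le_norm y i : `|y i 0| <= `|y|.
Proof.
rewrite [leRHS]/Num.norm /= mx_normrE.
by apply/bigmax_geP; right; exists (i, 0).
Qed.

End cV_norm.

Section partial_derivatives.
Variables (R : realType) (n : nat).
Implicit Types (g : 'cV[R]_n -> R) (y : 'cV[R]_n).
Local Notation e_ j := (delta_mx j 0 : 'cV[R]_n).

Lemma pderivE g j y dg : is_derive y (e_ j) g dg -> pderiv j g y = dg.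
Proof. by move=> h; rewrite /pderiv derive_val. Qed.

Lemma pderiv_is g j y : derivable g y (e_ j) -> is_derive y (e_ j) g (pderiv j g y).
Proof. exact: derivableP. Qed.

Lemma is_derive_coord k j y :
  is_derive y (e_ j) (fun z : 'cV[R]_n => z k 0) ((k == j)%:R).
Proof.
apply/is_derive_line0.
have -> : (fun h : R => (h *: e_ j + y) k 0) =
   (fun h : R => (k == j)%:R *: h) + cst (y k 0).
  by apply/funext => h; rewrite !mxE eqxx andbT [RHS]/= mulrC.
apply: is_derive_eq.
by rewrite addr0 [_ *: _]mulr1.
Qed.

(* Second-order difference quotients, computed by the mean value theorem in
   either order, squeeze both mixed derivatives to the same value. *)
Lemma Schwarz_pderiv i j g :
  (forall z, derivable g z (e_ i)) -> (forall z, derivable g z (e_ j)) ->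
  (forall z, derivable (pderiv i g) z (e_ j)) ->
  (forall z, derivable (pderiv j g) z (e_ i)) ->
  continuous (pderiv i (pderiv j g)) -> continuous (pderiv j (pderiv i g)) ->
  pderiv i (pderiv j g) = pderiv j (pderiv i g).
Proof.
move=> di dj dij dji cij cji; apply/funext => y.
have key (a b : 'I_n) (da : forall z, derivable g z (e_ a))
    (dab : forall z, derivable (pderiv a g) z (e_ b)) (s t : R) :
  exists th th', [/\ 0 <= th <= 1, 0 <= th' <= 1 &
   g (s *: e_ a + (t *: e_ b + y)) - g (t *: e_ b + y) - (g (s *: e_ a + y) - g y)
   = s * (t * pderiv b (pderiv a g) ((th' * t) *: e_ b + ((th * s) *: e_ a + y)))].
  pose h z := g (t *: e_ b + z) - g z.
  have dh z : is_derive z (e_ a) h (pderiv a g (t *: e_ b + z) - pderiv a g z).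
    apply: is_deriveB; last exact: derivableP.
    apply/is_derive_line0.
    have -> : (fun h0 : R => g (t *: e_ b + (h0 *: e_ a + z))) =
      (fun h0 : R => g (h0 *: e_ a + (t *: e_ b + z))).
      by apply/funext => h0; rewrite addrCA.
    exact: (is_derive_line0 _ _ _ _).1 (derivableP (da _)).
  have [|th [th0 th1 E1]] := @MVT_line R _ h y (e_ a) s.
    by move=> z; have [] := dh z.
  have [th' [th'0 th'1 E2]] :=
    @MVT_line R _ (pderiv a g) ((th * s) *: e_ a + y) (e_ b) t dab.
  exists th, th'; split; [exact/andP|exact/andP|].
  rewrite -E2 -(pderivE (dh _)) -E1 /h addrCA; ring.
pose D (s t : R) :=
   g (s *: e_ i + (t *: e_ j + y)) - g (t *: e_ j + y) - (g (s *: e_ i + y) - g y).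
apply/eqP; rewrite -subr_eq0 -normr_le0; apply/ler_addgt0Pl => eps eps0.
have eps2 : 0 < eps / 2 by rewrite divr_gt0.
have /cvgrPdist_le/(_ _ eps2)/nbhs_ballP[r1 /= r10 H1] := cij y.
have /cvgrPdist_le/(_ _ eps2)/nbhs_ballP[r2 /= r20 H2] := cji y.
pose r := Num.min r1 r2 / 2.
have r0 : 0 < r by rewrite divr_gt0// lt_min r10 r20.
have inball (r' th th' : R) (a b : 'I_n) : 0 < r' -> r <= r' / 2 ->
    0 <= th <= 1 -> 0 <= th' <= 1 ->
    ball y r' ((th' * (r / 2)) *: e_ b + ((th * (r / 2)) *: e_ a + y)).
  move=> rr rr' /andP[th0 th1] /andP[th'0 th'1].
  rewrite -ball_normE /ball_ /= distrC addrA addrK.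
  have nd (c : 'I_n) : `|e_ c| <= 1.
    apply: cV_norm_le => // k.
    by rewrite mxE; case: (_ && _); rewrite ?normr0 ?normr1.
  have nn (th0' : R) (c : 'I_n) : 0 <= th0' -> th0' <= 1 ->
      `|(th0' * (r / 2)) *: e_ c| <= r / 2.
    move=> p0 p1; rewrite normrZ ger0_norm; last by rewrite mulr_ge0// divr_ge0// ltW.
    rewrite -[leRHS]mulr1; apply: ler_pM => //; first by rewrite mulr_ge0// divr_ge0// ltW.
    by rewrite ler_piMl// divr_ge0// ltW.
  apply: le_lt_trans (ler_normD _ _) _.
  apply: (@le_lt_trans _ _ (r / 2 + r / 2)); last by rewrite -splitr (le_lt_trans rr')// ltr_pdivrMr// ltr_pMr// ltr1n.
  by rewrite lerD// nn.
have rr1 : r <= r1 / 2 by rewrite /r ler_pM2r// ge_min lexx.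
have rr2 : r <= r2 / 2 by rewrite /r ler_pM2r// ge_min lexx orbT.
have [a [a' [a0 a'0 Ea]]] := key i j di dij (r / 2) (r / 2).
have [b [b' [b0 b'0 Eb]]] := key j i dj dji (r / 2) (r / 2).
have := H1 _ (inball r1 b b' j i r10 rr1 b0 b'0).
have := H2 _ (inball r2 a a' i j r20 rr2 a0 a'0).
move: Ea Eb; set X := pderiv j _ (_ + _); set Y := pderiv i _ (_ + _).
rewrite [_ *: e_ j + (_ *: e_ i + y)]addrCA.
set u := g _; set v := g _; set w := g _; set z := g y.
move: X Y u v w z => X Y u v w z Ea Eb /= h1 h2.
have r2n : r / 2 != 0 by rewrite gt_eqF// divr_gt0.
have XY : X = Y.
  have E : r / 2 * (r / 2 * X) = r / 2 * (r / 2 * Y) by rewrite -Ea -Eb; ring.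
  by move/(mulfI r2n)/(mulfI r2n) : E.
rewrite {}XY in h1.
rewrite addr0 -(subrK Y (pderiv i _ _)) -addrA (splitr eps).
rewrite distrC in h1; exact: le_trans (ler_normD _ _) (lerD h2 h1).
Qed.

End partial_derivatives.

(* [Cls P k u]: the family u and all its partial derivatives up to order k
   consist of continuous functions and satisfy the uniform bound P. *)
Fixpoint Cls (R : realType) (n : nat) (I : Type)
    (P : (I -> 'cV[R]_n -> R) -> Prop) k (u : I -> 'cV[R]_n -> R) : Prop :=
  [/\ P u, forall i, continuous (u i) &
    if k is k'.+1 then
      forall j : 'I_n, (forall i y, derivable (u i) y (delta_mx j 0)) /\
        Cls P k' (fun i => pderiv j (u i))
    else True].

Section classes.
Variables (R : realType) (n : nat) (I : Type).
Implicit Types (P : (I -> 'cV[R]_n -> R) -> Prop) (u : I -> 'cV[R]_n -> R).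

Lemma Cls0 P k u : Cls P k u -> P u.
Proof. by case: k => [|k] []. Qed.

Lemma Cls_cont P k u : Cls P k u -> forall i, continuous (u i).
Proof. by case: k => [|k] []. Qed.

Lemma Cls_der P k u j : Cls P k.+1 u ->
  forall i y, derivable (u i) y (delta_mx j 0).
Proof. by case=> _ _ /(_ j)[]. Qed.

Lemma Cls_is P k u j : Cls P k.+1 u ->
  forall i y, is_derive y (delta_mx j 0 : 'cV[R]_n) (u i) (pderiv j (u i) y).
Proof. by move=> h i y; apply: derivableP; exact: Cls_der h i y. Qed.

Lemma Cls_pd P k u j : Cls P k.+1 u -> Cls P k (fun i => pderiv j (u i)).
Proof. by case=> _ _ /(_ j)[]. Qed.

Lemma ClsW P k u : Cls P k.+1 u -> Cls P k u.
Proof.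
elim: k u => [u []//|k IH u [Pu cu h]]; split => // j.
by split; [exact: (h j).1|apply: IH; exact: (h j).2].
Qed.

Lemma Cls_le P k l u : (k <= l)%N -> Cls P l u -> Cls P k u.
Proof.
elim: l => [|l IH]; first by rewrite leqn0 => /eqP ->.
by rewrite leq_eqVlt => /predU1P[->//|kl /ClsW]; exact: IH.
Qed.

Lemma Cls_imp P P' k u : (forall v, P v -> P' v) -> Cls P k u -> Cls P' k u.
Proof.
move=> PP'; elim: k u => [|k IH] u [Pu cu h]; split => //; try exact: PP'.
by move=> j; split; [exact: (h j).1|apply: IH; exact: (h j).2].
Qed.

Lemma Cls_ext P k u v : (forall i y, u i y = v i y) -> Cls P k u -> Cls P k v.
Proof. by move=> uv; have -> : u = v by apply/funext => i; apply/funext => y. Qed.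

Lemma ClsS P k u : P u -> (forall i, continuous (u i)) ->
  (forall j i y, derivable (u i) y (delta_mx j 0)) ->
  (forall j, Cls P k (fun i => pderiv j (u i))) -> Cls P k.+1 u.
Proof. by move=> Pu cu du h; split => // j; split. Qed.

Lemma pderivD u v k k' P P' j : Cls P k.+1 u -> Cls P' k'.+1 v ->
  (fun i => pderiv j (fun y => u i y + v i y)) =
  (fun i y => pderiv j (u i) y + pderiv j (v i) y).
Proof.
move=> hu hv; apply/funext => i; apply/funext => y; apply: pderivE.
by apply: is_deriveD; [exact: Cls_is hu i y|exact: Cls_is hv i y].
Qed.

Lemma pderivM u v k k' P P' j : Cls P k.+1 u -> Cls P' k'.+1 v ->
  (fun i => pderiv j (fun y => u i y * v i y)) =
  (fun i y => pderiv j (u i) y * v i y + u i y * pderiv j (v i) y).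
Proof.
move=> hu hv; apply/funext => i; apply/funext => y; apply: pderivE.
apply: is_derive_eq.
  by apply: is_deriveM; [exact: Cls_is hu i y|exact: Cls_is hv i y].
by rewrite addrC [v i y *: _]mulrC.
Qed.

Lemma ClsD P k u v : (forall a b, P a -> P b -> P (fun i y => a i y + b i y)) ->
  Cls P k u -> Cls P k v -> Cls P k (fun i y => u i y + v i y).
Proof.
move=> PD; elim: k u v => [|k IH] u v hu hv.
  case: hu hv => Pu cu _ [Pv cv _]; split; [exact: PD| |by []].
  by move=> i y; apply: continuousD; [exact: cu|exact: cv].
apply: ClsS.
- by apply: PD; [exact: Cls0 hu|exact: Cls0 hv].
- by move=> i y; apply: continuousD; [exact: (Cls_cont hu)|exact: (Cls_cont hv)].
- by move=> j i y; have [] := is_deriveD (Cls_is j hu i y) (Cls_is j hv i y).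
by move=> j; rewrite (pderivD _ hu hv); apply: IH; apply: Cls_pd.
Qed.

Lemma ClsM P1 P2 P3 k u v :
  (forall a b, P1 a -> (forall i, continuous (a i)) ->
    P2 b -> (forall i, continuous (b i)) -> P3 (fun i y => a i y * b i y)) ->
  (forall a b, P3 a -> P3 b -> P3 (fun i y => a i y + b i y)) ->
  Cls P1 k u -> Cls P2 k v -> Cls P3 k (fun i y => u i y * v i y).
Proof.
move=> PM PD; elim: k u v => [|k IH] u v hu hv.
  case: hu hv => Pu cu _ [Pv cv _]; split; [exact: PM| |by []].
  by move=> i y; apply: continuousM; [exact: cu|exact: cv].
apply: ClsS.
- by apply: PM; [exact: Cls0 hu|exact: Cls_cont hu|exact: Cls0 hv|exact: Cls_cont hv].
- by move=> i y; apply: continuousM; [exact: (Cls_cont hu)|exact: (Cls_cont hv)].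
- by move=> j i y; have [] := is_deriveM (Cls_is j hu i y) (Cls_is j hv i y).
move=> j; rewrite (pderivM _ hu hv); apply: ClsD => //; apply: IH.
- exact: Cls_pd.
- exact: ClsW.
- exact: ClsW.
- exact: Cls_pd.
Qed.

Lemma Cls_cst P k (c : I -> R) : P (fun i _ => c i) -> P (fun _ _ => 0) ->
  Cls P k (fun i _ => c i).
Proof.
move=> Pc P0; case: k => [|k].
  by split => // i; exact: cst_continuous.
apply: ClsS => //; first by move=> i; exact: cst_continuous.
move=> j.
have -> : (fun i : I => pderiv j (fun=> c i)) = (fun _ _ => 0).
  by apply/funext => i; apply/funext => y; apply: pderivE; exact: is_derive_cst.
elim: k {Pc} => [|k IH]; first by split => // i; exact: cst_continuous.
apply: ClsS => //; first by move=> i; exact: cst_continuous.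
move=> j'.
have -> : (fun _ : I => pderiv j' (fun=> 0 : R)) = (fun (_ : I) (_ : 'cV[R]_n) => 0).
  by apply/funext => i; apply/funext => y; apply: pderivE; exact: is_derive_cst.
exact: IH.
Qed.

Lemma Cls_reindex (J : Type) (s : J -> I) P (P' : (J -> 'cV[R]_n -> R) -> Prop) k u :
  (forall v, P v -> P' (fun j => v (s j))) -> Cls P k u -> Cls P' k (fun j => u (s j)).
Proof.
move=> PP'; elim: k u => [|k IH] u [Pu cu h]; split => //; try exact: PP'.
move=> j; split; first by move=> ? ?; exact: (h j).1.
by apply: (IH (fun i => pderiv j (u i))); exact: (h j).2.
Qed.

Lemma Cls_foldr P k u :
  (forall s : seq 'I_n, (size s <= k)%N ->
     [/\ P (fun i => foldr (@pderiv R n) (u i) s),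
         forall i, continuous (foldr (@pderiv R n) (u i) s) &
         forall j i y, derivable (foldr (@pderiv R n) (u i) s) y (delta_mx j 0)]) ->
  Cls P k u.
Proof.
elim: k u => [|k IH] u h; have [//|Pu cu du] := h [::]; first by split.
apply: ClsS => // j; apply: IH => s sk.
(* In [foldr] the last element of the list is the innermost derivative, whereas [Cls] takes the
   innermost derivative first. *)
have [|Ps cs ds] := h (rcons s j); first by rewrite size_rcons.
have E : (fun i => foldr (@pderiv R n) (u i) (rcons s j)) =
  (fun i => foldr (@pderiv R n) (pderiv j (u i)) s).
  by apply/funext => i; rewrite foldr_rcons.
split; first by rewrite -E.
- by move=> i; have := cs i; rewrite foldr_rcons.
- by move=> j' i y; have := ds j' i y; rewrite foldr_rcons.
Qed.

End classes.

Section smooth_functions.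
Variables (R : realType) (n : nat).
Implicit Types (g : 'cV[R]_n -> R).

Lemma smooth_foldr g s : smooth g -> smooth (foldr (@pderiv R n) g s).
Proof. by move=> sg t; have := sg (t ++ s); rewrite foldr_cat. Qed.

Lemma smooth_Schwarz g i j : smooth g ->
  pderiv i (pderiv j g) = pderiv j (pderiv i g).
Proof.
move=> sg; apply: Schwarz_pderiv.
- by move=> z; have [_] := sg [::]; exact.
- by move=> z; have [_] := sg [::]; exact.
- by move=> z; have [_] := sg [:: i]; exact.
- by move=> z; have [_] := sg [:: j]; exact.
- by have [] := sg [:: i; j].
- by have [] := sg [:: j; i].
Qed.

Lemma foldr_pderiv_perm g s t : smooth g -> perm_eq s t ->
  foldr (@pderiv R n) g s = foldr (@pderiv R n) g t.
Proof.
move=> sg; elim: s t => [|i s IH] t.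
  by move=> /perm_size/esym/size0nil ->.
move=> pst.
have it : i \in t by rewrite -(perm_mem pst) mem_head.
have : exists t1 t2, t = t1 ++ i :: t2 by case/splitPr: it => t1 t2; exists t1, t2.
case=> t1 [t2 E]; rewrite /= (IH (t1 ++ t2)); last first.
  by rewrite -(perm_cons i) (perm_trans pst)// E perm_catC /= perm_cons perm_catC.
rewrite {}E !foldr_cat /=.
elim: t1 {it pst} => //= k t1 <-.
by rewrite -foldr_cat; apply: smooth_Schwarz; exact: smooth_foldr.
Qed.

Lemma mderiv_foldr (a : multi n) g :
  mderiv a g = foldr (@pderiv R n) g (flatten [seq nseq (a i) i | i <- enum 'I_n]).
Proof.
rewrite /mderiv; elim: (enum 'I_n) => //= i s ->.
by rewrite foldr_cat; elim: (a i) => //= k ->.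
Qed.

(** Assumptions A and C bound multi-index derivatives, while [Cls] iterates partial derivatives in
    any order: this is the bridge. *)
Lemma foldr_mderiv g s : smooth g ->
  foldr (@pderiv R n) g s = mderiv [ffun i => count_mem i s] g.
Proof.
move=> sg; rewrite mderiv_foldr; apply: foldr_pderiv_perm => //.
apply/allP => i _ /=; apply/eqP.
rewrite count_flatten -map_comp.
rewrite sumnE big_map big_enum /= (bigD1 i)//= big1 ?addn0.
  by rewrite count_nseq ffunE /= eqxx mul1n.
by move=> k ki; rewrite count_nseq /= (negbTE ki).
Qed.

End smooth_functions.

(** * Integration on R^n *)

Section measurability.
Variables (R : realType) (n : nat).
Local Notation RM := (measurableTypeR R).

Lemma floor_approx (x : R) k :
  `|x - (Num.floor (x * k.+1%:R))%:~R / k.+1%:R| <= k.+1%:R^-1.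
Proof.
have k0 : 0 < k.+1%:R :> R by rewrite ltr0n.
have /andP[h1 h2] := floor_itv (x * k.+1%:R).
rewrite -(ler_pM2r k0) mulVf ?gt_eqF// -[X in _ * X]gtr0_norm// -normrM mulrBl.
rewrite divfK ?gt_eqF// ger0_norm ?subr_ge0// lerBlDl ltW//.
by move: h2; rewrite intrD.
Qed.

(** The sigma-algebra on tuples is a product, while continuity refers to column vectors. So [g] is
    obtained as the limit of its compositions with rounding down to a grid of mesh 1/(k+1): each
    takes countably many values, on cells that are products of half-open intervals. *)
Lemma measurable_contRn (g : 'cV[R]_n -> R) : continuous g -> measurableRn g.
Proof.
move=> cg; rewrite /measurableRn; apply/measurable_EFinP.
pose D k (t : n.-tuple RM) : 'cV[R]_n :=
  \col_i ((Num.floor (tnth t i * k.+1%:R))%:~R / k.+1%:R).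
apply: (emeasurable_fun_cvg (fun k t => (g (D k t))%:E)); last first.
  move=> t _; apply: cvg_EFin; first exact: nearW.
  apply: continuous_cvg; first exact: cg.
  apply/cvgrPdist_le => e e0; near=> k.
  apply: cV_norm_le; first exact: ltW.
  move=> i; rewrite !mxE; apply: le_trans (floor_approx _ _) _.
  by apply: ltW; near: k; exact: near_infty_natSinv_lt (PosNum e0).
move=> k; apply/measurable_EFinP => _ Y mY; rewrite setTI.
pose F (t : n.-tuple RM) : {ffun 'I_n -> int} :=
  [ffun i => Num.floor (tnth t i * k.+1%:R)].
have -> : (fun t => g (D k t)) @^-1` Y = \bigcup_m
  [set t | F t = m /\ Y (g (\col_i ((m i)%:~R / k.+1%:R)))].
  apply/seteqP; split => t /=.
    move=> h; exists (F t) => //; split => //=.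
    suff <- : D k t = \col_i ((F t i)%:~R / k.+1%:R) by [].
    by apply/colP => i; rewrite !mxE ffunE.
  move=> [m _ [<-]].
  suff <- : D k t = \col_i ((F t i)%:~R / k.+1%:R) by [].
  by apply/colP => i; rewrite !mxE ffunE.
apply: countable_bigcupT_measurable; first exact: countableP.
move=> m.
have [Ym|nYm] := pselect (Y (g (\col_i ((m i)%:~R / k.+1%:R)))); last first.
  by rewrite (_ : [set t | _] = set0) //; apply/seteqP; split => t //= -[].
have -> : [set t | F t = m /\ Y (g (\col_i ((m i)%:~R / k.+1%:R)))] =
  \bigcap_(i in [set: 'I_n]) ((fun t : n.-tuple RM => tnth t i) @^-1`
     `[(m i)%:~R / k.+1%:R, (m i + 1)%:~R / k.+1%:R[).
  have k0 : 0 < k.+1%:R :> R by rewrite ltr0n.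
  apply/seteqP; split => t /=.
    move=> [<- _] i _ /=; rewrite in_itv/= ffunE.
    by have /andP[] := floor_itv (tnth t i * k.+1%:R); rewrite ler_pdivrMr// ltr_pdivlMr// => -> ->.
  move=> h; split => //; apply/ffunP => i; rewrite ffunE.
  apply: floor_def; have := h i I => /=.
  by rewrite in_itv/= ler_pdivrMr// ltr_pdivlMr.
apply: fin_bigcap_measurable => //.
move=> i _; rewrite -[X in measurable X]setTI.
by apply: measurable_tnth => //; exact: measurable_itv.
Unshelve. all: by end_near. Qed.

End measurability.

Section integral_rules.
Variables (R : realType) (n : nat).
Implicit Types (g h : 'cV[R]_n -> R).

Lemma integrableRn_meas g : integrableRn g -> measurableRn g.
Proof. by move=> /measurable_int/measurable_EFinP. Qed.

Lemma integrableRnD g h : integrableRn g -> integrableRn h ->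
  integrableRn (fun y => g y + h y).
Proof. by move=> ig ih; exact: (integrableD measurableT ig ih). Qed.

Lemma integrableRnZ (c : R) g : integrableRn g -> integrableRn (fun y => c * g y).
Proof. by move=> ig; exact: (integrableZl measurableT c ig). Qed.

Lemma integrableRnN g : integrableRn g -> integrableRn (fun y => - g y).
Proof. by move=> ig; exact: (integrableN ig). Qed.

Lemma integrableRnB g h : integrableRn g -> integrableRn h ->
  integrableRn (fun y => g y - h y).
Proof. by move=> ig ih; exact: (integrableB measurableT ig ih). Qed.

Lemma integrableRn_le g h : measurableRn g -> (forall y, `|g y| <= h y) ->
  integrableRn h -> integrableRn g.
Proof.
move=> mg gh; apply: le_integrable => //; first exact/measurable_EFinP.
move=> t _; rewrite lee_fin; apply: le_trans (gh _) _; exact: ler_norm.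
Qed.

Lemma integrableRn_norm g : integrableRn g -> integrableRn (fun y => `|g y|).
Proof. by move=> ig; exact: integrable_norm. Qed.

Lemma integrableRn0 : integrableRn (fun _ : 'cV[R]_n => 0).
Proof. exact: integrable0. Qed.

Lemma integrableRn_sum (I : Type) (s : seq I) (P : pred I) (g : I -> 'cV[R]_n -> R) :
  (forall i, integrableRn (g i)) -> integrableRn (fun y => \sum_(i <- s | P i) g i y).
Proof.
move=> ig; elim: s => [|i s IH].
  by have -> : (fun y => \sum_(i <- [::] | P i) g i y) = (fun=> 0);
    [apply/funext => y; rewrite big_nil|exact: integrableRn0].
have [Pi|nPi] := boolP (P i).
  have -> : (fun y => \sum_(j <- i :: s | P j) g j y) =
     (fun y => g i y + \sum_(j <- s | P j) g j y).
    by apply/funext => y; rewrite big_cons Pi.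
  exact: integrableRnD.
suff -> : (fun y => \sum_(j <- i :: s | P j) g j y) =
     (fun y => \sum_(j <- s | P j) g j y) by [].
by apply/funext => y; rewrite big_cons (negbTE nPi).
Qed.

Lemma intRnD g h : integrableRn g -> integrableRn h ->
  intRn (fun y => g y + h y) = intRn g + intRn h.
Proof. by move=> ig ih; exact: RintegralD. Qed.

Lemma intRnB g h : integrableRn g -> integrableRn h ->
  intRn (fun y => g y - h y) = intRn g - intRn h.
Proof. by move=> ig ih; exact: RintegralB. Qed.

Lemma intRnZ (c : R) g : integrableRn g -> intRn (fun y => c * g y) = c * intRn g.
Proof. by move=> ig; exact: RintegralZl. Qed.

Lemma intRnN g : integrableRn g -> intRn (fun y => - g y) = - intRn g.
Proof.
move=> ig; rewrite -mulN1r -intRnZ//; congr intRn.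
by apply/funext => y; rewrite mulN1r.
Qed.

Lemma intRn0 : intRn (fun _ : 'cV[R]_n => 0) = 0.
Proof. by rewrite /intRn /Rintegral integral0. Qed.

Lemma intRn_ext g h : (forall y, g y = h y) -> intRn g = intRn h.
Proof. by move=> gh; congr intRn; exact/funext. Qed.

Lemma integrableRn_ext g h : (forall y, g y = h y) -> integrableRn g -> integrableRn h.
Proof. by move=> /funext ->. Qed.

Lemma intRn_sum (I : Type) (s : seq I) (P : pred I) (g : I -> 'cV[R]_n -> R) :
  (forall i, integrableRn (g i)) ->
  intRn (fun y => \sum_(i <- s | P i) g i y) = \sum_(i <- s | P i) intRn (g i).
Proof.
move=> ig; elim: s => [|i s IH].
  by rewrite big_nil -[RHS]intRn0; apply: intRn_ext => y; rewrite big_nil.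
have [Pi|nPi] := boolP (P i).
  rewrite big_cons Pi -IH -intRnD//; last exact: integrableRn_sum.
  by apply: intRn_ext => y; rewrite big_cons Pi.
rewrite big_cons (negbTE nPi) -IH.
by apply: intRn_ext => y; rewrite big_cons (negbTE nPi).
Qed.

Lemma le_intRn g h : integrableRn g -> integrableRn h ->
  (forall y, g y <= h y) -> intRn g <= intRn h.
Proof. by move=> ig ih gh; apply: le_Rintegral => // t _; exact: gh. Qed.

Lemma intRn_ge0 g : (forall y, 0 <= g y) -> 0 <= intRn g.
Proof. by move=> g0; apply: Rintegral_ge0 => t _; exact: g0. Qed.

Lemma le_normr_intRn g : integrableRn g -> `|intRn g| <= intRn (fun y => `|g y|).
Proof. by move=> ig; exact: le_normr_Rintegral. Qed.

Lemma intRn_norm_le g h : integrableRn g -> integrableRn h ->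
  (forall y, `|g y| <= h y) -> `|intRn g| <= intRn h.
Proof.
move=> ig ih gh; apply: le_trans (le_normr_intRn ig) _.
by apply: le_intRn => //; exact: integrableRn_norm.
Qed.

Lemma intRnE g : integrableRn g ->
  ((intRn g)%:E = \int[lebesgue_tuple R n]_t (g (tuple_col t))%:E)%E.
Proof. by move=> ig; rewrite /intRn /Rintegral fineK//; exact: integrable_fin_num. Qed.

Lemma dominated_intRn (u : nat -> 'cV[R]_n -> R) g h :
  (forall k, measurableRn (u k)) ->
  (forall y, (fun k => u k y) @ \oo --> g y) -> integrableRn h ->
  (forall k y, `|u k y| <= h y) ->
  integrableRn g /\ (fun k => intRn (u k)) @ \oo --> intRn g.
Proof.
move=> mu_ ug ih uh.
have mg : measurable_fun setT ((fun t => (g (tuple_col t))%:E) : n.-tuple (measurableTypeR R) -> \bar R).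
  apply: (emeasurable_fun_cvg (fun k t => (u k (tuple_col t))%:E)).
    by move=> k; have := mu_ k; move/measurable_EFinP.
  by move=> t _; apply: cvg_EFin; [exact: nearW|exact: ug].
have m_ k : measurable_fun setT
    ((fun t => (u k (tuple_col t))%:E) : n.-tuple (measurableTypeR R) -> \bar R).
  by have := mu_ k; move/measurable_EFinP.
have a1 : {ae lebesgue_tuple R n, forall t, setT t ->
    (fun k => (u k (tuple_col t))%:E) @ \oo --> (g (tuple_col t))%:E}.
  by apply/aeW => t _; apply: cvg_EFin; [exact: nearW|exact: ug].
have a2 : {ae lebesgue_tuple R n, forall t k, setT t ->
    (`|(u k (tuple_col t))%:E| <= (h (tuple_col t))%:E)%E}.
  by apply/aeW => t k _ /=; rewrite lee_fin.
have [ig _ cv] := dominated_convergence measurableT m_ mg a1 ih a2.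
split => //.
have cv' : (fun k => \int[lebesgue_tuple R n]_t (u k (tuple_col t))%:E)%E @ \oo
    --> (intRn g)%:E by rewrite intRnE.
exact: (fine_cvg cv').
Qed.

(** Integrability of the limit is part of the conclusion: this is how bounds survive the removal of
    a cut-off or of a truncation. *)
Lemma fatou_intRn (u : nat -> 'cV[R]_n -> R) g (C : R) :
  (forall k y, 0 <= u k y) -> (forall k, integrableRn (u k)) ->
  (forall y, (fun k => u k y) @ \oo --> g y) -> (forall k, intRn (u k) <= C) ->
  integrableRn g /\ intRn g <= C.
Proof.
move=> u0 iu ug uC.
have mu_ k : measurable_fun setT
    ((fun t => (u k (tuple_col t))%:E) : n.-tuple (measurableTypeR R) -> \bar R).
  by have := measurable_int _ (iu k).
have mg : measurable_fun setT ((fun t => (g (tuple_col t))%:E) : n.-tuple (measurableTypeR R) -> \bar R).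
  apply: (emeasurable_fun_cvg (fun k t => (u k (tuple_col t))%:E)) => //.
  by move=> t _; apply: cvg_EFin; [exact: nearW|exact: ug].
have g0 y : 0 <= g y.
  by apply: (ler_cvg_to (cvg_cst 0) (ug y)); exact: nearW.
have le : (\int[lebesgue_tuple R n]_t (g (tuple_col t))%:E <= C%:E)%E.
  have -> : (\int[lebesgue_tuple R n]_t (g (tuple_col t))%:E =
     \int[lebesgue_tuple R n]_t limn_einf (fun k => (u k (tuple_col t))%:E))%E.
    apply: eq_integral => t _.
    have ugE : (fun k => (u k (tuple_col t))%:E) @ \oo --> (g (tuple_col t))%:E.
      by apply: cvg_EFin; [exact: nearW|exact: ug].
    by rewrite (cvg_limn_einf_sup ugE).1.
  apply: le_trans (fatou _ _ _ _) _ => //.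
    by move=> k t _; rewrite lee_fin.
  rewrite limn_einf_lim; apply: lime_le; first exact: is_cvg_einfs.
  apply: nearW => k; apply: ereal_inf_le; exists (intRn (u k))%:E.
    by exists k => //=; rewrite intRnE.
  by rewrite lee_fin.
have ig : integrableRn g.
  apply/integrableP; split => //; apply: le_lt_trans (ltry C).
  apply: le_trans le; apply: ge0_le_integral => //.
  - exact: measurableT_comp.
  - by move=> t _; rewrite /= ger0_norm.
by split => //; rewrite -lee_fin intRnE.
Qed.

End integral_rules.

(** * Integrals of derivatives on the real line *)

Section derivative_integral.
Variable R : realType.
Local Notation leb := (@lebesgue_measure R).
Implicit Types (G : R -> R).

(** Otherwise [|G|] would be at least [eps] on a set of infinite measure. This replaces decay at
    infinity, which integrability does not give. *)
Lemma integrable_small G (D : set R) (eps : R) : measurable D ->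
  leb D = +oo%E -> leb.-integrable setT (EFin \o G) -> 0 < eps ->
  exists2 s, D s & `|G s| < eps.
Proof.
move=> mD Doo /integrableP[mG iG] e0; apply: contrapT => h.
have : (\int[leb]_(s in D) (cst eps%:E s) <= \int[leb]_s `|(EFin \o G) s|)%E.
  apply: (@le_trans _ _ (\int[leb]_(s in D) `|(EFin \o G) s|)%E).
    apply: ge0_le_integral => //.
    - by move=> s _; rewrite lee_fin ltW.
    - by apply: measurableT_comp => //; exact: measurable_funTS.
    - move=> s Ds /=; rewrite lee_fin leNgt; apply/negP => h'; apply: h.
      by exists s.
  apply: ge0_subset_integral => //; exact: measurableT_comp.
rewrite integral_cst// [X in (_ * X)%E]Doo mulry gtr0_sg// mul1e leye_eq => /eqP E.
by move: iG; rewrite E.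
Qed.

Lemma FTC_itv G G' (a b : R) : a < b ->
  (forall s, is_derive s (1 : R) G (G' s)) -> continuous G' ->
  (\int[leb]_(s in `[a, b]) (G' s)%:E = (G b)%:E - (G a)%:E)%E.
Proof.
move=> ab dG cG'.
have cG : continuous G.
  move=> s; apply/differentiable_continuous/derivable1_diffP.
  by have [] := dG s.
apply: continuous_FTC2 => //.
- exact: continuous_subspaceT.
- split.
  + by move=> s _; have [] := dG s.
  + by apply: cvg_at_right_filter; exact: cG.
  + by apply: cvg_at_left_filter; exact: cG.
- by move=> s _; rewrite derive1E derive_val.
Qed.

(** The fundamental theorem of calculus is applied on intervals whose endpoints go to infinity along
    points where [G] is small; dominated convergence does the rest. *)
Lemma integral_derivative_eq0 G G' :
  (forall s, is_derive s (1 : R) G (G' s)) -> continuous G' ->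
  leb.-integrable setT (EFin \o G) -> leb.-integrable setT (EFin \o G') ->
  (\int[leb]_s (G' s)%:E = 0)%E.
Proof.
move=> dG cG' iG iG'.
have Ha (k : nat) : exists s : R, s < - k.+1%:R /\ `|G s| < k.+1%:R^-1.
  have [| | |s] := @integrable_small G `]-oo, (- k.+1%:R)[%classic k.+1%:R^-1 _ _ iG.
  - exact: measurable_itv.
  - by rewrite lebesgue_measure_itv /= ltNyr.
  - by rewrite invr_gt0.
  by rewrite /= in_itv /= => sk Gs; exists s.
have Hb (k : nat) : exists s : R, k.+1%:R < s /\ `|G s| < k.+1%:R^-1.
  have [| | |s] := @integrable_small G `]k.+1%:R, +oo[%classic k.+1%:R^-1 _ _ iG.
  - exact: measurable_itv.
  - by rewrite lebesgue_measure_itv /= ltry.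
  - by rewrite invr_gt0.
  by rewrite /= in_itv /= andbT => sk Gs; exists s.
have [a Pa] := choice Ha; have [b Pb] := choice Hb.
have ab k : a k < b k.
  have [h1 _] := Pa k; have [h2 _] := Pb k.
  by apply: (lt_trans h1); apply: lt_trans h2; rewrite gtrN.
pose F k s := (((EFin \o G') \_ `[a k, b k]) s)%E.
have mF k : measurable_fun setT (F k).
  apply/(measurable_restrictT _ _).1 => //; apply: measurable_funTS.
  exact: measurable_int iG'.
have a1 : {ae leb, forall s, setT s -> (fun k => F k s) @ \oo --> (EFin \o G') s}.
  apply/aeW => s _; apply: cvg_near_cst.
  near=> k; rewrite /F patchE mem_set//= in_itv /=.
  have [h1 _] := Pa k; have [h2 _] := Pb k.
  have sk : `|s| < k.+1%:R.
    near: k; exists (Num.trunc `|s|) => // k /= hk.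
    by rewrite -truncn_lt_nat.
  move: sk; rewrite ltr_norml => /andP[s1 s2].
  by rewrite (ltW (lt_trans h1 s1)) (ltW (lt_trans s2 h2)).
have a2 : {ae leb, forall s k, setT s -> (`|F k s| <= (abse \o (EFin \o G')) s)%E}.
  apply/aeW => s k _; rewrite /F patchE; case: ifP => //= _.
  by rewrite normr0 lee_fin.
have mG' : measurable_fun setT (EFin \o G') by exact: measurable_int iG'.
have [_ _ cv] := @dominated_convergence _ _ R leb setT measurableT F
  (EFin \o G') (abse \o (EFin \o G')) mF mG' a1 (integrable_abse iG') a2.
have cv0 : (fun k => \int[leb]_s F k s)%E @ \oo --> 0%E.
  have E k : (\int[leb]_s F k s = (G (b k) - G (a k))%:E)%E.
    by rewrite /F -integral_mkcond EFinB -(FTC_itv (ab k) dG cG').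
  rewrite (_ : (fun k => _) = (fun k => (G (b k) - G (a k))%:E)); last exact/funext.
  apply: cvg_EFin; first exact: nearW.
  apply/cvgrPdist_le => e e0; near=> k; rewrite sub0r normrN.
  apply: le_trans (ler_normB _ _) _.
  have [_ /ltW h1] := Pa k; have [_ /ltW h2] := Pb k.
  apply: le_trans (lerD h2 h1) _; rewrite -mulr2n -[_ *+ 2]mulr_natr -ler_pdivlMr//.
  apply: ltW; near: k.
  have e2 : 0 < e / 2 by rewrite divr_gt0.
  exact: near_infty_natSinv_lt (PosNum e2).
exact: (cvg_unique (@ereal_hausdorff R) cv cv0).
Unshelve. all: by end_near. Qed.

(** Integrate [G'] up to [s] from a point on its left where [|G|] is below an arbitrary [e]. *)
Lemma derivative_sup_le G G' s :
  (forall s, is_derive s (1 : R) G (G' s)) -> continuous G' ->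
  leb.-integrable setT (EFin \o G) -> leb.-integrable setT (EFin \o G') ->
  (`|G s|%:E <= \int[leb]_t `|G' t|%:E)%E.
Proof.
move=> dG cG' iG iG'; apply/lee_addgt0Pr => e e0.
have [| | a] := @integrable_small G `]-oo, s[%classic e _ _ iG e0.
- exact: measurable_itv.
- by rewrite lebesgue_measure_itv /= ltNyr.
rewrite /= in_itv /= => as_ Ga.
have mG' : measurable_fun setT (EFin \o G') by exact: measurable_int iG'.
have : (`|(G s)%:E - (G a)%:E| <= \int[leb]_t `|G' t|%:E)%E.
  rewrite -(FTC_itv as_ dG cG').
  apply: le_trans (le_abse_integral _ _ _) _ => //.
    by apply: measurable_funTS.
  by apply: ge0_subset_integral => //; exact: measurableT_comp.
rewrite -EFinB /= => h.
apply: (@le_trans _ _ (`|G s - G a|%:E + `|G a|%:E)%E).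
  rewrite -EFinD lee_fin -[X in `|X| <= _](subrK (G a)).
  exact: ler_normD.
by apply: leeD => //; rewrite lee_fin ltW.
Qed.

End derivative_integral.

Lemma continuous_cV (R : realType) (T : topologicalType) n (f : T -> 'cV[R]_n) :
  (forall i, continuous (fun t => f t i 0)) -> continuous f.
Proof.
move=> cf t A [P nP sP]; apply: (filterS sP).
apply: filter_forall => i; apply: filter_forall => j.
by rewrite ord1; apply: cf; have := nP i j; rewrite ord1.
Qed.

(** * Tonelli and Fubini, with one coordinate split off *)

Section cons_coordinates.
Variables (R : realType) (n : nat).
Local Notation RM := (measurableTypeR R).
Local Notation leb := (@lebesgue_measure R).
Implicit Types (s h : R) (g : 'cV[R]_n.+1 -> R).

Definition ccons s (y : 'cV[R]_n) : 'cV[R]_n.+1 :=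
  \col_i oapp (fun j => y j 0) s (unlift ord0 i).

Lemma ccons0 s (y : 'cV[R]_n) : ccons s y ord0 0 = s.
Proof. by rewrite mxE unlift_none. Qed.

Lemma cconsS s (y : 'cV[R]_n) j : ccons s y (lift ord0 j) 0 = y j 0.
Proof. by rewrite mxE liftK. Qed.

Lemma tuple_col_cons s (t : n.-tuple RM) :
  tuple_col (tcons (s, t)) = ccons s (tuple_col t).
Proof.
apply/colP => i; case: (unliftP ord0 i) => [j ->|->].
  by rewrite cconsS !mxE tnthS.
by rewrite ccons0 mxE tnth0.
Qed.

Lemma ccons_shift0 h s (y : 'cV[R]_n) : ccons (h + s) y = h *: delta_mx ord0 0 + ccons s y.
Proof.
apply/colP => i; case: (unliftP ord0 i) => [j ->|->].
  by rewrite !mxE liftK /= !mulr0 add0r.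
by rewrite !mxE unlift_none /= !mulr1.
Qed.

Lemma ccons_shiftS h s (y : 'cV[R]_n) j :
  ccons s (h *: delta_mx j 0 + y) = h *: delta_mx (lift ord0 j) 0 + ccons s y.
Proof.
apply/colP => i; case: (unliftP ord0 i) => [k ->|->].
  by rewrite !mxE liftK /= !mxE (inj_eq lift_inj).
by rewrite !mxE unlift_none /= !mulr0 add0r.
Qed.

Lemma continuous_cconsl (y : 'cV[R]_n) : continuous (ccons^~ y).
Proof.
apply: continuous_cV => i; case: (unliftP ord0 i) => [k ->|->] s.
  by under eq_fun do rewrite cconsS; exact: cst_continuous.
by under eq_fun do rewrite ccons0; exact: cvg_id.
Qed.

Lemma continuous_cconsr s : continuous (ccons s).
Proof.
apply: continuous_cV => i; case: (unliftP ord0 i) => [k ->|->] y.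
  by under eq_fun do rewrite cconsS; exact: coord_continuous.
by under eq_fun do rewrite ccons0; exact: cst_continuous.
Qed.

Lemma is_derive_ccons0 g s (y : 'cV[R]_n) dg :
  is_derive (ccons s y) (delta_mx ord0 0) g dg ->
  is_derive s (1 : R) (fun s' => g (ccons s' y)) dg.
Proof.
move=> /is_derive_line0 hd; apply/is_derive_line0.
suff -> : (fun h : R => g (ccons (h *: (1 : R) + s) y)) =
  (fun h : R => g (h *: delta_mx ord0 0 + ccons s y)) by [].
by apply/funext => h; rewrite [h *: 1]mulr1 ccons_shift0.
Qed.

Lemma is_derive_cconsS g s (y : 'cV[R]_n) j dg :
  is_derive (ccons s y) (delta_mx (lift ord0 j) 0) g dg ->
  is_derive y (delta_mx j 0) (fun y' => g (ccons s y')) dg.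
Proof.
move=> /is_derive_line0 hd; apply/is_derive_line0.
suff -> : (fun h : R => g (ccons s (h *: delta_mx j 0 + y))) =
  (fun h : R => g (h *: delta_mx (lift ord0 j) 0 + ccons s y)) by [].
by apply/funext => h; rewrite ccons_shiftS.
Qed.

Let P (g : 'cV[R]_n.+1 -> R) (z : RM * n.-tuple RM) : \bar R :=
  (g (ccons z.1 (tuple_col z.2)))%:E.

Lemma integral_consE g :
  (forall y, 0 <= g y) -> measurableRn g ->
  (\int[lebesgue_tuple R n.+1]_t (g (tuple_col t))%:E =
   \int[(leb \x lebesgue_tuple R n)]_z P g z)%E.
Proof.
move=> g0 mg.
have -> : (\int[lebesgue_tuple R n.+1]_t (g (tuple_col t))%:E =
  \int[pushforward (leb \x lebesgue_tuple R n)%E (@tcons R n)]_t (g (tuple_col t))%:E)%E by [].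
rewrite ge0_integral_pushforward//=.
- by rewrite preimage_setT; apply: eq_integral => -[s t] _; rewrite /= tuple_col_cons.
- exact: measurable_tcons.
- by have := mg; move/measurable_EFinP.
- by move=> t _; rewrite lee_fin.
Qed.

Lemma measurable_P g : measurableRn g -> measurable_fun setT (P g).
Proof.
move=> /measurable_EFinP mg.
have -> : P g = (fun t => (g (tuple_col t))%:E) \o (@tcons R n).
  by apply/funext => -[s t]; rewrite /= tuple_col_cons.
by apply: measurableT_comp; [exact: mg|exact: measurable_tcons].
Qed.

Lemma tonelli_cons g : (forall y, 0 <= g y) -> measurableRn g ->
  (\int[lebesgue_tuple R n.+1]_t (g (tuple_col t))%:E =
   \int[leb]_s \int[lebesgue_tuple R n]_t (g (ccons s (tuple_col t)))%:E)%E.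
Proof.
move=> g0 mg; rewrite integral_consE// fubini_tonelli1//.
- exact: measurable_P.
- by move=> z; rewrite lee_fin.
Qed.

Lemma tonelli_cons' g : (forall y, 0 <= g y) -> measurableRn g ->
  (\int[lebesgue_tuple R n.+1]_t (g (tuple_col t))%:E =
   \int[lebesgue_tuple R n]_t \int[leb]_s (g (ccons s (tuple_col t)))%:E)%E.
Proof.
move=> g0 mg; rewrite integral_consE// fubini_tonelli2//.
- exact: measurable_P.
- by move=> z; rewrite lee_fin.
Qed.

Lemma measurable_tonelli_l g : (forall y, 0 <= g y) -> measurableRn g ->
  measurable_fun setT (fun s : RM =>
    \int[lebesgue_tuple R n]_t (g (ccons s (tuple_col t)))%:E)%E.
Proof.
move=> g0 mg; apply: (@measurable_fun_fubini_tonelli_F _ _ _ _ _ _ (P g)).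
- exact: measurable_P.
- by move=> z; rewrite lee_fin.
Qed.

Lemma measurable_tonelli_r g : (forall y, 0 <= g y) -> measurableRn g ->
  measurable_fun setT ((fun t => \int[leb]_s (g (ccons s (tuple_col t)))%:E)%E
    : n.-tuple RM -> \bar R).
Proof.
move=> g0 mg; apply: (@measurable_fun_fubini_tonelli_G _ _ _ _ _ _ (P g)).
- exact: measurable_P.
- by move=> z; rewrite lee_fin.
Qed.

Lemma integrable_P g : integrableRn g ->
  (leb \x lebesgue_tuple R n)%E.-integrable setT (P g).
Proof.
move=> ig; have mg := integrableRn_meas ig.
apply/integrableP; split; first exact: measurable_P.
move/integrableP : ig => [_]; congr (_ < _)%E.
have -> : (\int[lebesgue_tuple R n.+1]_x `|(g (tuple_col x))%:E| =
  \int[lebesgue_tuple R n.+1]_x (`|g (tuple_col x)|)%:E)%E by [].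
rewrite (integral_consE (g := fun y => `|g y|))//.
exact: measurableT_comp.
Qed.

Lemma integral_P g : integrableRn g ->
  (\int[(leb \x lebesgue_tuple R n)]_z P g z = (intRn g)%:E)%E.
Proof.
move=> ig; have mg := integrableRn_meas ig; rewrite intRnE//.
have -> : (\int[lebesgue_tuple R n.+1]_t (g (tuple_col t))%:E =
  \int[pushforward (leb \x lebesgue_tuple R n)%E (@tcons R n)]_t (g (tuple_col t))%:E)%E by [].
have PE : P g = (fun t => (g (tuple_col t))%:E) \o (@tcons R n).
  by apply/funext => -[s t]; rewrite /= tuple_col_cons.
rewrite integral_pushforward//= ?preimage_setT -?PE//.
- by apply: eq_integral => -[s t] _; rewrite /= tuple_col_cons.
- exact: measurable_tcons.
- by have := mg; move/measurable_EFinP.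
- exact: integrable_P.
Qed.

Lemma fubini_cons1 g : integrableRn g ->
  [/\ {ae leb, forall s, integrableRn (fun y => g (ccons s y))},
   leb.-integrable setT (fun s : R => \int[lebesgue_tuple R n]_t (g (ccons s (tuple_col t)))%:E)%E &
   (intRn g)%:E = (\int[leb]_s \int[lebesgue_tuple R n]_t (g (ccons s (tuple_col t)))%:E)%E].
Proof.
move=> ig; have iP := integrable_P ig; split.
- exact: ae_integrable1 iP.
- exact: integrable_fubini_F iP.
- by rewrite -integral_P// -integral12_prod_meas1.
Qed.

Lemma fubini_cons2 g : integrableRn g ->
  [/\ {ae lebesgue_tuple R n, forall t, leb.-integrable setT
          (fun s : R => (g (ccons s (tuple_col t)))%:E)},
   measurable_fun setT ((fun t => \int[leb]_s (g (ccons s (tuple_col t)))%:E)%E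
      : n.-tuple RM -> \bar R) &
   (intRn g)%:E = (\int[lebesgue_tuple R n]_t \int[leb]_s (g (ccons s (tuple_col t)))%:E)%E].
Proof.
move=> ig; have iP := integrable_P ig; split.
- exact: ae_integrable2 iP.
- exact: measurable_fubini_G iP.
- by rewrite -integral_P// -integral21_prod_meas1.
Qed.

End cons_coordinates.

Section integral_pderiv.
Variable R : realType.

(** Induction on the dimension. If [j] is the first coordinate, it is integrated first and the
    one-dimensional case applies on almost every line; otherwise it is one of the coordinates of the
    slices, almost all of which satisfy the induction hypothesis. Fubini gives integrable slices
    only almost everywhere, whence the [near] arguments. *)
Lemma intRn_pderiv_eq0 n (j : 'I_n) (g : 'cV[R]_n -> R) :
  (forall y, derivable g y (delta_mx j 0)) -> continuous (pderiv j g) ->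
  integrableRn g -> integrableRn (pderiv j g) -> intRn (pderiv j g) = 0.
Proof.
elim: n j g => [[]//|n IH] j g dg cg ig idg.
apply: EFin_inj.
have isd y : is_derive y (delta_mx j 0 : 'cV[R]_n.+1) g (pderiv j g y).
  exact: derivableP.
case: (unliftP ord0 j) => [k|] jE.
  rewrite {}jE in dg cg idg isd *.
  have [aeg _ _] := fubini_cons1 ig.
  have [aed id ->] := fubini_cons1 idg.
  rewrite -[RHS](integral0 lebesgue_measure setT).
  apply: ae_eq_integral => //; first exact: measurable_int id.
  near=> s => _.
  have is_g : integrableRn (fun y => g (ccons s y)) by near: s.
  have is_d : integrableRn (fun y => pderiv (lift ord0 k) g (ccons s y)) by near: s.
  have pE : pderiv k (fun y => g (ccons s y)) =
      (fun y => pderiv (lift ord0 k) g (ccons s y)).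
    by apply/funext => y; apply: pderivE; exact: is_derive_cconsS.
  rewrite -(intRnE is_d) -pE IH//; last by rewrite pE.
    by move=> y; have [] := is_derive_cconsS (isd (ccons s y)).
  rewrite pE => y; apply: continuous_comp; first exact: continuous_cconsr.
  exact: cg.
rewrite {}jE in dg cg idg isd *.
have [aeg _ _] := fubini_cons2 ig.
have [aed md ->] := fubini_cons2 idg.
rewrite -[RHS](integral0 (lebesgue_tuple R n) setT).
apply: ae_eq_integral => //.
near=> t => _.
apply: (@integral_derivative_eq0 _ (fun s => g (ccons s (tuple_col t)))).
- by move=> s; exact: is_derive_ccons0.
- move=> s; apply: continuous_comp; first exact: continuous_cconsl.
  exact: cg.
- by near: t.
- by near: t.
Unshelve. all: by end_near. Qed.

End integral_pderiv.

(** * Integrals of products over the coordinates *)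

Section product_integrals.
Variable R : realType.
Local Notation RM := (measurableTypeR R).
Local Notation leb := (@lebesgue_measure R).

Lemma measurable_coordRn n (i : 'I_n) (F : R -> R) : measurable_fun setT F ->
  measurableRn (fun y : 'cV[R]_n => F (y i 0)).
Proof.
move=> mF; rewrite /measurableRn.
rewrite (_ : (fun t => F _) = F \o (fun t : n.-tuple RM => tnth t i)); last first.
  by apply/funext => t /=; rewrite mxE.
by apply: measurableT_comp => //; exact: measurable_tnth.
Qed.

Lemma measurableRn_prod n (I : Type) (r : seq I) (h : I -> 'cV[R]_n -> R) :
  (forall i, measurableRn (h i)) -> measurableRn (fun y => \prod_(i <- r) h i y).
Proof.
move=> mh; elim: r => [|i r IH].
  rewrite (_ : (fun y => _) = fun=> 1); last by apply/funext => y; rewrite big_nil.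
  exact: measurable_cst.
rewrite (_ : (fun y => _) = fun y => h i y * \prod_(j <- r) h j y).
  by have := measurable_funM (mh i) IH.
by apply/funext => y; rewrite big_cons.
Qed.

Lemma integral_prod_coord n (F : 'I_n -> R -> R) (c : 'I_n -> R) :
  (forall i, measurable_fun setT (F i)) -> (forall i x, 0 <= F i x) ->
  (forall i, \int[leb]_x (F i x)%:E = (c i)%:E)%E ->
  (\int[lebesgue_tuple R n]_t (\prod_i F i (tuple_col t i 0))%:E
    = (\prod_i c i)%:E)%E.
Proof.
elim: n F c => [|n IH] F c mF F0 cE.
  rewrite /= integral_dirac//= ?diracT ?mul1e ?big_ord0//.
  rewrite (_ : (fun t => _) = cst 1%E)//.
  by apply/funext => t; rewrite big_ord0.
have mP : measurableRn (fun y : 'cV[R]_n.+1 => \prod_i F i (y i 0)).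
  by apply: measurableRn_prod => i; exact: measurable_coordRn.
rewrite (tonelli_cons (g := fun y => \prod_i F i (y i 0)))//; last first.
  by move=> y; apply: prodr_ge0.
have E s : (\int[lebesgue_tuple R n]_t (\prod_i F i (ccons s (tuple_col t) i 0))%:E
    = (F ord0 s)%:E * (\prod_i c (lift ord0 i))%:E)%E.
  rewrite -(IH (fun i => F (lift ord0 i)))//.
  rewrite -ge0_integralZl//; last 3 first.
  - apply/measurable_EFinP.
    have := @measurableRn_prod n _ (index_enum 'I_n)
     (fun i y => F (lift ord0 i) (y i 0)).
    by apply => i; exact: measurable_coordRn.
  - by move=> t _; rewrite lee_fin; exact: prodr_ge0.
  - by rewrite lee_fin.
  apply: eq_integral => t _; rewrite -EFinM big_ord_recl ccons0.
  by congr (_ * _)%:E; apply: eq_bigr => i _; rewrite cconsS.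
under eq_integral do rewrite E.
rewrite ge0_integralZr//.
- by rewrite cE big_ord_recl -EFinM.
- by have := mF ord0; move/measurable_EFinP.
- by move=> x _; rewrite lee_fin.
- by rewrite lee_fin -(lee_fin) ; apply: prodr_ge0 => i _;
    rewrite -lee_fin -cE; apply: integral_ge0 => x _; rewrite lee_fin.
Qed.

Lemma integral_exp_abs : (\int[leb]_x (expR (- `|x|))%:E = (2 : R)%:E)%E.
Proof.
have cN : continuous (fun x : R => expR (- `|x|)).
  move=> x; apply: continuous_comp; last exact: continuous_expR.
  by apply: continuousN; exact: norm_continuous.
rewrite (ge0_symfun_integralT (f := fun x => expR (- `|x|)))//; last first.
  by move=> x /=; rewrite normrN.
rewrite -[RHS]mule1; congr (_ * _)%E.
rewrite -(integral_exponential_pdf (@ltr01 R)).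
rewrite [LHS]integral_mkcond.
apply: eq_integral => x _; rewrite patchE; case: ifPn; rewrite ?inE ?notin_setE /= => x0.
  by by rewrite exponential_pdfE// mul1r mulN1r ger0_norm.
by rewrite lt0_exponential_pdf// ltNge; apply/negP.
Qed.

(** Exponential weights are built on the l1 norm because they then factor over the coordinates, and
    because it is the maximum of the linear forms [slin], whose exponentials are smooth. *)
Definition N1 n (y : 'cV[R]_n) : R := \sum_i `|y i 0|.

Lemma N1_ge0 n (y : 'cV[R]_n) : 0 <= N1 y.
Proof. exact: sumr_ge0. Qed.

Lemma continuous_sumR (T : topologicalType) (I : Type) (r : seq I) (h : I -> T -> R) :
  (forall i, continuous (h i)) -> continuous (fun y => \sum_(i <- r) h i y).
Proof.
move=> ch; elim: r => [|i r IH].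
  rewrite (_ : (fun y => _) = fun=> 0); last by apply/funext => y; rewrite big_nil.
  exact: cst_continuous.
rewrite (_ : (fun y => _) = fun y => h i y + \sum_(j <- r) h j y).
  by move=> y; apply: continuousD; [exact: ch|exact: IH].
by apply/funext => y; rewrite big_cons.
Qed.

Lemma continuous_N1 n : continuous (@N1 n).
Proof.
apply: continuous_sumR => i y.
by apply: continuous_comp; [exact: coord_continuous|exact: norm_continuous].
Qed.

Lemma integrable_expN1 n : integrableRn (fun y : 'cV[R]_n => expR (- N1 y)).
Proof.
have E (y : 'cV[R]_n) : expR (- N1 y) = \prod_i expR (- `|y i 0|).
  by rewrite -expR_sum sumrN.
have c1 : continuous (fun y : 'cV[R]_n => expR (- N1 y)).
  move=> y; apply: continuous_comp; last exact: continuous_expR.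
  by apply: continuousN; exact: continuous_N1.
apply/integrableP; split; first by have := measurable_contRn c1; move/measurable_EFinP.
rewrite (_ : (\int[_]_x _)%E = (\prod_(i < n) 2)%:E); first exact: ltry.
rewrite -(@integral_prod_coord n (fun _ x => expR (- `|x|))) //.
- by apply: eq_integral => t _; rewrite /= ger0_norm ?expR_ge0// E.
- move=> _; apply: continuous_measurable_fun => x.
  apply: continuous_comp; last exact: continuous_expR.
  by apply: continuousN; exact: norm_continuous.
- by move=> _; exact: integral_exp_abs.
Qed.

(** The indicator is a product, so that its integral factors and its slices are again cubes. *)
Definition cube n (c : 'cV[R]_n) (r : R) (y : 'cV[R]_n) : R :=
  \prod_i (`|y i 0 - c i 0| <= r)%R%:R.

Lemma cube01 n (c : 'cV[R]_n) r y :
  cube c r y = ([forall i, `|y i 0 - c i 0| <= r])%:R.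
Proof.
rewrite /cube; have [/forallP h|/forallPn[i h]] := boolP [forall i, `|y i 0 - c i 0| <= r].
  by rewrite big1// => i _; rewrite h.
by rewrite (bigD1 i)//= (negbTE h) mul0r.
Qed.

Lemma cube_ge0 n (c : 'cV[R]_n) r y : 0 <= cube c r y.
Proof. by rewrite cube01. Qed.

Lemma in_cc (x a r : R) : (x \in `[a - r, a + r]%classic) = (`|x - a| <= r).
Proof.
rewrite ler_distl; apply/idP/idP => h.
  by move/set_mem : h; rewrite /= in_itv.
by apply/mem_set; rewrite /= in_itv.
Qed.

Lemma measurable_cube1 (a r : R) : measurable_fun setT (fun x : R => (`|x - a| <= r)%R%:R : R).
Proof.
rewrite (_ : (fun x => _) = \1_(`[a - r, a + r])).
  by apply: measurable_indic; exact: measurable_itv.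
by apply/funext => x; rewrite indicE in_cc.
Qed.

Lemma measurable_cube n (c : 'cV[R]_n) r : measurableRn (cube c r).
Proof.
apply: measurableRn_prod => i.
apply: (measurable_coordRn i (F := fun x => (`|x - c i 0| <= r)%R%:R)).
exact: measurable_cube1.
Qed.

Lemma integral_cube1 (a r : R) : 0 <= r ->
  (\int[leb]_x ((`|x - a| <= r)%R%:R : R)%:E = (r *+ 2)%:E)%E.
Proof.
move=> r0.
have E x : (`|x - a| <= r)%R%:R = \1_(`[a - r, a + r]) x :> R.
  by rewrite indicE in_cc.
under eq_integral do rewrite E.
rewrite integral_indic//= setIT [LHS]lebesgue_measure_itv /= lte_fin.
rewrite ltrBlDr -addrA ltrDl -mulr2n; case: ltP => [_|r0']; last first.
  have -> : r = 0.
    by apply/eqP; rewrite eq_le r0 andbT; move: r0'; rewrite pmulrn_lle0.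
  by rewrite mul0rn.
by rewrite -EFinD; congr (_%:E); ring.
Qed.

Lemma integral_cube n (c : 'cV[R]_n) r : 0 <= r ->
  integrableRn (cube c r) /\ intRn (cube c r) = (r *+ 2) ^+ n.
Proof.
move=> r0.
have E : (\int[lebesgue_tuple R n]_t (cube c r (tuple_col t))%:E = ((r *+ 2) ^+ n)%:E)%E.
  rewrite (@integral_prod_coord n (fun i x => (`|x - c i 0| <= r)%R%:R) (fun=> r *+ 2)).
  - by rewrite prodr_const card_ord.
  - by move=> i; exact: measurable_cube1.
  - by [].
  - by move=> i; exact: integral_cube1.
have ic : integrableRn (cube c r).
  apply/integrableP; split.
    by have := measurable_cube c r; move/measurable_EFinP.
  rewrite (_ : (\int[_]_x _)%E = ((r *+ 2) ^+ n)%:E) ?ltry// -E.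
  by apply: eq_integral => t _; rewrite /= ger0_norm// cube_ge0.
by split => //; apply: EFin_inj; rewrite intRnE.
Qed.

Lemma cube_ccons n s r (y : 'cV[R]_n) :
  cube 0 r (ccons s y) = (`|s| <= r)%R%:R * cube 0 r y.
Proof.
rewrite /cube big_ord_recl ccons0 mxE subr0; congr (_ * _).
by apply: eq_bigr => i _; rewrite cconsS !mxE.
Qed.

End product_integrals.

(** * Poincare inequality on cubes *)

Section poincare.
Variable R : realType.
Local Notation RM := (measurableTypeR R).
Local Notation leb := (@lebesgue_measure R).

Lemma integral_cube10 (r : R) : 0 <= r ->
  (\int[leb]_x ((`|x| <= r)%R%:R : R)%:E = (r *+ 2)%:E)%E.
Proof.
move=> r0; rewrite -(integral_cube1 0 r0); apply: eq_integral => x _.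
by rewrite subr0.
Qed.

Lemma measurable_cube10 (r : R) :
  measurable_fun setT (fun x : R => (`|x| <= r)%R%:R : R).
Proof.
have := measurable_cube1 0 r; congr measurable_fun.
by apply/funext => x; rewrite subr0.
Qed.

(** Cauchy-Schwarz for the integral of [G'], on an interval of length 2r. The right-hand integral is
    an extended real, so the infinite case is covered as well. *)
Lemma sq_diff_le (G G' : R -> R) (r s t : R) : 0 < r ->
  (forall s, is_derive s (1 : R) G (G' s)) -> continuous G' ->
  `|s| <= r -> `|t| <= r ->
  (((G s - G t) ^+ 2)%:E <=
    (r *+ 2)%:E * \int[leb]_u ((`|u| <= r)%R%:R * G' u ^+ 2)%:E)%E.
Proof.
move=> r0 dG cG'; wlog ts : s t / t <= s => [hw sr tr|].
  have [ts|/ltW st] := leP t s; first exact: hw.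
  by rewrite -[X in X ^+ 2]opprB sqrrN; exact: hw.
rewrite !ler_norml => /andP[s1 s2] /andP[t1 t2].
have Q0 : (0 <= \int[leb]_u ((`|u| <= r)%R%:R * G' u ^+ 2)%:E)%E.
  by apply: integral_ge0 => u _; rewrite lee_fin mulr_ge0// sqr_ge0.
have r2 : 0 < r *+ 2 by rewrite pmulrn_lgt0.
have [->|A0] := eqVneq (G s - G t) 0.
  by rewrite expr0n /= mule_ge0// lee_fin ltW.
have {}ts : t < s.
  by rewrite lt_neqAle ts andbT; apply: contraNneq A0 => ->; rewrite subrr.
pose A := `|G s - G t|; have A_gt0 : 0 < A by rewrite normr_gt0.
have mG' : measurable_fun setT G' by exact: continuous_measurable_fun.
have mk : measurable_fun setT (fun u : R => (`|u| <= r)%R%:R : R).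
  exact: measurable_cube10.
have mQ : measurable_fun setT (fun u : R => ((`|u| <= r)%R%:R * G' u ^+ 2)%:E : \bar R).
  by apply/measurable_EFinP; apply: measurable_funM => //; exact: measurable_funX.
(* The pointwise inequality is v <= (r/A) v^2 + A/(4r), a weighted arithmetic-geometric mean; the
   weight is tuned to [A], so that the constant term integrates to A/2 and is absorbed by the left
   side. *)
have key : (A%:E <= (r / A)%:E * \int[leb]_u ((`|u| <= r)%R%:R * G' u ^+ 2)%:E
    + (A / 2)%:E)%E.
  have -> : ((A / 2)%:E = (A / (r *+ 2) / 2)%:E *
      \int[leb]_u ((`|u| <= r)%R%:R : R)%:E)%E.
    rewrite (integral_cube10 (ltW r0)).
    rewrite -EFinM; congr (_%:E).
    by rewrite mulrAC divfK// gt_eqF.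
  rewrite -ge0_integralZl//; last 2 first.
  - by move=> u _; rewrite lee_fin mulr_ge0// sqr_ge0.
  - by rewrite lee_fin divr_ge0// ltW.
  rewrite -ge0_integralZl//; last 2 first.
  - exact/measurable_EFinP.
  - by rewrite lee_fin !divr_ge0// ltW.
  rewrite -ge0_integralD//; last 4 first.
  - move=> u _; apply: mule_ge0; rewrite lee_fin; first by rewrite divr_ge0// ltW.
    by rewrite mulr_ge0// sqr_ge0.
  - exact: measurable_funeM.
  - by move=> u _; apply: mule_ge0; rewrite lee_fin// !divr_ge0// ltW.
  - by apply: measurable_funeM; exact/measurable_EFinP.
  apply: (@le_trans _ _ (\int[leb]_(u in `[t, s]) `|(G' u)%:E|)%E).
    rewrite /A -[X in (X <= _)%E]/(`|(G s - G t)%:E|)%E EFinB -(FTC_itv ts dG cG').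
    by apply: le_abse_integral => //; apply/measurable_EFinP; exact: measurable_funTS.
  rewrite [X in (X <= _)%E]integral_mkcond; apply: ge0_le_integral => //.
  - by move=> u _; rewrite patchE; case: ifP.
  - apply/(measurable_restrictT _ _).1 => //; apply: measurable_funTS.
    by apply: measurableT_comp => //; exact/measurable_EFinP.
  - apply: emeasurable_funD; first exact: measurable_funeM.
    by apply: measurable_funeM; exact/measurable_EFinP.
  move=> u _; rewrite patchE -!EFinM -EFinD.
  case: ifPn => [/set_mem|] /=; last first.
    move=> _; rewrite -[point]/(0%E) lee_fin.
    apply: addr_ge0; apply: mulr_ge0 => //.
    - by rewrite divr_ge0// ltW.
    - by rewrite mulr_ge0// sqr_ge0.
    - by rewrite !divr_ge0// ltW.
  rewrite in_itv /= => /andP[tu us].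
  have -> : (`|u| <= r) = true.
    by rewrite ler_norml (le_trans t1 tu) (le_trans us s2).
  rewrite lee_fin mul1r mulr1.
  rewrite -subr_ge0 -(pmulr_rge0 _ (mulr_gt0 A_gt0 r2)).
  rewrite -real_normK ?num_real//; set v := `|G' u|.
  have -> : A * (r *+ 2) * (r / A * v ^+ 2 + A / (r *+ 2) / 2 - v) =
      2 * (r * v - A / 2) ^+ 2.
    by field; rewrite !gt_eqF.
  by rewrite mulr_ge0// sqr_ge0.
move: Q0 key; case: (\int[leb]_u _)%E => [q| |//].
  rewrite !lee_fin => q0 key.
  rewrite -real_normK ?num_real// -/A.
  have : A * A <= A * (r / A * q + A / 2) by rewrite ler_pM2l.
  have -> : A * (r / A * q + A / 2) = r * q + A * A / 2 by field; rewrite gt_eqF.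
  have alg (x z : R) : x <= z + x / 2 -> x <= z + z by move=> h; lra.
  by move/alg; rewrite expr2 mulrnAl mulr2n.
by move=> _ _; rewrite gt0_muley ?leey// lte_fin.
Qed.

(** Induction on the dimension. The constant [c] is not the mean value: it is the one that the
    induction hypothesis gives on a slice of small energy, and [sq_diff_le] compares the other
    points with that slice along the first coordinate. The averaging that finds the slice costs
    [eps]. *)
Lemma poincare_cube n r : 0 < r -> exists2 C : R, 0 < C &
  forall (g : 'cV[R]_n -> R), continuous g ->
    (forall i y, derivable g y (delta_mx i 0)) ->
    (forall i, continuous (pderiv i g)) ->
  forall eps, 0 < eps -> exists c : R,
   (\int[lebesgue_tuple R n]_t (cube 0 r (tuple_col t) * (g (tuple_col t) - c) ^+ 2)%:E
   <= C%:E * (\int[lebesgue_tuple R n]_t (cube 0 r (tuple_col t) *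
          \sum_i (pderiv i g (tuple_col t)) ^+ 2)%:E + eps%:E))%E.
Proof.
move=> r0; elim: n => [|n [C C0 IH]].
  exists 1; first exact: ltr01.
  move=> g _ _ _ eps eps0; exists (g 0); rewrite mul1e integral0_eq.
    apply: adde_ge0; last by rewrite lee_fin ltW.
    by apply: integral_ge0 => t _; rewrite big_ord0 mulr0.
  move=> t _; rewrite (_ : tuple_col t = 0) ?subrr ?expr0n ?mulr0//.
  by apply/colP => -[].
have r2 : 0 < r *+ 2 by rewrite pmulrn_lgt0.
(* The first term comes from differences along the first coordinate; the two others from the slice,
   whose energy is at most the average (e + eps)/(2r), integrated over a length 2r. *)
exists (8 * r ^+ 2 + 2 * C + 4 * r * C).
  by rewrite !addr_gt0// !mulr_gt0// exprn_gt0.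
move=> g cg dg cdg eps eps0.
have isd i y : is_derive y (delta_mx i 0 : 'cV[R]_n.+1) g (pderiv i g y).
  exact: derivableP.
set K := _ + _ + _.
have K0 : 0 < K by rewrite !addr_gt0// !mulr_gt0// exprn_gt0.
set E := (\int[_]_t (_ * \sum_i _)%:E)%E.
have E0 : (0 <= E)%E.
  by apply: integral_ge0 => t _; rewrite lee_fin mulr_ge0 ?cube_ge0// sumr_ge0// => i _; exact: sqr_ge0.
have [Eoo|] := eqVneq E +oo%E.
  by exists 0; rewrite Eoo addye// gt0_muley ?leey// lte_fin.
rewrite -ltey => Efin; have [e eE] : exists e, E = e%:E.
  by exists (fine E); rewrite fineK// ge0_fin_numE.
pose F0 (y : 'cV[R]_n.+1) := cube 0 r y * pderiv ord0 g y ^+ 2.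
pose FS (y : 'cV[R]_n.+1) := cube 0 r y * \sum_(i < n) pderiv (lift ord0 i) g y ^+ 2.
have F00 y : 0 <= F0 y by rewrite mulr_ge0 ?cube_ge0// sqr_ge0.
have FS0 y : 0 <= FS y.
  by rewrite mulr_ge0 ?cube_ge0// sumr_ge0// => i _; exact: sqr_ge0.
have md i : measurableRn (fun y => pderiv i g y ^+ 2).
  have := measurable_funX 2 (measurable_contRn (cdg i)); exact.
have mF0 : measurableRn F0 by have := measurable_funM (measurable_cube 0 r) (md ord0).
have mFS : measurableRn FS.
  have ms : measurableRn (fun y => \sum_(i < n) pderiv (lift ord0 i) g y ^+ 2).
    have := @measurable_sum _ _ R setT _ (index_enum 'I_n)
     (fun i (t : n.+1.-tuple RM) => pderiv (lift ord0 i) g (tuple_col t) ^+ 2).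
    by apply => i; exact: md.
  by have := measurable_funM (measurable_cube 0 r) ms.
have EF0 : (\int[lebesgue_tuple R n.+1]_t (F0 (tuple_col t))%:E <= E)%E.
  apply: ge0_le_integral => //.
  - by move=> t _; rewrite lee_fin.
  - by move: mF0 => /measurable_EFinP.
  - have := measurable_funD mF0 mFS => /measurable_EFinP; congr measurable_fun.
    by apply/funext => t; rewrite big_ord_recl mulrDr.
  - by move=> t _; rewrite lee_fin big_ord_recl mulrDr lerDl FS0.
have EFS : (\int[lebesgue_tuple R n.+1]_t (FS (tuple_col t))%:E <= E)%E.
  apply: ge0_le_integral => //.
  - by move=> t _; rewrite lee_fin.
  - by move: mFS => /measurable_EFinP.
  - have := measurable_funD mF0 mFS => /measurable_EFinP; congr measurable_fun.
    by apply/funext => t; rewrite big_ord_recl mulrDr.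
  - by move=> t _; rewrite lee_fin big_ord_recl mulrDr lerDr F00.
rewrite tonelli_cons// in EFS.
(* a slice on which the remaining energy does not exceed its average *)
have [t0 [t0r ht0]] : exists t0 : R, `|t0| <= r /\
   (\int[lebesgue_tuple R n]_t (FS (ccons t0 (tuple_col t)))%:E <= ((e + eps) / (r *+ 2))%:E)%E.
  apply: contrapT => h.
  have : (\int[leb]_s (((e + eps) / (r *+ 2))%:E * ((`|s| <= r)%R%:R : R)%:E) <= E)%E.
    apply: le_trans EFS; apply: ge0_le_integral => //.
    - move=> s _; rewrite -EFinM lee_fin mulr_ge0// divr_ge0//; last exact: ltW.
      by rewrite addr_ge0//; [rewrite -lee_fin -eE|exact: ltW].
    - apply: measurable_funeM; apply/measurable_EFinP.
      exact: measurable_cube10.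
    - exact: measurable_tonelli_l.
    - move=> s _; have [sr|_] := boolP (`|s| <= r); last first.
        by rewrite mule0; apply: integral_ge0 => t _; rewrite lee_fin.
      rewrite mule1 leNgt; apply/negP => h'; apply: h; exists s; split => //.
      exact: ltW.
  rewrite ge0_integralZl//; last 2 first.
  - apply/measurable_EFinP.
    exact: measurable_cube10.
  - by rewrite lee_fin divr_ge0// ?ltW// ltr_wpDl// -lee_fin -eE.
  rewrite (integral_cube10 (ltW r0)).
  rewrite -EFinM divfK ?gt_eqF// eE lee_fin => h'.
  by move: h'; rewrite leNgt ltrDl eps0.
pose gs (y : 'cV[R]_n) := g (ccons t0 y).
have isdS i y : is_derive y (delta_mx i 0 : 'cV[R]_n) gs
    (pderiv (lift ord0 i) g (ccons t0 y)) by exact: is_derive_cconsS.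
have pgs i : pderiv i gs = fun y => pderiv (lift ord0 i) g (ccons t0 y).
  by apply/funext => y; exact: pderivE.
have cgs : continuous gs.
  by move=> y; apply: continuous_comp; [exact: continuous_cconsr|exact: cg].
have dgs i y : derivable gs y (delta_mx i 0 : 'cV[R]_n) by have [] := isdS i y.
have cdgs i : continuous (pderiv i gs).
  move=> y; rewrite pgs.
  by apply: continuous_comp; [exact: continuous_cconsr|exact: cdg].
have [c hc] := IH gs cgs dgs cdgs eps eps0.
have {}hc : (\int[lebesgue_tuple R n]_t (cube 0 r (tuple_col t) *
    (gs (tuple_col t) - c) ^+ 2)%:E <= (C * ((e + eps) / (r *+ 2) + eps))%:E)%E.
  have hE : (\int[lebesgue_tuple R n]_t (cube 0 r (tuple_col t) *
      \sum_i pderiv i gs (tuple_col t) ^+ 2)%:E =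
    \int[lebesgue_tuple R n]_t (FS (ccons t0 (tuple_col t)))%:E)%E.
    apply: eq_integral => t _.
    congr (_%:E); rewrite /FS cube_ccons t0r mul1r; congr (_ * _).
    by apply: eq_bigr => i _; rewrite pgs.
  rewrite hE in hc; apply: (le_trans hc); rewrite EFinM EFinD; apply: lee_wpmul2l.
    by rewrite lee_fin ltW.
  exact: leeD2r ht0.
exists c.
pose L (y : 'cV[R]_n.+1) := cube 0 r y * (g y - c) ^+ 2.
have L0 y : 0 <= L y by rewrite mulr_ge0 ?cube_ge0// sqr_ge0.
have mL : measurableRn L.
  have mg : measurableRn (fun y => (g y - c) ^+ 2).
    have := measurable_funX 2 (measurable_funB (measurable_contRn cg)
      (measurable_cst c)); exact.
  by have := measurable_funM (measurable_cube 0 r) mg.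
pose M (y : 'cV[R]_n) := cube 0 r y * (gs y - c) ^+ 2.
have M0 y : 0 <= M y by rewrite mulr_ge0 ?cube_ge0// sqr_ge0.
have mM : measurableRn M.
  have mg : measurableRn (fun y => (gs y - c) ^+ 2).
    have := measurable_funX 2 (measurable_funB (measurable_contRn cgs)
      (measurable_cst c)); exact.
  by have := measurable_funM (measurable_cube 0 r) mg.
pose Q (t : n.-tuple RM) : \bar R := (\int[leb]_s (F0 (ccons s (tuple_col t)))%:E)%E.
have Q0 t : (0 <= Q t)%E by apply: integral_ge0 => s _; rewrite lee_fin.
have mQ : measurable_fun setT Q by exact: measurable_tonelli_r.
have slice (t : n.-tuple RM) : (\int[leb]_s (L (ccons s (tuple_col t)))%:E <=
   (r *+ 2)%:E * ((r *+ 4)%:E * Q t + (M (tuple_col t) *+ 2)%:E))%E.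
  have X0 : (0 <= (r *+ 4)%:E * Q t + (M (tuple_col t) *+ 2)%:E)%E.
    by rewrite adde_ge0 ?mule_ge0// lee_fin mulrn_wge0// ltW.
  rewrite -(integral_cube10 (ltW r0)).
  rewrite -ge0_integralZr//; last first.
    apply/measurable_EFinP.
    exact: measurable_cube10.
  apply: ge0_le_integral => //.
  - by move=> s _; rewrite lee_fin.
  - have := measurable_P mL => mP.
    have := @measurable_fun_pair1 _ _ _ RM (n.-tuple RM) (\bar R)
      (fun z => (L (ccons z.1 (tuple_col z.2)))%:E) t mP; exact.
  - apply: emeasurable_funM => //; apply/measurable_EFinP.
    exact: measurable_cube10.
  move=> s _; rewrite /L cube_ccons.
  have [sr|_] := boolP (`|s| <= r); last by rewrite !mul0r mul0e.
  rewrite mul1r mul1e.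
  have [|kt1] := eqVneq (cube 0 r (tuple_col t)) 0.
    by move=> ->; rewrite mul0r.
  have kt : cube 0 r (tuple_col t) = 1.
    by move: kt1; rewrite cube01; case: [forall _, _] => //; rewrite eqxx.
  rewrite kt mul1r /M kt mul1r.
  have := @sq_diff_le (fun s => g (ccons s (tuple_col t)))
    (fun s => pderiv ord0 g (ccons s (tuple_col t))) r s t0 r0
    (fun s => is_derive_ccons0 (isd _ _)) _ sr t0r.
  have -> : (\int[leb]_u ((`|u| <= r)%R%:R * pderiv ord0 g (ccons u (tuple_col t)) ^+ 2)%:E
     = Q t)%E.
    by apply: eq_integral => u _; rewrite /F0 cube_ccons kt mulr1.
  move=> /(_ _)/le_trans h.
  (* The value on the chosen slice is inserted between [g] and [c]. *)
  apply: (@le_trans _ _ (((g (ccons s (tuple_col t)) - gs (tuple_col t)) ^+ 2) *+ 2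
    + ((gs (tuple_col t) - c) ^+ 2) *+ 2)%:E).
    rewrite lee_fin; set a := g _; set b := gs _.
    rewrite -subr_ge0; have -> : (a - b) ^+ 2 *+ 2 + (b - c) ^+ 2 *+ 2 - (a - c) ^+ 2
      = ((a - b) - (b - c)) ^+ 2 by ring.
    exact: sqr_ge0.
  rewrite EFinD; apply: leeD => //.
  rewrite (_ : r *+ 4 = 2 * (r *+ 2)); last by ring.
  rewrite -mulr_natl !EFinM -muleA; apply: lee_wpmul2l; first by rewrite lee_fin.
  apply: h; last exact: lexx.
  by move=> u; apply: continuous_comp; [exact: continuous_cconsl|exact: cdg].
rewrite (tonelli_cons' L0 mL).
apply: (@le_trans _ _ (\int[lebesgue_tuple R n]_t
   ((r *+ 2)%:E * ((r *+ 4)%:E * Q t + (M (tuple_col t) *+ 2)%:E)))%E).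
  apply: ge0_le_integral => //.
  - by move=> t _; apply: integral_ge0 => s _; rewrite lee_fin.
  - exact: measurable_tonelli_r.
  - apply: measurable_funeM; apply: emeasurable_funD; first exact: measurable_funeM.
    apply/measurable_EFinP; rewrite (_ : (fun _ => _) = (fun t => 2 * M (tuple_col t))).
      by have := measurable_funM (measurable_cst (2 : R)) mM.
    by apply/funext => t; rewrite mulr_natl.
have mM2 : measurable_fun setT ((fun t => (M (tuple_col t) *+ 2)%:E) : n.-tuple RM -> \bar R).
  apply/measurable_EFinP; rewrite (_ : (fun _ => _) = (fun t => 2 * M (tuple_col t))).
    by have := measurable_funM (measurable_cst (2 : R)) mM.
  by apply/funext => t; rewrite mulr_natl.
have hM2 : (\int[lebesgue_tuple R n]_t (M (tuple_col t) *+ 2)%:E =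
    (2 : R)%:E * \int[lebesgue_tuple R n]_t (M (tuple_col t))%:E)%E.
  rewrite -ge0_integralZl//.
  - by apply: eq_integral => t _; rewrite -EFinM mulr_natl.
  - by move: mM => /measurable_EFinP.
  - by move=> t _; rewrite lee_fin.
rewrite ge0_integralZl//; last 3 first.
- by apply: emeasurable_funD => //; exact: measurable_funeM.
- by move=> t _; rewrite adde_ge0 ?mule_ge0// lee_fin mulrn_wge0// ltW.
- by rewrite lee_fin ltW.
rewrite ge0_integralD//; last 3 first.
- by move=> t _; rewrite mule_ge0// lee_fin mulrn_wge0// ltW.
- exact: measurable_funeM.
- by move=> t _; rewrite lee_fin mulrn_wge0.
rewrite ge0_integralZl//; last by rewrite lee_fin mulrn_wge0// ltW.
rewrite hM2.
have {}EF0 : (\int[lebesgue_tuple R n]_t Q t <= e%:E)%E.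
  by rewrite -eE; apply: le_trans EF0; rewrite (tonelli_cons' F00 mF0).
apply: (@le_trans _ _ ((r *+ 2)%:E * ((r *+ 4)%:E * e%:E +
   (2 : R)%:E * (C * ((e + eps) / (r *+ 2) + eps))%:E))%E).
  apply: lee_wpmul2l; first by rewrite lee_fin ltW.
  apply: leeD; apply: lee_wpmul2l => //; rewrite lee_fin ?mulrn_wge0//; exact: ltW.
rewrite eE.
suff : ((r *+ 2 * (r *+ 4 * e + 2 * (C * ((e + eps) / (r *+ 2) + eps))))%:E <=
  (K * (e + eps))%:E)%E by [].
rewrite lee_fin.
have e0 : 0 <= e by rewrite -lee_fin -eE.
have -> : r *+ 2 * (r *+ 4 * e + 2 * (C * ((e + eps) / (r *+ 2) + eps))) =
   8 * r ^+ 2 * e + 2 * C * (e + eps) + 4 * r * C * eps.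
  by field; rewrite gt_eqF.
have h1 : 0 <= 8 * r ^+ 2 * eps by rewrite !mulr_ge0// ?sqr_ge0// ltW.
have h2 : 0 <= 4 * r * C * e by rewrite !mulr_ge0// ltW.
rewrite /K; lra.
Qed.

End poincare.

(** * Gaussian integrals *)

Section gaussian_integral.
Variable R : realType.
Local Notation RM := (measurableTypeR R).
Local Notation leb := (@lebesgue_measure R).

Lemma gauss_integral1 (p m : R) : 0 < p ->
  (\int[leb]_s (expR (- (p * (s - m) ^+ 2) / 2))%:E = (Num.sqrt (2 * pi / p))%:E)%E.
Proof.
move=> p0.
pose s0 : R := Num.sqrt p^-1.
have s02 : s0 ^+ 2 = p^-1 by rewrite sqr_sqrtr// invr_ge0 ltW.
have s00 : s0 != 0 by rewrite gt_eqF// sqrtr_gt0 invr_gt0.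
have E s : expR (- (p * (s - m) ^+ 2) / 2) = Num.sqrt (2 * pi / p) * normal_pdf m s0 s.
  rewrite normal_pdfE//= /normal_peak /normal_fun s02.
  have -> : p^-1 * pi *+ 2 = 2 * pi / p by rewrite -mulr_natl mulrCA mulrC.
  rewrite mulVKf; last by rewrite gt_eqF// sqrtr_gt0 divr_gt0// mulr_gt0// pi_gt0.
  congr expR; rewrite -mulr_natl; field; rewrite gt_eqF//.
under eq_integral do rewrite E EFinM.
rewrite ge0_integralZl//.
- by rewrite integral_normal_pdf// mule1.
- by apply/measurable_EFinP; exact: measurable_normal_pdf.
- by move=> s _; rewrite lee_fin normal_pdf_ge0.
Qed.

Lemma dotE n (P : 'M[R]_n) (u : 'cV[R]_n) :
  dot u (P *m u) = \sum_i \sum_j u i 0 * P i j * u j 0.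
Proof.
apply: eq_bigr => i _; rewrite mxE big_distrr /=.
by apply: eq_bigr => j _; rewrite mulrA.
Qed.

Definition schur n (P : 'M[R]_n.+1) : 'M[R]_n :=
  \matrix_(i, j) (P (lift ord0 i) (lift ord0 j) -
    P (lift ord0 i) ord0 * P ord0 (lift ord0 j) / P ord0 ord0).

(** Completion of the square in the first coordinate; symmetry of [P] merges the two cross terms. *)
Lemma dot_schur n (P : 'M[R]_n.+1) (s : R) (y : 'cV[R]_n) :
  P^T = P -> P ord0 ord0 != 0 ->
  dot (ccons s y) (P *m ccons s y) =
  P ord0 ord0 * (s + \sum_j P (lift ord0 j) ord0 * y j 0 / P ord0 ord0) ^+ 2
  + dot y (schur P *m y).
Proof.
move=> Ps p0; rewrite !dotE big_ord_recl /= big_ord_recl /= !ccons0.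
set p := P ord0 ord0 in p0 *.
pose B := \sum_j P (lift ord0 j) ord0 * y j 0.
have E1 : \sum_(i < n) s * P ord0 (lift ord0 i) * ccons s y (lift ord0 i) 0 = s * B.
  rewrite /B big_distrr /=; apply: eq_bigr => i _; rewrite cconsS.
  by rewrite -[in LHS]Ps mxE mulrA.
have E2 : \sum_(i < n) \sum_j ccons s y (lift ord0 i) 0 * P (lift ord0 i) j * ccons s y j 0
   = s * B + \sum_i \sum_j y i 0 * P (lift ord0 i) (lift ord0 j) * y j 0.
  rewrite /B big_distrr -big_split /=; apply: eq_bigr => i _.
  rewrite big_ord_recl ccons0 !cconsS; congr (_ + _); first by ring.
  by apply: eq_bigr => j _; rewrite cconsS.
have E3 : \sum_i \sum_j y i 0 * schur P i j * y j 0 =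
   \sum_i \sum_j y i 0 * P (lift ord0 i) (lift ord0 j) * y j 0 - B * B / p.
  rewrite {1}/B -mulrA big_distrl /= -sumrB; apply: eq_bigr => i _.
  rewrite /B !(big_distrl, big_distrr) /= -sumrB; apply: eq_bigr => j _.
  have sym : P ord0 (lift ord0 j) = P (lift ord0 j) ord0.
    by rewrite -[in LHS]Ps mxE.
  by rewrite mxE -/p sym; field.
have E4 : \sum_j P (lift ord0 j) ord0 * y j 0 / p = B / p by rewrite /B big_distrl.
by rewrite {}E1 {}E2 {}E3 {}E4; field.
Qed.

(** One step of Gaussian elimination, by a matrix of determinant 1. *)
Lemma det_schur n (P : 'M[R]_n.+1) : P ord0 ord0 != 0 ->
  \det P = P ord0 ord0 * \det (schur P).
Proof.
move=> p0; pose P1 : 'M[R]_(1 + n) := P.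
pose b : 'M[R]_(n, 1) := - (P ord0 ord0)^-1 *: dlsubmx P1.
pose E : 'M[R]_(1 + n) := block_mx 1%:M 0 b 1%:M.
have detE : \det E = 1 by rewrite det_lblock !det1 mulr1.
have l0 (n' : nat) (i : 'I_1) : lshift n' i = ord0 :> 'I_(1 + n').
  by apply: val_inj; rewrite /= ord1.
have rS (i : 'I_n) : rshift 1 i = lift ord0 i by exact: val_inj.
have EP : E *m P1 = block_mx (ulsubmx P1) (ursubmx P1) 0 (schur P).
  rewrite -[P1 in LHS]submxK mulmx_block !mul1mx !mul0mx !addr0.
  congr block_mx.
    apply/matrixP => i j; rewrite !mxE big_ord1 !mxE !ord1 !l0 !rS; field.
    exact: p0.
  by apply/matrixP => i j; rewrite !mxE big_ord1 !mxE !ord1 !l0 !rS; field.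
have : \det (E *m P1) = P ord0 ord0 * \det (schur P).
  by rewrite EP det_ublock det_mx11 !mxE !l0.
by rewrite det_mulmx detE mul1r.
Qed.

(** Induction on the dimension: integrating the completed square in the first coordinate leaves the
    Gaussian of the Schur complement, which is again symmetric and positive definite. Positivity of
    the determinant follows from the same recursion and is needed to combine the square roots. *)
Lemma gauss_integral n (P : 'M[R]_n) (c : 'cV[R]_n) :
  P^T = P -> (forall v : 'cV[R]_n, v != 0 -> 0 < dot v (P *m v)) ->
  0 < \det P /\
  (\int[lebesgue_tuple R n]_t
     (expR (- dot (tuple_col t - c) (P *m (tuple_col t - c)) / 2))%:E =
    (Num.sqrt ((2 * pi) ^+ n / \det P))%:E)%E.
Proof.
elim: n P c => [|n IH] P c Ps Ppos.
  rewrite det_mx00; split; first exact: ltr01.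
  rewrite expr0 divr1 sqrtr1.
  rewrite [LHS](_ : _ = \int[lebesgue_tuple R 0]_t (cst 1%E t))%E.
    by rewrite integral_cst//= diracT mule1.
  by apply: eq_integral => t _; rewrite /dot big_ord0 oppr0 mul0r expR0.
have p0 : 0 < P ord0 ord0.
  have -> : P ord0 ord0 = dot (delta_mx ord0 0) (P *m delta_mx ord0 0).
    rewrite -colE /dot (bigD1 ord0)//= big1 ?addr0.
      by rewrite !mxE eqxx mul1r.
    by move=> i i0; rewrite mxE (negbTE i0) mul0r.
  apply: Ppos; apply/eqP => /colP/(_ ord0); rewrite !mxE !eqxx /= => /eqP.
  by rewrite oner_eq0.
have pn0 : P ord0 ord0 != 0 by rewrite gt_eqF.
have Ss : (schur P)^T = schur P.
  apply/matrixP => i j; rewrite !mxE.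
  have sym a b : P a b = P b a by rewrite -[in LHS]Ps mxE.
  by rewrite sym (sym ord0) (sym _ ord0) [X in _ - X / _]mulrC.
have Spos v : v != 0 -> 0 < dot v (schur P *m v).
  move=> v0.
  (* With this first coordinate the completed square vanishes, and only the Schur complement
     remains. *)
  pose s := - \sum_j P (lift ord0 j) ord0 * v j 0 / P ord0 ord0.
  have := Ppos (ccons s v); rewrite dot_schur// /s addNr expr0n mulr0 add0r; apply.
  apply: contra v0 => /eqP/colP h; apply/eqP/colP => i.
  by have := h (lift ord0 i); rewrite cconsS !mxE.
pose c' : 'cV[R]_n := \col_j c (lift ord0 j) 0.
have [dS iS] := IH (schur P) c' Ss Spos.
rewrite det_schur//; split; first exact: mulr_gt0.
have cg k (M : 'M[R]_k) (d : 'cV[R]_k) :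
    continuous (fun y : 'cV[R]_k => expR (- dot (y - d) (M *m (y - d)) / 2)).
  move=> y; apply: continuous_comp; last exact: continuous_expR.
  apply: continuousM; last exact: cst_continuous.
  apply: continuousN; rewrite /dot; apply: continuous_sumR => i {}y.
  have cc l : continuous (fun y : 'cV[R]_k => (y - d) l 0).
    move=> z; under eq_fun do rewrite !mxE.
    by apply: continuousB; [exact: coord_continuous|exact: cst_continuous].
  apply: continuousM; first exact: cc.
  rewrite (_ : (fun x0 => _) = fun z => \sum_l M i l * (z - d) l 0).
    apply: continuous_sumR => l z; apply: continuousM; first exact: cst_continuous.
    exact: cc.
  by apply/funext => z; rewrite mxE.
rewrite (tonelli_cons' (g := fun y => expR (- dot (y - c) (P *m (y - c)) / 2))).
- pose m (t : n.-tuple RM) := c ord0 0 -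
    \sum_j P (lift ord0 j) ord0 * (tuple_col t - c') j 0 / P ord0 ord0.
  have E t s : expR (- dot (ccons s (tuple_col t) - c) (P *m (ccons s (tuple_col t) - c)) / 2)
    = expR (- dot (tuple_col t - c') (schur P *m (tuple_col t - c')) / 2) *
      expR (- (P ord0 ord0 * (s - m t) ^+ 2) / 2).
    have -> : ccons s (tuple_col t) - c = ccons (s - c ord0 0) (tuple_col t - c').
      apply/colP => i; case: (unliftP ord0 i) => [k ->|->].
        by rewrite [RHS]cconsS !mxE liftK /= !mxE.
      by rewrite [RHS]ccons0 !mxE unlift_none.
    rewrite dot_schur// -expRD; congr expR; rewrite /m.
    set B := \sum_j _; set D := dot _ _; ring.
  transitivity (\int[lebesgue_tuple R n]_t
    ((expR (- dot (tuple_col t - c') (schur P *m (tuple_col t - c')) / 2))%:E *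
      (Num.sqrt (2 * pi / P ord0 ord0))%:E))%E.
    apply: eq_integral => t _; rewrite -(gauss_integral1 (m t) p0).
    rewrite -ge0_integralZl//.
    + by apply: eq_integral => s _; rewrite E EFinM.
    + apply/measurable_EFinP; apply: continuous_measurable_fun => s.
      apply: continuous_comp; last exact: continuous_expR.
      apply: continuousM; last exact: cst_continuous.
      apply: continuousN; apply: continuousM; first exact: cst_continuous.
      rewrite (_ : (fun x0 => _) = fun x0 : R => (x0 - m t) * (x0 - m t)) //.
      by apply: continuousM; apply: continuousB => //; exact: cst_continuous.
  rewrite ge0_integralZr//.
  + rewrite iS -EFinM -sqrtrM; last first.
      by rewrite divr_ge0 ?exprn_ge0 ?mulr_ge0 ?pi_ge0// ltW.
    congr (Num.sqrt _)%:E; rewrite exprS; field.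
    by rewrite pn0 gt_eqF.
  + by have := measurable_contRn (cg _ (schur P) c') => /measurable_EFinP.
- by move=> y; exact: expR_ge0.
- exact: measurable_contRn.
Qed.

End gaussian_integral.

(** * Exponentially weighted classes *)

Section compactness.
Variables (R : realType) (n : nat).

Lemma cV_cube_compact (r : R) : compact [set y : 'cV[R]_n | forall i, `|y i 0| <= r].
Proof.
have := @rV_compact R n (fun=> `[-r, r]%classic) (fun=> @segment_compact _ _ _).
have cT : continuous (fun v : 'rV[R]_n => v^T).
  apply: continuous_cV => i; under eq_fun do rewrite mxE.
  exact: coord_continuous.
move=> /(continuous_compact (continuous_subspaceT cT)).
congr compact; apply/seteqP; split => y /=.
  move=> [v hv <-] i; rewrite mxE; have := hv i.
  by rewrite /= in_itv /= ler_norml.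
move=> hy; exists y^T; last exact: trmxK.
by move=> i /=; rewrite mxE in_itv /= -ler_norml.
Qed.

Lemma continuous_bounded_cube (g : 'cV[R]_n -> R) (r : R) : continuous g ->
  exists2 M : R, 0 <= M & forall y : 'cV[R]_n, (forall i, `|y i 0| <= r) -> `|g y| <= M.
Proof.
move=> cg.
have := continuous_compact (continuous_subspaceT cg) (@cV_cube_compact r).
move=> /compact_bounded[M [_ hM]].
exists (`|M| + 1); first by rewrite addr_ge0.
move=> y hy; apply: (hM (`|M| + 1)); last by exists y.
by rewrite (le_lt_trans (ler_norm _))// ltrDl.
Qed.

Lemma continuous_compact_support_integrable (g : 'cV[R]_n -> R) (r : R) :
  continuous g -> (forall (y : 'cV[R]_n) i, r < `|y i 0| -> g y = 0) -> integrableRn g.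
Proof.
move=> cg g0; have [M M0 hM] := continuous_bounded_cube r cg.
apply: (@integrableRn_le _ _ _ (fun y => M * expR (n%:R * r) * expR (- N1 y))).
- exact: measurable_contRn.
- move=> y; have [h|h] := pselect (forall i, `|y i 0| <= r).
    apply: le_trans (hM _ h) _; rewrite -mulrA -expRD ler_peMr//.
    rewrite -[leLHS]expR0 ler_expR subr_ge0 /N1.
    apply: le_trans (ler_sum _ (fun i _ => h i)) _.
    by rewrite sumr_const card_ord mulr_natl.
  have [i hi] : exists i, r < `|y i 0|.
    apply: contrapT => hh; apply: h => i; rewrite leNgt; apply/negP => hi.
    by apply: hh; exists i.
  by rewrite (g0 _ _ hi) normr0 !mulr_ge0// expR_ge0.
- by apply: integrableRnZ; exact: integrable_expN1.
Qed.

End compactness.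

Section square_integrable.
Variables (R : realType) (n : nat).
Implicit Types (u v : 'cV[R]_n -> R).

(** This yields Cauchy-Schwarz for every positive semidefinite form, including a degenerate one such
    as [aform]; so no sign of [C] is assumed. *)
Lemma discriminant (A B C : R) : (forall t, 0 <= A + 2 * t * B + t ^+ 2 * C) ->
  B ^+ 2 <= A * C.
Proof.
move=> h.
have C0 : 0 <= C.
  rewrite leNgt; apply/negP => C0.
  (* A [t] of modulus [k] and of sign opposite to [B], where [k] is at least 1 and k C = C - |A| -
     1: the trinomial is then negative. *)
  have := h (((`|A| + 1) / - C + 1) * (if 0 <= B then -1 else 1)).
  set k := (_ + 1); have k1 : 1 <= k by rewrite lerDr divr_ge0 ?addr_ge0// oppr_ge0 ltW.
  have kB : 2 * (k * (if 0 <= B then -1 else 1)) * B <= 0.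
    case: ifPn => B0; first by rewrite mulrN1 mulrN mulNr oppr_le0 !mulr_ge0// (le_trans _ k1).
    by rewrite mulr1 mulr_ge0_le0// ?mulr_ge0// ?(le_trans _ k1)// ltW// ltNge.
  have k2 : (k * (if 0 <= B then -1 else 1)) ^+ 2 = k ^+ 2.
    by case: ifP => _; rewrite ?mulrN1 ?sqrrN ?mulr1.
  rewrite k2 => hh.
  have hk : k ^+ 2 * C <= k * C.
    have k0 : 0 <= k by rewrite (le_trans _ k1).
    have h0 : (k - 1) * (k * C) <= 0.
      by rewrite mulr_ge0_le0 ?subr_ge0// mulr_ge0_le0// ltW.
    rewrite -subr_le0; apply: le_trans h0; rewrite le_eqVlt; apply/orP; left.
    by apply/eqP; ring.
  have kC : k * C = - (`|A| + 1) + C.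
    by rewrite /k mulrDl mul1r invrN mulrN mulNr divfK// lt_eqF.
  have := ler_norm A; lra.
have [CC0|Cn0] := eqVneq C 0.
  rewrite CC0 mulr0 in h *.
  have [->|B0] := eqVneq B 0; first by rewrite expr0n.
  (* The trinomial has degree one, and this is the point where it equals -1. *)
  have := h (- (A + 1) / (2 * B)).
  have -> : A + 2 * (- (A + 1) / (2 * B)) * B + (- (A + 1) / (2 * B)) ^+ 2 * 0 = -1.
    by field.
  by rewrite ler0N1.
have Cgt0 : 0 < C by rewrite lt_def Cn0.
have := h (- B / C).
have -> : A + 2 * (- B / C) * B + (- B / C) ^+ 2 * C = (A * C - B ^+ 2) / C by field.
by rewrite pmulr_lge0 ?invr_gt0// subr_ge0.
Qed.

Lemma measurableRnM u v : measurableRn u -> measurableRn v ->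
  measurableRn (fun y => u y * v y).
Proof. by move=> mu mv; have := measurable_funM mu mv. Qed.

Lemma measurableRnD u v : measurableRn u -> measurableRn v ->
  measurableRn (fun y => u y + v y).
Proof. by move=> mu mv; have := measurable_funD mu mv. Qed.

Lemma measurableRnX u k : measurableRn u -> measurableRn (fun y => u y ^+ k).
Proof. by move=> mu; have := measurable_funX k mu. Qed.

Lemma integrable_sq_mul u v : measurableRn u -> measurableRn v ->
  integrableRn (fun y => u y ^+ 2) -> integrableRn (fun y => v y ^+ 2) ->
  integrableRn (fun y => u y * v y).
Proof.
move=> mu mv iu iv.
apply: (@integrableRn_le _ _ _ (fun y => u y ^+ 2 + v y ^+ 2)).
- exact: measurableRnM.
- move=> y; rewrite normrM -[u y ^+ 2]real_normK ?num_real//.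
  rewrite -[v y ^+ 2]real_normK ?num_real//.
  set a := `|u y|; set b := `|v y|; have := sqr_ge0 (a - b).
  have := sqr_ge0 a; have := sqr_ge0 b; rewrite sqrrB; lra.
- exact: integrableRnD.
Qed.

Lemma cauchy_schwarz u v : measurableRn u -> measurableRn v ->
  integrableRn (fun y => u y ^+ 2) -> integrableRn (fun y => v y ^+ 2) ->
  intRn (fun y => u y * v y) ^+ 2 <=
  intRn (fun y => u y ^+ 2) * intRn (fun y => v y ^+ 2).
Proof.
move=> mu mv iu iv; have iuv := integrable_sq_mul mu mv iu iv.
apply: discriminant => t.
have <- : intRn (fun y => (u y + t * v y) ^+ 2) =
  intRn (fun y => u y ^+ 2) + 2 * t * intRn (fun y => u y * v y) +
  t ^+ 2 * intRn (fun y => v y ^+ 2).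
  rewrite -!intRnZ// -!intRnD//; first by apply: intRn_ext => y; ring.
  - by apply: integrableRnD => //; exact: integrableRnZ.
  - exact: integrableRnZ.
  - exact: integrableRnZ.
by apply: intRn_ge0 => y; exact: sqr_ge0.
Qed.

End square_integrable.

Section exponential_classes.
Variables (R : realType) (n : nat).
Local Notation cV := 'cV[R]_n.

Definition expb (I : Type) (m : I -> cV -> R) : Prop :=
  exists C k, [/\ 0 <= C, 0 <= k & forall i y, `|m i y| <= C * expR (k * N1 y)].

Definition wL2 (nu : R) (u : cV -> R) (y : cV) : R := u y ^+ 2 * expR (nu * N1 y).

Definition expL2 (I : Type) (u : I -> cV -> R) : Prop :=
  (forall i, measurableRn (u i)) /\ forall nu, exists C, forall i,
    integrableRn (wL2 nu (u i)) /\ intRn (wL2 nu (u i)) <= C.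

(* Up to k derivatives, MS bounds a family pointwise by an exponential (such
   functions act as multipliers), FS in L2 with every exponential weight; both
   uniformly over the family. The prefix s is for a single function. *)
Definition MS (I : Type) := Cls (@expb I).
Definition FS (I : Type) := Cls (@expL2 I).
Definition sFS k (u : cV -> R) := FS k (fun _ : unit => u).
Definition sMS k (u : cV -> R) := MS k (fun _ : unit => u).

Lemma wL2_ge0 nu u y : 0 <= wL2 nu u y.
Proof. by rewrite mulr_ge0 ?sqr_ge0// expR_ge0. Qed.

Lemma measurable_expN1 nu : measurableRn (fun y : cV => expR (nu * N1 y)).
Proof.
apply: measurable_contRn => y.
apply: continuous_comp; last exact: continuous_expR.
by apply: continuousM; [exact: cst_continuous|exact: continuous_N1].
Qed.

Lemma measurable_wL2 nu u : measurableRn u -> measurableRn (wL2 nu u).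
Proof.
by move=> mu; apply: measurableRnM; [exact: measurableRnX|exact: measurable_expN1].
Qed.

Lemma expbD I (a b : I -> cV -> R) : expb a -> expb b -> expb (fun i y => a i y + b i y).
Proof.
move=> [C [k [C0 k0 h]]] [C' [k' [C'0 k'0 h']]].
exists (C + C'), (k + k'); split; [exact: addr_ge0|exact: addr_ge0|].
move=> i y; apply: le_trans (ler_normD _ _) _; rewrite mulrDl.
apply: lerD.
  apply: le_trans (h i y) _; apply: ler_wpM2l => //.
  by rewrite ler_expR ler_wpM2r ?N1_ge0// lerDl.
apply: le_trans (h' i y) _; apply: ler_wpM2l => //.
by rewrite ler_expR ler_wpM2r ?N1_ge0// lerDr.
Qed.

Lemma expbM I (a b : I -> cV -> R) : expb a -> expb b -> expb (fun i y => a i y * b i y).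
Proof.
move=> [C [k [C0 k0 h]]] [C' [k' [C'0 k'0 h']]].
exists (C * C'), (k + k'); split; [exact: mulr_ge0|exact: addr_ge0|].
move=> i y; rewrite normrM mulrDl expRD mulrACA.
by apply: ler_pM.
Qed.

Lemma expb_cst I (c : I -> R) (M : R) : (forall i, `|c i| <= M) -> expb (fun i _ => c i).
Proof.
move=> h; exists (Num.max 0 M), 0; split => //; first by rewrite le_max lexx.
by move=> i y; rewrite mul0r expR0 mulr1 le_max h orbT.
Qed.

Lemma expL2D I (a b : I -> cV -> R) : expL2 a -> expL2 b ->
  expL2 (fun i y => a i y + b i y).
Proof.
move=> [ma ha] [mb hb]; split; first by move=> i; exact: measurableRnD.
move=> nu; have [C hC] := ha nu; have [C' hC'] := hb nu.
exists (2 * C + 2 * C') => i; have [ia Ca] := hC i; have [ib Cb] := hC' i.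
have le y : wL2 nu (fun y => a i y + b i y) y <= 2 * wL2 nu (a i) y + 2 * wL2 nu (b i) y.
  rewrite /wL2 !mulrA -mulrDl; apply: ler_wpM2r; first exact: expR_ge0.
  by have := sqr_ge0 (a i y - b i y); rewrite sqrrB sqrrD; lra.
have isum : integrableRn (fun y => 2 * wL2 nu (a i) y + 2 * wL2 nu (b i) y).
  by apply: integrableRnD; exact: integrableRnZ.
have iab : integrableRn (wL2 nu (fun y => a i y + b i y)).
  apply: integrableRn_le isum; first by apply: measurable_wL2; exact: measurableRnD.
  by move=> y; rewrite ger0_norm ?wL2_ge0.
split => //; apply: le_trans (le_intRn iab isum le) _.
by rewrite intRnD ?intRnZ//; [lra|exact: integrableRnZ|exact: integrableRnZ].
Qed.

(** A multiplier of exponential rate [k] shifts the weight by [2 * k]: this is why [expL2] asks for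
    every weight at once. *)
Lemma expL2_dom I J (v : J -> cV -> R) (u : I -> cV -> R) (s : I -> J) C k :
  0 <= C -> expL2 v -> (forall i, measurableRn (u i)) ->
  (forall i y, `|u i y| <= C * expR (k * N1 y) * `|v (s i) y|) -> expL2 u.
Proof.
move=> C0 [mv hv] mu huv; split => // nu.
have [D hD] := hv (nu + 2 * k).
exists (C ^+ 2 * D) => i; have [iv Dv] := hD (s i).
have le y : wL2 nu (u i) y <= C ^+ 2 * wL2 (nu + 2 * k) (v (s i)) y.
  rewrite /wL2 mulrDl expRD mulrC.
  have -> : C ^+ 2 * (v (s i) y ^+ 2 * (expR (nu * N1 y) * expR (2 * k * N1 y))) =
    expR (nu * N1 y) * (C ^+ 2 * (v (s i) y ^+ 2 * expR (2 * k * N1 y))) by ring.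
  apply: ler_wpM2l; first exact: expR_ge0.
  rewrite -[u i y ^+ 2]real_normK ?num_real//.
  have -> : C ^+ 2 * (v (s i) y ^+ 2 * expR (2 * k * N1 y)) =
     (C * expR (k * N1 y) * `|v (s i) y|) ^+ 2.
    rewrite !exprMn real_normK ?num_real// -expRM_natl.
    by rewrite -[2 * k * _]mulrA; ring.
  by rewrite lerXn2r ?nnegrE ?mulr_ge0 ?expR_ge0.
have ir : integrableRn (fun y => C ^+ 2 * wL2 (nu + 2 * k) (v (s i)) y) by exact: integrableRnZ.
have iu : integrableRn (wL2 nu (u i)).
  apply: integrableRn_le ir; first exact: measurable_wL2.
  by move=> y; rewrite ger0_norm ?wL2_ge0.
split => //; apply: le_trans (le_intRn iu ir le) _.
by rewrite intRnZ// ler_wpM2l// sqr_ge0.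
Qed.

Lemma expL2M I (m u : I -> cV -> R) : expb m -> (forall i, continuous (m i)) ->
  expL2 u -> (forall i, continuous (u i)) -> expL2 (fun i y => m i y * u i y).
Proof.
move=> [C [k [C0 k0 h]]] cm hu _.
apply: (@expL2_dom I I u _ id C k) => //.
- by move=> i; apply: measurableRnM; [exact: measurable_contRn|exact: hu.1].
- by move=> i y; rewrite normrM ler_wpM2r.
Qed.

Lemma FSD I k (u v : I -> cV -> R) : FS k u -> FS k v -> FS k (fun i y => u i y + v i y).
Proof. by apply: ClsD => a b; exact: expL2D. Qed.

Lemma MSD I k (u v : I -> cV -> R) : MS k u -> MS k v -> MS k (fun i y => u i y + v i y).
Proof. by apply: ClsD => a b; exact: expbD. Qed.

Lemma MSM I k (u v : I -> cV -> R) : MS k u -> MS k v -> MS k (fun i y => u i y * v i y).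
Proof. by apply: ClsM => a b; [move=> ? _ ? _; exact: expbM|exact: expbD]. Qed.

Lemma FSM I k (m u : I -> cV -> R) : MS k m -> FS k u -> FS k (fun i y => m i y * u i y).
Proof. by apply: ClsM => a b; [exact: expL2M|exact: expL2D]. Qed.

Lemma MS_cst I k (c : I -> R) (M : R) : (forall i, `|c i| <= M) -> MS k (fun i (_ : cV) => c i).
Proof.
move=> h; apply: Cls_cst; first exact: (expb_cst h).
by apply: (@expb_cst _ (fun=> 0) 0) => i; rewrite normr0.
Qed.

Lemma sMS_MS I k (m : cV -> R) : sMS k m -> MS k (fun _ : I => m).
Proof.
apply: (@Cls_reindex _ _ unit I (fun=> tt)) => v [C [k' [C0 k0 h]]].
by exists C, k'; split => // i y; exact: h.
Qed.

Lemma FS_reindex I J (s : J -> I) k (u : I -> cV -> R) : FS k u -> FS k (fun j => u (s j)).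
Proof.
apply: Cls_reindex => v [mv h]; split; first by move=> j; exact: mv.
by move=> nu; have [C hC] := h nu; exists C => j; exact: hC.
Qed.

Lemma FS_sFS I k (u : I -> cV -> R) i : FS k u -> sFS k (u i).
Proof. exact: (@FS_reindex I unit (fun=> i)). Qed.

Lemma FS_sum I k (J : Type) (r : seq J) (u : J -> I -> cV -> R) :
  (forall j, FS k (u j)) -> FS k (fun i y => \sum_(j <- r) u j i y).
Proof.
move=> h; elim: r => [|j r IH].
  apply: (@Cls_ext _ _ _ _ _ (fun _ _ => 0)); first by move=> i y; rewrite big_nil.
  have P0 : expL2 (fun (_ : I) (_ : cV) => 0).
    split; first by move=> _; exact: measurable_cst.
    move=> nu; exists 0 => _; rewrite /wL2.
    have -> : (fun y : cV => 0 ^+ 2 * expR (nu * N1 y)) = fun=> 0.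
      by apply/funext => y; rewrite expr0n mul0r.
    by rewrite intRn0; split => //; exact: integrableRn0.
  exact: (@Cls_cst _ _ _ _ _ (fun=> 0)).
apply: (@Cls_ext _ _ _ _ _ (fun i y => u j i y + \sum_(j <- r) u j i y)).
  by move=> i y; rewrite big_cons.
exact: FSD.
Qed.

Lemma MS_sum I k (J : Type) (r : seq J) (u : J -> I -> cV -> R) :
  (forall j, MS k (u j)) -> MS k (fun i y => \sum_(j <- r) u j i y).
Proof.
move=> h; elim: r => [|j r IH].
  apply: (@Cls_ext _ _ _ _ _ (fun _ _ => 0)); first by move=> i y; rewrite big_nil.
  by apply: (@MS_cst _ _ (fun=> 0) 0) => i; rewrite normr0.
apply: (@Cls_ext _ _ _ _ _ (fun i y => u j i y + \sum_(j <- r) u j i y)).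
  by move=> i y; rewrite big_cons.
exact: MSD.
Qed.

Lemma sFSZ k (c : R) u : sFS k u -> sFS k (fun y => c * u y).
Proof. by apply: FSM; apply: (@MS_cst _ _ (fun=> c) `|c|) => i. Qed.

Lemma sFSB k u v : sFS k u -> sFS k v -> sFS k (fun y => u y - v y).
Proof.
move=> hu hv; apply: (@Cls_ext _ _ _ _ _ (fun _ y => u y + (-1) * v y)).
  by move=> _ y; rewrite mulN1r.
by apply: FSD => //; exact: sFSZ.
Qed.

Lemma sFS_cont k u : sFS k u -> continuous u.
Proof. by move=> hu; exact: (@Cls_cont _ _ _ _ k _ hu tt). Qed.

Arguments sFS_cont {k u} _ _ _ _.

Lemma sFS_meas k u : sFS k u -> measurableRn u.
Proof. by move=> hu; apply: measurable_contRn; exact: sFS_cont hu. Qed.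

Lemma sFS_pd k u j : sFS k.+1 u -> sFS k (pderiv j u).
Proof. exact: Cls_pd. Qed.

Lemma sFS_is k u j y : sFS k.+1 u -> is_derive y (delta_mx j 0 : cV) u (pderiv j u y).
Proof. by move=> hu; exact: (@Cls_is _ _ _ _ k _ j hu tt y). Qed.

Lemma sFS_le k l u : (k <= l)%N -> sFS l u -> sFS k u.
Proof. exact: Cls_le. Qed.

Lemma sFS_sq k u : sFS k u -> integrableRn (fun y => u y ^+ 2).
Proof.
move=> /Cls0[_ /(_ 0)[C /(_ tt)[h _]]]; move: h; apply: integrableRn_ext => y.
by rewrite /wL2 mul0r expR0 mulr1.
Qed.

Lemma sFS_mul k l u v : sFS k u -> sFS l v -> integrableRn (fun y => u y * v y).
Proof.
move=> hu hv; apply: integrable_sq_mul.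
- exact: sFS_meas hu.
- exact: sFS_meas hv.
- exact: sFS_sq hu.
- exact: sFS_sq hv.
Qed.

Lemma sFS_CS k l u v : sFS k u -> sFS l v ->
  intRn (fun y => u y * v y) ^+ 2 <= intRn (fun y => u y ^+ 2) * intRn (fun y => v y ^+ 2).
Proof.
move=> hu hv; apply: cauchy_schwarz.
- exact: sFS_meas hu.
- exact: sFS_meas hv.
- exact: sFS_sq hu.
- exact: sFS_sq hv.
Qed.

Lemma sFS_IBP j u v : sFS 1 u -> sFS 1 v ->
  intRn (fun y => pderiv j u y * v y) = - intRn (fun y => u y * pderiv j v y).
Proof.
move=> hu hv; have pu := sFS_pd j hu; have pv := sFS_pd j hv.
apply/eqP; rewrite -subr_eq0 opprK -intRnD; last 2 first.
- exact: sFS_mul pu hv.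
- exact: sFS_mul hu pv.
have E : pderiv j (fun y => u y * v y) =
    (fun y => pderiv j u y * v y + u y * pderiv j v y).
  by have := @pderivM _ _ _ _ _ 0 0 _ _ j hu hv => /(congr1 (fun f => f tt)).
apply/eqP; rewrite -E; apply: intRn_pderiv_eq0.
- by move=> y; have [] := is_deriveM (sFS_is j y hu) (sFS_is j y hv).
- rewrite E => y; apply: (@continuousD _ _ _ (fun y => pderiv j u y * v y)
      (fun y => u y * pderiv j v y)); apply: continuousM.
  + exact: (sFS_cont pu y).
  + exact: (sFS_cont hv y).
  + exact: (sFS_cont hu y).
  + exact: (sFS_cont pv y).
- exact: sFS_mul hu hv.
- rewrite E; apply: integrableRnD; [exact: sFS_mul pu hv|exact: sFS_mul hu pv].
Qed.

End exponential_classes.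

(** * Cut-offs and functions of class C^k *)

Section cutoff.
Variable R : realType.

Lemma is_derive_quadratic (V : normedModType R) (g : V -> R) (y v : V) (d C : R) :
  (forall h : R, `|g (h *: v + y) - g y - h * d| <= C * h ^+ 2) ->
  is_derive y v g d.
Proof.
move=> hg.
have cv : (fun h : R => h^-1 *: ((g \o shift y) (h *: v) - g y)) @ 0^' --> d.
  apply/cvgrPdist_le => e e0.
  pose D := Num.max C 1; have D0 : 0 < D by rewrite lt_max ltr01 orbT.
  near=> h; have h0 : h != 0 by near: h; exact: nbhs_dnbhs_neq.
  rewrite /= -[d - _]opprB normrN.
  have -> : h^-1 *: (g (h *: v + y) - g y) - d = h^-1 * (g (h *: v + y) - g y - h * d).
    by rewrite [_ *: _]/(_ * _) [RHS]mulrBr mulKf.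
  rewrite normrM normfV ler_pdivrMl ?normr_gt0//.
  apply: le_trans (hg h) _; rewrite -real_normK ?num_real// expr2 mulrCA.
  apply: ler_wpM2l => //.
  apply: (@le_trans _ _ (D * `|h|)); first by rewrite ler_wpM2r// le_max lexx.
  rewrite -ler_pdivlMl//; near: h; apply: dnbhs0_le.
  by rewrite mulr_gt0// invr_gt0.
by apply: DeriveDef; [apply/cvg_ex; exists d|exact: cvg_lim cv].
Unshelve. all: by end_near. Qed.

Definition posp (t : R) : R := Num.max 0 t.

Lemma posp_ge0 t : 0 <= posp t.
Proof. by rewrite /posp le_max lexx. Qed.

(** The square of the positive part vanishes on a half-line and is continuously differentiable,
    which is the smoothness that integration by parts asks of a cut-off. *)
Lemma is_derive_posp2 (t : R) :
  is_derive t (1 : R) (fun t => posp t ^+ 2) (2 * posp t).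
Proof.
apply: (@is_derive_quadratic _ _ _ _ _ 1) => h; rewrite [h *: 1]mulr1 mul1r /posp.
rewrite ler_norml; apply/andP.
by case: (leP 0 t) => t0; case: (leP 0 (h + t)) => h0; split; nra.
Qed.

Lemma continuous_posp : continuous posp.
Proof.
move=> t; apply: (@continuous_max _ _ (fun=> 0) id); first exact: cst_continuous.
exact: cvg_id.
Qed.

End cutoff.

Section Ck_functions.
Variables (R : realType) (n : nat).
Local Notation cV := 'cV[R]_n.
Implicit Types (g h : cV -> R).

Definition Ck k (g : cV -> R) :=
  Cls (fun _ : unit -> cV -> R => True) k (fun _ => g).

Lemma CkD k g h : Ck k g -> Ck k h -> Ck k (fun y => g y + h y).
Proof. exact: ClsD. Qed.

Lemma CkM k g h : Ck k g -> Ck k h -> Ck k (fun y => g y * h y).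
Proof. exact: ClsM. Qed.

Lemma Ck_cst k (c : R) : Ck k (fun=> c).
Proof. exact: Cls_cst. Qed.

Lemma Ck_cont k g : Ck k g -> continuous g.
Proof. by move=> hg; exact: (@Cls_cont _ _ _ _ k _ hg tt). Qed.
Arguments Ck_cont {k g} _ _ _ _.

Lemma Ck_pd k g j : Ck k.+1 g -> Ck k (pderiv j g).
Proof. exact: Cls_pd. Qed.

Lemma Ck_is k g j y : Ck k.+1 g -> is_derive y (delta_mx j 0 : cV) g (pderiv j g y).
Proof. by move=> hg; exact: (@Cls_is _ _ _ _ k _ j hg tt y). Qed.

Lemma Ck_le k l g : (k <= l)%N -> Ck l g -> Ck k g.
Proof. exact: Cls_le. Qed.

Lemma Ck_sum k (J : Type) (r : seq J) (g : J -> cV -> R) :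
  (forall j, Ck k (g j)) -> Ck k (fun y => \sum_(j <- r) g j y).
Proof.
move=> hg; elim: r => [|j r IH].
  rewrite (_ : (fun y => _) = fun=> 0); first exact: Ck_cst.
  by apply/funext => y; rewrite big_nil.
rewrite (_ : (fun y => _) = fun y => g j y + \sum_(i <- r) g i y); first exact: CkD.
by apply/funext => y; rewrite big_cons.
Qed.

Lemma is_derive_sumR (J : Type) (r : seq J) (P : pred J) (g : J -> cV -> R) (dg : J -> R) (y v : cV) :
  (forall j, is_derive y v (g j) (dg j)) ->
  is_derive y v (fun y => \sum_(j <- r | P j) g j y) (\sum_(j <- r | P j) dg j).
Proof.
move=> hg; elim: r => [|j r IH].
  rewrite big_nil (_ : (fun y => _) = cst 0); first exact: is_derive_cst.
  by apply/funext => z; rewrite big_nil.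
rewrite big_cons; case: ifPn => Pj.
  rewrite (_ : (fun y => _) = g j + (fun y => \sum_(i <- r | P i) g i y)).
    exact: is_deriveD.
  by apply/funext => z; rewrite big_cons Pj.
rewrite (_ : (fun y => _) = (fun y => \sum_(i <- r | P i) g i y)) //.
by apply/funext => z; rewrite big_cons (negbTE Pj).
Qed.

Lemma smooth_Cls (I : Type) k (u : I -> cV -> R) : (forall i, smooth (u i)) ->
  Cls (fun _ => True) k u.
Proof.
move=> su; apply: Cls_foldr => s _; split => //.
  by move=> i; have [] := su i s.
by move=> j i y; have [_] := su i s; exact.
Qed.

Lemma smooth_Ck k g : smooth g -> Ck k g.
Proof. by move=> sg; exact: smooth_Cls. Qed.

Lemma smooth_pd g j : smooth g -> smooth (pderiv j g).
Proof. exact: (@smooth_foldr _ _ g [:: j]). Qed.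

Lemma Ck_smooth g : (forall k, Ck k g) -> smooth g.
Proof.
move=> hg s h; suff Hh k : Ck k h.
  split; first exact: (Ck_cont (Hh 0%N)).
  by move=> i y; have [] := Ck_is i y (Hh 1%N).
by rewrite /h; elim: s k {h} => [|j s IH] k //=; apply: Ck_pd; exact: IH.
Qed.

Lemma smoothD g h : smooth g -> smooth h -> smooth (fun y => g y + h y).
Proof. by move=> sg sh; apply: Ck_smooth => k; apply: CkD; exact: smooth_Ck. Qed.

Lemma smoothM g h : smooth g -> smooth h -> smooth (fun y => g y * h y).
Proof. by move=> sg sh; apply: Ck_smooth => k; apply: CkM; exact: smooth_Ck. Qed.

Lemma smooth_cst (c : R) : smooth (fun _ : cV => c).
Proof. by apply: Ck_smooth => k; exact: Ck_cst. Qed.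

Lemma smooth_sum (J : Type) (r : seq J) (g : J -> cV -> R) :
  (forall j, smooth (g j)) -> smooth (fun y => \sum_(j <- r) g j y).
Proof. by move=> sg; apply: Ck_smooth => k; apply: Ck_sum => j; exact: smooth_Ck. Qed.

(** Bootstrapping for functions of exponential type: each derivative of [g] is a multiplier times
    [g], so [g] gains one order at each turn. *)
Lemma Ck_eqmul k g (m : 'I_n -> cV -> R) : continuous g ->
  (forall j y, is_derive y (delta_mx j 0 : cV) g (m j y * g y)) ->
  (forall j, Ck k (m j)) -> Ck k g.
Proof.
move=> cg dg; elim: k => [|k IH] hm; first by split => // _.
have pE j : pderiv j g = fun y => m j y * g y.
  by apply/funext => y; exact: pderivE.
apply: ClsS => //.
- move=> j; rewrite pE; apply: CkM; first exact: Ck_le (hm j).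
  by apply: IH => i; exact: Ck_le (hm i).
Qed.

End Ck_functions.
Arguments Ck_cont {R n k g} _ _ _ _.

(** * Smooth exponential weights *)

Section signed_exponentials.
Variables (R : realType) (n : nat).
Local Notation cV := 'cV[R]_n.
Implicit Types (s : {ffun 'I_n -> bool}) (nu : R).

(** The weight e^(nu N1) is not differentiable on the coordinate hyperplanes. It is replaced by the
    2^n exponentials [sexp], one for each choice of signs: their sum dominates it, each has bounded
    logarithmic derivatives, and each is dominated by a weight in [N1]. *)
Definition slin s (y : cV) : R := \sum_k (-1) ^+ s k * y k 0.
Definition sexp nu s (y : cV) : R := expR (nu * slin s y).

Lemma sexp_ge0 nu s y : 0 <= sexp nu s y.
Proof. exact: expR_ge0. Qed.

Lemma slin_le s y : `|slin s y| <= N1 y.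
Proof.
apply: le_trans (ler_norm_sum _ _ _) _; apply: ler_sum => k _.
by rewrite normrM normrX normrN1 expr1n mul1r.
Qed.

Lemma sexp_le nu s y : sexp nu s y <= expR (`|nu| * N1 y).
Proof.
rewrite ler_expR; apply: le_trans (ler_norm _) _.
by rewrite normrM ler_wpM2l// slin_le.
Qed.

Lemma expN1_le_sum nu y : expR (nu * N1 y) <= \sum_s sexp nu s y.
Proof.
pose s0 : {ffun 'I_n -> bool} := [ffun k => y k 0 < 0].
rewrite (bigD1 s0)//= -[leLHS]addr0; apply: lerD.
  rewrite le_eqVlt; apply/orP; left; apply/eqP; congr (expR (_ * _)).
  apply: eq_bigr => k _; rewrite ffunE.
  have [h|h] := ltP (y k 0) 0; first by rewrite expr1 mulN1r ltr0_norm.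
  by rewrite expr0 mul1r ger0_norm.
by apply: sumr_ge0 => s _; exact: sexp_ge0.
Qed.

Lemma is_derive_slin s j y :
  is_derive y (delta_mx j 0 : cV) (slin s) ((-1) ^+ s j).
Proof.
have h := @is_derive_sumR _ _ _ (index_enum 'I_n) xpredT
  (fun k z => (-1) ^+ s k * z k 0) (fun k => (-1) ^+ s k * (k == j)%:R) y (delta_mx j 0).
apply: (is_derive_eq (h _)).
  move=> k.
  exact: (@is_deriveZ _ _ _ (fun z : cV => z k 0) ((-1) ^+ s k) y _ _ (is_derive_coord k j y)).
rewrite (bigD1 j)//= eqxx mulr1 big1 ?addr0// => k kj.
by rewrite (negbTE kj) mulr0.
Qed.

Lemma is_derive_sexp nu s j y :
  is_derive y (delta_mx j 0 : cV) (sexp nu s) (nu * (-1) ^+ s j * sexp nu s y).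
Proof.
have h1 : is_derive y (delta_mx j 0 : cV) (fun z => nu * slin s z) (nu * (-1) ^+ s j).
  exact: (@is_deriveZ _ _ _ (slin s) nu y _ _ (is_derive_slin s j y)).
have := @is_derive_compR _ _ expR (fun z : cV => nu * slin s z) y _ _ _
  (is_derive_expR (nu * slin s y)) h1.
by rewrite mulrC.
Qed.

Lemma continuous_sexp nu s : continuous (sexp nu s).
Proof.
move=> y; apply: continuous_comp; last exact: continuous_expR.
apply: continuousM; first exact: cst_continuous.
rewrite /slin; apply: continuous_sumR => k z.
apply: (@continuousM _ _ (fun=> (-1) ^+ s k) (fun y0 : cV => y0 k 0)).
  exact: cst_continuous.
exact: coord_continuous.
Qed.

Lemma Ck_sexp nu s k : Ck k (sexp nu s).
Proof.
apply: (@Ck_eqmul _ _ _ _ (fun j _ => nu * (-1) ^+ s j)).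
- exact: continuous_sexp.
- by move=> j y; exact: is_derive_sexp.
- by move=> j; exact: Ck_cst.
Qed.

Lemma sMS_sexp nu s k : sMS k (sexp nu s).
Proof.
have P0 : expb (fun (_ : unit) => sexp nu s).
  exists 1, `|nu|; split => // _ y; rewrite mul1r ger0_norm ?sexp_ge0//.
  exact: sexp_le.
elim: k => [|k IH]; first by split => // _; exact: continuous_sexp.
apply: ClsS => //.
- by move=> _; exact: continuous_sexp.
- by move=> j _ y; have [] := is_derive_sexp nu s j y.
move=> j; have -> : (fun _ : unit => pderiv j (sexp nu s)) =
    (fun _ y => nu * (-1) ^+ s j * sexp nu s y).
  by apply/funext => _; apply/funext => y; apply: pderivE; exact: is_derive_sexp.
apply: MSM => //.
exact: (@MS_cst _ _ _ _ (fun=> nu * (-1) ^+ s j) `|nu * (-1) ^+ s j|).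
Qed.

Lemma measurable_sexp nu s : measurableRn (sexp nu s).
Proof. by apply: measurable_contRn; exact: continuous_sexp. Qed.

Lemma expL2_sexp (I : Type) (u : I -> cV -> R) :
  (forall i, measurableRn (u i)) ->
  (forall nu s, exists C, forall i, integrableRn (fun y => u i y ^+ 2 * sexp nu s y) /\
     intRn (fun y => u i y ^+ 2 * sexp nu s y) <= C) -> expL2 u.
Proof.
move=> mu h; split => // nu.
have [C hC] := choice (h nu).
exists (\sum_s C s) => i.
have le y : wL2 nu (u i) y <= \sum_s u i y ^+ 2 * sexp nu s y.
  by rewrite -big_distrr /= ler_wpM2l ?sqr_ge0// expN1_le_sum.
have isum : integrableRn (fun y => \sum_s u i y ^+ 2 * sexp nu s y).
  by apply: integrableRn_sum => s; exact: (hC s i).1.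
have iu : integrableRn (wL2 nu (u i)).
  apply: integrableRn_le isum; first exact: measurable_wL2.
  by move=> y; rewrite ger0_norm ?wL2_ge0.
split => //; apply: le_trans (le_intRn iu isum le) _.
rewrite intRn_sum; last by move=> s; exact: (hC s i).1.
by apply: ler_sum => s _; exact: (hC s i).2.
Qed.

Lemma sexp_expL2 (I : Type) (u : I -> cV -> R) nu s : expL2 u ->
  exists C, forall i, integrableRn (fun y => u i y ^+ 2 * sexp nu s y) /\
     intRn (fun y => u i y ^+ 2 * sexp nu s y) <= C.
Proof.
move=> [mu /(_ `|nu|)[C hC]]; exists C => i; have [iu Cu] := hC i.
have le y : u i y ^+ 2 * sexp nu s y <= wL2 `|nu| (u i) y.
  by rewrite ler_wpM2l ?sqr_ge0// sexp_le.
have i1 : integrableRn (fun y => u i y ^+ 2 * sexp nu s y).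
  apply: integrableRn_le iu.
    by apply: measurableRnM; [exact: measurableRnX|exact: measurable_sexp].
  move=> y; rewrite ger0_norm; first exact: le.
  by rewrite mulr_ge0 ?sqr_ge0 ?sexp_ge0.
by split => //; apply: (le_trans _ Cu); exact: le_intRn i1 iu le.
Qed.

End signed_exponentials.

(** * The Schroedinger operator *)

Section schroedinger.
Variables (R : realType) (n : nat).
Local Notation cV := 'cV[R]_n.
Variable W : cV -> R.

Definition Hop (u : cV -> R) (y : cV) : R := - laplacian u y + W y * u y.

(** Being the square of a positive part, it controls the square of its own gradient, with a constant
    that does not depend on [k] ([dcutoff_sq_le]). *)
Definition cutoff (k : nat) (y : cV) : R :=
  posp (1 - (\sum_i y i 0 ^+ 2) / k.+1%:R ^+ 2) ^+ 2.

Lemma cutoff_support k (y : cV) i : k.+1%:R < `|y i 0| -> cutoff k y = 0.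
Proof.
move=> h; rewrite /cutoff /posp max_l ?expr0n//.
rewrite subr_le0 ler_pdivlMr ?exprn_gt0// mul1r.
apply: (@le_trans _ _ (y i 0 ^+ 2)).
  by rewrite -[leRHS]real_normK ?num_real// lerXn2r ?nnegrE// ltW.
by rewrite (bigD1 i)//= lerDl sumr_ge0// => j _; exact: sqr_ge0.
Qed.

Lemma cutoff_ge0 k y : 0 <= cutoff k y.
Proof. exact: sqr_ge0. Qed.

Lemma posp_cutoff_le1 k (y : cV) :
  posp (1 - (\sum_i y i 0 ^+ 2) / k.+1%:R ^+ 2) <= 1.
Proof.
rewrite /posp ge_max ler01 lerBlDr lerDl divr_ge0 ?sqr_ge0//.
by apply: sumr_ge0 => j _; exact: sqr_ge0.
Qed.

Lemma cutoff_le1 k y : cutoff k y <= 1.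
Proof. by rewrite /cutoff exprn_ile1// ?posp_ge0// posp_cutoff_le1. Qed.

Definition dcutoff k (j : 'I_n) (y : cV) : R :=
  2 * posp (1 - (\sum_i y i 0 ^+ 2) / k.+1%:R ^+ 2) * (- (2 * y j 0) / k.+1%:R ^+ 2).

Lemma is_derive_cutoff k j y : is_derive y (delta_mx j 0 : cV) (cutoff k) (dcutoff k j y).
Proof.
apply: (@is_derive_compR _ _ (fun t => posp t ^+ 2)
  (fun y : cV => 1 - (\sum_i y i 0 ^+ 2) / k.+1%:R ^+ 2) y _ _ _ (is_derive_posp2 _)).
have hs : is_derive y (delta_mx j 0 : cV) (fun y : cV => \sum_i y i 0 ^+ 2) (2 * y j 0).
  have h := @is_derive_sumR _ _ _ (index_enum 'I_n) xpredT
    (fun i (z : cV) => z i 0 ^+ 2) (fun i => 2 * y i 0 * (i == j)%:R) y (delta_mx j 0).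
  apply: (is_derive_eq (h _)).
    move=> i; have := @is_deriveX _ _ (fun z : cV => z i 0) 2 y _ _ (is_derive_coord i j y).
    by rewrite expr1.
  rewrite (bigD1 j)//= eqxx mulr1 big1 ?addr0// => i ij.
  by rewrite (negbTE ij) mulr0.
have := is_deriveB (is_derive_cst (1 : R) y (delta_mx j 0 : cV))
  (@is_deriveZ _ _ _ (fun y : cV => \sum_i y i 0 ^+ 2) (k.+1%:R ^- 2) y _ _ hs).
rewrite sub0r => h.
rewrite (_ : (fun y : cV => _) = cst 1 - k.+1%:R ^- 2 \*: (fun y : cV => \sum_i y i 0 ^+ 2)).
  by apply: (is_derive_eq h); rewrite -[_ *: _]/(_ * _) mulNr mulrC.
by apply/funext => z; rewrite [in LHS]mulrC.
Qed.

Lemma continuous_cutoff_arg k :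
  continuous (fun y : cV => posp (1 - (\sum_i y i 0 ^+ 2) / k.+1%:R ^+ 2)).
Proof.
move=> y; apply: (@continuous_comp _ _ _
  (fun y : cV => 1 - (\sum_i y i 0 ^+ 2) / k.+1%:R ^+ 2) (@posp R)); last exact: continuous_posp.
apply: (@continuousB _ _ _ (fun=> (1 : R)) (fun y : cV => (\sum_i y i 0 ^+ 2) / k.+1%:R ^+ 2)).
  exact: cst_continuous.
apply: (@continuousM _ _ (fun y : cV => \sum_i y i 0 ^+ 2) (fun=> k.+1%:R ^- 2)); last exact: cst_continuous.
apply: continuous_sumR => i z.
rewrite (_ : (fun _ => _) = fun z : cV => z i 0 * z i 0) //.
by apply: (@continuousM _ _ (fun z : cV => z i 0) (fun z : cV => z i 0)); exact: coord_continuous.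
Qed.

Lemma continuous_cutoff k : continuous (cutoff k).
Proof.
move=> y; rewrite /cutoff.
rewrite (_ : (fun _ => _) = fun z : cV =>
  posp (1 - (\sum_i z i 0 ^+ 2) / k.+1%:R ^+ 2) * posp (1 - (\sum_i z i 0 ^+ 2) / k.+1%:R ^+ 2)) //.
by apply: (@continuousM _ _ (fun z : cV => posp (1 - (\sum_i z i 0 ^+ 2) / k.+1%:R ^+ 2))
  (fun z : cV => posp (1 - (\sum_i z i 0 ^+ 2) / k.+1%:R ^+ 2))); exact: continuous_cutoff_arg.
Qed.

Lemma Ck1_cutoff k : Ck 1 (cutoff k).
Proof.
apply: ClsS => //.
- by move=> _; exact: continuous_cutoff.
- by move=> j _ y; have [] := is_derive_cutoff k j y.
move=> j; have -> : (fun _ : unit => pderiv j (cutoff k)) = fun _ => dcutoff k j.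
  by apply/funext => _; apply/funext => y; apply: pderivE; exact: is_derive_cutoff.
split => // _ y; rewrite /dcutoff.
apply: (@continuousM _ _ (fun y : cV => 2 * posp (1 - (\sum_i y i 0 ^+ 2) / k.+1%:R ^+ 2))
  (fun y : cV => - (2 * y j 0) / k.+1%:R ^+ 2)).
  apply: (@continuousM _ _ (fun=> 2) (fun y : cV => posp (1 - (\sum_i y i 0 ^+ 2) / k.+1%:R ^+ 2))).
    exact: cst_continuous.
  exact: continuous_cutoff_arg.
apply: (@continuousM _ _ (fun y : cV => - (2 * y j 0)) (fun=> k.+1%:R ^- 2)); last exact: cst_continuous.
apply: (@continuousN _ _ _ (fun y : cV => 2 * y j 0)); apply: (@continuousM _ _ (fun=> 2) (fun z : cV => z j 0)).
  exact: cst_continuous.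
exact: coord_continuous.
Qed.

Lemma dcutoff_sq_le k j y : dcutoff k j y ^+ 2 <= 16 * cutoff k y.
Proof.
rewrite /dcutoff /cutoff; set p := posp _.
have [->|pn0] := eqVneq p 0; first by rewrite mulr0 mul0r !expr0n mulr0.
have k0 : 0 < k.+1%:R :> R by [].
have k1 : 1 <= k.+1%:R :> R by rewrite ler1n.
have hy : y j 0 ^+ 2 <= k.+1%:R ^+ 2.
  rewrite leNgt; apply/negP => h; move/eqP: pn0; apply.
  rewrite /p /posp max_l// subr_le0 ler_pdivlMr ?exprn_gt0// mul1r.
  apply: (le_trans (ltW h)).
  by rewrite (bigD1 j)//= lerDl sumr_ge0// => i _; exact: sqr_ge0.
have -> : (2 * p * (- (2 * y j 0) / k.+1%:R ^+ 2)) ^+ 2 =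
   16 * p ^+ 2 * (y j 0 ^+ 2 / (k.+1%:R ^+ 2) ^+ 2).
  by field; rewrite gt_eqF.
rewrite -[leRHS]mulr1; apply: ler_wpM2l.
  by rewrite mulr_ge0// sqr_ge0.
rewrite ler_pdivrMr ?exprn_gt0// mul1r; apply: (le_trans hy).
by rewrite [leRHS]expr2 ler_peMr// ?exprn_ge0// exprn_ege1.
Qed.

Lemma sexp_cutoff_cvg (s : {ffun 'I_n -> bool}) nu (v : cV -> R) y :
  (fun k => cutoff k y ^+ 2 * sexp nu s y * v y) @ \oo --> sexp nu s y * v y.
Proof.
have c1 : (fun k => cutoff k y) @ \oo --> (1 : R).
  have h0 : (fun k => 1 - (\sum_i y i 0 ^+ 2) / k.+1%:R ^+ 2) @ \oo --> (1 : R).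
    rewrite -[X in _ --> X]subr0; apply: cvgB; first exact: cvg_cst.
    rewrite -[X in _ --> X](mulr0 (\sum_i y i 0 ^+ 2)).
    apply: cvgM; first exact: cvg_cst.
    rewrite (_ : (fun k => _) = fun k => (k.+1%:R^-1 : R) * k.+1%:R^-1).
      rewrite -[X in _ --> X](mulr0 0).
      by apply: cvgM; exact: cvg_harmonic.
    by apply/funext => k; rewrite expr2 invfM.
  have h1 : (fun k => posp (1 - (\sum_i y i 0 ^+ 2) / k.+1%:R ^+ 2)) @ \oo --> (1 : R).
    have p1 : (1 : R) = posp 1 by rewrite /posp max_r.
    rewrite [X in _ --> X]p1.
    by apply: continuous_cvg => //; exact: continuous_posp.
  rewrite /cutoff -[X in _ --> X](mulr1 1); under eq_fun do rewrite expr2.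
  exact: cvgM.
suff : (fun k => cutoff k y * cutoff k y * (sexp nu s y * v y)) @ \oo -->
    1 * 1 * (sexp nu s y * v y).
  by rewrite !mul1r; under eq_fun do rewrite mulrA -expr2.
by apply: cvgM; [exact: cvgM|exact: cvg_cst].
Qed.

(** Here [z] is the truncated weight, [E] the full one and [a] a derivative of [z]. The cross term
    is split so that its part in [y], a derivative of the solution, is half of what the left side of
    the energy estimate can absorb. *)
Lemma young_cross (a z E K x y : R) : 0 <= z -> 0 <= E -> 0 <= K ->
  a ^+ 2 <= K * z * E -> - (a * x * y) <= z * y ^+ 2 / 2 + K * E * x ^+ 2 / 2.
Proof.
move=> z0 E0 K0 h.
have X0 : 0 <= z * y ^+ 2 / 2 + K * E * x ^+ 2 / 2.
  by apply: addr_ge0; apply: divr_ge0 => //; apply: mulr_ge0; rewrite ?sqr_ge0// mulr_ge0.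
apply: le_trans (ler_norm _) _; rewrite normrN.
rewrite -(@ler_pXn2r _ 2)// ?nnegrE//.
rewrite real_normK ?num_real//.
have h1 : (a * x * y) ^+ 2 <= K * z * E * (x * y) ^+ 2.
  by rewrite -mulrA exprMn ler_wpM2r// sqr_ge0.
apply: (le_trans h1).
have := sqr_ge0 (z * y ^+ 2 / 2 - K * E * x ^+ 2 / 2).
have -> : (z * y ^+ 2 / 2 + K * E * x ^+ 2 / 2) ^+ 2 =
  (z * y ^+ 2 / 2 - K * E * x ^+ 2 / 2) ^+ 2 + K * z * E * (x * y) ^+ 2 by field.
by rewrite lerDr.
Qed.

(* Caccioppoli's inequality, by testing the equation against zeta u with zeta a
   compactly supported cut-off of an exponential weight. *)
Lemma caccioppoli (I : Type) (K : R) (u F : I -> cV -> R) :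
  0 <= K -> (forall y, - K <= W y) -> (forall i, Ck 2 (u i)) -> (forall i, continuous (F i)) ->
  expL2 u -> expL2 F -> (forall i y, Hop (u i) y = F i y) ->
  forall j, expL2 (fun i => pderiv j (u i)).
Proof.
move=> K0 hW cu cF Lu LF HF j.
apply: expL2_sexp => [i|nu s].
  by apply: measurable_contRn; apply: Ck_cont (Ck_pd j (cu i)).
have [Cu hCu] := sexp_expL2 nu s Lu; have [CF hCF] := sexp_expL2 nu s LF.
(* A derivative of c^2 E, with c the cut-off, is c E (2 c' + c nu) up to signs, where |c'| <= 4 and
   c <= 1. *)
pose K1 := (8 + `|nu|) ^+ 2.
have K10 : 0 <= K1 by exact: sqr_ge0.
(* Twice the energy identity contributes 1 from the product of solution and right-hand side, [2 * K]
   from the negative part of [W], and [K1] from the cross term of each coordinate. *)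
pose K2 := 1 + 2 * K + n%:R * K1.
have K20 : 0 <= K2 by rewrite !addr_ge0// !mulr_ge0.
exists (K2 * (Cu + CF)) => i.
have [iu hu] := hCu i; have [iF hF] := hCF i.
pose E := sexp nu s.
have E0 y : 0 <= E y by exact: sexp_ge0.
pose z k y := cutoff k y ^+ 2 * E y.
have z0 k y : 0 <= z k y by rewrite mulr_ge0// sqr_ge0.
have zE k y : z k y <= E y.
  by rewrite -[leRHS]mul1r ler_wpM2r// exprn_ile1// ?cutoff_ge0// cutoff_le1.
have cz k : Ck 1 (z k).
  apply: CkM; last exact: Ck_sexp.
  rewrite (_ : (fun y => _) = fun y => cutoff k y * cutoff k y) //.
  by apply: CkM; exact: Ck1_cutoff.
have dz k l y : is_derive y (delta_mx l 0 : cV) (z k)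
    (2 * cutoff k y * dcutoff k l y * E y + cutoff k y ^+ 2 * (nu * (-1) ^+ s l * E y)).
  have h1 := @is_deriveX _ _ (cutoff k) 2 y _ _ (is_derive_cutoff k l y).
  have h2 := is_deriveM h1 (is_derive_sexp nu s l y).
  apply: (is_derive_eq h2); rewrite expr1 -/E /=.
  by rewrite -![_ *: _]/(_ * _) fctE; ring.
have dzb k l y : pderiv l (z k) y ^+ 2 <= K1 * z k y * E y.
  rewrite (pderivE (dz k l y)) /z.
  set c := cutoff k y; set d := dcutoff k l y; set e := E y.
  have c0 : 0 <= c := cutoff_ge0 k y; have c1 : c <= 1 := cutoff_le1 k y.
  have hd : d ^+ 2 <= 16 * c := dcutoff_sq_le k l y.
  clearbody c d e.
  have hd4 : `|d| <= 4.
    rewrite -(@ler_pXn2r _ 2)// ?nnegrE// real_normK ?num_real//.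
    by apply: (le_trans hd); rewrite -natrX; move: c1; lra.
  have -> : 2 * c * d * e + c ^+ 2 * (nu * (-1) ^+ s l * e) =
    (c * e) * (2 * d + c * (nu * (-1) ^+ s l)) by ring.
  have -> : K1 * (c ^+ 2 * e) * e = (c * e) ^+ 2 * K1 by ring.
  rewrite exprMn ler_wpM2l ?sqr_ge0// -[leLHS]real_normK ?num_real//.
  rewrite lerXn2r ?nnegrE// ?addr_ge0//.
  apply: le_trans (ler_normD _ _) _; apply: lerD.
    by rewrite normrM gtr0_norm//; move: hd4; lra.
  rewrite !normrM normrX normrN1 expr1n mulr1 ger0_norm//.
  by rewrite ler_piMl.
pose G k l y := z k y * (u i y * pderiv l (u i) y).
have cG k l : Ck 1 (G k l).
  apply: CkM => //; apply: CkM; first exact: Ck_le (cu i).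
  exact: Ck_pd (cu i).
have dG k l y : pderiv l (G k l) y = pderiv l (z k) y * u i y * pderiv l (u i) y +
    z k y * pderiv l (u i) y ^+ 2 + z k y * (u i y * pderiv l (pderiv l (u i)) y).
  apply: pderivE.
  have h1 := Ck_is l y (cz k); have h2 := Ck_is l y (cu i).
  have h3 := Ck_is l y (Ck_pd l (cu i)).
  apply: (is_derive_eq (is_deriveM h1 (is_deriveM h2 h3))).
  by rewrite -![_ *: _]/(_ * _) fctE; ring.
have z_supp k (y : cV) l : k.+1%:R < `|y l 0| -> z k y = 0.
  by move=> h; rewrite /z (cutoff_support h) expr0n mul0r.
have dz_supp k (y : cV) l l' : k.+1%:R < `|y l 0| -> pderiv l' (z k) y = 0.
  move=> h; rewrite (pderivE (dz k l' y)) (cutoff_support h) expr0n.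
  by rewrite mulr0 !mul0r addr0.
have iG k l : integrableRn (G k l).
  apply: (@continuous_compact_support_integrable _ _ _ k.+1%:R).
    exact: Ck_cont (cG k l).
  by move=> y l' h; rewrite /G (z_supp _ _ _ h) mul0r.
have idG k l : integrableRn (pderiv l (G k l)).
  apply: (@continuous_compact_support_integrable _ _ _ k.+1%:R).
    exact: Ck_cont (Ck_pd l (cG k l)).
  move=> y l' h; rewrite dG (z_supp _ _ _ h) (dz_supp _ _ _ _ h).
  by rewrite !mul0r !addr0.
have G0 k l : intRn (pderiv l (G k l)) = 0.
  apply: intRn_pderiv_eq0 => //.
  - by move=> y; have [] := Ck_is l y (cG k l).
  - exact: Ck_cont (Ck_pd l (cG k l)).
pose D k y := z k y * \sum_l pderiv l (u i) y ^+ 2.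
have iD k l : integrableRn (fun y => z k y * pderiv l (u i) y ^+ 2).
  apply: (@continuous_compact_support_integrable _ _ _ k.+1%:R).
    have : Ck 1 (fun y => z k y * (pderiv l (u i) y * pderiv l (u i) y)).
      by apply: CkM => //; apply: CkM; exact: Ck_pd (cu i).
    exact: Ck_cont.
  by move=> y l' h; rewrite (z_supp _ _ _ h) mul0r.
have iS k : integrableRn (fun y => \sum_l pderiv l (G k l) y) by exact: integrableRn_sum.
have S0 k : intRn (fun y => \sum_l pderiv l (G k l) y) = 0.
  by rewrite intRn_sum// big1.
pose B y := u i y ^+ 2 * E y + F i y ^+ 2 * E y.
have iB : integrableRn B by exact: integrableRnD.
have key k y : z k y * pderiv j (u i) y ^+ 2 <=
    2 * \sum_l pderiv l (G k l) y + K2 * B y.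
  have h1 : z k y * pderiv j (u i) y ^+ 2 <= D k y.
    rewrite /D ler_wpM2l// (bigD1 j)//= lerDl sumr_ge0// => l _; exact: sqr_ge0.
  apply: (le_trans h1).
  have h2 : \sum_l pderiv l (G k l) y = D k y +
      \sum_l (pderiv l (z k) y * u i y * pderiv l (u i) y) + z k y * (u i y * laplacian (u i) y).
    rewrite /D /laplacian !big_distrr -!big_split /=; apply: eq_bigr => l _.
    by rewrite dG; ring.
  have h3 : laplacian (u i) y = W y * u i y - F i y by rewrite -HF /Hop; ring.
  have h4 : - \sum_l (pderiv l (z k) y * u i y * pderiv l (u i) y) <=
     D k y / 2 + n%:R * K1 * E y * u i y ^+ 2 / 2.
    rewrite -sumrN; apply: le_trans (ler_sum _ (fun l _ =>
      young_cross (u i y) (pderiv l (u i) y) (z0 k y) (E0 y) K10 (dzb k l y))) _.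
    rewrite big_split /= sumr_const card_ord /D -mulr_natl big_distrr big_distrl /=.
    by rewrite le_eqVlt; apply/orP; left; apply/eqP; congr (_ + _); ring.
  have h5 : z k y * (u i y * F i y) <= B y / 2.
    have : u i y * F i y <= (u i y ^+ 2 + F i y ^+ 2) / 2.
      by have := sqr_ge0 (u i y - F i y); rewrite sqrrB; lra.
    move=> /(ler_wpM2l (z0 k y))/le_trans; apply.
    have -> : B y / 2 = E y * ((u i y ^+ 2 + F i y ^+ 2) / 2) by rewrite /B; ring.
    by rewrite ler_wpM2r// divr_ge0// addr_ge0// sqr_ge0.
  have h6 : - (z k y * (W y * u i y ^+ 2)) <= K * (E y * u i y ^+ 2).
    have : 0 <= z k y * ((K + W y) * u i y ^+ 2).
      by rewrite mulr_ge0// mulr_ge0 ?sqr_ge0//; have := hW y; lra.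
    have : z k y * (K * u i y ^+ 2) <= E y * (K * u i y ^+ 2).
      by rewrite ler_wpM2r// mulr_ge0// sqr_ge0.
    by rewrite mulrDl mulrDr (mulrCA (E y)); lra.
  have E5 : z k y * (u i y * laplacian (u i) y) =
    z k y * (W y * u i y ^+ 2) - z k y * (u i y * F i y) by rewrite h3; ring.
  have E6 : n%:R * K1 * E y * u i y ^+ 2 / 2 <= n%:R * K1 * B y / 2.
    rewrite ler_wpM2r// -[leLHS]mulrA ler_wpM2l ?mulr_ge0//.
    by rewrite /B [E y * _]mulrC lerDl mulr_ge0// sqr_ge0.
  have E7 : K * (E y * u i y ^+ 2) <= K * B y.
    by rewrite ler_wpM2l// /B mulrC lerDl mulr_ge0// sqr_ge0.
  move: h2 h4 h5 h6 E6 E7; rewrite E5.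
  have -> : K2 * B y = B y + 2 * (K * B y) + n%:R * K1 * B y by rewrite /K2; ring.
  move: (\sum_l _) (\sum_l _) (D k y) (n%:R * K1 * E y * u i y ^+ 2) (B y)
    (z k y * (W y * u i y ^+ 2)) (z k y * (u i y * F i y)) (n%:R * K1 * B y)
    (K * B y) (K * (E y * u i y ^+ 2)).
  by clear; intros; lra.
have bound k : intRn (fun y => z k y * pderiv j (u i) y ^+ 2) <= K2 * (Cu + CF).
  apply: le_trans (le_intRn (iD k j) _ (key k)) _.
    by apply: integrableRnD; exact: integrableRnZ.
  rewrite intRnD; [|exact: integrableRnZ|exact: integrableRnZ].
  rewrite intRnZ// S0 mulr0 add0r intRnZ// ler_wpM2l// intRnD//.
  exact: lerD.
have := @fatou_intRn R n (fun k y => z k y * pderiv j (u i) y ^+ 2)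
  (fun y => pderiv j (u i) y ^+ 2 * sexp nu s y) (K2 * (Cu + CF)).
apply => //.
- by move=> k y; rewrite mulr_ge0// sqr_ge0.
- move=> y; rewrite mulrC.
  exact: (@sexp_cutoff_cvg s nu (fun y => pderiv j (u i) y ^+ 2) y).
Qed.

Lemma pderiv_Hop j (u : cV -> R) : smooth u -> smooth W ->
  pderiv j (Hop u) = fun y => Hop (pderiv j u) y + pderiv j W y * u y.
Proof.
move=> su sW; apply/funext => y; apply: pderivE.
have S (k l : 'I_n) (v : cV -> R) : smooth v -> pderiv k (pderiv l v) = pderiv l (pderiv k v).
  exact: smooth_Schwarz.
have h1 : is_derive y (delta_mx j 0 : cV) (laplacian u) (laplacian (pderiv j u) y).
  apply: (@is_derive_sumR _ _ _ (index_enum 'I_n) xpredT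
    (fun i => pderiv i (pderiv i u)) (fun i => pderiv i (pderiv i (pderiv j u)) y)) => i.
  rewrite -(S j i u su) -(S j i (pderiv i u)); last exact: smooth_pd.
  exact: Ck_is (smooth_Ck 1 (smooth_pd i (smooth_pd i su))).
have h2 := is_deriveM (Ck_is j y (smooth_Ck 1 sW)) (Ck_is j y (smooth_Ck 1 su)).
apply: (is_derive_eq (is_deriveD (is_deriveN h1) h2)).
by rewrite /Hop -![_ *: _]/(_ * _); ring.
Qed.

(** Each derivative of [u] solves the same equation with right-hand side the derivative of [F] minus
    a derivative of [W] times [u], which the induction hypothesis already controls; Caccioppoli's
    inequality starts the induction. *)
Lemma regularity (I : Type) (K : R) :
  0 <= K -> (forall y, - K <= W y) -> smooth W -> (forall k, sMS k W) ->
  forall k (u F : I -> cV -> R), (forall i, smooth (u i)) ->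
  FS 0 u -> FS k F -> (forall i y, Hop (u i) y = F i y) -> FS k.+1 u.
Proof.
move=> K0 hW sW MW; elim => [|k IH] u F su u0 FF HF.
  have h := caccioppoli K0 hW (fun i => smooth_Ck 2 (su i)) (Cls_cont FF) (Cls0 u0) (Cls0 FF) HF.
  apply: ClsS; [exact: Cls0 u0|exact: Cls_cont u0| |].
  - by move=> j i y; have [] := Ck_is j y (smooth_Ck 1 (su i)).
  - move=> j; split => // i; exact: Ck_cont (smooth_Ck 0 (smooth_pd j (su i))).
have uk : FS k.+1 u by apply: (IH u F) => //; exact: ClsW FF.
apply: ClsS; [exact: Cls0 u0|exact: Cls_cont u0| |].
- by move=> j i y; have [] := Ck_is j y (smooth_Ck 1 (su i)).
move=> j.
apply: (IH _ (fun i y => pderiv j (F i) y + (-1 * pderiv j W y) * u i y)).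
- by move=> i; exact: smooth_pd.
- by apply: (@Cls_le _ _ _ _ 0 k) => //; exact: Cls_pd uk.
- apply: FSD; first exact: Cls_pd FF.
  apply: FSM; last exact: ClsW uk.
  apply: MSM; first exact: (@MS_cst _ _ _ _ (fun=> -1) `|-1|).
  exact: sMS_MS (Cls_pd j (MW k.+1)).
- move=> i y; have := pderiv_Hop j (su i) sW.
  have -> : Hop (u i) = F i by apply/funext => y'; exact: HF.
  by move=> /(congr1 (fun f => f y)) ->; ring.
Qed.

End schroedinger.

(** * Ground state and spectral gap *)

Section norms.
Variables (R : realType).

Lemma mnorm_ge0 p q (M : 'M[R]_(p, q)) : 0 <= mnorm M.
Proof. exact: sqrtr_ge0. Qed.

Lemma mnorm_sq p q (M : 'M[R]_(p, q)) : mnorm M ^+ 2 = \sum_i \sum_j M i j ^+ 2.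
Proof. by rewrite sqr_sqrtr// !sumr_ge0// => i _; apply: sumr_ge0 => j _; exact: sqr_ge0. Qed.

Lemma entry_le_mnorm p q (M : 'M[R]_(p, q)) i j : `|M i j| <= mnorm M.
Proof.
rewrite -(@ler_pXn2r _ 2)// ?nnegrE ?mnorm_ge0// mnorm_sq real_normK ?num_real//.
rewrite (bigD1 i)//= (bigD1 j)//= -addrA lerDl addr_ge0//.
  by apply: sumr_ge0 => k _; exact: sqr_ge0.
by apply: sumr_ge0 => k _; apply: sumr_ge0 => l _; exact: sqr_ge0.
Qed.

Lemma sum_sq_le (I : finType) (a : I -> R) : (forall i, 0 <= a i) ->
  \sum_i a i ^+ 2 <= (\sum_i a i) ^+ 2.
Proof.
move=> a0; elim: (index_enum I) => [|i r IH]; first by rewrite !big_nil expr0n.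
rewrite !big_cons sqrrD; apply: (le_trans (lerD (lexx _) IH)).
rewrite -addrA lerD2l lerDr mulrn_wge0// mulr_ge0// sumr_ge0//.
Qed.

Lemma mnorm_le_sum p q (M : 'M[R]_(p, q)) : mnorm M <= \sum_i \sum_j `|M i j|.
Proof.
have s0 : 0 <= \sum_i \sum_j `|M i j| by apply: sumr_ge0 => i _; exact: sumr_ge0.
rewrite -(@ler_pXn2r _ 2)// ?nnegrE ?mnorm_ge0// mnorm_sq.
apply: le_trans (sum_sq_le _); last by move=> i; exact: sumr_ge0.
apply: ler_sum => i _.
apply: le_trans (sum_sq_le _); last by [].
by apply: ler_sum => j _; rewrite real_normK ?num_real.
Qed.

Lemma mnorm_le_N1 n (y : 'cV[R]_n) : mnorm y <= N1 y.
Proof.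
apply: le_trans (mnorm_le_sum y) _; apply: ler_sum => i _.
by rewrite big_ord1.
Qed.

Lemma at_infty_gt n (g : 'cV[R]_n -> R) : g @ at_infty --> +oo ->
  forall A, exists2 r, 0 <= r & forall (y : 'cV[R]_n) i, r < `|y i 0| -> A < g y.
Proof.
move=> goo A.
have [r _ hr] : at_infty (g @^-1` [set x | A < x]).
  by apply: goo; exists A; split => //; exact: num_real.
exists (Num.max 0 r); first by rewrite le_max lexx.
move=> y i h; apply: hr => /=; apply: lt_le_trans (entry_le_mnorm y i 0).
by apply: le_lt_trans h; rewrite le_max lexx orbT.
Qed.

Lemma poly_le_exp (l : nat) : exists2 C : R, 0 <= C & forall x : R, 0 <= x ->
  1 + x ^+ l <= C * expR x.
Proof.
exists (1 + l`!%:R); first by rewrite addr_ge0.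
move=> x x0; rewrite mulrDl mul1r; apply: lerD.
  by rewrite -[leLHS]expR0 ler_expR.
elim: l => [|l IH] in x x0 *.
  by rewrite expr0 mul1r -[leLHS]expR0 ler_expR.
rewrite mulrC -ler_pdivrMr ?ltr0n ?fact_gt0//.
by apply: le_trans (expR_ge1Dxn l x0); rewrite lerDr.
Qed.

End norms.

(** * Second differences and the maximum principle *)

Section maximum_principle.
Variables (R : realType) (n : nat).
Local Notation cV := 'cV[R]_n.
Local Notation e_ j := (delta_mx j 0 : cV).

Lemma scale_comb (a b t : R) (e y : cV) :
  (a * t) *: e + ((b * t) *: e + (- t *: e + y)) = ((a + b - 1) * t) *: e + y.
Proof. by rewrite !addrA -(scalerDl e) -(scalerDl e) mulrBl mulrDl mul1r. Qed.

(** The mean value theorem is applied to the first difference over the step [t], started at [- t],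
    and then to the first derivative. *)
Lemma second_difference (g : cV -> R) j y t : Ck 2 g -> exists2 s : R, `|s| <= `|t| &
  g (t *: e_ j + y) + g (- t *: e_ j + y) - 2 * g y =
  t * (t * pderiv j (pderiv j g) (s *: e_ j + y)).
Proof.
move=> cg.
have d1 z : derivable g z (e_ j) by have [] := Ck_is j z cg.
have d2 z : derivable (pderiv j g) z (e_ j) by have [] := Ck_is j z (Ck_pd j cg).
pose h z := g (t *: e_ j + z) - g z.
have dh z : is_derive z (e_ j) h (pderiv j g (t *: e_ j + z) - pderiv j g z).
  apply: is_deriveB; last exact: derivableP.
  apply: (is_derive_line0 _ _ _ _).2.
  have -> : (fun h0 : R => g (t *: e_ j + (h0 *: e_ j + z))) =
    (fun h0 : R => g (h0 *: e_ j + (t *: e_ j + z))).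
    by apply/funext => h0; rewrite addrCA.
  exact: (is_derive_line0 _ _ _ _).1 (derivableP (d1 _)).
have [|th [th0 th1 E1]] := @MVT_line R _ h (- t *: e_ j + y) (e_ j) t.
  by move=> z; have [] := dh z.
have [th' [th'0 th'1 E2]] :=
  @MVT_line R _ (pderiv j g) ((th * t) *: e_ j + (- t *: e_ j + y)) (e_ j) t d2.
exists ((th' + th - 1) * t).
  rewrite normrM ler_piMl// ler_norml; lra.
move: E1; rewrite -/(pderiv j h _) (pderivE (dh _)) E2 /h.
have -> : t *: e_ j + (- t *: e_ j + y) = y by rewrite addrA scaleNr subrr add0r.
have -> : (th' * t) *: e_ j + ((th * t) *: e_ j + (- t *: e_ j + y)) =
   ((th' + th - 1) * t) *: e_ j + y.
  exact: scale_comb.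
move=> <-; ring.
Qed.

Lemma second_pderiv_le0 (g : cV -> R) j y : Ck 2 g -> (forall z, g z <= g y) ->
  pderiv j (pderiv j g) y <= 0.
Proof.
move=> cg gmax; rewrite leNgt; apply/negP => D0.
have cD := Ck_cont (Ck_pd j (Ck_pd j cg)).
have /nbhs_ballP[e /= e0 he] : \forall z \near y, 0 < pderiv j (pderiv j g) z.
  exact: (cvgr_gt _ (cD y) _ D0).
have [s hs E] := second_difference j y (e / 2) cg.
have e20 : 0 < e / 2 by rewrite divr_gt0.
have : 0 < e / 2 * (e / 2 * pderiv j (pderiv j g) (s *: e_ j + y)).
  apply: (mulr_gt0 e20); apply: (mulr_gt0 e20); apply: (he _).
  rewrite -ball_normE /ball_ /= distrC addrK normrZ.
  apply: (@le_lt_trans _ _ (e / 2 * 1)); last by rewrite mulr1 ltr_pdivrMr// ltr_pMr// ltr1n.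
  apply: ler_pM => //; first by rewrite (le_trans hs)// gtr0_norm.
  apply: cV_norm_le => // k.
  by rewrite mxE; case: (_ && _); rewrite ?normr0 ?normr1.
rewrite -E; have := gmax ((e / 2) *: e_ j + y); have := gmax (- (e / 2) *: e_ j + y).
move: (g _) (g _) (g _); clear => a b c; lra.
Qed.

End maximum_principle.

Section ground_state.
Variables (R : realType) (n : nat) (V : 'cV[R]_n -> R).
Local Notation cV := 'cV[R]_n.
Variables (sV : smooth V).

Definition ground_state (y : cV) : R := expR (- V y / 2).

Local Notation gs := ground_state.

Lemma gs_gt0 y : 0 < gs y.
Proof. exact: expR_gt0. Qed.

Lemma is_derive_gs j y : is_derive y (delta_mx j 0 : cV) gs (- pderiv j V y / 2 * gs y).
Proof.
have dV := Ck_is j y (smooth_Ck 1 sV).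
have h1 : is_derive y (delta_mx j 0 : cV) (fun z => - V z / 2) (- pderiv j V y / 2).
  have := @is_deriveZ _ _ _ V (- 2^-1) y _ _ dV.
  rewrite -[_ *: pderiv _ _ _]/(_ * _) mulNr mulrC -mulNr.
  suff -> : (- 2^-1 \*: V) = (fun z => - V z / 2) by [].
  by apply/funext => z; rewrite /= -[_ *: _]/(_ * _) mulNr mulrC mulNr.
have := @is_derive_compR _ _ expR (fun z => - V z / 2) y _ _ _ (is_derive_expR (- V y / 2)) h1.
by rewrite mulrC.
Qed.

Lemma continuous_gs : continuous gs.
Proof.
have cV' := Ck_cont (smooth_Ck 0 sV).
move=> y; apply: (@continuous_comp _ _ _ (fun z => - V z / 2)); last exact: continuous_expR.
apply: (@continuousM _ _ (fun z => - V z) (fun=> 2^-1)); last exact: cst_continuous.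
by apply: continuousN; exact: cV'.
Qed.

Lemma smooth_gs : smooth gs.
Proof.
apply: Ck_smooth => k.
apply: (@Ck_eqmul _ _ _ _ (fun j y => - pderiv j V y / 2)).
- exact: continuous_gs.
- by move=> j y; exact: is_derive_gs.
- move=> j; have := CkM (@Ck_cst R n k (- 2^-1)) (smooth_Ck k (smooth_pd j sV)).
  suff -> : (fun y => - 2^-1 * pderiv j V y) = (fun y => - pderiv j V y / 2) by [].
  by apply/funext => y; rewrite mulNr mulrC mulNr.
Qed.

Lemma WpotE y : Wpot V y = \sum_i (pderiv i V y ^+ 2 / 4 - pderiv i (pderiv i V) y / 2).
Proof.
rewrite /Wpot mnorm_sq big_split /= sumrN -!big_distrl /=; congr (_ / _ - _).
by apply: eq_bigr => i _; rewrite big_ord1 !mxE.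
Qed.

Lemma smooth_Wpot : smooth (Wpot V).
Proof.
have -> : Wpot V = fun y => \sum_i (pderiv i V y * pderiv i V y * 4^-1 +
    pderiv i (pderiv i V) y * (- 2^-1)).
  apply/funext => y; rewrite WpotE; apply: eq_bigr => i _.
  by rewrite expr2 mulrN.
apply: smooth_sum => i; apply: smoothD; apply: smoothM; try exact: smooth_cst.
  by apply: smoothM; exact: smooth_pd.
by do 2! apply: smooth_pd.
Qed.

Lemma Hop_gs (u : cV -> R) y : smooth u ->
  Hop (Wpot V) (fun z => gs z * u z) y = gs y * - generator V u y.
Proof.
move=> su.
have d1 j z : is_derive z (delta_mx j 0 : cV) (fun z => gs z * u z)
    (gs z * (pderiv j u z - pderiv j V z / 2 * u z)).
  have := is_deriveM (is_derive_gs j z) (Ck_is j z (smooth_Ck 1 su)).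
  by move=> h; apply: (is_derive_eq h); rewrite -![_ *: _]/(_ * _); ring.
have E (g a b c d e : R) : g * (a - (2^-1 * c * b + e * (2^-1 * d))) +
    (b - 2^-1 * c * e) * (- c / 2 * g) = g * (a - c * b + (c ^+ 2 / 4 - d / 2) * e).
  by field.
have d2 j z : is_derive z (delta_mx j 0 : cV)
    (fun z => gs z * (pderiv j u z - pderiv j V z / 2 * u z))
    (gs z * (pderiv j (pderiv j u) z - pderiv j V z * pderiv j u z
      + (pderiv j V z ^+ 2 / 4 - pderiv j (pderiv j V) z / 2) * u z)).
  have hu := Ck_is j z (smooth_Ck 1 su).
  have hu2 := Ck_is j z (smooth_Ck 1 (smooth_pd j su)).
  have hV2 := Ck_is j z (smooth_Ck 1 (smooth_pd j sV)).
  have h3 := is_deriveM (@is_deriveZ _ _ _ (pderiv j V) (2^-1) z _ _ hV2) hu.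
  have := is_deriveM (is_derive_gs j z) (is_deriveB hu2 h3).
  rewrite (_ : gs * _ = (fun z => gs z * (pderiv j u z - pderiv j V z / 2 * u z))).
    by move=> h; apply: (is_derive_eq h); exact: E.
  by apply/funext => w; rewrite [_ / 2]mulrC.
rewrite /Hop /generator /laplacian WpotE big_distrl /=.
have E2 (g a b c d e : R) : - (g * (a - c * b + (c ^+ 2 / 4 - d / 2) * e)) +
    (c ^+ 2 / 4 - d / 2) * (g * e) = - (g * (a - c * b)) by ring.
have L i : pderiv i (pderiv i (fun z => gs z * u z)) y =
    gs y * (pderiv i (pderiv i u) y - pderiv i V y * pderiv i u y
      + (pderiv i V y ^+ 2 / 4 - pderiv i (pderiv i V) y / 2) * u y).
  have -> : pderiv i (fun z => gs z * u z) =
      (fun z => gs z * (pderiv i u z - pderiv i V z / 2 * u z)).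
    by apply/funext => z; apply: pderivE; exact: d1.
  by apply: pderivE; exact: d2.
rewrite /dot -sumrB mulrN big_distrr -!sumrN -big_split /=.
apply: eq_bigr => i _; rewrite L !mxE; exact: E2.
Qed.

End ground_state.

Lemma cube_dichotomy (R : realType) n (y : 'cV[R]_n) (r : R) :
  (forall i, `|y i 0| <= r) \/ exists i, r < `|y i 0|.
Proof.
have [h|h] := pselect (exists i, r < `|y i 0|); [by right|left => i].
by rewrite leNgt; apply/negP => hi; apply: h; exists i.
Qed.

Lemma pderivZ (R : realType) n k (c : R) j (g : 'cV[R]_n -> R) : Ck k.+1 g ->
  pderiv j (fun y => c * g y) = fun y => c * pderiv j g y.
Proof.
move=> hg; apply/funext => z; apply: pderivE.
exact: (@is_deriveZ _ _ _ g c z _ _ (Ck_is j z hg)).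
Qed.

Section single_functions.
Variables (R : realType) (n : nat).
Implicit Types (m u v : 'cV[R]_n -> R).

Lemma sMS_le k l m : (k <= l)%N -> sMS l m -> sMS k m.
Proof. exact: Cls_le. Qed.

Lemma sMS_pd k m j : sMS k.+1 m -> sMS k (pderiv j m).
Proof. exact: Cls_pd. Qed.

Lemma sMSM k m1 m2 : sMS k m1 -> sMS k m2 -> sMS k (fun y => m1 y * m2 y).
Proof. exact: MSM. Qed.

Lemma sMSD k m1 m2 : sMS k m1 -> sMS k m2 -> sMS k (fun y => m1 y + m2 y).
Proof. exact: MSD. Qed.

Lemma sMS_cst k (c : R) : sMS k (fun _ : 'cV[R]_n => c).
Proof. by apply: (@MS_cst _ _ _ _ (fun=> c) `|c|) => i. Qed.

Lemma sMSZ k (c : R) m : sMS k m -> sMS k (fun y => c * m y).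
Proof. by apply: sMSM; exact: sMS_cst. Qed.

Lemma sMS_sum k (J : Type) (r : seq J) (m : J -> 'cV[R]_n -> R) :
  (forall j, sMS k (m j)) -> sMS k (fun y => \sum_(j <- r) m j y).
Proof. exact: (@MS_sum _ _ unit k J r (fun j _ => m j)). Qed.

Lemma sFSM k m u : sMS k m -> sFS k u -> sFS k (fun y => m y * u y).
Proof. exact: FSM. Qed.

Lemma sFSD k u v : sFS k u -> sFS k v -> sFS k (fun y => u y + v y).
Proof. exact: FSD. Qed.

Lemma sFS_sum k (J : Type) (r : seq J) (u : J -> 'cV[R]_n -> R) :
  (forall j, sFS k (u j)) -> sFS k (fun y => \sum_(j <- r) u j y).
Proof. exact: (@FS_sum _ _ unit k J r (fun j _ => u j)). Qed.

End single_functions.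

Lemma FS_eqmul (R : realType) n k (g : 'cV[R]_n -> R) (m : 'I_n -> 'cV[R]_n -> R) :
  expL2 (fun _ : unit => g) -> continuous g ->
  (forall j y, is_derive y (delta_mx j 0 : 'cV[R]_n) g (m j y * g y)) ->
  (forall j, sMS k (m j)) -> sFS k g.
Proof.
move=> Lg cg dg; elim: k => [|k IH] hm; first by split => // _.
have pE j : pderiv j g = fun y => m j y * g y.
  by apply/funext => y; exact: pderivE.
apply: ClsS => // j; rewrite pE; apply: sFSM; first exact: sMS_le (hm j).
by apply: IH => i; exact: sMS_le (hm i).
Qed.

Section confining_potential.
Variables (R : realType) (n : nat) (V : 'cV[R]_n -> R).
Local Notation cV := 'cV[R]_n.
Local Notation W := (Wpot V).
Local Notation gs := (ground_state V).
Variables (sV : smooth V) (Voo : V @ at_infty --> +oo) (Woo : W @ at_infty --> +oo).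

Lemma Wpot_lower : exists2 K, 0 <= K & forall y, - K <= W y.
Proof.
have [r r0 hr] := at_infty_gt Woo 0.
have [M M0 hM] := continuous_bounded_cube r (Ck_cont (smooth_Ck 0 (smooth_Wpot sV))).
exists M => // y; have [h|[i hi]] := cube_dichotomy y r.
  by have := hM y h; rewrite ler_norml => /andP[].
by apply: (@le_trans _ _ 0); rewrite ?oppr_le0// ltW// (hr _ _ hi).
Qed.

(** Constants are in the kernel of the generator, so after conjugation the ground state is in the
    kernel of the Schroedinger operator. *)
Lemma laplacian_gs y : laplacian gs y = W y * gs y.
Proof.
have := Hop_gs sV y (smooth_cst 1 : smooth (fun _ : cV => 1)).
have -> : (fun z => gs z * 1) = gs by apply/funext => z; rewrite mulr1.
have d0 (i : 'I_n) : pderiv i (fun _ : cV => 1 : R) = fun=> 0.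
  by apply/funext => z; apply: pderivE; exact: is_derive_cst.
have d00 (i : 'I_n) : pderiv i (fun _ : cV => 0 : R) = fun=> 0.
  by apply/funext => z; apply: pderivE; exact: is_derive_cst.
have -> : generator V (fun=> 1) y = 0.
  rewrite /generator /laplacian /dot !big1 ?subr0// => i _; last by rewrite d0 d00.
  by rewrite !mxE d0 mulr0.
by rewrite oppr0 mulr0 /Hop => /eqP; rewrite addrC subr_eq0 => /eqP.
Qed.

Lemma laplacian_sexp nu s (y : cV) : laplacian (sexp nu s) y = n%:R * nu ^+ 2 * sexp nu s y.
Proof.
have d1 j : pderiv j (sexp nu s) = fun y : cV => nu * (-1) ^+ s j * sexp nu s y.
  by apply/funext => z; apply: pderivE; exact: is_derive_sexp.
rewrite /laplacian (eq_bigr (fun=> nu ^+ 2 * sexp nu s y)) => [|j _].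
  by rewrite sumr_const card_ord -[RHS]mulrA mulr_natl.
rewrite d1; apply: pderivE.
have := @is_deriveZ _ _ _ (sexp nu s) (nu * (-1) ^+ s j) y _ _ (is_derive_sexp nu s j y).
have -> : nu ^+ 2 * sexp nu s y = (nu * (-1) ^+ s j) *: (nu * (-1) ^+ s j * sexp nu s y).
  by rewrite [RHS]mulrA -expr2 exprMn sqrr_sign mulr1.
exact.
Qed.

(* The ground state is compared, outside a large cube, with the supersolution
   [C * sexp (- nu) s] of the Schroedinger equation. *)
Lemma gs_sexp_bounded nu s : exists2 C, 0 <= C & forall y, gs y * sexp nu s y <= C.
Proof.
pose lam : R := n%:R * nu ^+ 2.
have lam0 : 0 <= lam by rewrite mulr_ge0// sqr_ge0.
(* [lam] is the factor by which the Laplacian acts on [sexp (- nu) s]; beyond [r], where W exceeds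
   it, that function is a supersolution. *)
have [r r0 hr] := at_infty_gt Woo lam.
have cg : Ck 2 (fun y => gs y * sexp nu s y).
  by apply: CkM; [exact: smooth_Ck (smooth_gs sV)|exact: Ck_sexp].
have [M M0 hM] := continuous_bounded_cube r (Ck_cont cg).
exists M => // y0; rewrite leNgt; apply/negP => h0.
pose d (y : cV) := gs y + - M * sexp (- nu) s y.
have sK y : sexp nu s y * sexp (- nu) s y = 1.
  by rewrite /sexp -expRD mulNr subrr expR0.
have dE y : d y = (gs y * sexp nu s y - M) * sexp (- nu) s y.
  by rewrite mulrBl -[gs y * _ * _]mulrA sK mulr1 /d mulNr.
have d0 : 0 < d y0 by rewrite dE mulr_gt0 ?subr_gt0// expR_gt0.
have cd : Ck 2 d.
  apply: CkD; first exact: smooth_Ck (smooth_gs sV).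
  by apply: CkM; [exact: Ck_cst|exact: Ck_sexp].
(* Beyond [r2] the ground state, hence [d], is below d(y0), because [gs] is e^(-V/2); so [d] attains
   its maximum over the whole space. *)
have [r2 r20 hr2] := at_infty_gt Voo (- 2 * ln (d y0)).
pose K := [set y : cV | forall i, `|y i 0| <= Num.max r2 `|y0|].
have Ky0 : K y0.
  by move=> i; rewrite le_max coord_le_norm orbT.
have K0 : K !=set0 by exists y0.
have [ym Kym hym] := compact_EVT_max K0 (@cV_cube_compact _ _ _)
  (continuous_subspaceT (Ck_cont cd)).
have dm : d y0 <= d ym by apply: hym; exact: mem_set.
have gmax z : d z <= d ym.
  have [h|[i hi]] := cube_dichotomy z (Num.max r2 `|y0|).
    by apply: hym; exact: mem_set.
  apply: le_trans dm; rewrite /d.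
  apply: (@le_trans _ _ (gs z)).
    by rewrite gerDl mulNr oppr_le0 mulr_ge0// sexp_ge0.
  rewrite -[leRHS]lnK ?posrE// ler_expR.
  have : r2 < `|z i 0| by apply: le_lt_trans hi; rewrite le_max lexx.
  by move=> /hr2; lra.
have dm0 := lt_le_trans d0 dm.
(* On the cube of side [r] the choice of [M] makes [d] nonpositive, and [d] is positive at its
   maximum. *)
have Wm : lam < W ym.
  have [h|[i hi]] := cube_dichotomy ym r; last exact: hr _ _ hi.
  have := hM _ h => /(le_trans (ler_norm _)); rewrite -subr_le0 => h1.
  by move: dm0; rewrite dE pmulr_lgt0 ?expR_gt0// ltNge h1.
have : laplacian d ym <= 0.
  by apply: sumr_le0 => j _; exact: second_pderiv_le0.
have -> : laplacian d ym = laplacian gs ym + - M * laplacian (sexp (- nu) s) ym.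
  rewrite /laplacian big_distrr -big_split /=; apply: eq_bigr => j _.
  have cg1 := smooth_Ck 2 (smooth_gs sV).
  have ce1 := @Ck_sexp R n (- nu) s 2.
  have ce2 := @CkM R n 2 (fun=> - M) (sexp (- nu) s) (@Ck_cst R n 2 (- M)) ce1.
  have ce3 := @CkM R n 1 (fun=> - M) _ (@Ck_cst R n 1 (- M)) (Ck_pd j ce1).
  have /(congr1 (fun f => f tt)) E1 := @pderivD _ _ _ _ _ 1 1 _ _ j cg1 ce2.
  have /(congr1 (fun f => f tt)) E2 := @pderivD _ _ _ _ _ 0 0 _ _ j (Ck_pd j cg1) ce3.
  by rewrite /d E1 (pderivZ _ j ce1) E2 (pderivZ _ j (Ck_pd j ce1)).
rewrite laplacian_gs laplacian_sexp sqrrN -/lam leNgt => /negP; apply.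
have gp : 0 < gs ym := gs_gt0 V ym.
have -> : W ym * gs ym + - M * (lam * sexp (- nu) s ym) = (W ym - lam) * gs ym + lam * d ym.
  by rewrite /d; ring.
by rewrite ltr_pwDl// ?mulr_gt0 ?subr_gt0// mulr_ge0// ltW.
Qed.

Lemma gs_le kappa : exists2 C, 0 <= C & forall y, gs y * expR (kappa * N1 y) <= C.
Proof.
have h s : exists C, 0 <= C /\ forall y, gs y * sexp kappa s y <= C.
  by have [C C0 hC] := gs_sexp_bounded kappa s; exists C.
have [C hC] := choice h.
exists (\sum_s C s); first by apply: sumr_ge0 => s _; exact: (hC s).1.
move=> y; apply: (@le_trans _ _ (\sum_s gs y * sexp kappa s y)).
  by rewrite -big_distrr /= ler_wpM2l ?expN1_le_sum// ltW// gs_gt0.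
by apply: ler_sum => s _; exact: (hC s).2.
Qed.

Lemma expL2_gs : expL2 (fun _ : unit => gs).
Proof.
have mg : measurableRn gs by apply: measurable_contRn; exact: continuous_gs.
(* Squaring the bound at rate (nu + 1)/2 leaves a spare factor e^(-N1), which is integrable. *)
split=> // nu; have [C C0 hC] := gs_le ((nu + 1) / 2).
have le y : wL2 nu gs y <= C ^+ 2 * expR (- N1 y).
  have -> : wL2 nu gs y = (gs y * expR ((nu + 1) / 2 * N1 y)) ^+ 2 * expR (- N1 y).
    have E (g b c : R) : (g * expR b) ^+ 2 * expR c = g ^+ 2 * expR (2 * b + c).
      by rewrite expRD mulrA exprMn -expRM_natl.
    by rewrite E; congr (_ * expR _); field.
  rewrite ler_wpM2r ?expR_ge0// lerXn2r ?nnegrE// mulr_ge0 ?expR_ge0//.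
have i0 : integrableRn (fun y : cV => C ^+ 2 * expR (- N1 y)).
  by apply: integrableRnZ; exact: integrable_expN1.
have i1 : integrableRn (wL2 nu gs).
  apply: integrableRn_le i0; first exact: measurable_wL2.
  by move=> y; rewrite ger0_norm ?wL2_ge0.
exists (intRn (fun y : cV => C ^+ 2 * expR (- N1 y))) => _.
by split => //; exact: le_intRn i1 i0 le.
Qed.

Variables (MV : forall k, sMS k V).

Lemma sFS_gs k : sFS k gs.
Proof.
apply: (@FS_eqmul _ _ _ _ (fun j y => - 2^-1 * pderiv j V y)).
- exact: expL2_gs.
- exact: continuous_gs.
- move=> j y; apply: (is_derive_eq (is_derive_gs sV j y)).
  by rewrite !mulNr [_ / 2]mulrC.
- by move=> j; apply: sMSZ; exact: sMS_pd (MV k.+1).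
Qed.

Lemma sMS_Wpot k : sMS k W.
Proof.
have -> : W = fun y => \sum_i (4^-1 * (pderiv i V y * pderiv i V y) +
    - 2^-1 * pderiv i (pderiv i V) y).
  apply/funext => y; rewrite WpotE; apply: eq_bigr => i _.
  by rewrite expr2 mulNr; congr (_ - _); exact: mulrC.
apply: sMS_sum => i; apply: sMSD; apply: sMSZ.
  by apply: sMSM; exact: sMS_pd (MV k.+1).
exact: sMS_pd (sMS_pd i (MV k.+2)).
Qed.

(** Green's formula; the classes are unequal because both derivatives fall on [v]. *)
Lemma sFS_aform k l u v : sFS k.+1 u -> sFS l.+2 v ->
  integrableRn (fun y => dot (grad u y) (grad v y) + W y * u y * v y) /\
  aform V u v = intRn (fun y => u y * Hop W v y).
Proof.
move=> hu hv.
have hu1 : sFS 1 u by exact: sFS_le hu.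
have hv1 j : sFS 1 (pderiv j v) by apply: (@sFS_le _ _ 1 l.+1) => //; exact: sFS_pd hv.
have hWu : sFS 0 (fun y => W y * u y).
  by apply: sFSM; [exact: sMS_Wpot|exact: sFS_le hu].
have i1 j : integrableRn (fun y => pderiv j u y * pderiv j v y).
  exact: sFS_mul (sFS_pd j hu1) (hv1 j).
have i2 j : integrableRn (fun y => u y * pderiv j (pderiv j v) y).
  exact: sFS_mul hu1 (sFS_pd j (hv1 j)).
have i3 : integrableRn (fun y => W y * u y * v y) by exact: sFS_mul hWu hv.
have dE y : dot (grad u y) (grad v y) = \sum_j pderiv j u y * pderiv j v y.
  by apply: eq_bigr => j _; rewrite !mxE.
have iD : integrableRn (fun y => dot (grad u y) (grad v y)).
  by apply: (@integrableRn_ext _ _ (fun y => \sum_j pderiv j u y * pderiv j v y)) => //;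
    exact: integrableRn_sum.
split; first exact: integrableRnD.
rewrite /aform intRnD//.
have -> : intRn (fun y => u y * Hop W v y) =
    intRn (fun y => - \sum_j u y * pderiv j (pderiv j v) y + W y * u y * v y).
  apply: intRn_ext => y; rewrite /Hop /laplacian mulrDr mulrN big_distrr /=.
  by congr (_ + _); rewrite mulrCA mulrA.
rewrite intRnD//; last by apply: integrableRnN; exact: integrableRn_sum.
congr (_ + _); rewrite intRnN; last exact: integrableRn_sum.
rewrite (intRn_ext dE) !intRn_sum// -sumrN; apply: eq_bigr => j _.
by rewrite sFS_IBP.
Qed.

Lemma Hop_sFS k v : sFS k.+2 v -> sFS k (Hop W v).
Proof.
move=> hv; apply: (@Cls_ext _ _ _ _ _ (fun _ y => -1 * (\sum_j pderiv j (pderiv j v) y) + W y * v y)).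
  by move=> _ y; rewrite mulN1r.
apply: sFSD.
  by apply: sFSZ; apply: sFS_sum => j; exact: sFS_pd (sFS_pd j hv).
by apply: sFSM; [exact: sMS_Wpot|exact: sFS_le (leqW (leqnSn k)) hv].
Qed.

(* Completing the square with the ground state. *)
Lemma aform_square v : sFS 1 v ->
  integrableRn (fun y => \sum_j (pderiv j v y + pderiv j V y / 2 * v y) ^+ 2) /\
  aform V v v = intRn (fun y => \sum_j (pderiv j v y + pderiv j V y / 2 * v y) ^+ 2).
Proof.
move=> hv.
have hVv j : sFS 1 (fun y => 2^-1 * pderiv j V y * v y).
  by apply: (@sFSM _ _ 1 (fun y => 2^-1 * pderiv j V y)) => //; apply: sMSZ; exact: sMS_pd (MV 2).
have hg j : sFS 0 (fun y => pderiv j v y + 2^-1 * pderiv j V y * v y).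
  by apply: sFSD; [exact: sFS_pd hv|exact: sFS_le (hVv j)].
have i0 j : integrableRn (fun y => (pderiv j v y + pderiv j V y / 2 * v y) ^+ 2).
  apply: integrableRn_ext (sFS_sq (hg j)) => y.
  by rewrite [2^-1 * _]mulrC.
have hd j : pderiv j (fun y => 2^-1 * pderiv j V y * v y) =
   fun y => 2^-1 * pderiv j (pderiv j V) y * v y + 2^-1 * pderiv j V y * pderiv j v y.
  apply/funext => y; apply: pderivE.
  have h1 := @is_deriveZ _ _ _ (pderiv j V) (2^-1) y _ _ (Ck_is j y (smooth_Ck 1 (smooth_pd j sV))).
  apply: (is_derive_eq (is_deriveM h1 (sFS_is j y hv))).
  by rewrite addrC; congr (_ + _); exact: mulrC.
have hW : sFS 0 (fun y => W y * v y).
  by apply: sFSM; [exact: sMS_Wpot|exact: sFS_le hv].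
have iW : integrableRn (fun y => W y * v y * v y) by exact: sFS_mul hW hv.
have i1 j : integrableRn (fun y => pderiv j v y * pderiv j v y).
  exact: sFS_mul (sFS_pd j hv) (sFS_pd j hv).
have i2 j : integrableRn (fun y => pderiv j (fun y => 2^-1 * pderiv j V y * v y) y * v y).
  exact: sFS_mul (sFS_pd j (hVv j)) hv.
have i3 j : integrableRn (fun y => 2^-1 * pderiv j V y * v y * pderiv j v y).
  exact: sFS_mul (hVv j) (sFS_pd j hv).
split; first exact: integrableRn_sum.
have E y : \sum_j (pderiv j v y + pderiv j V y / 2 * v y) ^+ 2 =
   (dot (grad v y) (grad v y) + W y * v y * v y) +
   \sum_j (pderiv j (fun y => 2^-1 * pderiv j V y * v y) y * v y
           + 2^-1 * pderiv j V y * v y * pderiv j v y).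
  rewrite WpotE !big_distrl /= /dot -!big_split /=; apply: eq_bigr => j _.
  by rewrite hd !mxE; field.
rewrite [RHS](intRn_ext E) intRnD; last 2 first.
- apply: integrableRnD => //.
  apply: (@integrableRn_ext _ _ (fun y => \sum_j pderiv j v y * pderiv j v y)).
    by move=> y; apply: eq_bigr => j _; rewrite !mxE.
  exact: integrableRn_sum.
- by apply: integrableRn_sum => j; exact: integrableRnD.
rewrite intRn_sum; last by move=> j; exact: integrableRnD.
rewrite big1 ?addr0// => j _; rewrite intRnD// sFS_IBP//.
exact: addNr.
Qed.

Lemma aform_ge0 v : sFS 1 v -> 0 <= aform V v v.
Proof.
move=> /aform_square[_ ->]; apply: intRn_ge0 => y; apply: sumr_ge0 => j _; exact: sqr_ge0.
Qed.

End confining_potential.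

(** * Linear inequalities of the energy estimates *)

Section linear_arithmetic.
Variable R : realFieldType.
Implicit Types a b c d e q : R.

Lemma le_shift a b d e : - d <= e -> d + a <= b -> a <= e + b.
Proof. lra. Qed.

Lemma le_add2_nonneg e a b : 0 <= e -> 0 <= a -> b <= e + (a + b).
Proof. lra. Qed.

Lemma absorb_cross_term a b d q : 0 <= b -> 0 <= d - a -> d <= q -> a <= 2 * q - a + 2 * b.
Proof. lra. Qed.

Lemma split_cross_term a b c d e q : 0 <= a -> 0 <= b ->
  c + d + a <= b -> - c <= e -> e - d <= q -> a <= 2 * q - a + 2 * b.
Proof. lra. Qed.

End linear_arithmetic.

(** * Spectral gap, Agmon estimate and regularity of Poisson solutions *)

Section spectral_gap.
Variables (R : realType) (n : nat) (V : 'cV[R]_n -> R).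
Local Notation cV := 'cV[R]_n.
Local Notation W := (Wpot V).
Local Notation gs := (ground_state V).
Variables (sV : smooth V) (Voo : V @ at_infty --> +oo) (Woo : W @ at_infty --> +oo).
Variables (MV : forall k, sMS k V).

Lemma aform_integrable u v : sFS 1 u -> sFS 1 v ->
  integrableRn (fun y => dot (grad u y) (grad v y) + W y * u y * v y).
Proof.
move=> hu hv; apply: integrableRnD.
  apply: (@integrableRn_ext _ _ (fun y => \sum_j pderiv j u y * pderiv j v y)).
    by move=> y; apply: eq_bigr => j _; rewrite !mxE.
  by apply: integrableRn_sum => j; exact: sFS_mul (sFS_pd j hu) (sFS_pd j hv).
have hWu : sFS 0 (fun y => W y * u y).
  by apply: sFSM; [exact: sMS_Wpot|exact: sFS_le hu].
exact: sFS_mul hWu hv.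
Qed.

(** By [aform_square] the form is the integral of gs^2 |grad (v/gs)|^2. On a cube gs is bounded
    above and below, so the Poincare inequality for v/gs controls v - c gs there; outside the cube W
    > 1 and the form itself controls the L2 norm. *)
Lemma poincare_gs : exists2 C, 0 <= C & forall v, sFS 1 v -> forall eps, 0 < eps ->
  exists c, intRn (fun y => (v y - c * gs y) ^+ 2) <= C * (aform V v v + eps).
Proof.
have [K K0 hK] := Wpot_lower sV Woo.
have [r0 r00 hr0] := at_infty_gt Woo 1.
(* [r0] may be 0, and [poincare_cube] asks for a positive side. *)
pose r := r0 + 1; have r_gt0 : 0 < r by rewrite ltr_wpDl.
(* The ground state of -V is the inverse of that of V, so its derivative is already known. *)
pose V' (y : cV) := -1 * V y.
have sV' : smooth V' := smoothM (smooth_cst _) sV.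
pose gi := ground_state V'.
have gK y : gs y * gi y = 1.
  by rewrite /gi /ground_state /V' -expRD mulN1r opprK mulNr addNr expR0.
have [M M0 hM] := continuous_bounded_cube r (continuous_gs sV).
have [M' M'0 hM'] := continuous_bounded_cube r (continuous_gs sV').
have [CP CP0 hCP] := @poincare_cube R n r r_gt0.
exists (1 + (K + 1) * (M ^+ 2 * (CP * (M' ^+ 2 + 1)))).
  apply: addr_ge0 => //; apply: mulr_ge0; first exact: addr_ge0.
  apply: mulr_ge0; first exact: sqr_ge0.
  by apply: mulr_ge0; [exact: ltW|apply: addr_ge0 => //; exact: sqr_ge0].
move=> v hv eps eps0.
have hgs := sFS_gs sV Voo Woo MV.
pose g y := v y * gi y.
have cv : Ck 1 v by apply: Cls_imp hv.
have cg : Ck 1 g by apply: CkM => //; exact: smooth_Ck (smooth_gs sV').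
have dg j y : pderiv j g y = gi y * (pderiv j v y + pderiv j V y / 2 * v y).
  apply: pderivE; have h := is_deriveM (Ck_is j y cv) (is_derive_gs sV' j y).
  apply: (is_derive_eq h); rewrite (pderivZ _ j (smooth_Ck 1 sV)).
  by rewrite -![_ *: _]/(_ * _) -/gi; field.
have [|||c hc] := hCP g _ _ _ eps eps0.
- exact: Ck_cont cg.
- by move=> j y; have [] := Ck_is j y cg.
- by move=> j; exact: Ck_cont (Ck_pd j cg).
exists c.
have hw : sFS 1 (fun y => v y - c * gs y) := sFSB hv (sFSZ c (hgs 1)).
set w := fun y => v y - c * gs y in hw *.
have gsq y : (g y - c) = w y * gi y by rewrite /w mulrBl -mulrA gK mulr1.
have cb (y : cV) (P : Prop) : ((forall i, `|y i 0| <= r) -> cube 0 r y = 1 -> P) ->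
    ((exists i, r < `|y i 0|) -> cube 0 r y = 0 -> P) -> P.
  move=> h1 h2; have [h|[i hi]] := cube_dichotomy y r.
    apply: h1 => //; rewrite cube01; case: forallP => // -[] i.
    by rewrite mxE subr0.
  apply: h2; first by exists i.
  rewrite cube01; case: forallP => // /(_ i); rewrite mxE subr0 => h.
  by move: hi; rewrite ltNge h.
have iw := sFS_sq hw.
have iA : integrableRn (fun y => cube 0 r y * (g y - c) ^+ 2).
  apply: (@integrableRn_le _ _ _ (fun y => M' ^+ 2 * w y ^+ 2)); last exact: integrableRnZ.
    apply: measurableRnM; first exact: measurable_cube.
    apply: measurableRnX; apply: measurableRnD; last exact: measurable_cst.
    by apply: measurable_contRn; exact: Ck_cont cg.
  move=> y; rewrite ger0_norm; last by rewrite mulr_ge0 ?cube_ge0 ?sqr_ge0.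
  rewrite gsq exprMn mulrC; apply: (cb y) => [h ->|_ ->]; last first.
    by rewrite mulr0 mulr_ge0 ?sqr_ge0.
  rewrite mulr1 mulrC ler_wpM2r ?sqr_ge0// -[leLHS]real_normK ?num_real//.
  by rewrite lerXn2r ?nnegrE//; exact: hM'.
have [iS aS] := aform_square sV MV hv.
have iB : integrableRn (fun y => cube 0 r y * \sum_j pderiv j g y ^+ 2) /\
    forall y, cube 0 r y * \sum_j pderiv j g y ^+ 2 <=
     M' ^+ 2 * \sum_j (pderiv j v y + pderiv j V y / 2 * v y) ^+ 2.
  have le y : cube 0 r y * \sum_j pderiv j g y ^+ 2 <=
     M' ^+ 2 * \sum_j (pderiv j v y + pderiv j V y / 2 * v y) ^+ 2.
    apply: (cb y) => [h ->|_ ->]; last first.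
      by rewrite mul0r mulr_ge0 ?sqr_ge0// sumr_ge0// => j _; exact: sqr_ge0.
    rewrite mul1r big_distrr /=; apply: ler_sum => j _.
    rewrite dg exprMn ler_wpM2r ?sqr_ge0// -[leLHS]real_normK ?num_real//.
    by rewrite lerXn2r ?nnegrE//; exact: hM'.
  split => //.
  apply: (@integrableRn_le _ _ _ (fun y => M' ^+ 2 * \sum_j (pderiv j v y + pderiv j V y / 2 * v y) ^+ 2)).
  - apply: measurableRnM; first exact: measurable_cube.
    apply: measurable_contRn; apply: continuous_sumR => j.
    rewrite (_ : (fun y => _) = fun y => pderiv j g y * pderiv j g y) //.
    by move=> y; apply: (@continuousM _ _ (pderiv j g) (pderiv j g)); exact: (Ck_cont (Ck_pd j cg)).
  - move=> y; rewrite ger0_norm; first exact: le.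
    by rewrite mulr_ge0 ?cube_ge0// sumr_ge0// => j _; exact: sqr_ge0.
  - exact: integrableRnZ.
have hAB : intRn (fun y => cube 0 r y * (g y - c) ^+ 2) <=
    CP * (intRn (fun y => cube 0 r y * \sum_j pderiv j g y ^+ 2) + eps).
  by have := hc; rewrite -(intRnE iA) -(intRnE iB.1) -EFinD -EFinM lee_fin.
have hB : intRn (fun y => cube 0 r y * \sum_j pderiv j g y ^+ 2) <= M' ^+ 2 * aform V v v.
  rewrite aS -intRnZ//; apply: le_intRn; [exact: iB.1|exact: integrableRnZ|exact: iB.2].
(* The squares in [aform_square] vanish on the ground state, so subtracting [c * gs] leaves the form
   unchanged. *)
have aw : aform V w w = aform V v v.
  rewrite (aform_square sV MV hw).2 aS; apply: intRn_ext => y; apply: eq_bigr => j _.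
  congr (_ ^+ 2); have -> : pderiv j w y = pderiv j v y - c * (- pderiv j V y / 2 * gs y).
    apply: pderivE; apply: is_deriveB; first exact: sFS_is hv.
    exact: (@is_deriveZ _ _ _ gs c y _ _ (is_derive_gs sV j y)).
  by rewrite /w; field.
(* Outside the cube W w^2 already exceeds w^2. Inside, W is only at least -K, and (K + 1) w^2 makes
   up the deficit. *)
have pw y : w y ^+ 2 <= (dot (grad w y) (grad w y) + W y * w y * w y) +
    (K + 1) * (M ^+ 2 * (cube 0 r y * (g y - c) ^+ 2)).
  have d0 : 0 <= dot (grad w y) (grad w y).
    by apply: sumr_ge0 => j _; rewrite -expr2 sqr_ge0.
  rewrite -[leLHS]add0r -addrA; apply: lerD => //.
  apply: (cb y) => [h ->|[i hi] ->].
    rewrite mul1r gsq.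
    have h1 : w y ^+ 2 <= M ^+ 2 * (w y * gi y) ^+ 2.
      have -> : w y ^+ 2 = gs y ^+ 2 * (w y * gi y) ^+ 2.
        by rewrite -exprMn mulrCA gK mulr1.
      rewrite ler_wpM2r ?sqr_ge0// -[leLHS]real_normK ?num_real//.
      by rewrite lerXn2r ?nnegrE//; exact: hM.
    have h2 : - K * w y ^+ 2 <= W y * w y ^+ 2 by rewrite ler_wpM2r ?sqr_ge0.
    have h3 : (K + 1) * w y ^+ 2 <= (K + 1) * (M ^+ 2 * (w y * gi y) ^+ 2).
      by rewrite ler_wpM2l// addr_ge0.
    have h4 : (K + 1) * w y ^+ 2 = K * w y ^+ 2 + w y ^+ 2 by ring.
    rewrite -[_ * w y * w y]mulrA -expr2; move: h2 h3; rewrite h4 mulNr.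
    exact: le_shift.
  have W1 : 1 < W y by apply: (hr0 y i); apply: le_lt_trans hi; rewrite lerDl.
  rewrite mul0r !mulr0 addr0 -mulrA -expr2 -[leLHS]mul1r.
  by rewrite ler_wpM2r ?sqr_ge0// ltW.
have iw2 := aform_integrable hw hw.
apply: le_trans (le_intRn iw _ pw) _.
  by apply: integrableRnD => //; do 2! apply: integrableRnZ.
rewrite intRnD//; last by do 2! apply: integrableRnZ.
rewrite -/(aform V w w) aw intRnZ; last exact: integrableRnZ.
rewrite intRnZ//.
have a0 : 0 <= aform V v v by apply: aform_ge0.
have h1 : intRn (fun y => cube 0 r y * (g y - c) ^+ 2) <= CP * ((M' ^+ 2 + 1) * (aform V v v + eps)).
  apply: (le_trans hAB); apply: ler_wpM2l; first exact: ltW.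
  apply: (le_trans (lerD hB (lexx eps))).
  have e1 : 0 <= M' ^+ 2 * eps by rewrite mulr_ge0 ?sqr_ge0// ltW.
  rewrite mulrDl [_ ^+ 2 * (_ + _)]mulrDr mul1r -addrA lerD2l.
  by move: e1 a0; exact: le_add2_nonneg.
have h2 : (K + 1) * (M ^+ 2 * intRn (fun y => cube 0 r y * (g y - c) ^+ 2)) <=
  (K + 1) * (M ^+ 2 * (CP * ((M' ^+ 2 + 1) * (aform V v v + eps)))).
  by rewrite ler_wpM2l ?addr_ge0// ler_wpM2l ?sqr_ge0.
apply: (le_trans (lerD (lexx _) h2)).
rewrite [leRHS]mulrDl mul1r lerD//; first by rewrite lerDl ltW.
by rewrite !mulrA.
Qed.

(** The gap in dual form: orthogonality to the ground state is asked of [B] alone, since subtracting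
    [c * gs] from [v] does not change the pairing. It thus applies to Galerkin solutions, whose
    component along the ground state is not controlled. *)
Lemma spectral_gap : exists2 C, 0 <= C & forall B v, sFS 0 B -> sFS 1 v ->
  intRn (fun y => B y * gs y) = 0 ->
  intRn (fun y => B y * v y) ^+ 2 <= C * intRn (fun y => B y ^+ 2) * aform V v v.
Proof.
have [C C0 hC] := poincare_gs; exists C => // B v hB hv B0.
have hgs := sFS_gs sV Voo Woo MV.
set S := intRn (fun y => B y ^+ 2).
have S0 : 0 <= S by apply: intRn_ge0 => y; exact: sqr_ge0.
apply/ler_addgt0Pr => e e0.
have CS0 : 0 <= C * S by rewrite mulr_ge0.
(* This makes C S times the loss of [poincare_gs] at most [e]. *)
have eps0 : 0 < e / (C * S + 1) by rewrite divr_gt0// ltr_wpDl.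
have [c hc] := hC v hv _ eps0.
have -> : intRn (fun y => B y * v y) = intRn (fun y => B y * (v y - c * gs y)).
  have -> : intRn (fun y => B y * (v y - c * gs y)) =
      intRn (fun y => B y * v y - c * (B y * gs y)).
    by apply: intRn_ext => y; ring.
  rewrite intRnB ?intRnZ ?B0 ?mulr0 ?subr0//.
  - exact: sFS_mul hB (hgs 0).
  - exact: sFS_mul hB hv.
  - by apply: integrableRnZ; exact: sFS_mul hB (hgs 0).
have hw : sFS 1 (fun y => v y - c * gs y) := sFSB hv (sFSZ c (hgs 1)).
apply: le_trans (sFS_CS hB hw) _.
apply: le_trans (ler_wpM2l S0 hc) _.
rewrite mulrA [S * C]mulrC mulrDr lerD2l.
rewrite mulrA ler_pdivrMr; last by rewrite ltr_wpDl.
by rewrite mulrDr mulr1 [C * S * e]mulrC lerDl ltW.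
Qed.

(** Write S and T for the squared L2 norms of u and Hu. The gap with [B] and [v] both equal to [u]
    gives S <= C a(u,u), and Cauchy-Schwarz gives a(u,u)^2 <= S T because a(u,u) = <u, Hu>. *)
Lemma Hop_L2_bound : exists2 C, 0 <= C & forall u, sFS 2 u ->
  intRn (fun y => u y * gs y) = 0 ->
  intRn (fun y => u y ^+ 2) <= C * intRn (fun y => Hop W u y ^+ 2).
Proof.
have [C C0 hC] := spectral_gap; exists (C ^+ 2); first exact: sqr_ge0.
move=> u hu u0.
have hu0 : sFS 0 u by exact: sFS_le hu.
have hu1 : sFS 1 u by exact: sFS_le hu.
have hH := Hop_sFS MV hu.
have h1 := hC u u hu0 hu1 u0; have [_ h2] := sFS_aform MV hu1 hu.
have h3 := sFS_CS hu0 hH.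
rewrite -h2 in h3.
move: h1 h3 (aform_ge0 sV MV hu1).
have -> : intRn (fun y => u y * u y) = intRn (fun y => u y ^+ 2) by [].
have : 0 <= intRn (fun y => u y ^+ 2) by apply: intRn_ge0 => y; exact: sqr_ge0.
have : 0 <= intRn (fun y => Hop W u y ^+ 2) by apply: intRn_ge0 => y; exact: sqr_ge0.
move: (intRn _) (intRn _) (aform _ _ _) => S T a T0 S0 h1 h3 a0.
have [->|Sn0] := eqVneq S 0; first by rewrite mulr_ge0 ?sqr_ge0.
have S1 : 0 < S by rewrite lt_def Sn0.
have h4 : S <= C * a by rewrite -(ler_pM2l S1) -expr2 (le_trans h1)// mulrAC mulrC.
have h5 : S ^+ 2 <= C ^+ 2 * (S * T).
  apply: (@le_trans _ _ ((C * a) ^+ 2)); first by rewrite lerXn2r ?nnegrE ?mulr_ge0.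
  by rewrite exprMn ler_wpM2l ?sqr_ge0.
by rewrite -(ler_pM2l S1) -expr2 (le_trans h5)// mulrCA.
Qed.

(* Agmon's method: testing the equation against [sexp nu s * u], the positivity
   of the potential at infinity beats the loss from differentiating the weight. *)
Lemma agmon (I : Type) (u : I -> cV -> R) C0 :
  (forall i, sFS 2 (u i)) -> (forall i, intRn (fun y => u i y ^+ 2) <= C0) ->
  expL2 (fun i => Hop W (u i)) -> expL2 u.
Proof.
move=> hu uC0 LF; have [K K0 hK] := Wpot_lower sV Woo.
apply: expL2_sexp => [i|nu s]; first exact: sFS_meas (hu i).
(* The loss: completing the square against the weight shifts each of the [n] derivatives by nu/2 up
   to sign. *)
pose lam : R := n%:R * (nu / 2) ^+ 2.
have lam0 : 0 <= lam by rewrite mulr_ge0// sqr_ge0.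
have [r r0 hr] := at_infty_gt Woo (lam + 1).
have [M M0 hM] := continuous_bounded_cube r (@continuous_sexp R n nu s).
have [CF hCF] := sexp_expL2 nu s LF.
(* With this term added, W - lam - 1 is nonnegative on the cube as well, where the weight is bounded
   by [M] and the plain L2 bound suffices. *)
pose K' := K + lam + 1.
have K'0 : 0 <= K' by rewrite !addr_ge0.
exists (CF + 2 * (K' * (M * C0))) => i.
have hu1 : sFS 1 (u i) by exact: sFS_le (hu i).
have hu0 : sFS 0 (u i) by exact: sFS_le (hu i).
have hE k : sFS k (u i) -> sFS k (fun y => sexp nu s y * u i y).
  by move=> h; apply: sFSM => //; exact: sMS_sexp.
have hu2 := hE 1 hu1.
pose E := sexp nu s.
have E0 y : 0 <= E y := sexp_ge0 nu s y.
have iu : integrableRn (fun y => u i y ^+ 2 * E y).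
  apply: integrableRn_ext (sFS_mul hu0 (hE 0 hu0)) => y.
  by rewrite /E mulrCA mulrC -expr2.
split => //.
have [iF hF] := hCF i.
have [iQ hQ] := sFS_aform MV hu2 (hu i).
pose Q y := dot (grad (fun y => E y * u i y) y) (grad (u i) y) + W y * (E y * u i y) * u i y.
have alg (a b c d t : R) : t * t = 1 ->
    (2 * a * t * b * c + b * d) * d = b * (d + a * t * c) ^+ 2 - a ^+ 2 * (b * c ^+ 2).
  move=> t1; have -> : b * (d + a * t * c) ^+ 2 =
    b * d * d + 2 * a * t * b * c * d + a ^+ 2 * (t * t) * (b * c ^+ 2) by ring.
  by rewrite t1; ring.
have Qge y : (W y - lam) * (u i y ^+ 2 * E y) <= Q y.
  have dE j : pderiv j (fun y => E y * u i y) y =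
     nu * (-1) ^+ s j * E y * u i y + E y * pderiv j (u i) y.
    apply: pderivE; apply: (is_derive_eq (is_deriveM (is_derive_sexp nu s j y) (sFS_is j y hu1))).
    by rewrite addrC; congr (_ + _); exact: mulrC.
  have -> : Q y = E y * (\sum_j (pderiv j (u i) y + nu / 2 * (-1) ^+ s j * u i y) ^+ 2) +
      (W y - lam) * (u i y ^+ 2 * E y).
    rewrite /Q.
    have -> : dot (grad (fun y => E y * u i y) y) (grad (u i) y) =
       \sum_j (E y * (pderiv j (u i) y + nu / 2 * (-1) ^+ s j * u i y) ^+ 2
          - (nu / 2) ^+ 2 * (E y * u i y ^+ 2)).
      apply: eq_bigr => j _; rewrite !mxE dE.
      have s1 : (-1) ^+ s j * (-1) ^+ s j = 1 :> R by rewrite -expr2 sqrr_sign.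
      by rewrite -(alg _ _ _ _ _ s1); field.
    by rewrite big_split /= -big_distrr sumrN sumr_const card_ord /= /lam -mulr_natl; ring.
  by rewrite lerDr mulr_ge0// sumr_ge0// => j _; exact: sqr_ge0.
have pw y : u i y ^+ 2 * E y <= 2 * Q y - u i y ^+ 2 * E y + 2 * (K' * (M * u i y ^+ 2)).
  have h0 : 0 <= u i y ^+ 2 * E y by rewrite mulr_ge0 ?sqr_ge0.
  have h1 : 0 <= K' * (M * u i y ^+ 2) := mulr_ge0 K'0 (mulr_ge0 M0 (sqr_ge0 _)).
  have := Qge y; have [h|[j hj]] := cube_dichotomy y r; last first.
    have := hr y j hj; rewrite -subr_gt0 => /ltW h2.
    have := mulr_ge0 h2 h0; move: h1.
    have -> : (W y - (lam + 1)) * (u i y ^+ 2 * E y) =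
       (W y - lam) * (u i y ^+ 2 * E y) - u i y ^+ 2 * E y by ring.
    exact: absorb_cross_term.
  have h2 : u i y ^+ 2 * E y <= M * u i y ^+ 2.
    by rewrite mulrC ler_wpM2r ?sqr_ge0// (le_trans (ler_norm _))//; exact: hM.
  have h3 := ler_wpM2l K'0 h2.
  have h4 : - K * (u i y ^+ 2 * E y) <= W y * (u i y ^+ 2 * E y) by rewrite ler_wpM2r.
  have h5 : K' * (u i y ^+ 2 * E y) =
    K * (u i y ^+ 2 * E y) + lam * (u i y ^+ 2 * E y) + u i y ^+ 2 * E y by rewrite /K'; ring.
  rewrite h5 in h3; rewrite mulrBl; move: h4; rewrite mulNr; move: h0 h1 h3.
  exact: split_cross_term.
have i1 : integrableRn (fun y => K' * (M * u i y ^+ 2)).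
  by do 2! apply: integrableRnZ; exact: sFS_sq hu0.
have iR : integrableRn (fun y => 2 * Q y - u i y ^+ 2 * E y).
  by apply: integrableRnB => //; exact: integrableRnZ.
apply: le_trans (le_intRn iu _ pw) _.
  by apply: integrableRnD => //; exact: integrableRnZ.
rewrite intRnD//; last exact: integrableRnZ.
have iM : integrableRn (fun y => M * u i y ^+ 2) by apply: integrableRnZ; exact: sFS_sq hu0.
rewrite intRnZ// intRnZ// intRnZ; last exact: sFS_sq hu0.
apply: lerD; last by rewrite ler_wpM2l// ler_wpM2l// ler_wpM2l.
rewrite intRnB//; last exact: integrableRnZ.
rewrite intRnZ// lerBlDr.
have -> : intRn Q = intRn (fun y => E y * u i y * Hop W (u i) y) by [].
have iuF : integrableRn (fun y => E y * u i y * Hop W (u i) y).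
  exact: sFS_mul hu2 (Hop_sFS MV (hu i)).
rewrite -intRnZ//.
apply: (@le_trans _ _ (intRn (fun y => Hop W (u i) y ^+ 2 * E y + u i y ^+ 2 * E y))).
  apply: le_intRn; [exact: integrableRnZ|exact: integrableRnD|move=> y].
  have := mulr_ge0 (E0 y) (sqr_ge0 (u i y - Hop W (u i) y)).
  move: (E y) (u i y) (Hop W (u i) y) => a b d; rewrite sqrrB => h.
  rewrite -subr_ge0; apply: (le_trans h); rewrite le_eqVlt; apply/orP; left.
  by apply/eqP; ring.
by rewrite intRnD// lerD2r.
Qed.

(** Two passes. The polynomial growth of each [Phi i], with its own constants, first places each
    solution separately in the regular classes, so that integrations by parts are legitimate. The
    gap then gives an L2 bound uniform in [i], and the Agmon and Caccioppoli estimates are run again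
    on the whole family. *)
Lemma poisson_regularity : exists2 C, 0 <= C &
  forall (I : Type) (Phi F : I -> cV -> R),
  (forall i, smooth (Phi i)) ->
  (forall i, exists (D : R) (l : nat), forall y, `|Phi i y| <= D * (1 + mnorm y ^+ l)) ->
  (forall k, MS k F) -> (forall i y, - generator V (Phi i) y = F i y) ->
  (forall i, intRn (fun y => expR (- V y) * Phi i y) = 0) ->
  (forall k, FS k (fun i y => gs y * Phi i y)) /\
  forall i, intRn (fun y => (gs y * Phi i y) ^+ 2) <= C * intRn (fun y => (gs y * F i y) ^+ 2).
Proof.
have [C C0 hC] := Hop_L2_bound; exists C => // I Phi F sPhi Phil MF HF Phi0.
have [K K0 hK] := Wpot_lower sV Woo.
have sW := smooth_Wpot sV; have MW := sMS_Wpot MV.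
have hgs := sFS_gs sV Voo Woo MV.
pose u i y := gs y * Phi i y.
have su i : smooth (u i) := smoothM (smooth_gs sV) (sPhi i).
have Hu i y : Hop W (u i) y = F i y * gs y.
  by rewrite /u (Hop_gs sV _ (sPhi i)) HF mulrC.
have FF k : FS k (fun i y => F i y * gs y).
  exact: FSM (MF k) (@FS_reindex _ _ unit I (fun=> tt) k (fun _ => gs) (hgs k)).
have u0 i : sFS 0 (u i).
  split => //; last by move=> _; exact: Ck_cont (smooth_Ck 0 (su i)).
  have [D [l hD]] := Phil i; have [D' D'0 hD'] := poly_le_exp R l.
  apply: (@expL2_dom _ _ _ _ (fun _ : unit => gs) _ id (`|D| * D') 1).
  - by rewrite mulr_ge0.
  - exact: Cls0 (hgs 0).
  - by move=> _; apply: measurable_contRn; exact: Ck_cont (smooth_Ck 0 (su i)).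
  move=> _ y; rewrite normrM mulrC ler_wpM2r// mul1r.
  apply: (le_trans (hD y)); apply: (@le_trans _ _ (`|D| * (1 + mnorm y ^+ l))).
    by rewrite ler_wpM2r ?ler_norm// addr_ge0// exprn_ge0// mnorm_ge0.
  rewrite -mulrA ler_wpM2l// (le_trans (hD' _ (mnorm_ge0 _)))// ler_wpM2l// ler_expR.
  exact: mnorm_le_N1.
(* First pass, for a fixed [i]. *)
have uk i k : sFS k.+1 (u i).
  exact: (@regularity _ _ W unit K K0 hK sW MW k (fun=> u i) (fun=> fun y => F i y * gs y)
    (fun=> su i) (u0 i) (FS_sFS i (FF k)) (fun=> Hu i)).
have bd i : intRn (fun y => u i y ^+ 2) <= C * intRn (fun y => (gs y * F i y) ^+ 2).
  have := hC (u i) (uk i 1).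
  have -> : intRn (fun y => u i y * gs y) = intRn (fun y => expR (- V y) * Phi i y).
    apply: intRn_ext => y; rewrite /u mulrAC; congr (_ * _).
    by rewrite /ground_state -expRD; congr expR; field.
  rewrite Phi0 => /(_ erefl) /le_trans; apply.
  rewrite le_eqVlt; apply/orP; left; apply/eqP; congr (_ * _); apply: intRn_ext => y.
  by rewrite Hu mulrC.
split => //.
have [mF hF] := Cls0 (FF 0); have [CF hCF] := hF 0.
(* Second pass, with bounds independent of [i]. *)
have Lu : expL2 u.
  apply: (@agmon I u (C * CF)) => //.
  - move=> i; apply: (le_trans (bd i)); rewrite ler_wpM2l//.
    apply: le_trans (hCF i).2; rewrite le_eqVlt; apply/orP; left; apply/eqP.
    by apply: intRn_ext => y; rewrite /wL2 mul0r expR0 mulr1 mulrC.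
  - rewrite (_ : (fun i => _) = fun i y => F i y * gs y); first exact: Cls0 (FF 0).
    by apply/funext => i; apply/funext => y; exact: Hu.
move=> k; apply: (@ClsW _ _ _ _ k); apply: (regularity K0 hK sW MW su _ (FF k) Hu).
by split => // i; exact: Ck_cont (smooth_Ck 0 (su i)).
Qed.

End spectral_gap.

(** * Hermite functions *)

Section one_dimensional.
Variable R : realType.
Implicit Types (s : R) (r : nat).

(** Two consecutive polynomials are carried along, which makes the three-term recurrence
    structural. *)
Fixpoint hermite_rec r s : R * R :=
  if r is r'.+1 then
    let: (p, q) := hermite_rec r' s in (q, s * q - r'.+1%:R * p)
  else (1, s).

(* The monic (probabilists') Hermite polynomials. *)
Definition Hf r s : R := (hermite_rec r s).1.

Lemma Hf0 s : Hf 0 s = 1. Proof. by []. Qed.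

Lemma HfSS r s : Hf r.+2 s = s * Hf r.+1 s - r.+1%:R * Hf r s.
Proof. by rewrite /Hf /=; case: (hermite_rec r s). Qed.

(** At r = 0 the value [r.-1] is a default; here and below it comes with a factor [r%:R] or
    [Num.sqrt r%:R], which is 0. *)
Lemma Hf_rec r s : Hf r.+1 s = s * Hf r s - r%:R * Hf r.-1 s.
Proof.
case: r => [|r]; first by rewrite /Hf /= mul0r subr0 mulr1.
exact: HfSS.
Qed.

Lemma is_derive_Hf r s : is_derive s (1 : R) (Hf r) (r%:R * Hf r.-1 s).
Proof.
suff : is_derive s (1 : R) (Hf r) (r%:R * Hf r.-1 s) /\
    is_derive s (1 : R) (Hf r.+1) (r.+1%:R * Hf r s) by case.
elim: r => [|r [IH1 IH2]].
  split; first by rewrite mul0r; exact: is_derive_cst.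
  by rewrite mulr1; exact: is_derive_id.
split => //.
rewrite (_ : Hf r.+2 = id * Hf r.+1 - r.+1%:R \*: Hf r); last first.
  by apply/funext => t; rewrite HfSS.
apply: (is_derive_eq (is_deriveB (is_deriveM (is_derive_id s 1) IH2)
  (@is_deriveZ _ _ _ (Hf r) r.+1%:R s _ _ IH1))).
rewrite -![_ *: _]/(_ * _) mulr1 Hf_rec -[r.+2%:R]natr1 -[r.+1%:R]natr1.
by rewrite /id; ring.
Qed.

Lemma is_derive_sq s : is_derive s (1 : R) (fun s => s ^+ 2) (2 * s).
Proof.
apply: (is_derive_eq (is_deriveM (is_derive_id s 1) (is_derive_id s 1))).
by rewrite -![_ *: _]/(_ * _) /id; ring.
Qed.

Lemma derive1n_gauss r :
  derive1n r (fun s : R => expR (- s ^+ 2 / 2)) = fun s => (-1) ^+ r * Hf r s * expR (- s ^+ 2 / 2).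
Proof.
have dg (s : R) : is_derive s (1 : R) (fun s : R => expR (- s ^+ 2 / 2)) (- s * expR (- s ^+ 2 / 2)).
  have h : is_derive s (1 : R) (fun s : R => - s ^+ 2 / 2) (- s).
    have := @is_deriveZ _ _ _ (fun s : R => s ^+ 2) (- 2^-1) s _ _
      (is_derive_sq s).
    rewrite (_ : _ \*: _ = (fun s : R => - s ^+ 2 / 2)).
      by move=> h; apply: (is_derive_eq h); rewrite -![_ *: _]/(_ * _); field.
    by apply/funext => t; rewrite /= -[_ *: _]/(_ * _); ring.
  have := @is_derive_compR _ _ expR (fun s : R => - s ^+ 2 / 2) s _ _ _ (is_derive_expR _) h.
  by rewrite mulrC.
elim: r => [|r IH].
  by apply/funext => s; rewrite /= expr0 mul1r mul1r.
rewrite derive1nS IH; apply/funext => s; rewrite derive1E.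
have h := is_deriveM (is_derive_Hf r s) (dg s).
have := @is_deriveZ _ _ _ (Hf r * (fun s : R => expR (- s ^+ 2 / 2))) ((-1) ^+ r) s _ _ h.
rewrite (_ : _ \*: _ = (fun s => (-1) ^+ r * Hf r s * expR (- s ^+ 2 / 2))); last first.
  by apply/funext => t; rewrite /= -[_ *: _]/(_ * _) mulrA.
have alg (e a b c p t : R) : e * (a * (- t * b) + b * (c * p)) = -1 * e * (t * a - c * p) * b.
  by ring.
by move=> [_ ->]; rewrite Hf_rec [(-1) ^+ r.+1]exprS; exact: alg.
Qed.

Lemma hermiteE r s : hermite r s = Hf r s / Num.sqrt r`!%:R.
Proof.
rewrite /hermite derive1n_gauss mulrAC.
have -> : (-1) ^+ r / Num.sqrt r`!%:R * ((-1) ^+ r * Hf r s * expR (- s ^+ 2 / 2)) * expR (s ^+ 2 / 2) =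
  ((-1) ^+ r * (-1) ^+ r) * (Hf r s / Num.sqrt r`!%:R) * (expR (- s ^+ 2 / 2) * expR (s ^+ 2 / 2)) by ring.
by rewrite -expRD mulNr addNr expR0 mulr1 -expr2 sqrr_sign mul1r.
Qed.

(** The one-dimensional Hermite function up to a constant factor: the exponential is the square root
    of the Gaussian weight. *)
Definition hh r s : R := hermite r s * expR (- s ^+ 2 / 4).

Lemma sqrt_fact r : Num.sqrt r.+1`!%:R = Num.sqrt r.+1%:R * Num.sqrt r`!%:R :> R.
Proof. by rewrite factS natrM sqrtrM// ler0n. Qed.

Lemma sqrt_fact_neq0 r : Num.sqrt r`!%:R != 0 :> R.
Proof. by rewrite gt_eqF// sqrtr_gt0 ltr0n fact_gt0. Qed.

Lemma sqrt_natM r : Num.sqrt r%:R * Num.sqrt r%:R = r%:R :> R.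
Proof. by rewrite -expr2 sqr_sqrtr// ler0n. Qed.

Lemma Hf_pred_norm r s : r%:R * Hf r.-1 s / Num.sqrt r`!%:R =
  Num.sqrt r%:R * (Hf r.-1 s / Num.sqrt r.-1`!%:R).
Proof.
case: r => [|r]; first by rewrite sqrtr0 !mul0r.
have h1 := sqrt_fact_neq0 r.
have h2 : Num.sqrt r.+1%:R != 0 :> R by rewrite gt_eqF// sqrtr_gt0 ltr0n.
rewrite sqrt_fact -{1}(sqrt_natM r.+1) /=; field; exact/andP.
Qed.

Lemma hermite_mulX r s : s * hermite r s =
  Num.sqrt r.+1%:R * hermite r.+1 s + Num.sqrt r%:R * hermite r.-1 s.
Proof.
rewrite !hermiteE -(Hf_pred_norm r s) Hf_rec sqrt_fact.
have h1 := sqrt_fact_neq0 r.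
have h2 : Num.sqrt r.+1%:R != 0 :> R by rewrite gt_eqF// sqrtr_gt0 ltr0n.
by field; exact/andP.
Qed.

Lemma hh_mulX r s : s * hh r s = Num.sqrt r.+1%:R * hh r.+1 s + Num.sqrt r%:R * hh r.-1 s.
Proof. by rewrite /hh mulrA hermite_mulX; ring. Qed.

Lemma is_derive_hh r s : is_derive s (1 : R) (hh r)
  ((Num.sqrt r%:R * hh r.-1 s - Num.sqrt r.+1%:R * hh r.+1 s) / 2).
Proof.
have h1 : is_derive s (1 : R) (hermite r) (Num.sqrt r%:R * hermite r.-1 s).
  have := @is_deriveZ _ _ _ (Hf r) (Num.sqrt r`!%:R)^-1 s _ _ (is_derive_Hf r s).
  rewrite (_ : _ \*: _ = hermite r); last by apply/funext => t; rewrite hermiteE mulrC.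
  move=> h; apply: (is_derive_eq h); rewrite hermiteE -Hf_pred_norm.
  by rewrite -[_ *: _]/(_ * _) mulrC.
have h2 : is_derive s (1 : R) (fun s : R => - s ^+ 2 / 4) (- s / 2).
  have := @is_deriveZ _ _ _ (fun s : R => s ^+ 2) (- 4^-1) s _ _
    (is_derive_sq s).
  rewrite (_ : _ \*: _ = (fun s : R => - s ^+ 2 / 4)).
    by move=> h; apply: (is_derive_eq h); rewrite -![_ *: _]/(_ * _); field.
  by apply/funext => t; rewrite /= -[_ *: _]/(_ * _); ring.
have h3 := @is_derive_compR _ _ expR (fun s : R => - s ^+ 2 / 4) s _ _ _ (is_derive_expR _) h2.
apply: (is_derive_eq (is_deriveM h1 h3)).
rewrite -![_ *: _]/(_ * _).
have -> : hermite r s * (expR (- s ^+ 2 / 4) * (- s / 2)) = - (s * hh r s) / 2 by rewrite /hh; ring.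
by rewrite hh_mulX /hh; field.
Qed.

End one_dimensional.

Section multi_indices.
Variable n : nat.
Implicit Types (a b : multi n) (k : 'I_n).

Definition wt a := (\sum_i a i)%N.
Definition inc a k : multi n := [ffun i => (a i + (i == k))%N].
(** When [a k] is 0 this is [a] itself; in the ladder relations that value is multiplied by the
    square root of [a k]. *)
Definition dec a k : multi n := [ffun i => (a i - (i == k))%N].
Definition mi0 : multi n := [ffun=> 0%N].

Lemma incK a k : dec (inc a k) k = a.
Proof. by apply/ffunP => i; rewrite !ffunE addnK. Qed.

Lemma decK a k : (0 < a k)%N -> inc (dec a k) k = a.
Proof.
move=> ak; apply/ffunP => i; rewrite !ffunE subnK//.
by have [->|] := eqVneq i k.
Qed.

Lemma wt_inc a k : wt (inc a k) = (wt a).+1.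
Proof.
rewrite /wt; under eq_bigr do rewrite ffunE.
rewrite big_split /= (bigD1 k)//= (bigD1 k (P := xpredT) (F := fun i => nat_of_bool (i == k)))//=.
by rewrite eqxx [X in (1 + X)%N]big1 ?addn0 ?addn1// => i /negbTE ->.
Qed.

Lemma wt_dec a k : (0 < a k)%N -> wt a = (wt (dec a k)).+1.
Proof. by move=> ak; rewrite -(wt_inc _ k) decK. Qed.

Lemma wt_eq0 a : wt a = 0%N -> a = mi0.
Proof.
move/eqP; rewrite /wt sum_nat_eq0 => /forallP h; apply/ffunP => i; rewrite ffunE.
exact/eqP/(h i).
Qed.

Lemma wt_gt0 a : (0 < wt a)%N -> exists k, (0 < a k)%N.
Proof.
move=> h; apply: contrapT => hn; move: h; rewrite /wt big1// => i _.
by apply/eqP; rewrite -leqn0 leqNgt; apply/negP => ai; apply: hn; exists i.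
Qed.

(** The ladder relation expresses the function of index [inc a k] by those of [a] and of [dec a k],
    hence the strong induction hypothesis. *)
Lemma multi_ind (P : multi n -> Prop) :
  P mi0 -> (forall a k, (forall b, (wt b <= wt a)%N -> P b) -> P (inc a k)) -> forall a, P a.
Proof.
move=> P0 PS a; suff H N : forall b, (wt b <= N)%N -> P b by exact: (H (wt a)).
elim: N => [|N IH] b; first by rewrite leqn0 => /eqP/wt_eq0 ->.
move=> hb; have [/wt_eq0->//|wb] := eqVneq (wt b) 0%N.
have [k bk] : exists k, (0 < b k)%N by apply: wt_gt0; rewrite lt0n.
rewrite -(decK bk); apply: PS => c hc; apply: IH.
by apply: (leq_trans hc); rewrite -ltnS -(wt_dec bk).
Qed.

Lemma mem_midx d a : (a \in midx n d) = (wt a <= d)%N.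
Proof.
apply/mapP/idP => [[b]|h].
  rewrite mem_filter => /andP[hb _] ->; rewrite /wt.
  by under eq_bigr do rewrite ffunE.
have hi i : (a i < d.+1)%N.
  by rewrite ltnS (leq_trans _ h)// /wt (bigD1 i)//= leq_addr.
exists [ffun i => Ordinal (hi i)]; last by apply/ffunP => i; rewrite !ffunE.
rewrite mem_filter mem_enum andbT.
by under eq_bigr do rewrite ffunE.
Qed.

Lemma midx_uniq d : uniq (midx n d).
Proof.
rewrite map_inj_uniq; first by rewrite filter_uniq// enum_uniq.
move=> a b /ffunP h; apply/ffunP => i; apply: val_inj.
by have := h i; rewrite !ffunE.
Qed.

End multi_indices.

Section preliminaries.
Variables (R : realType) (n : nat).
Local Notation cV := 'cV[R]_n.

Lemma is_derive_prodR (J : eqType) (r : seq J) (g : J -> cV -> R) (dg : J -> R) (y v : cV) :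
  uniq r -> (forall j, is_derive y v (g j) (dg j)) ->
  is_derive y v (fun y => \prod_(j <- r) g j y)
    (\sum_(j <- r) dg j * \prod_(i <- r | i != j) g i y).
Proof.
move=> + hg; elim: r => [|j r IH] => [_|/= /andP[jr ur]].
  rewrite big_nil (_ : (fun y => _) = cst 1); first exact: is_derive_cst.
  by apply/funext => z; rewrite big_nil.
rewrite (_ : (fun y => _) = g j * (fun y => \prod_(i <- r) g i y)); last first.
  by apply/funext => z; rewrite big_cons.
apply: (is_derive_eq (is_deriveM (hg j) (IH ur))).
rewrite -![_ *: _]/(_ * _) big_cons [in RHS]big_cons eqxx addrC; congr (_ + _).
  rewrite mulrC; congr (_ * _); rewrite [LHS]big_seq [RHS]big_seq_cond; apply: eq_bigl => i.
  by have [->|] := eqVneq i j; rewrite ?(negbTE jr) ?andbT.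
rewrite big_distrr /= !big_seq; apply: eq_bigr => i ir.
rewrite big_cons ifT; last by apply: contraNneq jr => ->.
by rewrite mulrCA.
Qed.

Lemma expL2_decay (g : cV -> R) : measurableRn g ->
  (forall kappa, exists C, forall y, `|g y| * expR (kappa * N1 y) <= C) ->
  expL2 (fun _ : unit => g).
Proof.
move=> mg hg; split=> // nu; have [C hC] := hg ((nu + 1) / 2).
have le y : wL2 nu g y <= C ^+ 2 * expR (- N1 y).
  have E (x b c : R) : (x * expR b) ^+ 2 * expR c = x ^+ 2 * expR (2 * b + c).
    by rewrite expRD mulrA exprMn -expRM_natl.
  have -> : wL2 nu g y = (`|g y| * expR ((nu + 1) / 2 * N1 y)) ^+ 2 * expR (- N1 y).
    by rewrite E real_normK ?num_real//; congr (_ * expR _); field.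
  have h0 : 0 <= `|g y| * expR ((nu + 1) / 2 * N1 y) by rewrite mulr_ge0 ?expR_ge0.
  rewrite ler_wpM2r ?expR_ge0// lerXn2r ?nnegrE//.
  exact: le_trans h0 (hC y).
have i0 : integrableRn (fun y : cV => C ^+ 2 * expR (- N1 y)).
  by apply: integrableRnZ; exact: integrable_expN1.
have i1 : integrableRn (wL2 nu g).
  apply: integrableRn_le i0; first exact: measurable_wL2.
  by move=> y; rewrite ger0_norm ?wL2_ge0.
exists (intRn (fun y : cV => C ^+ 2 * expR (- N1 y))) => _.
by split => //; exact: le_intRn i1 i0 le.
Qed.

Lemma sMS_coord k (j : 'I_n) : sMS k (fun y : cV => y j 0).
Proof.
have P0 : expb (fun _ : unit => (fun y : cV => y j 0)).
  exists 1, 1; split => // _ y; rewrite !mul1r.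
  apply: (@le_trans _ _ (N1 y)); first by rewrite /N1 (bigD1 j)//= lerDl sumr_ge0.
  by apply: le_trans (expR_ge1Dx _); rewrite lerDr.
have cc : continuous (fun y : cV => y j 0) by exact: coord_continuous.
case: k => [|k]; first by split => // _.
apply: ClsS => // [l _ y|l].
  by have [] := is_derive_coord j l y.
have -> : (fun _ : unit => pderiv l (fun y : cV => y j 0)) = (fun _ _ => (j == l)%:R).
  by apply/funext => _; apply/funext => y; apply: pderivE; exact: is_derive_coord.
exact: sMS_cst.
Qed.

End preliminaries.

(** * Hermite functions in an affine frame *)

Section hermite_frame.
Variables (R : realType) (n : nat) (S : 'M[R]_n) (mu : 'cV[R]_n) (cG : R).
Variable hS : S \in unitmx.
Local Notation cV := 'cV[R]_n.
Local Notation Si := (invmx S).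
Local Notation sq r := (Num.sqrt r%:R).
Implicit Types (a b : multi n) (y : cV).

Definition zc (k : 'I_n) (y : cV) : R := (Si *m (y - mu)) k 0.

(** The frame is any invertible matrix and the factor [cG] is free: the covariance matrix and the
    normalization only enter through [hermite_fun_ef]. *)
Definition ef a (y : cV) : R := cG * \prod_k hh (a k) (zc k y).

Lemma zcE k y : zc k y = \sum_j Si k j * (y j 0 - mu j 0).
Proof. by rewrite /zc mxE; apply: eq_bigr => j _; rewrite !mxE. Qed.

Lemma zcK y i : y i 0 = mu i 0 + \sum_k S i k * zc k y.
Proof.
have -> : \sum_k S i k * zc k y = (S *m (Si *m (y - mu))) i 0 by rewrite mxE.
by rewrite mulmxA mulmxV// mul1mx !mxE [RHS]addrC subrK.
Qed.

Lemma is_derive_zc j k y : is_derive y (delta_mx j 0 : cV) (zc k) (Si k j).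
Proof.
have h := @is_derive_sumR _ _ _ (index_enum 'I_n) xpredT
  (fun l (z : cV) => Si k l * (z l 0 - mu l 0)) (fun l => Si k l * (l == j)%:R) y (delta_mx j 0).
have -> : zc k = fun y => \sum_l Si k l * (y l 0 - mu l 0) by apply/funext => z; exact: zcE.
apply: (is_derive_eq (h _)).
  move=> l; have h1 := is_deriveB (is_derive_coord l j y)
    (is_derive_cst (mu l 0) y (delta_mx j 0 : cV)).
  have := @is_deriveZ _ _ _ _ (Si k l) y _ _ h1.
  by rewrite subr0.
rewrite (bigD1 j)//= eqxx mulr1 big1 ?addr0// => l lj.
by rewrite (negbTE lj) mulr0.
Qed.

Lemma sMS_zc m k : sMS m (zc k).
Proof.
have -> : zc k = fun y => \sum_l Si k l * (y l 0 + - mu l 0) by apply/funext => z; exact: zcE.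
apply: sMS_sum => l; apply: sMSZ; apply: sMSD; [exact: sMS_coord|exact: sMS_cst].
Qed.

Lemma prod_inc (F : 'I_n -> nat -> R) a k :
  \prod_i F i (inc a k i) = F k (a k).+1 * \prod_(i | i != k) F i (a i).
Proof.
rewrite (bigD1 k)//= ffunE eqxx addn1; congr (_ * _).
by apply: eq_bigr => i ik; rewrite ffunE (negbTE ik) addn0.
Qed.

Lemma prod_dec (F : 'I_n -> nat -> R) a k :
  \prod_i F i (dec a k i) = F k (a k).-1 * \prod_(i | i != k) F i (a i).
Proof.
rewrite (bigD1 k)//= ffunE eqxx subn1; congr (_ * _).
by apply: eq_bigr => i ik; rewrite ffunE (negbTE ik) subn0.
Qed.

Lemma ef_mulz k a y :
  zc k y * ef a y = sq (a k).+1 * ef (inc a k) y + sq (a k) * ef (dec a k) y.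
Proof.
rewrite /ef (prod_inc (fun i r => hh r (zc i y))) (prod_dec (fun i r => hh r (zc i y))).
rewrite (bigD1 k)//=; set P := \prod_(i | _) _.
have -> : zc k y * (cG * (hh (a k) (zc k y) * P)) = cG * P * (zc k y * hh (a k) (zc k y)) by ring.
by rewrite hh_mulX; ring.
Qed.

Lemma is_derive_ef j a y : is_derive y (delta_mx j 0 : cV) (ef a)
  (\sum_k Si k j * ((sq (a k) * ef (dec a k) y - sq (a k).+1 * ef (inc a k) y) / 2)).
Proof.
have h k : is_derive y (delta_mx j 0 : cV) (fun y => hh (a k) (zc k y))
    ((sq (a k) * hh (a k).-1 (zc k y) - sq (a k).+1 * hh (a k).+1 (zc k y)) / 2 * Si k j).
  exact: (@is_derive_compR _ _ (hh (a k)) (zc k) y _ _ _ (is_derive_hh _ _) (is_derive_zc j k y)).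
have h1 := is_derive_prodR (index_enum_uniq 'I_n) h.
apply: (is_derive_eq (@is_deriveZ _ _ _ _ cG y _ _ h1)).
rewrite -[_ *: _]/(_ * _) big_distrr /=; apply: eq_bigr => k _.
rewrite /ef (prod_inc (fun i r => hh r (zc i y))) (prod_dec (fun i r => hh r (zc i y))).
by rewrite /=; ring.
Qed.

Lemma pderiv_ef j a : pderiv j (ef a) = fun y =>
  \sum_k Si k j * ((sq (a k) * ef (dec a k) y - sq (a k).+1 * ef (inc a k) y) / 2).
Proof. by apply/funext => y; apply: pderivE; exact: is_derive_ef. Qed.

Lemma ef0E y : ef (mi0 n) y = cG * expR (- (\sum_k zc k y ^+ 2) / 4).
Proof.
rewrite /ef mulNr big_distrl /= -sumrN expR_sum; congr (_ * _); apply: eq_bigr => k _.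
by rewrite ffunE /hh hermiteE Hf0 fact0 sqrtr1 divr1 mul1r mulNr.
Qed.

Lemma N1_le_zc y : N1 y <= N1 mu + (\sum_i \sum_k `|S i k|) * \sum_k `|zc k y|.
Proof.
rewrite /N1 big_distrl /= -big_split /=; apply: ler_sum => i _.
rewrite zcK; apply: (le_trans (ler_normD _ _)); rewrite lerD2l.
apply: (le_trans (ler_norm_sum _ _ _)); rewrite big_distrl /=; apply: ler_sum => k _.
by rewrite normrM ler_wpM2l// (bigD1 k)//= lerDl sumr_ge0.
Qed.

(** The exponent 1/8, against 1/4 in [ef0E], leaves room for the factor e^qdist of [Pol_decay]. The
    bound comes from c x <= x^2/8 + 2 c^2 in each coordinate. *)
Lemma gauss_decay kappa : exists C, forall y,
  expR (- (\sum_k zc k y ^+ 2) / 8) * expR (kappa * N1 y) <= C.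
Proof.
pose B : R := \sum_i \sum_k `|S i k|.
have B0 : 0 <= B by apply: sumr_ge0 => i _; exact: sumr_ge0.
pose c := `|kappa| * B.
exists (expR (`|kappa| * N1 mu + n%:R * (2 * c ^+ 2))) => y.
rewrite -expRD ler_expR.
have h1 : kappa * N1 y <= `|kappa| * N1 mu + c * \sum_k `|zc k y|.
  apply: (@le_trans _ _ (`|kappa| * N1 y)); first by rewrite ler_wpM2r ?N1_ge0 ?ler_norm.
  by rewrite /c -mulrA -mulrDr ler_wpM2l// N1_le_zc.
have h2 : c * \sum_k `|zc k y| <= (\sum_k zc k y ^+ 2) / 8 + n%:R * (2 * c ^+ 2).
  have -> : n%:R * (2 * c ^+ 2) = \sum_(k < n) (2 * c ^+ 2) by rewrite sumr_const card_ord mulr_natl.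
  rewrite big_distrr big_distrl -big_split /=; apply: ler_sum => k _.
  rewrite -[zc k y ^+ 2]real_normK ?num_real//.
  have := sqr_ge0 (`|zc k y| - 4 * c); set x := `|_|; rewrite sqrrB exprMn; lra.
by move: h1 h2; rewrite mulNr; lra.
Qed.

Lemma ef0_decay kappa : exists C, forall y, `|ef (mi0 n) y| * expR (kappa * N1 y) <= C.
Proof.
have [C hC] := gauss_decay kappa; exists (`|cG| * C) => y.
rewrite ef0E normrM [`|expR _|]ger0_norm ?expR_ge0// -mulrA ler_wpM2l//.
apply: le_trans (hC y); rewrite ler_wpM2r ?expR_ge0// ler_expR.
have : 0 <= \sum_k zc k y ^+ 2 by apply: sumr_ge0 => k _; exact: sqr_ge0.
by rewrite !mulNr; lra.
Qed.

Lemma sFS_ef0 m : sFS m (ef (mi0 n)).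
Proof.
have cef : continuous (ef (mi0 n)).
  have -> : ef (mi0 n) = fun y => cG * expR (\sum_k (- 4^-1) * (zc k y * zc k y)).
    apply/funext => y; rewrite ef0E; congr (_ * expR _).
    rewrite mulNr big_distrl /= -sumrN; apply: eq_bigr => k _.
    by rewrite mulNr mulrC expr2.
  move=> y; apply: (@continuousM _ _ (fun _ : cV => cG)
    (fun y => expR (\sum_k (- 4^-1) * (zc k y * zc k y)))); first exact: cst_continuous.
  apply: (@continuous_comp _ _ _ (fun y => \sum_k (- 4^-1) * (zc k y * zc k y))); last exact: continuous_expR.
  apply: continuous_sumR => k.
  have : sMS 0 (fun y => (- 4^-1) * (zc k y * zc k y)).
    by apply: sMSZ; apply: sMSM; exact: sMS_zc.
  by move=> h; exact: (@Cls_cont _ _ _ _ 0 _ h tt).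
apply: (@FS_eqmul _ _ _ _ (fun j y => \sum_k (- (Si k j / 2)) * zc k y)).
- apply: expL2_decay; first exact: measurable_contRn.
  exact: ef0_decay.
- exact: cef.
- move=> j y; apply: (is_derive_eq (is_derive_ef j (mi0 n) y)).
  rewrite big_distrl /=; apply: eq_bigr => k _.
  by rewrite -mulrA ef_mulz ffunE sqrtr0; ring.
- by move=> j; apply: sMS_sum => k; apply: sMSZ; exact: sMS_zc.
Qed.

Lemma sq_neq0 r : sq r.+1 != 0 :> R.
Proof. by rewrite gt_eqF// sqrtr_gt0 ltr0n. Qed.

Lemma sFS_ef m a : sFS m (ef a).
Proof.
elim/multi_ind: a => [|a k IH]; first exact: sFS_ef0.
apply: (@Cls_ext _ _ _ _ _ (fun _ y => (sq (a k).+1)^-1 *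
    (zc k y * ef a y - sq (a k) * ef (dec a k) y))).
  by move=> _ y; rewrite ef_mulz addrK mulKf// sq_neq0.
apply: sFSZ; apply: sFSB; first by apply: sFSM; [exact: sMS_zc|exact: IH].
have [->|ak] := posnP (a k); last first.
  by apply: sFSZ; apply: IH; rewrite [leqRHS](wt_dec ak).
apply: (@Cls_ext _ _ _ _ _ (fun _ y => 0 * ef a y)); last by apply: sFSZ; exact: IH.
by move=> _ y; rewrite sqrtr0 !mul0r.
Qed.

(** The lowering operator z/2 + d/dz of the k-th frame coordinate: the column [k] of [S] is the
    direction along which that coordinate alone varies. *)
Definition low (k : 'I_n) (u : cV -> R) (y : cV) : R :=
  2^-1 * zc k y * u y + \sum_j S j k * pderiv j u y.

Lemma dirder_ef k a y : \sum_j S j k * pderiv j (ef a) y =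
  (sq (a k) * ef (dec a k) y - sq (a k).+1 * ef (inc a k) y) / 2.
Proof.
have E l : \sum_j Si l j * S j k = (l == k)%:R.
  by have := mulVmx hS => /matrixP/(_ l k); rewrite !mxE.
pose X l := (sq (a l) * ef (dec a l) y - sq (a l).+1 * ef (inc a l) y) / 2.
transitivity (\sum_l (\sum_j Si l j * S j k) * X l).
  under [RHS]eq_bigr do rewrite big_distrl /=.
  rewrite exchange_big /=; apply: eq_bigr => j _.
  rewrite pderiv_ef big_distrr /=; apply: eq_bigr => l _.
  by rewrite /X mulrA [Si l j * _]mulrC.
rewrite (bigD1 k)//= E eqxx mul1r big1 ?addr0// => l lk.
by rewrite E (negbTE lk) mul0r.
Qed.

Lemma low_ef k a y : low k (ef a) y = sq (a k) * ef (dec a k) y.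
Proof. by rewrite /low dirder_ef -mulrA ef_mulz; field. Qed.

Lemma low_FS (I : Type) m k (u : I -> cV -> R) : FS m.+1 u -> FS m (fun i => low k (u i)).
Proof.
move=> hu; apply: FSD.
  apply: FSM; last exact: ClsW hu.
  by apply: sMS_MS; apply: sMSZ; exact: sMS_zc.
apply: FS_sum => j; apply: FSM; last exact: Cls_pd hu.
exact: (sMS_MS _ (sMS_cst _ _ (S j k))).
Qed.

(** Integration by parts turns z/2 + d/dz into z/2 - d/dz, which raises the index. *)
Lemma low_adj k u b : sFS 1 u ->
  intRn (fun y => low k u y * ef b y) = sq (b k).+1 * intRn (fun y => u y * ef (inc b k) y).
Proof.
move=> hu; have he := sFS_ef 1 b.
have hz : sFS 1 (fun y => 2^-1 * zc k y * u y).
  by apply: (@sFSM _ _ 1 (fun y => 2^-1 * zc k y)) => //; apply: sMSZ; exact: sMS_zc.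
have i1 : integrableRn (fun y => 2^-1 * zc k y * u y * ef b y) by exact: sFS_mul hz he.
have i2 j : integrableRn (fun y => S j k * (pderiv j u y * ef b y)).
  by apply: integrableRnZ; exact: sFS_mul (sFS_pd j hu) he.
have i3 j : integrableRn (fun y => S j k * (u y * pderiv j (ef b) y)).
  by apply: integrableRnZ; exact: sFS_mul hu (sFS_pd j he).
transitivity (intRn (fun y => 2^-1 * zc k y * u y * ef b y) +
    intRn (fun y => \sum_j S j k * (pderiv j u y * ef b y))).
  rewrite -intRnD//; last exact: integrableRn_sum.
  apply: intRn_ext => y; rewrite mulrDl big_distrl /=; congr (_ + _).
  by apply: eq_bigr => j _; rewrite mulrA.
rewrite intRn_sum//.
have -> : \sum_j intRn (fun y => S j k * (pderiv j u y * ef b y)) =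
    - intRn (fun y => \sum_j S j k * (u y * pderiv j (ef b) y)).
  rewrite intRn_sum// -sumrN; apply: eq_bigr => j _.
  rewrite intRnZ; last exact: sFS_mul (sFS_pd j hu) he.
  rewrite sFS_IBP// mulrN intRnZ//; exact: sFS_mul hu (sFS_pd j he).
rewrite -intRnB//; last exact: integrableRn_sum.
rewrite -intRnZ; last exact: sFS_mul hu (sFS_ef 0 _).
apply: intRn_ext => y.
have -> : \sum_j S j k * (u y * pderiv j (ef b) y) = u y * \sum_j S j k * pderiv j (ef b) y.
  by rewrite big_distrr /=; apply: eq_bigr => j _; rewrite mulrCA.
have -> : 2^-1 * zc k y * u y * ef b y = 2^-1 * u y * (zc k y * ef b y) by ring.
by rewrite dirder_ef ef_mulz; field.
Qed.

Variable nrm : intRn (fun y => ef (mi0 n) y ^+ 2) = 1.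

Lemma ef_orthonormal a b : intRn (fun y => ef a y * ef b y) = (a == b)%:R.
Proof.
(* Raising one index amounts to lowering the other, so both inductions descend to the Gaussian,
   where [nrm] applies. *)
have key (c d : multi n) (k : 'I_n) : sq (d k).+1 * intRn (fun y => ef c y * ef (inc d k) y) =
    sq (c k) * intRn (fun y => ef (dec c k) y * ef d y).
  rewrite -low_adj; last exact: sFS_ef.
  rewrite -intRnZ; last exact: sFS_mul (sFS_ef 0 _) (sFS_ef 0 _).
  by apply: intRn_ext => y; rewrite low_ef mulrA.
have sym c d : intRn (fun y => ef c y * ef d y) = intRn (fun y => ef d y * ef c y).
  by apply: intRn_ext => y; rewrite mulrC.
elim/multi_ind: b a => [|b k IH] a.
  elim/multi_ind: a => [|a k _]; first by rewrite eqxx -nrm.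
  rewrite sym; apply: (mulfI (sq_neq0 (a k))); rewrite key ffunE sqrtr0 mul0r.
  have /negbTE -> : inc a k != mi0 n; last by rewrite mulr0.
  by apply/eqP => /ffunP/(_ k); rewrite !ffunE eqxx addn1.
apply: (mulfI (sq_neq0 (b k))); rewrite key.
have [a0|ak] := posnP (a k).
  rewrite a0 sqrtr0 mul0r; have /negbTE -> : a != inc b k; last by rewrite mulr0.
  by apply/eqP => /ffunP/(_ k); rewrite !ffunE eqxx addn1 a0.
rewrite IH// -[X in X == inc b k](decK ak).
have -> : (inc (dec a k) k == inc b k) = (dec a k == b).
  apply/eqP/eqP => [h|->//]; by rewrite -(incK (dec a k) k) h incK.
have [dab|] := eqVneq (dec a k) b; last by rewrite !mulr0.
by rewrite !mulr1 -dab ffunE eqxx subn1 prednK.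
Qed.

End hermite_frame.

Section gaussian_normalization.
Variables (R : realType) (n : nat).
Local Notation cV := 'cV[R]_n.

Lemma dot_mx (u v : cV) : dot u v = (u^T *m v) 0 0.
Proof. by rewrite mxE; apply: eq_bigr => i _; rewrite mxE. Qed.

Lemma dot_zc (S : 'M[R]_n) (mu y : cV) :
  dot (y - mu) ((invmx S)^T *m invmx S *m (y - mu)) = \sum_k zc S mu k y ^+ 2.
Proof.
rewrite dot_mx !mulmxA -trmx_mul -mulmxA mxE; apply: eq_bigr => k _.
by rewrite mxE -expr2.
Qed.

Lemma gauss_frame (S : 'M[R]_n) (mu : cV) : S \in unitmx ->
  0 < \det ((invmx S)^T *m invmx S) /\
  intRn (fun y => expR (- (\sum_k zc S mu k y ^+ 2) / 2)) =
    Num.sqrt ((2 * pi) ^+ n / \det ((invmx S)^T *m invmx S)).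
Proof.
move=> hS; set P := _ *m _.
have Ps : P^T = P by rewrite trmx_mul trmxK.
have Pp (v : cV) : v != 0 -> 0 < dot v (P *m v).
  move=> v0; have E := dot_zc S 0 v; rewrite subr0 in E; rewrite E.
  rewrite lt_def sumr_ge0 ?andbT; last by move=> i _; exact: sqr_ge0.
  apply: contra v0; rewrite psumr_eq0; last by move=> i _; exact: sqr_ge0.
  move=> /allP h; rewrite -(mulKVmx hS v); apply/eqP.
  have -> : invmx S *m v = 0; last by rewrite mulmx0.
  apply/colP => k; have := h k (mem_index_enum _); rewrite /zc subr0 sqrf_eq0 => /eqP ->.
  by rewrite mxE.
have [dP I] := gauss_integral mu Ps Pp; split => //.
rewrite /intRn /Rintegral.
suff -> : (\int[lebesgue_tuple R n]_x
    (expR (- (\sum_k zc S mu k (tuple_col x) ^+ 2) / 2))%:E)%E =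
    (Num.sqrt ((2 * pi) ^+ n / \det P))%:E by [].
by rewrite -I; apply: eq_integral => t _; rewrite dot_zc.
Qed.

Lemma ef0_norm (S : 'M[R]_n) (mu : cV) (c : R) : S \in unitmx ->
  c ^+ 2 * Num.sqrt ((2 * pi) ^+ n / \det ((invmx S)^T *m invmx S)) = 1 ->
  intRn (fun y => ef S mu c (mi0 n) y ^+ 2) = 1.
Proof.
move=> hS hc; have [dP I] := gauss_frame mu hS.
have E y : ef S mu c (mi0 n) y ^+ 2 = c ^+ 2 * expR (- (\sum_k zc S mu k y ^+ 2) / 2).
  by rewrite ef0E exprMn -expRM_natl; congr (_ * expR _); field.
have c0 : c != 0.
  by apply/eqP => c0; move: hc; rewrite c0 expr0n mul0r => /esym/eqP; rewrite oner_eq0.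
rewrite (intRn_ext E) intRnZ ?I//.
apply: (@integrableRn_ext _ _ (fun y => c ^- 2 * ef S mu c (mi0 n) y ^+ 2)).
  by move=> y; rewrite E mulKf// expf_neq0.
by apply: integrableRnZ; exact: (sFS_sq (sFS_ef0 mu c hS 0)).
Qed.

(** Everything follows from S S^T = Sigma, which uses that the diagonal of [L] is nonnegative and
    that the entrywise square root keeps the zeros off the diagonal. *)
Lemma covariance_frame (Sigma Q L : 'M[R]_n) : is_covariance Sigma Q L ->
  let S := Q *m map_mx Num.sqrt L in
  [/\ S \in unitmx, 0 < \det Sigma & invmx Sigma = (invmx S)^T *m invmx S].
Proof.
move=> [Ss Sp Ld QQ SE] S.
have QQ' : Q^T *m Q = 1%:M by exact: mulmx1C.
(* Positivity of [Sigma] is tested on the i-th column of [Q], an eigenvector. *)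
have L0 i : 0 <= L i i.
  pose v : cV := Q *m delta_mx i 0.
  have v0 : v != 0.
    apply/eqP => /(congr1 (mulmx Q^T)); rewrite /v mulmxA QQ' mul1mx mulmx0.
    by move=> /colP/(_ i); rewrite !mxE !eqxx => /eqP; rewrite oner_eq0.
  have := ltW (Sp v v0).
  rewrite dot_mx SE /v trmx_mul !mulmxA -[_ *m Q^T *m Q]mulmxA QQ' mulmx1.
  rewrite -[_ *m Q^T *m Q]mulmxA QQ' mulmx1 trmx_delta -rowE mxE.
  rewrite (bigD1 i)//= big1 ?addr0.
    by rewrite !mxE !eqxx mulr1.
  by move=> j ji; rewrite !mxE (negbTE ji) mulr0.
have LL : map_mx Num.sqrt L *m (map_mx Num.sqrt L)^T = L.
  apply/matrixP => i j; rewrite mxE (bigD1 i)//= big1 ?addr0.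
    rewrite !mxE; have [<-|ij] := eqVneq i j; first by rewrite -expr2 sqr_sqrtr.
    have /is_diag_mxP := Ld => /(_ i j ij) ->.
    by have /is_diag_mxP := Ld => /(_ j i); rewrite eq_sym => /(_ ij) ->; rewrite sqrtr0 mulr0.
  move=> k ki; rewrite !mxE; have /is_diag_mxP := Ld => /(_ i k).
  by rewrite eq_sym => /(_ ki) ->; rewrite sqrtr0 mul0r.
have SS : S *m S^T = Sigma.
  by rewrite /S trmx_mul mulmxA -[_ *m _ *m (map_mx _ _)^T]mulmxA LL SE.
have [dS _] := gauss_integral 0 Ss Sp.
have hS : S \in unitmx.
  rewrite unitmxE unitfE; apply/eqP => d0; move: dS.
  by rewrite -SS det_mulmx det_tr d0 mulr0 ltxx.
split => //.
have hSi : Sigma \in unitmx by rewrite unitmxE unitfE gt_eqF.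
have E : Sigma *m ((invmx S)^T *m invmx S) = 1%:M.
  by rewrite -SS trmx_inv mulmxA -[S *m S^T *m _]mulmxA mulmxV ?unitmx_tr// mulmx1 mulmxV.
by rewrite -[LHS]mulmx1 -E mulmxA mulVmx// mul1mx.
Qed.

Lemma hermite_fun_ef (mu : cV) (Sigma Q L : 'M[R]_n) : is_covariance Sigma Q L ->
  exists S c, [/\ S \in unitmx, hermite_fun mu Sigma Q L = ef S mu c &
    intRn (fun y => ef S mu c (mi0 n) y ^+ 2) = 1].
Proof.
move=> hcov; have [hS dS E] := covariance_frame hcov.
pose S := Q *m map_mx Num.sqrt L.
pose c : R := Num.sqrt (Num.sqrt ((2 * pi) ^+ n * \det Sigma))^-1.
have p0 : 0 < (2 * pi) ^+ n * \det Sigma :> R by rewrite mulr_gt0// exprn_gt0// mulr_gt0// pi_gt0.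
exists S, c; split => //.
  apply/funext => a; apply/funext => y; rewrite /hermite_fun /ef -/S /gaussian_density.
  rewrite E -/S mulNr dot_zc sqrtrM ?expR_ge0// -/c.
  have -> : \prod_k hh (a k) (zc S mu k y) =
    (\prod_k hermite (a k) (zc S mu k y)) * expR (- (\sum_k zc S mu k y ^+ 2) / 4).
    rewrite mulNr big_distrl /= -sumrN expR_sum -big_split /=.
    by apply: eq_bigr => k _; rewrite /hh mulNr.
  have -> : Num.sqrt (expR (- ((\sum_k zc S mu k y ^+ 2) / 2))) =
      expR (- (\sum_k zc S mu k y ^+ 2) / 4).
    rewrite -[RHS]ger0_norm ?expR_ge0// -sqrtr_sqr -expRM_natl; congr (Num.sqrt (expR _)).
    by field.
  by rewrite /zc; ring.
apply: ef0_norm => //; rewrite /c sqr_sqrtr ?invr_ge0 ?sqrtr_ge0// -E det_inv invrK.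
by rewrite mulVf// gt_eqF// sqrtr_gt0.
Qed.

End gaussian_normalization.

(** * Sup bound on Hermite functions *)

Section hermite_sup.
Variable R : realType.
Local Notation leb := (@lebesgue_measure R).

Lemma continuous_hh r : continuous (@hh R r).
Proof.
move=> s; apply/differentiable_continuous/derivable1_diffP.
by have [] := is_derive_hh r s.
Qed.

Lemma continuous_hh_sq r : continuous (fun s => @hh R r s ^+ 2).
Proof.
move=> s; rewrite (_ : (fun s => _) = fun s => hh r s * hh r s) //.
by apply: (@continuousM _ _ (@hh R r) (@hh R r)); exact: continuous_hh.
Qed.

Lemma integral_tuple0 (G : 0.-tuple (measurableTypeR R) -> \bar R) :
  (\int[lebesgue_tuple R 0]_t G t = G [tuple])%E.
Proof.
rewrite (eq_integral (cst (G [tuple]))); last by move=> t _; rewrite (tuple0 t).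
by rewrite integral_cst//= diracT mule1.
Qed.

(** Read off from orthonormality in dimension 1 with the identity frame; what matters is that the
    value does not depend on [r]. *)
Lemma integral_hh_sq : exists2 N : R, 0 < N &
  forall r, (\int[leb]_s ((@hh R r s) ^+ 2)%:E = N%:E)%E.
Proof.
pose S : 'M[R]_1 := 1%:M.
have hS : S \in unitmx by exact: unitmx1.
pose K : R := Num.sqrt ((2 * pi) ^+ 1 / \det ((invmx S)^T *m invmx S)).
have K0 : 0 < K.
  have [dP _] := gauss_frame 0 hS.
  by rewrite sqrtr_gt0 divr_gt0// exprn_gt0// mulr_gt0// pi_gt0.
pose c := Num.sqrt K^-1.
have c2 : c ^+ 2 = K^-1 by rewrite sqr_sqrtr// invr_ge0 ltW.
have nrm : intRn (fun y => ef S 0 c (mi0 1) y ^+ 2) = 1.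
  by apply: ef0_norm => //; rewrite c2 -/K mulVf// gt_eqF.
exists K => // r.
pose a : multi 1 := [ffun=> r].
have h := ef_orthonormal hS nrm a a; rewrite eqxx in h.
have efE (y : 'cV[R]_1) : ef S 0 c a y = c * hh r (y ord0 0).
  by rewrite /ef big_ord1 ffunE /zc invmx1 mul1mx subr0.
have i1 : integrableRn (fun y => ef S 0 c a y * ef S 0 c a y).
  exact: sFS_mul (sFS_ef 0 c hS 0 a) (sFS_ef 0 c hS 0 a).
have := intRnE i1; rewrite h (@tonelli_cons R 0 (fun y => ef S 0 c a y * ef S 0 c a y)); last 2 first.
- by move=> y; rewrite -expr2 sqr_ge0.
- exact: integrableRn_meas i1.
have E s : (\int[lebesgue_tuple R 0]_t
    (ef S 0 c a (ccons s (tuple_col t)) * ef S 0 c a (ccons s (tuple_col t)))%:E =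
    (K^-1)%:E * ((hh r s) ^+ 2)%:E)%E.
  rewrite integral_tuple0 !efE ccons0 -EFinM; congr (_%:E).
  by rewrite -c2; ring.
under eq_integral do rewrite E.
rewrite ge0_integralZl//; last 3 first.
- apply/measurable_EFinP; by apply: continuous_measurable_fun; exact: continuous_hh_sq.
- by move=> s _; rewrite lee_fin sqr_ge0.
- by rewrite lee_fin invr_ge0 ltW.
move=> /(congr1 (fun x => K%:E * x)%E); rewrite muleA -!EFinM divff ?gt_eqF// mul1e.
by rewrite mulr1 => ->.
Qed.

(** The square of [hh r] is at most the L1 norm of its derivative, which the ladder relation bounds
    by L2 norms of the neighbouring functions. The bound is crude, but any polynomial in [r] is
    beaten by the decay of coefficients. *)
Lemma hh_sup : exists2 C : R, 0 < C & forall r s, (@hh R r s) ^+ 2 <= C * r.+1%:R.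
Proof.
have [N N0 hN] := integral_hh_sq; exists (2 * N); first by rewrite mulr_gt0.
move=> r s.
pose dh (t : R) : R := (Num.sqrt r%:R * hh r.-1 t - Num.sqrt r.+1%:R * hh r.+1 t) / 2.
have mh q : measurable_fun setT (fun t => (((@hh R q t) ^+ 2)%:E)).
  apply/measurable_EFinP; apply: continuous_measurable_fun; exact: continuous_hh_sq.
pose B (t : R) : \bar R := (((hh r t) ^+ 2)%:E + ((r%:R / 2)%:E * ((hh r.-1 t) ^+ 2)%:E +
   (r.+1%:R / 2)%:E * ((hh r.+1 t) ^+ 2)%:E))%E.
have sq0 q t : (0 <= ((@hh R q t) ^+ 2)%:E)%E by rewrite lee_fin sqr_ge0.
have m1 (c : R) q : measurable_fun setT (fun t => (c%:E * ((@hh R q t) ^+ 2)%:E)%E).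
  exact: measurable_funeM.
have p1 (c : R) q t : 0 <= c -> (0 <= c%:E * ((@hh R q t) ^+ 2)%:E)%E.
  by move=> c0; rewrite mule_ge0// lee_fin.
have r20 : 0 <= r%:R / 2 :> R by rewrite divr_ge0.
have r120 : 0 <= r.+1%:R / 2 :> R by rewrite divr_ge0.
have Z (c : R) q : 0 <= c -> (\int[leb]_t (c%:E * ((@hh R q t) ^+ 2)%:E) = (c * N)%:E)%E.
  move=> c0; rewrite EFinM -(hN q); apply: ge0_integralZl => //.
  exact: mh.
have iB : (\int[leb]_t B t = (N + (r%:R / 2 * N + r.+1%:R / 2 * N))%:E)%E.
  rewrite /B ge0_integralD//; last 3 first.
  - exact: mh.
  - by move=> t _; rewrite adde_ge0// p1.
  - by apply: emeasurable_funD; exact: m1.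
  rewrite ge0_integralD//; try exact: m1; try by move=> t _; exact: p1.
  by rewrite (Z _ _ r20) (Z _ _ r120) hN.
(* With a, b, c the values at [r], [r.-1], [r.+1] and x, z the square roots of r and r+1, this reads
   |a (x b - z c)| <= a^2 + x^2 b^2 / 2 + z^2 c^2 / 2. *)
have le t : (`|2 * hh r t * dh t|%:E <= B t)%E.
  rewrite /B -!EFinM -!EFinD lee_fin.
  have q1 := sqrt_natM R r; have q2 := sqrt_natM R r.+1.
  rewrite /dh; move: (Num.sqrt _) (Num.sqrt _) q1 q2 => z x q1 q2.
  rewrite -q1 -q2; move: (hh r t) (hh r.-1 t) (hh r.+1 t); clear => a b c.
  rewrite ler_norml; apply/andP; split; rewrite -subr_ge0.
    have := sqr_ge0 (a + (x * b - z * c) / 2); have := sqr_ge0 ((x * b + z * c) / 2).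
    have := sqr_ge0 (x * b); have := sqr_ge0 (z * c); nra.
  have := sqr_ge0 (a - (x * b - z * c) / 2); have := sqr_ge0 ((x * b + z * c) / 2).
  have := sqr_ge0 (x * b); have := sqr_ge0 (z * c); nra.
have dG t : is_derive t (1 : R) (fun t => hh r t ^+ 2) (2 * hh r t * dh t).
  apply: (is_derive_eq (is_deriveM (is_derive_hh r t) (is_derive_hh r t))).
  by rewrite -![_ *: _]/(_ * _) -/(dh t); ring.
have cdh : continuous (fun t => 2 * hh r t * dh t).
  have cM (c : R) q : continuous (fun t : R => c * hh q t).
    move=> t; apply: (@continuousM _ _ (fun _ : R => c) (@hh R q)); first exact: cst_continuous.
    exact: continuous_hh.
  move=> t; apply: (@continuousM _ _ (fun t : R => 2 * hh r t) dh); first exact: cM.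
  apply: (@continuousM _ _ (fun t : R => Num.sqrt r%:R * hh r.-1 t - Num.sqrt r.+1%:R * hh r.+1 t)
    (fun _ : R => 2^-1)); last exact: cst_continuous.
  apply: (@continuousB _ _ _ (fun t : R => Num.sqrt r%:R * hh r.-1 t)
    (fun t : R => Num.sqrt r.+1%:R * hh r.+1 t)); exact: cM.
have mB : measurable_fun setT B.
  apply: emeasurable_funD; first exact: mh.
  by apply: emeasurable_funD; exact: m1.
have iG' : leb.-integrable setT (EFin \o (fun t => 2 * hh r t * dh t)).
  apply/integrableP; split; first by apply/measurable_EFinP; exact: continuous_measurable_fun.
  apply: (@le_lt_trans _ _ (\int[leb]_t B t)%E); last by rewrite iB ltry.
  apply: ge0_le_integral => //.
  - apply: measurableT_comp => //; apply/measurable_EFinP; exact: continuous_measurable_fun.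
  - by move=> t _; apply: le_trans (le t); rewrite lee_fin.
have iG : leb.-integrable setT (EFin \o (fun t => hh r t ^+ 2)).
  apply/integrableP; split; first exact: mh.
  suff -> : (\int[leb]_x `|(EFin \o (fun t : R => (hh r t ^+ 2)%R)) x|)%E = N%:E by exact: ltry.
  by rewrite -(hN r); apply: eq_integral => t _; rewrite /= ger0_norm ?sqr_ge0.
have := derivative_sup_le s dG cdh iG iG'.
have : (\int[leb]_t `|2 * hh r t * dh t|%:E <= \int[leb]_t B t)%E.
  apply: ge0_le_integral => //.
  by apply/measurable_EFinP; apply: measurableT_comp => //; exact: continuous_measurable_fun.
move=> h1 h2; have := le_trans h2 h1; rewrite iB lee_fin => /(le_trans (ler_norm _)) /le_trans; apply.
have h0 : 0 <= r%:R * N by rewrite mulr_ge0// ltW.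
rewrite -[r.+1%:R]natr1 -subr_ge0.
have -> : 2 * N * (r%:R + 1) - (N + (r%:R / 2 * N + (r%:R + 1) / 2 * N)) = r%:R * N + N / 2 by field.
by rewrite addr_ge0// divr_ge0// ltW.
Qed.

End hermite_sup.

(** * Hermite expansions *)

Section finite_sums.
Variable R : realType.

Lemma sum_cauchy_schwarz (J : Type) (r : seq J) (P : pred J) (om x : J -> R) :
  (forall j, 0 < om j) ->
  (\sum_(j <- r | P j) x j) ^+ 2 <=
  (\sum_(j <- r | P j) om j) * \sum_(j <- r | P j) x j ^+ 2 / om j.
Proof.
move=> om0; rewrite mulrC; apply: discriminant => t.
have -> : \sum_(j <- r | P j) x j ^+ 2 / om j + 2 * t * (\sum_(j <- r | P j) x j) +
   t ^+ 2 * (\sum_(j <- r | P j) om j) =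
   \sum_(j <- r | P j) om j * (x j / om j + t) ^+ 2.
  rewrite !big_distrr -!big_split /=; apply: eq_bigr => j _.
  by field; rewrite gt_eqF.
by apply: sumr_ge0 => j _; rewrite mulr_ge0 ?sqr_ge0// ltW.
Qed.

(** A weight on multi-indices whose sum is at most 2^n for every truncation; every sum over [midx]
    below is reduced to it. *)
Definition omega n (a : multi n) : R := \prod_k ((a k).+1%:R ^- 2).

Lemma omegaE n (a : multi n) : omega a = (\prod_k (a k).+1%:R) ^- 2.
Proof. by rewrite /omega -prodrXl -prodfV. Qed.

Lemma omega_gt0 n (a : multi n) : 0 < omega a.
Proof. by apply: prodr_gt0 => k _; rewrite invr_gt0 exprn_gt0. Qed.

(** The subtracted term makes the induction telescope. *)
Lemma sum_inv_sq d : \sum_(r < d.+1) (r.+1%:R ^- 2 : R) <= 2 - d.+1%:R^-1.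
Proof.
elim: d => [|d IH]; first by rewrite big_ord1 expr1n !invr1; lra.
rewrite big_ord_recr /=; apply: (le_trans (lerD IH (lexx _))).
have h1 : d.+1%:R != 0 :> R by [].
have h2 : d.+2%:R != 0 :> R by [].
have h : d.+2%:R ^- 2 <= (d.+1%:R)^-1 - (d.+2%:R)^-1 :> R.
  have -> : (d.+1%:R)^-1 - (d.+2%:R)^-1 = (d.+1%:R * d.+2%:R)^-1 :> R.
    move: h2; rewrite -[d.+2%:R]natr1; move: (d.+1%:R) h1 => x h1 h2; field.
    exact/andP.
  rewrite lef_pV2 ?posrE ?exprn_gt0 ?mulr_gt0// expr2 ler_wpM2r// ler_nat//.
by apply: (le_trans (lerD (lexx _) h)); rewrite addrA subrK.
Qed.

Lemma sum_omega n d : \sum_(a <- midx n d) omega a <= 2 ^+ n.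
Proof.
rewrite /midx big_map big_filter.
(* The simplex of indices is enlarged to a box, over which the sum of products factors. *)
apply: (@le_trans _ _ (\sum_(a : {ffun 'I_n -> 'I_d.+1}) \prod_k ((a k).+1%:R ^- 2 : R))).
  rewrite big_enum_cond /=.
  rewrite [leRHS](bigID (fun a : {ffun 'I_n -> 'I_d.+1} => (\sum_i a i <= d)%N)) /=.
  apply: ler_wpDr.
    by apply: sumr_ge0 => a _; apply: prodr_ge0 => k _; rewrite invr_ge0 exprn_ge0.
  rewrite le_eqVlt; apply/orP; left; apply/eqP; apply: eq_bigr => a _.
  by apply: eq_bigr => k _; rewrite ffunE.
rewrite -(bigA_distr_bigA (fun (k : 'I_n) (r : 'I_d.+1) => (r.+1%:R ^- 2 : R))) /=.
rewrite -[X in 2 ^+ X]card_ord -prodr_const; apply: ler_prod => k _.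
rewrite sumr_ge0 /=; last by move=> r _; rewrite invr_ge0 exprn_ge0.
by apply: le_trans (sum_inv_sq d) _; rewrite gerBl invr_ge0.
Qed.

Lemma sum_midx_split n (F : multi n -> R) d D : (d <= D)%N ->
  \sum_(a <- midx n D) F a = \sum_(a <- midx n d) F a + \sum_(a <- midx n D | (d < wt a)%N) F a.
Proof.
move=> dD; rewrite (bigID (fun a => (wt a <= d)%N)) /=; congr (_ + _).
  rewrite -big_filter; apply: perm_big; apply: uniq_perm.
  - by rewrite filter_uniq// midx_uniq.
  - exact: midx_uniq.
  - move=> a; rewrite mem_filter !mem_midx.
    by case: leqP => //= h; rewrite (leq_trans h).
by apply: eq_bigl => a; rewrite -ltnNge.
Qed.

Lemma prod_le_wt n (a : multi n) : \prod_k (a k).+1%:R <= (wt a).+1%:R ^+ n :> R.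
Proof.
rewrite -[X in _ ^+ X]card_ord -prodr_const; apply: ler_prod => k _.
by rewrite ler0n ler_nat ltnS /wt (bigD1 k)//= leq_addr.
Qed.

End finite_sums.

Section coefficients.
Variables (R : realType) (n : nat) (S : 'M[R]_n) (mu : 'cV[R]_n) (cG : R).
Variable hS : S \in unitmx.
Local Notation cV := 'cV[R]_n.
Local Notation e := (ef S mu cG).
Variable nrm : intRn (fun y => e (mi0 n) y ^+ 2) = 1.
Implicit Types (a b : multi n) (y : cV).

Lemma ef_sup : exists2 C : R, 0 <= C & forall a y, `|e a y| <= C * \prod_k (a k).+1%:R.
Proof.
have [C C0 hC] := hh_sup R; exists (`|cG| * (C + 1) ^+ n).
  by rewrite mulr_ge0// exprn_ge0// addr_ge0// ltW.
move=> a y; rewrite /ef normrM -mulrA ler_wpM2l// normr_prod.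
rewrite -[X in _ ^+ X]card_ord -prodr_const -big_split /=.
apply: ler_prod => k _; rewrite normr_ge0 /=.
have h1 : 0 <= (C + 1) * (a k).+1%:R by rewrite mulr_ge0// addr_ge0// ltW.
rewrite -(@ler_pXn2r _ 2)// ?nnegrE// real_normK ?num_real//.
apply: le_trans (hC _ _) _; rewrite exprMn; apply: ler_pM => //; first exact: ltW.
  by apply: (@le_trans _ _ (C + 1)); [rewrite lerDl|rewrite ler_eXnr// lerDr ltW].
by rewrite ler_eXnr// ler1n.
Qed.

Definition coef (u : cV -> R) a : R := intRn (fun y => u y * e a y).

Lemma coef_bessel u a : sFS 0 u -> coef u a ^+ 2 <= intRn (fun y => u y ^+ 2).
Proof.
move=> hu; apply: le_trans (sFS_CS hu (sFS_ef mu cG hS 0 a)) _.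
have -> : intRn (fun y => e a y ^+ 2) = 1.
  by have := ef_orthonormal hS nrm a a; rewrite eqxx.
by rewrite mulr1.
Qed.

Lemma FS_L2_bound (I : Type) m (u : I -> cV -> R) : FS m u ->
  exists2 C, 0 <= C & forall i, intRn (fun y => u i y ^+ 2) <= C.
Proof.
move=> hu; have [_ /(_ 0)[C hC]] := Cls0 hu; exists `|C| => // i.
apply: le_trans (le_trans (hC i).2 (ler_norm C)).
rewrite le_eqVlt; apply/orP; left; apply/eqP; apply: intRn_ext => y.
by rewrite /wL2 mul0r expR0 mulr1.
Qed.

(* Each lowering operator maps the family to a family of the same kind, and
   gains a factor [sqrt (a k)] on the coefficients. *)
Lemma coef_decay (s : nat) : forall (I : Type) (u : I -> cV -> R), (forall m, FS m u) ->
  exists2 C, 0 <= C & forall i a, coef (u i) a ^+ 2 * (wt a).+1%:R ^+ s <= C.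
Proof.
elim: s => [|s IH] I u hu.
  have [C C0 hC] := FS_L2_bound (hu 0); exists C => // i a.
  rewrite expr0 mulr1; apply: le_trans (hC i).
  exact: coef_bessel (FS_sFS i (hu 0)).
have [C C0 hC] := IH I u hu.
have h k : exists C', 0 <= C' /\ forall i a, coef (low S mu k (u i)) a ^+ 2 * (wt a).+1%:R ^+ s <= C'.
  have [C' C'0 hC'] := IH I (fun i => low S mu k (u i)) (fun m => low_FS S mu k (hu m.+1)).
  by exists C'.
have [C' hC'] := choice h.
exists (C + 2 ^+ s * \sum_k C' k).
  by rewrite addr_ge0// mulr_ge0// ?exprn_ge0// sumr_ge0// => k _; exact: (hC' k).1.
move=> i a.
(* One factor |a| + 1 is written as 1 plus the sum of the [a k], each of which is traded for a
   lowering operator. *)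
have -> : coef (u i) a ^+ 2 * (wt a).+1%:R ^+ s.+1 =
  coef (u i) a ^+ 2 * (wt a).+1%:R ^+ s + \sum_k coef (u i) a ^+ 2 * (a k)%:R * (wt a).+1%:R ^+ s.
  rewrite -big_distrl -big_distrr /= -natr_sum -/(wt a) [(wt a).+1%:R ^+ s.+1]exprS.
  have -> : (wt a).+1%:R = (wt a)%:R + 1 :> R by rewrite natr1.
  by ring.
apply: lerD; first exact: hC.
rewrite big_distrr /=; apply: ler_sum => k _.
have [->|ak] := posnP (a k).
  by rewrite mulr0 mul0r mulr_ge0 ?exprn_ge0//; exact: (hC' k).1.
have hu1 : sFS 1 (u i) := FS_sFS i (hu 1).
have E : coef (low S mu k (u i)) (dec a k) ^+ 2 = coef (u i) a ^+ 2 * (a k)%:R.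
  rewrite /coef (low_adj _ _ hS)// decK// ffunE eqxx subn1 prednK// exprMn mulrC.
  by rewrite sqr_sqrtr.
rewrite -E; apply: (@le_trans _ _ (2 ^+ s * (coef (low S mu k (u i)) (dec a k) ^+ 2 *
   (wt (dec a k)).+1%:R ^+ s))); last by rewrite ler_wpM2l ?exprn_ge0//; exact: (hC' k).2.
(* Lowering replaces |a| + 1 by |a|, which is at least half of it: hence the factor 2^s. *)
rewrite mulrCA ler_wpM2l ?sqr_ge0// -exprMn lerXn2r ?nnegrE ?mulr_ge0//.
by rewrite (wt_dec ak) -natrM ler_nat; lia.
Qed.

Lemma coef_decay_sq (I : Type) (u : I -> cV -> R) s : (forall m, FS m u) ->
  exists2 C, 0 <= C & forall i a, coef (u i) a ^+ 2 * (wt a).+1%:R ^+ s <= C * omega R a ^+ 2.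
Proof.
(* The product over [k] of a_k + 1 is at most (|a| + 1)^n, and its fourth power is the inverse of
   omega squared. *)
move=> hu; have [C C0 hC] := coef_decay (n * 4 + s) hu; exists C => // i a.
have w0 : 0 < (wt a).+1%:R :> R by [].
have p0 : 0 < \prod_k (a k).+1%:R :> R by apply: prodr_gt0.
have -> : omega R a ^+ 2 = (\prod_k (a k).+1%:R) ^- 4.
  by rewrite omegaE exprVn -exprM.
rewrite ler_pdivlMr ?exprn_gt0//; apply: le_trans (hC i a).
rewrite -mulrA ler_wpM2l ?sqr_ge0// exprD mulrC ler_wpM2r ?exprn_ge0//.
by rewrite exprM lerXn2r ?nnegrE ?exprn_ge0// ?prod_le_wt// ltW.
Qed.

Lemma coef_decay_abs (I : Type) (u : I -> cV -> R) s : (forall m, FS m u) ->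
  exists2 C, 0 <= C & forall i a, `|coef (u i) a| * \prod_k (a k).+1%:R * (wt a).+1%:R ^+ s
    <= C * omega R a.
Proof.
(* After squaring, the product of the a_k + 1 occurs to the power 6: 2 from the sup of [e a] and 4
   from omega. [C + 1] replaces the square root of [C]. *)
move=> hu; have [C C0 hC] := coef_decay (n * 6 + s * 2) hu; exists (C + 1).
  by rewrite addr_ge0.
move=> i a.
have w0 : 0 < (wt a).+1%:R :> R by [].
have p0 : 0 < \prod_k (a k).+1%:R :> R by apply: prodr_gt0.
have pp := ltW p0.
rewrite omegaE ler_pdivlMr ?exprn_gt0//.
rewrite -(@ler_pXn2r _ 2)// ?nnegrE ?addr_ge0 ?mulr_ge0 ?exprn_ge0//.
apply: (@le_trans _ _ (C + 1)); last by rewrite ler_eXnr// lerDr.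
apply: (@le_trans _ _ C); last by rewrite lerDl.
apply: le_trans (hC i a).
rewrite exprD [_ ^+ (s * 2)]exprM.
have v0 : 0 <= (wt a).+1%:R ^+ s :> R by rewrite exprn_ge0.
move: (_ ^+ s) v0 => v v0.
have -> : (`|coef (u i) a| * \prod_k (a k).+1%:R * v * (\prod_k (a k).+1%:R) ^+ 2) ^+ 2 =
    coef (u i) a ^+ 2 * ((\prod_k (a k).+1%:R) ^+ 6 * v ^+ 2).
  by rewrite -[in RHS](real_normK (num_real (coef (u i) a))); ring.
rewrite ler_wpM2l ?sqr_ge0// ler_wpM2r ?sqr_ge0// exprM.
by rewrite lerXn2r ?nnegrE ?exprn_ge0// prod_le_wt.
Qed.

Definition psum (u : cV -> R) d : cV -> R := lincomb e d (coef u).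

(** Tails are small even in the sup norm: the decay of coefficients pays for the sup of [e a], for
    the rate, and for [omega]. *)
Lemma psum_tail (I : Type) (u : I -> cV -> R) s : (forall m, FS m u) ->
  exists2 C, 0 <= C & forall i d D y, (d <= D)%N ->
    `|psum (u i) D y - psum (u i) d y| <= C * d.+1%:R ^- s.
Proof.
move=> hu; have [C C0 hC] := coef_decay_abs s hu; have [B B0 hB] := ef_sup.
exists (B * C * 2 ^+ n); first by rewrite !mulr_ge0// exprn_ge0.
move=> i d D y dD; rewrite /psum /lincomb (sum_midx_split _ dD) addrC addKr.
apply: le_trans (ler_norm_sum _ _ _) _.
apply: (@le_trans _ _ (\sum_(a <- midx n D | (d < wt a)%N) B * C * d.+1%:R ^- s * omega R a)).
  apply: ler_sum => a da; rewrite normrM.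
  apply: (@le_trans _ _ (`|coef (u i) a| * (B * \prod_k (a k).+1%:R))); first by rewrite ler_wpM2l.
  rewrite mulrCA -!mulrA ler_wpM2l// mulrCA ler_pdivlMl ?exprn_gt0// mulrC.
  apply: le_trans (hC i a); rewrite ler_wpM2l ?mulr_ge0 ?prodr_ge0//.
  by rewrite lerXn2r ?nnegrE// ler_nat ltnW.
rewrite -big_distrr /= [leRHS]mulrAC ler_wpM2l ?mulr_ge0 ?invr_ge0 ?exprn_ge0//.
apply: le_trans (sum_omega R n D).
rewrite [leRHS](bigID (fun a => (d < wt a)%N)) /= lerDl.
by apply: sumr_ge0 => a _; exact/ltW/omega_gt0.
Qed.

End coefficients.

Section exponential_series.
Variable R : realType.

Lemma cvg_exp_series (x : R) : series (exp_coeff x) @ \oo --> expR x.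
Proof. exact: is_cvg_series_exp_coeff. Qed.

Lemma exp_coeffN : exists c : nat -> R, forall x k, exp_coeff (- x) k = c k * x ^+ k.
Proof.
exists (fun k => (- 1 : R) ^+ k / k`!%:R) => x k.
rewrite /exp_coeff /= exprNn; exact: mulrAC.
Qed.

Lemma exp_series_le (x : R) N : `|series (exp_coeff x) N| <= expR `|x|.
Proof.
apply: (@le_trans _ _ (series (exp_coeff `|x|) N)).
  rewrite /series /=; apply: le_trans (ler_norm_sum _ _ _) _; apply: ler_sum => i _.
  by rewrite /exp_coeff /= normrM normrX normfV normr_nat.
apply: nondecreasing_cvgn_le; last exact: is_cvg_series_exp_coeff.
by apply: nondecreasing_series => i _ _; exact: exp_coeff_ge0.
Qed.

End exponential_series.

(** * Completeness of the Hermite functions *)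

Section completeness.
Variables (R : realType) (n : nat) (S : 'M[R]_n) (mu : 'cV[R]_n) (cG : R).
Variable hS : S \in unitmx.
Local Notation cV := 'cV[R]_n.
Local Notation e := (ef S mu cG).
Local Notation zc := (zc S mu).
Local Notation sq r := (Num.sqrt r%:R).

(** A quadratic polynomial in the frame coordinates, so that multiplying by it preserves
    combinations of Hermite functions. With the factor 1/16 the Gaussian of [ef] still absorbs
    e^qdist. *)
Definition qdist (y0 y : cV) : R := (\sum_k (zc k y - zc k y0) ^+ 2) / 16.

Lemma qdist_ge0 y0 y : 0 <= qdist y0 y.
Proof. by rewrite divr_ge0// sumr_ge0// => k _; exact: sqr_ge0. Qed.

Lemma qdist0 y0 : qdist y0 y0 = 0.
Proof. by rewrite /qdist big1 ?mul0r// => k _; rewrite subrr expr0n. Qed.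

Lemma continuous_qdist y0 : continuous (qdist y0).
Proof.
have h k : sMS 0 (fun y => (zc k y + - zc k y0) * (zc k y + - zc k y0)).
  by apply: sMSM; apply: sMSD; [exact: sMS_zc|exact: sMS_cst|exact: sMS_zc|exact: sMS_cst].
have := @sMSZ _ _ 0 16^-1 _ (@sMS_sum _ _ 0 _ (index_enum 'I_n) _ h).
have -> : (fun y => 16^-1 * \sum_k (zc k y + - zc k y0) * (zc k y + - zc k y0)) = qdist y0.
  by apply/funext => y; rewrite /qdist mulrC.
by move=> h0; exact: (@Cls_cont _ _ _ _ 0 _ h0 tt).
Qed.

Lemma qdist_far (y0 : cV) (rho : R) : 0 < rho -> exists2 q0 : R, 0 < q0 &
  forall (y : cV) i, rho < `|y i 0 - y0 i 0| -> q0 <= qdist y0 y.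
Proof.
move=> rho0; pose B : R := \sum_i \sum_k `|S i k|.
have B0 : 0 <= B by apply: sumr_ge0 => i _; exact: sumr_ge0.
exists (rho ^+ 2 / (16 * (B ^+ 2 + 1))).
  by rewrite divr_gt0 ?exprn_gt0// mulr_gt0// ltr_wpDl// sqr_ge0.
move=> y i hi.
pose X := \sum_k (zc k y - zc k y0) ^+ 2.
have X0 : 0 <= X by apply: sumr_ge0 => k _; exact: sqr_ge0.
have E : y i 0 - y0 i 0 = \sum_k S i k * (zc k y - zc k y0).
  rewrite (zcK mu hS y i) (zcK mu hS y0 i) opprD addrACA subrr add0r -sumrB.
  by apply: eq_bigr => k _; rewrite mulrBr.
have h1 : `|y i 0 - y0 i 0| <= B * Num.sqrt X.
  rewrite E; apply: le_trans (ler_norm_sum _ _ _) _.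
  apply: (@le_trans _ _ (\sum_k `|S i k| * Num.sqrt X)).
    apply: ler_sum => k _; rewrite normrM ler_wpM2l//.
    rewrite -sqrtr_sqr ler_wsqrtr// /X (bigD1 k)//= lerDl sumr_ge0// => l _.
    exact: sqr_ge0.
  rewrite -big_distrl /= ler_wpM2r ?sqrtr_ge0// /B [leRHS](bigD1 i)//= lerDl.
  by apply: sumr_ge0 => j _; exact: sumr_ge0.
have h2 : rho ^+ 2 <= B ^+ 2 * X.
  rewrite -[X]sqr_sqrtr// -exprMn lerXn2r ?nnegrE ?mulr_ge0 ?sqrtr_ge0//; first exact: ltW.
  exact: le_trans (ltW hi) h1.
have B1 : 0 < B ^+ 2 + 1 by rewrite ltr_wpDl// sqr_ge0.
rewrite /qdist -/X ler_pdivrMr ?mulr_gt0//.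
have -> : X / 16 * (16 * (B ^+ 2 + 1)) = B ^+ 2 * X + X by field.
by rewrite (le_trans h2)// lerDl.
Qed.

(* The Laplace method: as j grows, the weights concentrate at y0. *)
Lemma laplace_le0 (h : cV -> R) y0 : continuous h -> integrableRn h ->
  (forall j : nat, intRn (fun y => h y * expR (- (j%:R * qdist y0 y))) = 0) -> h y0 <= 0.
Proof.
move=> ch ih h0; rewrite leNgt; apply/negP => hy0.
have hpos : 0 < h y0 / 2 by rewrite divr_gt0.
have /nbhs_ballP[r1 /= r10 hr1] : \forall y \near y0, h y0 / 2 < h y.
  by apply: (cvgr_gt _ (ch y0)); rewrite ltr_pdivrMr// ltr_pMr// ltr1n.
pose rho := r1 / 2; have rho0 : 0 < rho by rewrite divr_gt0.
have [q0 q00 hq0] := qdist_far y0 rho0.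
have /nbhs_ballP[r2 /= r20 hr2] : \forall y \near y0, qdist y0 y < q0 / 2.
  have cq : qdist y0 y @[y --> y0] --> qdist y0 y0 by exact: continuous_qdist.
  by apply: (cvgr_lt _ cq); rewrite qdist0 divr_gt0.
pose rho' := Num.min rho (r2 / 2).
have rho'0 : 0 < rho' by rewrite lt_min rho0 divr_gt0.
have near_ball (y : cV) (r : R) : 0 < r -> (forall i, `|y i 0 - y0 i 0| <= r / 2) -> ball y0 r y.
  move=> r0 hy; rewrite -ball_normE /ball_ /= distrC.
  apply: (@le_lt_trans _ _ (r / 2)); last by rewrite ltr_pdivrMr// ltr_pMr// ltr1n.
  by apply: cV_norm_le => [|i]; [rewrite divr_ge0// ltW|rewrite !mxE].
pose E (j : nat) y := expR (- (j%:R * qdist y0 y)).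
have E1 j y : E j y <= 1 by rewrite -[leRHS]expR0 ler_expR oppr_le0 mulr_ge0// qdist_ge0.
have E0 j y : 0 <= E j y by exact: expR_ge0.
(* On the small cube the weight is at least e^(-j q0/2) and h exceeds half of h(y0); on the cube of
   side [rho] the integrand is nonnegative; farther away the weight is at most e^(-j q0), a smaller
   order. *)
have pw j y : cube y0 rho' y * (h y0 / 2 * expR (- (j%:R * (q0 / 2)))) <=
    h y * E j y + expR (- (j%:R * q0)) * `|h y|.
  have t0 : 0 <= expR (- (j%:R * q0)) * `|h y| by rewrite mulr_ge0// expR_ge0.
  have [hin|hout] := pselect (forall i, `|y i 0 - y0 i 0| <= rho).
    have hh : h y0 / 2 < h y by apply: hr1; exact: near_ball.
    have hge : 0 <= h y by rewrite ltW// (lt_trans hpos).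
    rewrite cube01; case: forallP => [hc|_] /=; last first.
      by rewrite mul0r addr_ge0// mulr_ge0.
    rewrite mul1r; apply: ler_wpDr => //; apply: ler_pM; rewrite ?expR_ge0 ?(ltW hpos)//.
      exact: ltW.
    rewrite ler_expR lerN2 ler_wpM2l// ltW//; apply: hr2; apply: near_ball => // i.
    by apply: le_trans (hc i) _; rewrite ge_min lexx orbT.
  have [i hi] : exists i, rho < `|y i 0 - y0 i 0|.
    apply: contrapT => hn; apply: hout => i; rewrite leNgt; apply/negP => hi.
    by apply: hn; exists i.
  rewrite cube01; case: forallP => [hc|_] /=.
    by have := hc i; rewrite leNgt => /negP; case; apply: le_lt_trans hi; rewrite ge_min lexx.
  rewrite mul0r -lerBlDr sub0r mulrC; apply: (@le_trans _ _ (- (`|h y| * E j y))).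
    rewrite lerN2 ler_wpM2l// ler_expR lerN2 ler_wpM2l//; exact: hq0 hi.
  by rewrite -mulNr ler_wpM2r// lerNl -normrN ler_norm.
have iE j : integrableRn (fun y => h y * E j y).
  apply: (@integrableRn_le _ _ _ (fun y => `|h y|)); last exact: integrableRn_norm.
    apply: measurableRnM; first exact: measurable_contRn.
    apply: measurable_contRn => y.
    apply: (@continuous_comp _ _ _ (fun y => - (j%:R * qdist y0 y))); last exact: continuous_expR.
    apply: (@continuousN _ _ _ (fun y => j%:R * qdist y0 y)).
    apply: (@continuousM _ _ (fun _ : cV => j%:R) (qdist y0)); first exact: cst_continuous.
    exact: continuous_qdist.
  by move=> y; rewrite normrM [`|E j y|]ger0_norm// ler_piMr.
have [ic vc] := @integral_cube R n y0 rho' (ltW rho'0).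
pose v : R := (rho' *+ 2) ^+ n; have v0 : 0 < v by rewrite exprn_gt0// pmulrn_rgt0.
have key j : v * (h y0 / 2 * expR (- (j%:R * (q0 / 2)))) <=
    expR (- (j%:R * q0)) * intRn (fun y => `|h y|).
  have -> : v * (h y0 / 2 * expR (- (j%:R * (q0 / 2)))) =
     intRn (fun y => h y0 / 2 * expR (- (j%:R * (q0 / 2))) * cube y0 rho' y).
    by rewrite intRnZ// vc mulrC.
  apply: (@le_trans _ _ (intRn (fun y => h y * E j y + expR (- (j%:R * q0)) * `|h y|))).
    apply: le_intRn.
    - exact: integrableRnZ.
    - by apply: integrableRnD => //; apply: integrableRnZ; exact: integrableRn_norm.
    - by move=> y; rewrite mulrC.
  rewrite intRnD//; last by apply: integrableRnZ; exact: integrableRn_norm.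
  by rewrite h0 add0r intRnZ//; exact: integrableRn_norm.
pose I := intRn (fun y => `|h y|).
(* Dividing by e^(-j q0) leaves e^(j q0/2) on the left, which grows at least linearly in [j],
   against a fixed integral. *)
have grow j : v * (h y0 / 2) * (j%:R * (q0 / 2)) <= I.
  have := key j; rewrite -/I.
  have -> : expR (- (j%:R * (q0 / 2))) = expR (- (j%:R * q0)) * expR (j%:R * (q0 / 2)).
    by rewrite -expRD; congr expR; field.
  have alg (a b c d : R) : a * (b * (c * d)) = c * (a * b * d) by ring.
  rewrite alg ler_pM2l ?expR_gt0//; apply: le_trans; rewrite ler_wpM2l//.
    by rewrite mulr_ge0// ltW.
  by apply: le_trans (expR_ge1Dx _); rewrite lerDr.
have d0 : 0 < v * (h y0 / 2) * (q0 / 2) by rewrite !mulr_gt0// divr_gt0.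
have I0 : 0 <= I by apply: intRn_ge0.
have := grow (Num.truncn (I / (v * (h y0 / 2) * (q0 / 2)))).+1.
rewrite leNgt => /negP; apply.
rewrite mulrCA -ltr_pdivrMr//.
exact: truncnS_gt.
Qed.

(** Finite linear combinations of Hermite functions, as a closure that supports induction; by the
    ladder relation it is stable under the frame coordinates. *)
Inductive Pol : (cV -> R) -> Prop :=
| Pol_e a : Pol (e a)
| Pol_Z c v : Pol v -> Pol (fun y => c * v y)
| Pol_D u v : Pol u -> Pol v -> Pol (fun y => u y + v y).

Lemma Pol_ext u v : (forall y, u y = v y) -> Pol u -> Pol v.
Proof. by move=> uv; have -> : u = v by exact/funext. Qed.

Lemma Pol_zc k v : Pol v -> Pol (fun y => zc k y * v y).
Proof.
elim=> [a|c w _ IH|u w _ IHu _ IHw].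
- apply: (@Pol_ext (fun y => sq (a k).+1 * e (inc a k) y + sq (a k) * e (dec a k) y)).
    by move=> y; rewrite ef_mulz.
  by apply: Pol_D; apply: Pol_Z; exact: Pol_e.
- by apply: Pol_ext (Pol_Z c IH) => y; rewrite mulrCA.
- by apply: Pol_ext (Pol_D IHu IHw) => y; rewrite mulrDr.
Qed.

Lemma Pol_qdist y0 v : Pol v -> Pol (fun y => qdist y0 y * v y).
Proof.
move=> hv; apply: (@Pol_ext (fun y => 16^-1 * (\sum_k (zc k y - zc k y0) ^+ 2 * v y))).
  by move=> y; rewrite /qdist -big_distrl /=; ring.
apply: Pol_Z; elim: (index_enum 'I_n) => [|k r IH].
  by apply: Pol_ext (Pol_Z 0 hv) => y; rewrite big_nil mul0r.
apply: (@Pol_ext (fun y => (zc k y - zc k y0) ^+ 2 * v y + \sum_(j <- r) (zc j y - zc j y0) ^+ 2 * v y)).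
  by move=> y; rewrite big_cons.
apply: Pol_D => //.
have h1 w : Pol w -> Pol (fun y => (zc k y - zc k y0) * w y).
  move=> hw; apply: Pol_ext (Pol_D (Pol_zc k hw) (Pol_Z (- zc k y0) hw)) => y.
  by rewrite mulrBl mulNr.
by apply: Pol_ext (h1 _ (h1 _ hv)) => y; rewrite mulrA -expr2.
Qed.

Lemma Pol_qdistX y0 v k : Pol v -> Pol (fun y => qdist y0 y ^+ k * v y).
Proof.
move=> hv; elim: k => [|k IH]; first by apply: Pol_ext hv => y; rewrite mul1r.
by apply: Pol_ext (Pol_qdist y0 IH) => y; rewrite exprS mulrA.
Qed.

Lemma Pol_cont v : Pol v -> continuous v.
Proof.
elim=> [a|c w _ cw|u w _ cu _ cw].
- exact: sFS_cont (sFS_ef mu cG hS 0 a).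
- by move=> y; apply: (@continuousM _ _ (fun _ : cV => c) w); [exact: cst_continuous|exact: cw].
- by move=> y; apply: (@continuousD _ _ _ u w); [exact: cu|exact: cw].
Qed.

Lemma Pol_decay y0 v : Pol v -> forall kappa, exists2 C, 0 <= C &
  forall y, `|v y| * expR (qdist y0 y + kappa * N1 y) <= C.
Proof.
pose dec_ (v : cV -> R) := forall kappa, exists2 C, 0 <= C &
  forall y, `|v y| * expR (qdist y0 y + kappa * N1 y) <= C.
have decZ c w : dec_ w -> dec_ (fun y => c * w y).
  move=> hw kappa; have [C C0 hC] := hw kappa; exists (`|c| * C); first by rewrite mulr_ge0.
  by move=> y; rewrite normrM -mulrA ler_wpM2l.
have decD u w : dec_ u -> dec_ w -> dec_ (fun y => u y + w y).
  move=> hu hw kappa; have [C C0 hC] := hu kappa; have [C' C'0 hC'] := hw kappa.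
  exists (C + C'); first by rewrite addr_ge0.
  move=> y; apply: (@le_trans _ _ ((`|u y| + `|w y|) * expR (qdist y0 y + kappa * N1 y))).
    by rewrite ler_wpM2r ?expR_ge0// ler_normD.
  by rewrite mulrDl lerD.
have decz k w : dec_ w -> dec_ (fun y => zc k y * w y).
  move=> hw kappa; have [C1 [k1 [C10 k10 hz]]] := Cls0 (sMS_zc S mu 0 k).
  have [C C0 hC] := hw (kappa + k1); exists (C1 * C); first by rewrite mulr_ge0.
  move=> y; rewrite normrM.
  apply: (@le_trans _ _ (C1 * expR (k1 * N1 y) * `|w y| * expR (qdist y0 y + kappa * N1 y))).
    by rewrite ler_wpM2r ?expR_ge0// ler_wpM2r//; exact: hz tt y.
  have -> : C1 * expR (k1 * N1 y) * `|w y| * expR (qdist y0 y + kappa * N1 y) =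
    C1 * (`|w y| * (expR (qdist y0 y + kappa * N1 y) * expR (k1 * N1 y))) by ring.
  rewrite -expRD ler_wpM2l//.
  have -> : qdist y0 y + kappa * N1 y + k1 * N1 y = qdist y0 y + (kappa + k1) * N1 y by ring.
  exact: hC.
have dece a : dec_ (e a).
  elim/multi_ind: a => [kappa|a k IH].
    have [C hC] := gauss_decay mu hS kappa.
    pose K := (\sum_k zc k y0 ^+ 2) / 8.
    exists (`|cG| * (expR K * `|C|)); first by rewrite mulr_ge0// mulr_ge0 ?expR_ge0.
    move=> y; rewrite ef0E normrM [`|expR _|]ger0_norm ?expR_ge0// -mulrA ler_wpM2l//.
    apply: (@le_trans _ _ (expR K * (expR (- (\sum_k zc k y ^+ 2) / 8) * expR (kappa * N1 y)))).
      rewrite -!expRD ler_expR !addrA lerD2r.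
      have : qdist y0 y <= (\sum_k zc k y ^+ 2) / 8 + K.
        rewrite /qdist /K -mulrDl -big_split /= !big_distrl /=; apply: ler_sum => k _.
        by have := sqr_ge0 (zc k y + zc k y0); rewrite sqrrD sqrrB; lra.
      by rewrite !mulNr; lra.
    by rewrite ler_wpM2l ?expR_ge0// (le_trans (hC y))// ler_norm.
  have E y : (sq (a k).+1)^-1 * (zc k y * e a y + (- sq (a k)) * e (dec a k) y) = e (inc a k) y.
    by rewrite ef_mulz mulNr addrK mulKf// sq_neq0.
  have : dec_ (fun y => (sq (a k).+1)^-1 * (zc k y * e a y + (- sq (a k)) * e (dec a k) y)).
    apply/decZ/decD; first by apply: decz; exact: IH.
    have [->|ak] := posnP (a k); last by apply: decZ; apply: IH; rewrite [leqRHS](wt_dec ak).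
    have -> : (fun y => - sq 0 * e (dec a k) y) = (fun y => 0 * e a y).
      by apply/funext => y; rewrite sqrtr0 oppr0 !mul0r.
    by apply: decZ; exact: IH.
  by have -> : (fun y => (sq (a k).+1)^-1 * (zc k y * e a y + (- sq (a k)) * e (dec a k) y)) =
    e (inc a k) by exact/funext.
by elim=> [a|c w _|u w _ hu _ hw]; [exact: dece|exact: decZ|exact: decD].
Qed.

(** Orthogonality to all Hermite functions is carried over to their products with e^(-j qdist), for
    every [j]. The Laplace method, applied at [y0] to plus and minus g times the Gaussian, then
    gives g(y0) = 0. *)
Lemma hermite_complete (g : cV -> R) : cG != 0 -> continuous g ->
  integrableRn (fun y => g y ^+ 2 * expR (- N1 y)) ->
  (forall a, intRn (fun y => g y * e a y) = 0) -> forall y, g y = 0.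
Proof.
move=> cG0 cg ig g0 y0.
have dom v : Pol v -> exists2 B : cV -> R, integrableRn B &
    forall m y, `|m| <= expR (qdist y0 y) -> `|g y * v y * m| <= B y.
  move=> hv; have [C C0 hC] := Pol_decay y0 hv 1.
  exists (fun y => C * (g y ^+ 2 * expR (- N1 y) + expR (- N1 y))).
    by apply: integrableRnZ; apply: integrableRnD => //; exact: integrable_expN1.
  move=> m y hm; rewrite !normrM -mulrA.
  have h1 : `|v y| * `|m| <= C * expR (- N1 y).
    apply: (@le_trans _ _ (`|v y| * expR (qdist y0 y))); first by rewrite ler_wpM2l.
    rewrite -ler_pdivrMr ?expR_gt0// -expRN opprK -mulrA -expRD.
    by have := hC y; rewrite mul1r.
  apply: (@le_trans _ _ (`|g y| * (C * expR (- N1 y)))); first by rewrite ler_wpM2l.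
  rewrite mulrCA ler_wpM2l// -[X in _ <= _ + X]mul1r -mulrDl ler_wpM2r ?expR_ge0//.
  have := sqr_ge0 (`|g y| - 1); rewrite sqrrB real_normK ?num_real//.
  have := sqr_ge0 (g y); lra.
have cE (j : nat) : continuous (fun y => expR (- (j%:R * qdist y0 y))).
  move=> y; apply: (@continuous_comp _ _ _ (fun y => - (j%:R * qdist y0 y))); last exact: continuous_expR.
  apply: (@continuousN _ _ _ (fun y => j%:R * qdist y0 y)).
  apply: (@continuousM _ _ (fun _ : cV => j%:R) (qdist y0)); first exact: cst_continuous.
  exact: continuous_qdist.
have E0 (j : nat) y : 0 <= expR (- (j%:R * qdist y0 y)) by exact: expR_ge0.
have E1 (j : nat) y : expR (- (j%:R * qdist y0 y)) <= 1.
  by rewrite -[leRHS]expR0 ler_expR oppr_le0 mulr_ge0// qdist_ge0.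
have eq1 y : 1 <= expR (qdist y0 y) by rewrite -[leLHS]expR0 ler_expR qdist_ge0.
have int (v : cV -> R) (m : cV -> R) : Pol v -> measurableRn m ->
    (forall y, `|m y| <= expR (qdist y0 y)) -> integrableRn (fun y => g y * v y * m y).
  move=> hv mm hm; have [B iB hB] := dom v hv.
  apply: integrableRn_le iB; last by move=> y; exact: hB.
  apply: measurableRnM => //; apply: measurableRnM; apply: measurable_contRn => //.
  exact: Pol_cont.
have intE (j : nat) v : Pol v -> integrableRn (fun y => g y * v y * expR (- (j%:R * qdist y0 y))).
  move=> hv; apply: int => //; first exact: measurable_contRn.
  by move=> y; rewrite ger0_norm// (le_trans (E1 j y)).
(* One factor e^(-qdist) is expanded at a time: its partial sums are dominated by e^qdist, whereas
   expanding e^(-j qdist) at once would require e^(j qdist), which the Gaussian does not absorb for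
   large [j]. *)
have claim (j : nat) : forall v, Pol v -> intRn (fun y => g y * v y * expR (- (j%:R * qdist y0 y))) = 0.
  elim: j => [|j IH] v hv.
    have -> : intRn (fun y => g y * v y * expR (- (0 * qdist y0 y))) = intRn (fun y => g y * v y).
      by apply: intRn_ext => y; rewrite mul0r oppr0 expR0 mulr1.
    have int0 w : Pol w -> integrableRn (fun y => g y * w y).
      move=> hw; apply: integrableRn_ext (intE 0%N w hw) => y.
      by rewrite mul0r oppr0 expR0 mulr1.
    elim: hv => [a|c w hw IHw|u w hu IHu hw IHw]; first exact: g0.
      have -> : intRn (fun y => g y * (c * w y)) = intRn (fun y => c * (g y * w y)).
        by apply: intRn_ext => y; rewrite mulrCA.
      by rewrite intRnZ ?IHw ?mulr0//; exact: int0.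
    have -> : intRn (fun y => g y * (u y + w y)) = intRn (fun y => g y * u y + g y * w y).
      by apply: intRn_ext => y; rewrite mulrDr.
    by rewrite intRnD ?IHu ?IHw ?addr0//; exact: int0.
  pose s N y := series (exp_coeff (- qdist y0 y)) N.
  pose u N y := g y * v y * (s N y * expR (- (j%:R * qdist y0 y))).
  have sb N y : `|s N y * expR (- (j%:R * qdist y0 y))| <= expR (qdist y0 y).
    rewrite normrM [`|expR _|]ger0_norm//.
    apply: (@le_trans _ _ (`|s N y|)); first by rewrite ler_piMr.
    by rewrite (le_trans (exp_series_le _ _))// normrN ger0_norm ?qdist_ge0.
  have [c hc] := exp_coeffN R.
  have uE N y : u N y = \sum_(0 <= k < N)
      c k * (g y * (qdist y0 y ^+ k * v y) * expR (- (j%:R * qdist y0 y))).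
    rewrite /u /s /series /= big_distrl big_distrr /=; apply: eq_bigr => k _.
    have alg (a b d p q : R) : a * b * (d * p * q) = d * (a * (p * b) * q) by ring.
    by rewrite hc; exact: alg.
  have iu N k : integrableRn (fun y => c k *
      (g y * (qdist y0 y ^+ k * v y) * expR (- (j%:R * qdist y0 y)))).
    by apply: integrableRnZ; apply: (intE j); exact: Pol_qdistX.
  have u0 N : intRn (u N) = 0.
    rewrite (intRn_ext (uE N)) intRn_sum; last by move=> k; exact: iu.
    rewrite big1// => k _; rewrite intRnZ; last by apply: (intE j); exact: Pol_qdistX.
    by rewrite IH ?mulr0//; exact: Pol_qdistX.
  have [B iB hB] := dom v hv.
  have [] := @dominated_intRn R n u (fun y => g y * v y * expR (- (j.+1%:R * qdist y0 y))) B.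
  - move=> N; have : integrableRn (fun y => \sum_(0 <= k < N)
      c k * (g y * (qdist y0 y ^+ k * v y) * expR (- (j%:R * qdist y0 y)))).
      by apply: integrableRn_sum => k; exact: iu.
    move=> /integrableRn_meas; congr measurableRn; apply/funext => y.
    by rewrite uE.
  - move=> y.
    have -> : expR (- (j.+1%:R * qdist y0 y)) = expR (- qdist y0 y) * expR (- (j%:R * qdist y0 y)).
      by rewrite -expRD; congr expR; rewrite -natr1; ring.
    apply: cvgM; first exact: cvg_cst.
    by apply: cvgM; [exact: cvg_exp_series|exact: cvg_cst].
  - exact: iB.
  - by move=> N y; exact: hB.
  have -> : (fun N => intRn (u N)) = fun=> 0 by exact/funext.
  move=> _ cv; have c0 : (fun _ : nat => (0 : R)) @ \oo --> (0 : R) by exact: cvg_cst.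
  exact: (cvg_unique _ cv c0).
have half (sgn : R) : sgn * (g y0 * e (mi0 n) y0) <= 0.
  apply: (@laplace_le0 (fun y => sgn * (g y * e (mi0 n) y)) y0).
  - move=> y; apply: (@continuousM _ _ (fun _ : cV => sgn) (fun y => g y * e (mi0 n) y)).
      exact: cst_continuous.
    apply: (@continuousM _ _ g (e (mi0 n))); first exact: cg.
    exact: Pol_cont (Pol_e _) y.
  - apply: integrableRnZ; apply: integrableRn_ext (intE 0%N _ (Pol_e (mi0 n))) => y.
    by rewrite mul0r oppr0 expR0 mulr1.
  - move=> j.
    have -> : intRn (fun y => sgn * (g y * e (mi0 n) y) * expR (- (j%:R * qdist y0 y))) =
       intRn (fun y => sgn * (g y * e (mi0 n) y * expR (- (j%:R * qdist y0 y)))).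
      by apply: intRn_ext => y; rewrite !mulrA.
    rewrite intRnZ; last by apply: intE; exact: Pol_e.
    by rewrite claim ?mulr0//; exact: Pol_e.
have : g y0 * e (mi0 n) y0 = 0.
  apply/eqP; rewrite eq_le; have := half 1; have := half (-1).
  by rewrite mul1r mulN1r oppr_le0 => -> ->.
move=> /eqP; rewrite mulf_eq0 ef0E mulf_eq0 (negbTE cG0) /=.
by have /gt_eqF -> := expR_gt0 (- (\sum_k zc k y0 ^+ 2) / 4); rewrite orbF => /eqP.
Qed.

End completeness.

Lemma cauchy_rate_cvg (R : realType) (x : nat -> R) (C : R) :
  (forall d D, (d <= D)%N -> `|x D - x d| <= C / d.+1%:R) -> x @ \oo --> lim (x @ \oo).
Proof.
move=> hx; apply/cauchy_cvgP/cauchy_exP => eps eps0.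
have C0 : 0 <= C by have := hx 0%N 0%N (leqnn _); rewrite subrr normr0 divr1.
pose d := Num.truncn (C / eps); exists (x d); suff : \forall D \near \oo, ball (x d) eps (x D) by [].
near=> D.
rewrite -ball_normE /ball_ /= distrC; apply: le_lt_trans (hx d D _) _.
  by near: D; exact: nbhs_infty_ge.
rewrite ltr_pdivrMr// mulrC -ltr_pdivrMr//; exact: truncnS_gt.
Unshelve. all: by end_near. Qed.

Lemma continuous_unif_limit (R : realType) (T : topologicalType) (g : nat -> T -> R) (w : T -> R) :
  (forall eps, 0 < eps -> exists d, forall z, `|w z - g d z| <= eps) ->
  (forall d, continuous (g d)) -> continuous w.
Proof.
move=> hw cg z0; apply/cvgrPdist_le => eps eps0.
have e3 : 0 < eps / 3 by rewrite divr_gt0.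
have [d hd] := hw _ e3.
have := cg d z0 => /cvgrPdist_le/(_ _ e3) near0.
near=> z.
have -> : w z0 - w z = (w z0 - g d z0) + (g d z0 - g d z) + (g d z - w z) by ring.
have -> : eps = eps / 3 + eps / 3 + eps / 3 by field.
apply: le_trans (ler_normD _ _) _; apply: lerD; last by rewrite distrC.
apply: le_trans (ler_normD _ _) _; apply: lerD; first exact: hd.
by near: z.
Unshelve. all: by end_near. Qed.

(** * Truncation errors in the L2 norm and in the form *)

Section approximation.
Variables (R : realType) (n : nat) (S : 'M[R]_n) (mu : 'cV[R]_n) (cG : R).
Variable hS : S \in unitmx.
Local Notation cV := 'cV[R]_n.
Local Notation e := (ef S mu cG).
Local Notation zc := (zc S mu).
Local Notation sq r := (Num.sqrt r%:R).
Variable nrm : intRn (fun y => e (mi0 n) y ^+ 2) = 1.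
Local Notation coef := (coef S mu cG).
Local Notation psum := (psum S mu cG).
Implicit Types (a b : multi n) (y : cV).

Lemma sFS_int k u : @sFS R n k u -> integrableRn u.
Proof.
move=> hu; have [mu_ hL] := Cls0 hu; have [C /(_ tt)[hC _]] := hL 1.
apply: (@integrableRn_le _ _ _ (fun y => wL2 1 u y + expR (- N1 y))).
- exact: mu_ tt.
- move=> y; rewrite /wL2 mul1r expRN.
  have e0 := expR_gt0 (N1 y); move: (expR _) e0 => E E0.
  rewrite -[_ ^+ 2]real_normK ?num_real//; move: (`|u y|) => x.
  rewrite -(ler_pM2r E0) mulrDl mulVf ?gt_eqF//.
  have := sqr_ge0 (x * E - 1); have := sqr_ge0 (x * E).
  have -> : x ^+ 2 * E * E = (x * E) ^+ 2 by ring.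
  by rewrite sqrrB; lra.
- by apply: integrableRnD => //; exact: integrable_expN1.
Qed.

Lemma sFS_psum k (u : cV -> R) d : sFS k (psum u d).
Proof. by apply: sFS_sum => a; apply: sFSZ; exact: sFS_ef. Qed.

Lemma cG_neq0 : cG != 0.
Proof.
apply/eqP => c0; have := nrm; rewrite (_ : (fun y => _) = fun=> 0).
  by rewrite intRn0 => /eqP; rewrite eq_sym oner_eq0.
by apply/funext => y; rewrite ef0E c0 mul0r expr0n.
Qed.

Lemma coef_psum (u : cV -> R) d a : (wt a <= d)%N ->
  intRn (fun y => psum u d y * e a y) = coef u a.
Proof.
move=> ad; have iab b : integrableRn (fun y => e b y * e a y).
  exact: sFS_mul (sFS_ef mu cG hS 0 b) (sFS_ef mu cG hS 0 a).
have -> : intRn (fun y => psum u d y * e a y) =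
    intRn (fun y => \sum_(b <- midx n d) coef u b * (e b y * e a y)).
  by apply: intRn_ext => y; rewrite big_distrl /=; apply: eq_bigr => b _; rewrite mulrA.
rewrite intRn_sum; last by move=> b; exact: integrableRnZ.
rewrite (bigD1_seq a) ?mem_midx ?midx_uniq//= intRnZ// (ef_orthonormal hS nrm) eqxx mulr1.
rewrite big1 ?addr0// => b ba.
by rewrite intRnZ// (ef_orthonormal hS nrm) (negbTE ba) mulr0.
Qed.

(** The truncations converge uniformly to some continuous [w] by [psum_tail]. The difference u - w
    is orthogonal to every Hermite function, so completeness identifies the limit. *)
Lemma psum_cvg (u : cV -> R) y : (forall m, sFS m u) ->
  (fun d => psum u d y) @ \oo --> u y.
Proof.
move=> hu.
have [C C0 hC] := psum_tail hS nrm 1 (hu : forall m, FS m (fun _ : unit => u)).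
have hC1 d D z : (d <= D)%N -> `|psum u D z - psum u d z| <= C / d.+1%:R.
  by move=> dD; have := hC tt d D z dD; rewrite expr1.
pose w (z : cV) : R := lim ((fun d => psum u d z) @ \oo).
have cw z : (fun d => psum u d z) @ \oo --> w z.
  by apply: (@cauchy_rate_cvg R _ C) => d D; exact: hC1.
have hw z d : `|w z - psum u d z| <= C / d.+1%:R.
  have c1 : (fun D => `|psum u D z - psum u d z|) @ \oo --> `|w z - psum u d z|.
    by apply: cvg_norm; apply: cvgB => //; exact: cvg_cst.
  apply: (ler_cvg_to c1 (cvg_cst (C / d.+1%:R))).
  by near=> D; apply: hC1; near: D; exact: nbhs_infty_ge.
suff : u y - w y = 0 by move/eqP; rewrite subr_eq0 => /eqP ->.
have rate (eps : R) : 0 < eps -> exists d0, forall d, (d0 <= d)%N -> C / d.+1%:R <= eps.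
  move=> e0; exists (Num.truncn (C / eps)) => d hd.
  rewrite ler_pdivrMr// mulrC -ler_pdivrMr// ltW// (lt_le_trans (truncnS_gt _))//.
  by rewrite ler_nat.
have ctw : continuous (w : cV -> R).
  apply: (@continuous_unif_limit _ _ (psum u)) => [eps e0|d].
    by have [d hd] := rate _ e0; exists d => z; apply: le_trans (hw z d) _; exact: hd.
  exact: sFS_cont (sFS_psum 0 u d).
have cu := sFS_cont (hu 0).
have cg : continuous (fun z => u z - w z).
  by move=> z; apply: (@continuousB _ _ _ u w); [exact: cu|exact: ctw].
have iE := @integrable_expN1 R n.
apply: (hermite_complete (mu := mu) hS cG_neq0 cg).
  have [mu_ /(_ (-1))[C' /(_ tt)[iu _]]] := Cls0 (hu 0).
  (* [w] differs from the first truncation by at most [C], so u - w is a sum of three terms that are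
     square integrable against e^(-N1). *)
  apply: (@integrableRn_le _ _ _ (fun z => 3 * (wL2 (-1) u z) +
      (3 * wL2 (-1) (psum u 0) z + 3 * C ^+ 2 * expR (- N1 z)))).
  - apply: measurableRnM; first by apply: measurableRnX; exact: measurable_contRn.
    have := measurable_expN1 (R := R) (n := n) (-1); congr measurableRn.
    by apply/funext => z; rewrite mulN1r.
  - move=> z; rewrite ger0_norm; last by rewrite mulr_ge0 ?sqr_ge0// expR_ge0.
    rewrite /wL2 mulN1r !mulrA -!mulrDl ler_wpM2r ?expR_ge0//.
    have h1 : (w z - psum u 0 z) ^+ 2 <= C ^+ 2.
      rewrite -[leLHS]real_normK ?num_real// lerXn2r ?nnegrE//.
      by have := hw z 0%N; rewrite divr1.
    move: h1; move: (u z) (w z) (psum u 0 z) => x x' x'' h1.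
    have -> : (x - x') ^+ 2 = (x - (x' - x'') - x'') ^+ 2 by ring.
    have := sqr_ge0 (x - - (x' - x'')); have := sqr_ge0 (x - - x'').
    have := sqr_ge0 ((x' - x'') - x'').
    move: (x' - x'') h1 => t h1; rewrite !sqrrB !sqrrN; nra.
  - apply: integrableRnD; first exact: integrableRnZ.
    apply: integrableRnD; last exact: integrableRnZ.
    apply: integrableRnZ; have [_ /(_ (-1))[C'' /(_ tt)[//]]] := Cls0 (sFS_psum 0 u 0).
move=> a.
have ie := sFS_int (sFS_ef mu cG hS 0 a).
have iue : integrableRn (fun z => u z * e a z) by exact: sFS_mul (hu 0) (sFS_ef mu cG hS 0 a).
have ipe d : integrableRn (fun z => psum u d z * e a z).
  exact: sFS_mul (sFS_psum 0 u d) (sFS_ef mu cG hS 0 a).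
have iwe d : integrableRn (fun z => (w z - psum u d z) * e a z).
  apply: (@integrableRn_le _ _ _ (fun z => C * `|e a z|)).
  - apply: measurableRnM; last exact: sFS_meas (sFS_ef mu cG hS 0 a).
    apply: measurable_contRn => z; apply: (@continuousB _ _ _ w (psum u d)); first exact: ctw.
    exact: sFS_cont (sFS_psum 0 u d) z.
  - move=> z; rewrite normrM ler_wpM2r//; apply: le_trans (hw z d) _.
    by rewrite ler_pdivrMr// ler_peMr// ler1n.
  - by apply: integrableRnZ; exact: integrableRn_norm.
pose M := intRn (fun z => `|e a z|).
have M0 : 0 <= M by apply: intRn_ge0.
apply/eqP; rewrite -normr_le0; apply/ler_addgt0Pr => eps eps0; rewrite add0r.
have e1 : 0 < eps / (M + 1) by rewrite divr_gt0// ltr_wpDl.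
have [d0 hd0] := rate _ e1.
(* From |a| on, the truncation has exactly the coefficient of [u] along [e a]. *)
pose d := maxn d0 (wt a).
have -> : intRn (fun z => (u z - w z) * e a z) = - intRn (fun z => (w z - psum u d z) * e a z).
  have E z : (u z - w z) * e a z =
      (u z * e a z - psum u d z * e a z) - (w z - psum u d z) * e a z by ring.
  rewrite (intRn_ext E) intRnB//; last exact: integrableRnB.
  by rewrite intRnB// coef_psum ?leq_maxr// -/(coef u a) subrr sub0r.
rewrite normrN.
apply: (@le_trans _ _ (intRn (fun z => eps / (M + 1) * `|e a z|))).
  apply: intRn_norm_le => //; first by apply: integrableRnZ; exact: integrableRn_norm.
  move=> z; rewrite normrM ler_wpM2r//; apply: le_trans (hw z d) _.
  by apply: hd0; exact: leq_maxl.
rewrite intRnZ; last exact: integrableRn_norm.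
rewrite -/M mulrAC ler_pdivrMr ?ltr_wpDl// ler_wpM2l ?(ltW eps0)//.
by rewrite lerDl.
Unshelve. all: by end_near. Qed.

(* A truncated expansion is bounded by the L2 norm through its finitely many
   coefficients, and the tails are uniformly small. *)
Lemma FS_sup (I : Type) (u : I -> cV -> R) : (forall m, FS m u) ->
  forall eps, 0 < eps -> exists2 C, 0 <= C & forall i M y, 0 <= M ->
    intRn (fun y => u i y ^+ 2) <= M ^+ 2 -> `|u i y| <= C * M + eps.
Proof.
move=> hu eps eps0.
have [C C0 hC] := psum_tail hS nrm 1 hu; have [B B0 hB] := ef_sup S mu cG.
pose d := Num.truncn (C / eps).
have dB : C / d.+1%:R <= eps.
  by rewrite ler_pdivrMr// mulrC -ler_pdivrMr// ltW// truncnS_gt.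
exists (\sum_(a <- midx n d) B * \prod_k (a k).+1%:R).
  by apply: sumr_ge0 => a _; rewrite mulr_ge0// prodr_ge0.
move=> i M y M0 hM; have hui m := FS_sFS i (hu m).
have -> : u i y = psum (u i) d y + (u i y - psum (u i) d y) by ring.
apply: le_trans (ler_normD _ _) _; apply: lerD.
  rewrite big_distrl /=; apply: le_trans (ler_norm_sum _ _ _) _.
  apply: ler_sum => a _; rewrite normrM mulrC; apply: ler_pM => //.
  rewrite -(@ler_pXn2r _ 2)// ?nnegrE// real_normK ?num_real//.
  exact: le_trans (coef_bessel hS nrm a (hui 0)) hM.
apply: le_trans dB.
have c1 : (fun D => `|psum (u i) D y - psum (u i) d y|) @ \oo --> `|u i y - psum (u i) d y|.
  by apply: cvg_norm; apply: cvgB; [exact: psum_cvg|exact: cvg_cst].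
apply: (ler_cvg_to c1 (cvg_cst (C / d.+1%:R))).
near=> D; have := hC i d D y; rewrite expr1; apply.
by near: D; exact: nbhs_infty_ge.
Unshelve. all: by end_near. Qed.

(** Families whose L2 norms grow polynomially in |a|, hence are beaten by rapidly decaying
    coefficients. The Hermite functions form one, and the ladder relations keep this under frame
    coordinates and derivatives; so H e_a is another. *)
Definition polyfam (g : multi n -> cV -> R) : Prop :=
  (forall a, sFS 0 (g a)) /\ exists (C : R) M, 0 <= C /\
    forall a, intRn (fun y => g a y ^+ 2) <= C * (wt a).+1%:R ^+ M.

Lemma polyfam_e : polyfam e.
Proof.
split; first by move=> a; exact: sFS_ef.
exists 1, 0%N; split => // a; rewrite expr0 mulr1.
have -> : intRn (fun y => e a y ^+ 2) = 1; last exact: lexx.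
by have := ef_orthonormal hS nrm a a; rewrite eqxx.
Qed.

Lemma polyfamD g h : polyfam g -> polyfam h -> polyfam (fun a y => g a y + h a y).
Proof.
move=> [sg [C [M [C0 hC]]]] [sh [C' [M' [C'0 hC']]]]; split; first by move=> a; exact: sFSD.
exists (2 * C + 2 * C'), (M + M')%N; split; first by rewrite addr_ge0// mulr_ge0.
move=> a.
apply: (@le_trans _ _ (2 * intRn (fun y => g a y ^+ 2) + 2 * intRn (fun y => h a y ^+ 2))).
  have i1 := sFS_sq (sg a); have i2 := sFS_sq (sh a).
  rewrite -!intRnZ// -intRnD; [|exact: integrableRnZ|exact: integrableRnZ].
  apply: le_intRn.
  - exact: sFS_sq (sFSD (sg a) (sh a)).
  - by apply: integrableRnD; exact: integrableRnZ.
  - by move=> y; have := sqr_ge0 (g a y - h a y); rewrite sqrrB sqrrD; lra.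
have -> : (2 * C + 2 * C') * (wt a).+1%:R ^+ (M + M') =
  2 * (C * (wt a).+1%:R ^+ (M + M')) + 2 * (C' * (wt a).+1%:R ^+ (M + M')) by ring.
have w1 : 1 <= (wt a).+1%:R :> R by rewrite ler1n.
apply: lerD; rewrite ler_wpM2l//.
  by apply: le_trans (hC a) _; rewrite ler_wpM2l// ler_weXn2l// leq_addr.
by apply: le_trans (hC' a) _; rewrite ler_wpM2l// ler_weXn2l// leq_addl.
Qed.

Lemma polyfam_shift g (c : multi n -> R) (s : multi n -> multi n) K L : polyfam g -> 0 <= K ->
  (forall a, c a ^+ 2 <= K * (wt a).+1%:R ^+ L) -> (forall a, (wt (s a) <= (wt a).+1)%N) ->
  polyfam (fun a y => c a * g (s a) y).
Proof.
move=> [sg [C [M [C0 hC]]]] K0 hc hs; split; first by move=> a; exact: sFSZ.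
exists (K * (C * 2 ^+ M)), (L + M)%N; split; first by rewrite !mulr_ge0// exprn_ge0.
move=> a.
have -> : intRn (fun y => (c a * g (s a) y) ^+ 2) = c a ^+ 2 * intRn (fun y => g (s a) y ^+ 2).
  rewrite -intRnZ; last exact: sFS_sq (sg _).
  by apply: intRn_ext => y; rewrite exprMn.
have g0 : 0 <= intRn (fun y => g (s a) y ^+ 2) by apply: intRn_ge0 => y; exact: sqr_ge0.
apply: le_trans (ler_pM (sqr_ge0 _) g0 (hc a) (hC (s a))) _.
rewrite exprD -!mulrA ler_wpM2l// mulrCA ler_wpM2l// [leRHS]mulrCA.
rewrite ler_wpM2l ?exprn_ge0// -exprMn lerXn2r ?nnegrE ?mulr_ge0//.
by rewrite -natrM ler_nat; have := hs a; lia.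
Qed.

Lemma polyfamZ g (c : R) : polyfam g -> polyfam (fun a y => c * g a y).
Proof.
move=> hg; apply: (@polyfam_shift g (fun=> c) id (c ^+ 2) 0) => //; first exact: sqr_ge0.
by move=> a; rewrite mulr1.
Qed.

Lemma polyfam_sum (J : Type) (r : seq J) (g : J -> multi n -> cV -> R) :
  (forall j, polyfam (g j)) -> polyfam (fun a y => \sum_(j <- r) g j a y).
Proof.
move=> hg; elim: r => [|j r IH].
  have -> : (fun a y => \sum_(j <- [::]) g j a y) = (fun a y => 0 * e a y).
    by apply/funext => a; apply/funext => y; rewrite big_nil mul0r.
  by apply: polyfamZ; exact: polyfam_e.
have -> : (fun a y => \sum_(i <- j :: r) g i a y) = (fun a y => g j a y + \sum_(i <- r) g i a y).
  by apply/funext => a; apply/funext => y; rewrite big_cons.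
exact: polyfamD.
Qed.

Lemma polyfam_inc g k : polyfam g -> polyfam (fun a y => sq (a k).+1 * g (inc a k) y).
Proof.
move=> hg; apply: (@polyfam_shift g (fun a => sq (a k).+1) (fun a => inc a k) 1 1) => //.
  by move=> a; rewrite mul1r expr1 sqr_sqrtr// ler_nat ltnS /wt (bigD1 k)//= leq_addr.
by move=> a; rewrite wt_inc.
Qed.

Lemma wt_dec_le a k : (wt (dec a k) <= wt a)%N.
Proof. by apply: leq_sum => i _; rewrite ffunE leq_subr. Qed.

Lemma polyfam_dec g k : polyfam g -> polyfam (fun a y => sq (a k) * g (dec a k) y).
Proof.
move=> hg; apply: (@polyfam_shift g (fun a => sq (a k)) (fun a => dec a k) 1 1) => //.
  by move=> a; rewrite mul1r expr1 sqr_sqrtr// ler_nat (@leq_trans (wt a))// /wt (bigD1 k)//= leq_addr.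
by move=> a; rewrite leqW// wt_dec_le.
Qed.

Lemma polyfam_zc (w : cV -> R) k : polyfam (fun a y => w y * e a y) ->
  polyfam (fun a y => w y * zc k y * e a y).
Proof.
move=> hw; have := polyfamD (polyfam_inc k hw) (polyfam_dec k hw).
congr polyfam; apply/funext => a; apply/funext => y.
by rewrite -[RHS]mulrA ef_mulz mulrDr; congr (_ + _); rewrite mulrCA.
Qed.

(** A polynomial on which the ladder relations act; W is bounded by one of its powers. *)
Definition mz (y : cV) : R := 1 + \sum_k zc k y ^+ 2.

Lemma mz_ge1 y : 1 <= mz y.
Proof. by rewrite lerDl sumr_ge0// => k _; exact: sqr_ge0. Qed.

Lemma polyfam_mz K : polyfam (fun a y => mz y ^+ K * e a y).
Proof.
elim: K => [|K IH].
  have := polyfam_e; congr polyfam; apply/funext => a; apply/funext => y.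
  by rewrite expr0 mul1r.
have := polyfamD IH (polyfam_sum (index_enum 'I_n) (fun k => polyfam_zc k (polyfam_zc k IH))).
congr polyfam; apply/funext => a; apply/funext => y.
rewrite exprSr {3}/mz mulrDr mulr1 mulrDl; congr (_ + _).
rewrite big_distrr big_distrl /=; apply: eq_bigr => k _; ring.
Qed.

(** Stated for the ladder combination and not for a derivative of [g], so that it serves twice: on
    [e], and on the derivatives of [e] by [pderiv2_ef]. *)
Lemma polyfam_pderiv g j : polyfam g ->
  polyfam (fun a y => \sum_k invmx S k j *
    ((sq (a k) * g (dec a k) y - sq (a k).+1 * g (inc a k) y) / 2)).
Proof.
move=> hg; apply: polyfam_sum => k.
have := polyfamZ (invmx S k j / 2) (polyfamD (polyfam_dec k hg) (polyfamZ (-1) (polyfam_inc k hg))).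
congr polyfam; apply/funext => a; apply/funext => y; ring.
Qed.

Lemma pderiv2_ef j a : pderiv j (pderiv j (e a)) = fun y => \sum_k invmx S k j *
  ((sq (a k) * pderiv j (e (dec a k)) y - sq (a k).+1 * pderiv j (e (inc a k)) y) / 2).
Proof.
have alg (t t' : R) : t * (t' / 2) = t / 2 * t' by rewrite mulrA mulrAC.
rewrite [in LHS]pderiv_ef; apply/funext => y; apply: pderivE.
apply: is_derive_sumR => k.
have h1 := @is_deriveZ _ _ _ _ (sq (a k)) y _ _ (sFS_is j y (sFS_ef mu cG hS 1 (dec a k))).
have h2 := @is_deriveZ _ _ _ _ (sq (a k).+1) y _ _ (sFS_is j y (sFS_ef mu cG hS 1 (inc a k))).
have h3 := @is_deriveZ _ _ _ _ (invmx S k j / 2) y _ _ (is_deriveB h1 h2).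
have -> : (fun y => invmx S k j * ((sq (a k) * e (dec a k) y - sq (a k).+1 * e (inc a k) y) / 2)) =
  (invmx S k j / 2) \*: (sq (a k) \*: e (dec a k) - sq (a k).+1 \*: e (inc a k)).
  by apply/funext => z; exact: alg.
by apply: (is_derive_eq h3); exact/esym/alg.
Qed.

Lemma polyfam_le g h (K : R) : polyfam g -> 0 <= K -> (forall a, sFS 0 (h a)) ->
  (forall a y, `|h a y| <= K * `|g a y|) -> polyfam h.
Proof.
move=> [sg [C [M [C0 hC]]]] K0 sh hle; split => //.
exists (K ^+ 2 * C), M; split; first by rewrite mulr_ge0// sqr_ge0.
move=> a; apply: (@le_trans _ _ (intRn (fun y => K ^+ 2 * g a y ^+ 2))).
  apply: le_intRn; [exact: sFS_sq (sh a)|by apply: integrableRnZ; exact: sFS_sq (sg a)|move=> y].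
  rewrite -exprMn -[leLHS]real_normK ?num_real// -[leRHS]real_normK ?num_real//.
  by rewrite lerXn2r ?nnegrE// normrM (ger0_norm K0).
by rewrite intRnZ; [rewrite -mulrA ler_wpM2l ?sqr_ge0|exact: sFS_sq (sg a)].
Qed.

Variables (V : cV -> R) (sV : smooth V) (MV : forall k, sMS k V).
Local Notation W := (Wpot V).
Variable Wle : exists (C : R) K, 0 <= C /\ forall y, `|W y| <= C * mz y ^+ K.

Lemma polyfam_Hop : polyfam (fun a => Hop W (e a)).
Proof.
have [C [K [C0 hC]]] := Wle.
have -> : (fun a => Hop W (e a)) = (fun a y => (-1) * (\sum_j pderiv j (pderiv j (e a)) y) + W y * e a y).
  by apply/funext => a; apply/funext => y; rewrite mulN1r.
apply: polyfamD; last first.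
  apply: (polyfam_le (polyfam_mz K) C0) => [a|a y].
    by apply: sFSM; [exact: sMS_Wpot|exact: sFS_ef].
  rewrite normrM [`|_ * e a y|]normrM [leRHS]mulrA ler_wpM2r//; apply: le_trans (hC y) _.
  by rewrite ger0_norm// exprn_ge0// (le_trans ler01)// mz_ge1.
apply: polyfamZ; apply: (polyfam_sum (index_enum 'I_n)
  (g := fun j a => pderiv j (pderiv j (e a)))) => j.
have h1 : polyfam (fun a => pderiv j (e a)).
  have := polyfam_pderiv j polyfam_e; congr polyfam; apply/funext => a.
  by rewrite pderiv_ef.
have := polyfam_pderiv j h1; congr polyfam; apply/funext => a.
by rewrite pderiv2_ef.
Qed.

(** Cauchy-Schwarz with the weights [omega] bounds the square of the sum pointwise by a sum of
    squares, which is integrated term by term; the g a need not be orthogonal. *)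
Lemma polyfam_sum_coef (g : multi n -> cV -> R) (I : Type) (u : I -> cV -> R) s :
  polyfam g -> (forall m, FS m u) -> exists2 C, 0 <= C & forall i d D,
  intRn (fun y => (\sum_(a <- midx n D | (d <= wt a)%N) coef (u i) a * g a y) ^+ 2)
    <= C * d.+1%:R ^- s.
Proof.
move=> [sg [C [M [C0 hC]]]] hu.
have [C' C'0 hC'] := coef_decay_sq hS nrm (M + s) hu.
exists (2 ^+ n * (C' * C * 2 ^+ n)); first by rewrite !mulr_ge0// exprn_ge0.
move=> i d D; pose P a := (d <= wt a)%N.
have isq a : integrableRn (fun y => (coef (u i) a) ^+ 2 / omega R a * g a y ^+ 2).
  by apply: integrableRnZ; exact: sFS_sq (sg a).
apply: (@le_trans _ _ (intRn (fun y => 2 ^+ n *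
    \sum_(a <- midx n D | P a) (coef (u i) a) ^+ 2 / omega R a * g a y ^+ 2))).
  apply: le_intRn.
  - have hs : sFS 0 (fun y => \sum_(a <- [seq a <- midx n D | P a]) coef (u i) a * g a y).
      by apply: sFS_sum => a; exact: sFSZ.
    apply: integrableRn_ext (sFS_sq hs) => y; by rewrite big_filter.
  - by apply: integrableRnZ; exact: integrableRn_sum.
  - move=> y; apply: le_trans (sum_cauchy_schwarz (midx n D) P (fun a => coef (u i) a * g a y) (@omega_gt0 R n)) _.
    have E : \sum_(a <- midx n D | P a) (coef (u i) a * g a y) ^+ 2 / omega R a =
       \sum_(a <- midx n D | P a) coef (u i) a ^+ 2 / omega R a * g a y ^+ 2.
      by apply: eq_bigr => a _; rewrite exprMn mulrAC.
    rewrite E ler_wpM2r//.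
      apply: sumr_ge0 => a _; rewrite mulr_ge0 ?sqr_ge0// divr_ge0 ?sqr_ge0//.
      exact/ltW/omega_gt0.
    apply: le_trans (sum_omega R n D).
    rewrite [leRHS](bigID P) /= lerDl.
    by apply: sumr_ge0 => a _; exact/ltW/omega_gt0.
rewrite intRnZ; last exact: integrableRn_sum.
rewrite intRn_sum// -mulrA ler_wpM2l ?exprn_ge0//.
apply: (@le_trans _ _ (\sum_(a <- midx n D | P a) C' * C * d.+1%:R ^- s * omega R a)).
  apply: ler_sum => a Pa; rewrite intRnZ; last exact: sFS_sq (sg a).
  have o0 := omega_gt0 R a.
  rewrite mulrAC ler_pdivrMr//.
  apply: (@le_trans _ _ (coef (u i) a ^+ 2 * (C * (wt a).+1%:R ^+ M))).
    by rewrite ler_wpM2l ?sqr_ge0.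
  have -> : C' * C * d.+1%:R ^- s * omega R a * omega R a =
     C * (C' * omega R a ^+ 2 / d.+1%:R ^+ s) by ring.
  rewrite mulrCA.
  rewrite ler_wpM2l// ler_pdivlMr ?exprn_gt0//; apply: le_trans (hC' i a).
  rewrite exprD mulrA; apply: ler_wpM2l.
    by apply: mulr_ge0; [exact: sqr_ge0|exact: exprn_ge0].
  by rewrite lerXn2r ?nnegrE// ler_nat ltnS.
rewrite -big_distrr /= [leRHS]mulrAC ler_wpM2l ?mulr_ge0 ?invr_ge0 ?exprn_ge0//.
apply: le_trans (sum_omega R n D).
rewrite [leRHS](bigID P) /= lerDl.
by apply: sumr_ge0 => a _; exact/ltW/omega_gt0.
Qed.

(** The bound holds for the differences of two truncations, and Fatou's lemma passes to the limit in
    the longer one. *)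
Lemma psum_L2 (I : Type) (u : I -> cV -> R) s : (forall m, FS m u) ->
  exists2 C, 0 <= C & forall i d, intRn (fun y => (u i y - psum (u i) d y) ^+ 2) <= C * d.+1%:R ^- s.
Proof.
move=> hu; have [C C0 hC] := polyfam_sum_coef s polyfam_e hu; exists C => // i d.
have hui m := FS_sFS i (hu m).
have [] := @fatou_intRn R n (fun k y => (psum (u i) (d + k)%N y - psum (u i) d y) ^+ 2)
  (fun y => (u i y - psum (u i) d y) ^+ 2) (C * d.+1%:R ^- s) => //.
- by move=> k y; exact: sqr_ge0.
- by move=> k; exact: sFS_sq (sFSB (sFS_psum 0 _ _) (sFS_psum 0 _ _)).
- move=> y; rewrite (_ : (fun k => _) = fun k => (psum (u i) (d + k)%N y - psum (u i) d y) *
     (psum (u i) (d + k)%N y - psum (u i) d y)) // expr2.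
  have c1 : (fun k => psum (u i) (d + k)%N y - psum (u i) d y) @ \oo --> u i y - psum (u i) d y.
    apply: cvgB; last exact: cvg_cst.
    have := @psum_cvg (u i) y hui; rewrite -(cvg_shiftn d).
    by under eq_fun do rewrite addnC.
  exact: cvgM.
- move=> k; have -> : intRn (fun y => (psum (u i) (d + k) y - psum (u i) d y) ^+ 2) =
      intRn (fun y => (\sum_(a <- midx n (d + k) | (d.+1 <= wt a)%N) coef (u i) a * e a y) ^+ 2).
    apply: intRn_ext => y.
    by rewrite /psum /lincomb (sum_midx_split _ (leq_addr k d)) addrC addKr.
  apply: le_trans (hC i d.+1 (d + k)%N) _.
  rewrite ler_wpM2l// lef_pV2 ?posrE ?exprn_gt0//.
  by rewrite lerXn2r ?nnegrE// ler_nat.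
Qed.

Lemma Hop_psum (u : cV -> R) d y :
  Hop W (psum u d) y = \sum_(a <- midx n d) coef u a * Hop W (e a) y.
Proof.
have dsum j (g : multi n -> cV -> R) : (forall a, Ck 1 (g a)) ->
    pderiv j (fun z => \sum_(a <- midx n d) coef u a * g a z) =
    fun z => \sum_(a <- midx n d) coef u a * pderiv j (g a) z.
  move=> hg; apply/funext => z; apply: pderivE; apply: is_derive_sumR => a.
  exact: (@is_deriveZ _ _ _ (g a) (coef u a) z _ _ (Ck_is j z (hg a))).
have ce a : Ck 2 (e a) by apply: Cls_imp (sFS_ef mu cG hS 2 a).
have E j : pderiv j (pderiv j (psum u d)) y =
    \sum_(a <- midx n d) coef u a * pderiv j (pderiv j (e a)) y.
  rewrite /psum /lincomb dsum; last by move=> a; exact: Ck_le (ce a).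
  by rewrite dsum// => a; exact: Ck_pd (ce a).
have EL : laplacian (psum u d) y = \sum_(a <- midx n d) coef u a * laplacian (e a) y.
  rewrite /laplacian; transitivity (\sum_j \sum_(a <- midx n d) coef u a * pderiv j (pderiv j (e a)) y).
    by apply: eq_bigr => j _; exact: E.
  by rewrite exchange_big /=; apply: eq_bigr => a _; rewrite big_distrr.
rewrite /Hop EL.
rewrite -sumrN /psum /lincomb big_distrr -big_split /=; apply: eq_bigr => a _.
by rewrite mulrDr mulrN; congr (_ + _); exact: mulrCA.
Qed.

Lemma HopB (u v : cV -> R) y : Ck 2 u -> Ck 2 v ->
  Hop W (fun z => u z - v z) y = Hop W u y - Hop W v y.
Proof.
move=> cu cv.
have dB j (g h : cV -> R) : Ck 1 g -> Ck 1 h ->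
    pderiv j (fun z => g z - h z) = fun z => pderiv j g z - pderiv j h z.
  move=> hg hh; apply/funext => z; apply: pderivE.
  exact: (@is_deriveB _ _ _ g h z _ _ _ (Ck_is j z hg) (Ck_is j z hh)).
have E j : pderiv j (pderiv j (fun z => u z - v z)) y =
    pderiv j (pderiv j u) y - pderiv j (pderiv j v) y.
  rewrite dB; [|exact: Ck_le cu|exact: Ck_le cv].
  by rewrite dB; [|exact: Ck_pd cu|exact: Ck_pd cv].
have EL : laplacian (fun z => u z - v z) y = laplacian u y - laplacian v y.
  by rewrite /laplacian -sumrB; apply: eq_bigr => j _; exact: E.
have alg (a b c w d : R) : - (a - b) + w * (c - d) = - a + w * c - (- b + w * d) by ring.
by rewrite /Hop EL; exact: alg.
Qed.

(** For the error w, a(w,w) = <w, Hw>. It is enough that Hw be bounded in L2, while the L2 error is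
    taken at the double rate [s + s] because Cauchy-Schwarz halves it. *)
Lemma psum_aform (I : Type) (u : I -> cV -> R) s : (forall m, FS m u) ->
  exists2 C, 0 <= C & forall i d,
   aform V (fun y => u i y - psum (u i) d y) (fun y => u i y - psum (u i) d y) <= C * d.+1%:R ^- s.
Proof.
move=> hu; have [C1 C10 hC1] := psum_L2 (s + s) hu.
have [C2 C20 hC2] := polyfam_sum_coef 0 polyfam_Hop hu.
have cH m : FS m.+2 (fun i => u i) -> FS m (fun i => Hop W (u i)).
  move=> h; apply: (@Cls_ext _ _ _ _ _ (fun i y => -1 * (\sum_j pderiv j (pderiv j (u i)) y) + W y * u i y)).
    by move=> i y; rewrite mulN1r.
  apply: FSD.
    apply: FSM; first exact: (sMS_MS _ (sMS_cst _ _ (-1 : R))).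
    apply: (@FS_sum _ _ _ _ _ (index_enum 'I_n) (fun j i => pderiv j (pderiv j (u i)))) => j.
    have h1 : FS m.+1 (fun i => pderiv j (u i)) := @Cls_pd _ _ _ _ m.+1 _ j h.
    exact: (@Cls_pd _ _ _ _ m _ j h1).
  by apply: FSM; [exact: (sMS_MS _ (sMS_Wpot MV m))|exact: (@Cls_le _ _ _ _ m m.+2 _ (leqW (leqnSn m)) h)].
have [C3 C30 hC3] := FS_L2_bound (cH 0%N (hu 2%N)).
exists (C1 * (2 * C3 + 2 * C2) + 1).
  by rewrite addr_ge0// mulr_ge0// addr_ge0// mulr_ge0.
move=> i d; set w := fun y => u i y - psum (u i) d y.
have hui m := FS_sFS i (hu m).
have hw m : sFS m w := sFSB (hui m) (sFS_psum m (u i) d).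
have hHu := Hop_sFS MV (hui 2); have hHp := Hop_sFS MV (sFS_psum 2 (u i) d).
have hHw := Hop_sFS MV (hw 2).
have Hw : intRn (fun y => Hop W w y ^+ 2) <= 2 * C3 + 2 * C2.
  have ip : intRn (fun y => Hop W (psum (u i) d) y ^+ 2) <= C2.
    have := hC2 i 0%N d; rewrite expr0 invr1 mulr1; congr (_ <= _); apply: intRn_ext => y.
    by rewrite Hop_psum; congr (_ ^+ 2); apply: eq_bigl => a.
  apply: (@le_trans _ _ (intRn (fun y => 2 * Hop W (u i) y ^+ 2 + 2 * Hop W (psum (u i) d) y ^+ 2))).
    apply: le_intRn.
    - exact: sFS_sq hHw.
    - by apply: integrableRnD; apply: integrableRnZ; [exact: sFS_sq hHu|exact: sFS_sq hHp].
    - move=> y; rewrite /w HopB; [|exact: Cls_imp (hui 2)|exact: Cls_imp (sFS_psum 2 _ _)].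
      by have := sqr_ge0 (Hop W (u i) y + Hop W (psum (u i) d) y); rewrite sqrrB sqrrD; lra.
  rewrite intRnD; [|apply: integrableRnZ; exact: sFS_sq hHu|apply: integrableRnZ; exact: sFS_sq hHp].
  rewrite !intRnZ; [|exact: sFS_sq hHp|exact: sFS_sq hHu].
  by apply: lerD; rewrite ler_wpM2l.
have [_ aE] := sFS_aform MV (hw 1) (hw 2).
have a0 := aform_ge0 sV MV (hw 1).
have key : aform V w w ^+ 2 <= C1 * d.+1%:R ^- (s + s) * (2 * C3 + 2 * C2).
  rewrite aE; apply: le_trans (sFS_CS (hw 0) hHw) _; apply: ler_pM => //.
  - by apply: intRn_ge0 => y; exact: sqr_ge0.
  - by apply: intRn_ge0 => y; exact: sqr_ge0.
  - exact: hC1.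
have K0 : 0 <= C1 * (2 * C3 + 2 * C2) by rewrite mulr_ge0// addr_ge0// mulr_ge0.
have ds0 : 0 <= d.+1%:R ^- s :> R by rewrite invr_ge0 exprn_ge0.
rewrite -(@ler_pXn2r _ 2)// ?nnegrE ?mulr_ge0 ?addr_ge0//.
move: key ds0; rewrite exprD invfM; move: (d.+1%:R ^- s : R) => t key t0; apply: (le_trans key).
have -> : C1 * (t * t) * (2 * C3 + 2 * C2) = C1 * (2 * C3 + 2 * C2) * t ^+ 2 by ring.
rewrite exprMn; apply: ler_wpM2r; first exact: sqr_ge0.
move: (C1 * _) K0 => K K0; rewrite sqrrD1; have := sqr_ge0 K; lra.
Qed.

End approximation.

(** * The Galerkin error *)

Section growth_classes.
Variables (R : realType) (n : nat).
Local Notation cV := 'cV[R]_n.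

Lemma expb_exp_mnorm (I : Type) (u : I -> cV -> R) (c k : R) : 0 <= c ->
  (forall i y, `|u i y| <= c * expR (k * mnorm y)) -> expb u.
Proof.
move=> c0 hu; exists c, `|k|; split => // i y; apply: le_trans (hu i y) _.
rewrite ler_wpM2l// ler_expR; apply: (@le_trans _ _ (`|k| * mnorm y)).
  by rewrite ler_wpM2r ?mnorm_ge0// ler_norm.
by rewrite ler_wpM2l// mnorm_le_N1.
Qed.

Lemma expb_poly (I : Type) (u : I -> cV -> R) (c : R) l : 0 <= c ->
  (forall i y, `|u i y| <= c * (1 + mnorm y ^+ l)) -> expb u.
Proof.
move=> c0 hu; have [C C0 hC] := poly_le_exp R l.
apply: (@expb_exp_mnorm _ _ (c * C) 1); first by rewrite mulr_ge0.
move=> i y; apply: le_trans (hu i y) _.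
by rewrite mul1r -mulrA ler_wpM2l//; apply: hC; exact: mnorm_ge0.
Qed.

Lemma MS_mderiv (I : Type) (u : I -> cV -> R) : (forall i, smooth (u i)) ->
  (forall a, expb (fun i => mderiv a (u i))) -> forall k, MS k u.
Proof.
move=> su hu k; apply: Cls_foldr => s _; split.
- have := hu [ffun i => count_mem i s]; congr expb; apply/funext => i.
  by rewrite foldr_mderiv.
- by move=> i; have [] := su i s.
- by move=> j i; have [_] := su i s; apply.
Qed.

Lemma mpoly_fun_le N (c : multi n -> R) y :
  `|mpoly_fun N c y| <= (\sum_(a <- midx n N) `|c a|) * (1 + N1 y) ^+ N.
Proof.
rewrite /mpoly_fun; apply: le_trans (ler_norm_sum _ _ _) _.
have N1y : 1 <= 1 + N1 y by rewrite lerDl N1_ge0.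
rewrite big_distrl /= big_seq [leRHS]big_seq; apply: ler_sum => a; rewrite mem_midx => aN.
rewrite normrM ler_wpM2l//; apply: le_trans (ler_weXn2l N1y aN).
rewrite normr_prod /wt -prodrXr; apply: ler_prod => i _; rewrite normr_ge0 normrX /=.
apply: lerXn2r; rewrite ?nnegrE; [exact: normr_ge0|exact: le_trans ler01 N1y|].
by rewrite /N1 (bigD1 i)//= addrCA lerDl addr_ge0// sumr_ge0.
Qed.

Lemma N1_le_mz (S : 'M[R]_n) (mu : cV) : S \in unitmx ->
  exists2 B : R, 0 <= B & forall y, 1 + N1 y <= B * mz S mu y.
Proof.
move=> hS; pose A := \sum_i \sum_k `|S i k|.
have A0 : 0 <= A by apply: sumr_ge0 => i _; exact: sumr_ge0.
have M0 := N1_ge0 mu.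
exists (1 + N1 mu + A * n.+1%:R); first by rewrite !addr_ge0// mulr_ge0.
move=> y; have h := N1_le_zc mu hS y; have z1 := mz_ge1 S mu y.
have hz : \sum_k `|zc S mu k y| <= n.+1%:R * mz S mu y.
  have h1 : \sum_k `|zc S mu k y| <= n%:R + \sum_k zc S mu k y ^+ 2.
    apply: (@le_trans _ _ (\sum_(k < n) (1 + zc S mu k y ^+ 2))).
      apply: ler_sum => k _; have := sqr_ge0 (`|zc S mu k y| - 1).
      by rewrite sqrrB1 real_normK ?num_real//; have := normr_ge0 (zc S mu k y); lra.
    by rewrite big_split /= sumr_const card_ord.
  apply: (le_trans h1); rewrite -natr1 mulrDl mul1r; apply: lerD.
    by rewrite ler_peMr.
  by rewrite /mz lerDr.
move: h hz; rewrite -/A; move: (N1 y) (N1 mu) (\sum_k _) (mz S mu y) z1 M0 => a b c z z1 M0 h hz.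
apply: (@le_trans _ _ ((1 + b) * z + A * (n.+1%:R * z))); last by rewrite [leRHS]mulrDl mulrA.
have h2 := ler_wpM2l A0 hz.
have h3 : 1 + b <= (1 + b) * z by rewrite ler_peMr// addr_ge0.
lra.
Qed.

End growth_classes.

Section potential.
Variables (R : realType) (n : nat) (V : 'cV[R]_n -> R).
Variables (sV : smooth V) (Woo : Wpot V @ at_infty --> +oo).

Lemma assumptionA_MS : assumptionA V -> forall k, sMS k V.
Proof.
move=> [_ hV]; apply: MS_mderiv => [_|a]; first exact: sV.
have [c [k [c0 h]]] := hV a; apply: (@expb_exp_mnorm _ _ _ _ c k (ltW c0)).
by move=> _ y; exact: h.
Qed.

Lemma assumptionA_Wpot (S : 'M[R]_n) mu : S \in unitmx -> assumptionA V ->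
  exists (C : R) K, 0 <= C /\ forall y, `|Wpot V y| <= C * mz S mu y ^+ K.
Proof.
move=> hS [[k [c hW]] _]; have [K K0 hK] := Wpot_lower sV Woo.
have [B B0 hB] := N1_le_mz mu hS; pose A := \sum_(a <- midx n (4 * k)) `|c a|.
have A0 : 0 <= A by exact: sumr_ge0.
exists (A * B ^+ (4 * k) + K), (4 * k)%N; split.
  by rewrite addr_ge0// mulr_ge0// exprn_ge0.
move=> y; have z1 := mz_ge1 S mu y.
have zk : 1 <= mz S mu y ^+ (4 * k) by exact: exprn_ege1.
have hp : `|mpoly_fun (4 * k) c y| <= A * B ^+ (4 * k) * mz S mu y ^+ (4 * k).
  apply: le_trans (mpoly_fun_le _ _ _) _; rewrite -mulrA ler_wpM2l// -exprMn.
  rewrite lerXn2r ?nnegrE ?addr_ge0 ?N1_ge0// mulr_ge0//.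
  exact: le_trans ler01 z1.
have Kz : K <= K * mz S mu y ^+ (4 * k) by rewrite ler_peMr.
have p1 := le_trans (ler_norm _) hp.
have h0 : 0 <= A * B ^+ (4 * k) * mz S mu y ^+ (4 * k) by exact: le_trans (normr_ge0 _) hp.
rewrite mulrDl ler_norml; apply/andP; split.
  have := hK y; move: (A * _ * _) h0 (K * _) Kz (Wpot V y) => a h0 b Kz w h; lra.
have := le_trans (hW y) p1; move: (A * _ * _) h0 (K * _) Kz (Wpot V y) => a h0 b Kz w h; lra.
Qed.

End potential.

(** [K + 1] stands in for the square root of [K]. *)
Lemma sq_le_norm_le (R : realType) (x K t : R) : 0 <= K -> 0 <= t -> x ^+ 2 <= K * t ^+ 2 ->
  `|x| <= (K + 1) * t.
Proof.
move=> K0 t0 h; rewrite -(@ler_pXn2r _ 2)// ?nnegrE ?mulr_ge0 ?addr_ge0//.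
rewrite real_normK ?num_real// (le_trans h)// exprMn ler_wpM2r ?sqr_ge0//.
by rewrite sqrrD1; have := sqr_ge0 K; lra.
Qed.

Section galerkin_error.
Variables (R : realType) (n : nat) (S : 'M[R]_n) (mu : 'cV[R]_n) (cG : R).
Variable hS : S \in unitmx.
Local Notation cV := 'cV[R]_n.
Local Notation e := (ef S mu cG).
Variable nrm : intRn (fun y => e (mi0 n) y ^+ 2) = 1.
Variables (V : cV -> R) (sV : smooth V).
Variables (Voo : V @ at_infty --> +oo) (Woo : Wpot V @ at_infty --> +oo).
Variable MV : forall k, sMS k V.
Variable Wle : exists (C : R) K, 0 <= C /\ forall y, `|Wpot V y| <= C * mz S mu y ^+ K.
Local Notation W := (Wpot V).
Local Notation gs := (ground_state V).

Lemma aform_sym u v : aform V u v = aform V v u.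
Proof.
apply: intRn_ext => y; rewrite mulrAC; congr (_ + _).
by apply: eq_bigr => i _; exact: mulrC.
Qed.

Lemma aform_CS u v : sFS 1 u -> sFS 1 v -> aform V u v ^+ 2 <= aform V u u * aform V v v.
Proof.
move=> hu hv; apply: discriminant => t.
have iuu := aform_integrable MV hu hu; have iuv := aform_integrable MV hu hv.
have ivv := aform_integrable MV hv hv.
have := aform_ge0 sV MV (sFSD hu (sFSZ t hv)); congr (_ <= _).
rewrite /aform -!intRnZ// -intRnD//; last exact: integrableRnZ.
rewrite -intRnD; [|by apply: integrableRnD => //; exact: integrableRnZ|exact: integrableRnZ].
apply: intRn_ext => y.
have D i : grad (fun z => u z + t * v z) y i 0 = grad u y i 0 + t * grad v y i 0.
  rewrite !mxE; apply: pderivE.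
  apply: (@is_deriveD _ _ _ u (fun z => t * v z) y _ _ _ (sFS_is i y hu)).
  exact: (@is_deriveZ _ _ _ v t y _ _ (sFS_is i y hv)).
have -> : dot (grad (fun z => u z + t * v z) y) (grad (fun z => u z + t * v z) y) =
   dot (grad u y) (grad u y) + 2 * t * dot (grad u y) (grad v y) + t ^+ 2 * dot (grad v y) (grad v y).
  rewrite /dot !big_distrr -!big_split /=; apply: eq_bigr => i _; rewrite !D.
  by move: (grad u y i 0) (grad v y i 0) => a b; ring.
move: (dot _ _) (dot _ _) (dot _ _) (W y) (u y) (v y) => a b c w p q; ring.
Qed.

Lemma lincomb_inner d (c c' : multi n -> R) (B : cV -> R) :
  (forall b, c' b = intRn (fun y => e b y * B y)) -> sFS 0 B ->
  \sum_(a <- midx n d) \sum_(b <- midx n d) L2inner (e a) (e b) * (c a * c' b) =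
  intRn (fun y => lincomb e d c y * B y).
Proof.
move=> hc' hB.
have ieB a : integrableRn (fun y => e a y * B y) := sFS_mul (sFS_ef mu cG hS 0 a) hB.
have -> : intRn (fun y => lincomb e d c y * B y) =
    intRn (fun y => \sum_(a <- midx n d) c a * (e a y * B y)).
  by apply: intRn_ext => y; rewrite big_distrl /=; apply: eq_bigr => a _; rewrite mulrA.
rewrite intRn_sum; last by move=> a; exact: integrableRnZ.
rewrite big_seq [RHS]big_seq; apply: eq_bigr => a am.
rewrite (bigD1_seq a) ?midx_uniq//= /L2inner (ef_orthonormal hS nrm) eqxx mul1r big1 ?addr0.
  by rewrite hc' intRnZ.
by move=> b ba; rewrite (ef_orthonormal hS nrm) eq_sym (negbTE ba) mul0r.
Qed.

(** The constant is chosen before [c], which may be any solution of the Galerkin equations: the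
    solution enters through its energy alone, which a component in the kernel of the form does not
    change. *)
Lemma galerkin_error (I : Type) (h g psi : I -> cV -> R) (s : nat) :
  (forall m, FS m (fun i y => gs y * h i y)) ->
  (forall i, intRn (fun y => gs y * h i y * gs y) = 0) ->
  (forall m, FS m psi) -> (forall i y, Hop W (psi i) y = gs y * g i y) ->
  exists2 C, 0 <= C & forall i d (c c' : multi n -> R),
    galerkin_solution V e d (h i) c ->
    (forall b, c' b = intRn (fun y => e b y * (gs y * g i y))) ->
    `|\sum_(a <- midx n d) \sum_(b <- midx n d) L2inner (e a) (e b) * (c a * c' b) -
      intRn (fun y => gs y * h i y * psi i y)| <= C * d.+1%:R ^- s.
Proof.
move=> Fh mh Fpsi Hpsi.
have [Cg Cg0 hCg] := spectral_gap sV Voo Woo MV.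
have [M M0 hM] := FS_L2_bound (Fh 0%N).
have [C1 C10 hC1] := psum_L2 hS nrm (s + s) Fpsi.
have [C2 C20 hC2] := psum_aform hS nrm sV MV Wle (s + s) Fpsi.
(* The two brackets bound a(u, w) and <gs h, w>, where w is the truncation error of psi. *)
exists ((Cg * M * C2 + 1) + (M * C1 + 1)); first by rewrite !addr_ge0// !mulr_ge0.
move=> i d c c' gal hc'.
have hp m := FS_sFS i (Fpsi m); have hh m := FS_sFS i (Fh m).
set u := lincomb e d c; pose v := psum S mu cG (psi i) d.
have hu m : sFS m u by apply: sFS_sum => a; apply: sFSZ; exact: sFS_ef.
have hv m : sFS m v := sFS_psum mu cG hS m (psi i) d.
pose w y := psi i y - v y.
have hw m : sFS m w := sFSB (hp m) (hv m).
have gsE y : expR (- V y / 2) = gs y by [].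
have gE (z : cV -> R) : Shat e d z -> aform V u z = intRn (fun y => gs y * h i y * z y).
  move=> hz; rewrite (gal _ hz); apply: intRn_ext => y.
  by rewrite gsE mulrC mulrA.
have au : aform V u u = intRn (fun y => gs y * h i y * u y) by apply: gE; exists c.
have av : aform V u v = intRn (fun y => gs y * h i y * v y).
  by apply: gE; exists (coef S mu cG (psi i)).
have hB : sFS 0 (fun y => gs y * g i y).
  have := Hop_sFS MV (hp 2); rewrite (_ : Hop _ _ = fun y => gs y * g i y)//.
  by apply/funext => y; exact: Hpsi.
rewrite (lincomb_inner d c hc' hB) -/u.
have -> : intRn (fun y => u y * (gs y * g i y)) = aform V u (psi i).
  have [_ ->] := sFS_aform MV (hu 1) (hp 2); apply: intRn_ext => y; by rewrite Hpsi.
have aD : aform V u (psi i) = aform V u v + aform V u w.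
  have [_ ->] := sFS_aform MV (hu 1) (hp 2); have [_ ->] := sFS_aform MV (hu 1) (hv 2).
  have [_ ->] := sFS_aform MV (hu 1) (hw 2).
  rewrite -intRnD; [|exact: sFS_mul (hu 0) (Hop_sFS MV (hv 2))|exact: sFS_mul (hu 0) (Hop_sFS MV (hw 2))].
  apply: intRn_ext => y; rewrite /w HopB; [|exact: Cls_imp (hp 2)|exact: Cls_imp (hv 2)].
  by rewrite -mulrDr addrC subrK.
have hD : intRn (fun y => gs y * h i y * psi i y) =
    intRn (fun y => gs y * h i y * v y) + intRn (fun y => gs y * h i y * w y).
  rewrite -intRnD; [|exact: sFS_mul (hh 0) (hv 0)|exact: sFS_mul (hh 0) (hw 0)].
  by apply: intRn_ext => y; rewrite -mulrDr addrC subrK.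
have -> : aform V u (psi i) - intRn (fun y => gs y * h i y * psi i y) =
    aform V u w - intRn (fun y => gs y * h i y * w y).
  by rewrite aD hD av opprD addrACA subrr add0r.
have t0 : 0 <= d.+1%:R ^- s :> R by rewrite invr_ge0 exprn_ge0.
(* Testing with [u] itself gives a(u,u) = <gs h, u>, whose square the gap bounds by Cg M a(u,u). *)
have auu : aform V u u <= Cg * M.
  have h0 := aform_ge0 sV MV (hu 1).
  have := hCg _ _ (hh 0) (hu 1) (mh i); rewrite -au => k1.
  have k2 : aform V u u ^+ 2 <= Cg * M * aform V u u.
    by apply: (le_trans k1); rewrite ler_wpM2r// ler_wpM2l.
  move: h0; rewrite le_eqVlt => /predU1P[<-|h0]; first exact: mulr_ge0.
  by rewrite -(ler_pM2r h0) -expr2.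
have split2 (x : nat) : (d.+1%:R ^- (x + x) : R) = (d.+1%:R ^- x) ^+ 2.
  by rewrite exprD invfM expr2.
have := hC1 i d; have := hC2 i d; rewrite -/v -/w split2.
move: (d.+1%:R ^- s : R) t0 => t t0 k2 k1.
rewrite mulrDl; apply: le_trans (ler_normB _ _) _; apply: lerD.
  apply: sq_le_norm_le => //; first by rewrite !mulr_ge0.
  apply: le_trans (aform_CS (hu 1) (hw 1)) _; rewrite -[leRHS]mulrA.
  exact: ler_pM (aform_ge0 sV MV (hu 1)) (aform_ge0 sV MV (hw 1)) auu k2.
apply: sq_le_norm_le => //; first by rewrite mulr_ge0.
apply: le_trans (sFS_CS (hh 0) (hw 0)) _; rewrite -[leRHS]mulrA.
by apply: (ler_pM _ _ (hM i) k1); apply: intRn_ge0 => y; exact: sqr_ge0.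
Qed.

End galerkin_error.

(** * Dependence on x *)

Section parametric.
Variables (R : realType) (m n : nat).
Local Notation e_ j := (delta_mx j 0 : 'cV[R]_m).

Lemma foldr_pderiv_lin p (u v : 'cV[R]_p -> R) (c : R) s : smooth u -> smooth v ->
  foldr (@pderiv R p) (fun y => c * (u y - v y)) s =
  fun y => c * (foldr (@pderiv R p) u s y - foldr (@pderiv R p) v s y).
Proof.
move=> su sv; elim: s => //= j s ->; apply/funext => y; apply: pderivE.
have [_ /(_ j y)/pderiv_is du] := su s; have [_ /(_ j y)/pderiv_is dv] := sv s.
exact: (@is_deriveZ _ _ _ _ c y _ _ (is_deriveB du dv)).
Qed.

Lemma smooth_lin p (u v : 'cV[R]_p -> R) (c : R) : smooth u -> smooth v ->
  smooth (fun y => c * (u y - v y)).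
Proof.
move=> su sv; have -> : (fun y => c * (u y - v y)) = fun y => (fun _ => c) y * (u y + (fun _ => -1) y * v y).
  by apply/funext => y; rewrite mulN1r.
exact: (smoothM (smooth_cst _) (smoothD su (smoothM (smooth_cst _) sv))).
Qed.

Section joint.
Variable g : 'cV[R]_(m + n) -> R.

Lemma is_derive_dcol x y j dg :
  is_derive (col_mx x y) (delta_mx (rshift m j) 0 : 'cV[R]_(m + n)) g dg ->
  is_derive y (delta_mx j 0 : 'cV[R]_n) (fun y => g (col_mx x y)) dg.
Proof.
move=> /is_derive_line0 h; apply/is_derive_line0; move: h; congr is_derive.
apply/funext => h; congr g.
by rewrite delta_mx_dshift scale_col_mx add_col_mx scaler0 add0r.
Qed.

Lemma is_derive_ucol x y j dg :
  is_derive (col_mx x y) (delta_mx (lshift n j) 0 : 'cV[R]_(m + n)) g dg ->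
  is_derive x (e_ j) (fun x => g (col_mx x y)) dg.
Proof.
move=> /is_derive_line0 h; apply/is_derive_line0; move: h; congr is_derive.
apply/funext => h; congr g.
by rewrite delta_mx_ushift scale_col_mx add_col_mx scaler0 add0r.
Qed.

Lemma continuous_dcol (x : 'cV[R]_m) : continuous (fun y : 'cV[R]_n => col_mx x y).
Proof.
apply: continuous_cV => i; case: (split_ordP i) => k ->.
  by under eq_fun do rewrite col_mxEu; exact: cst_continuous.
by under eq_fun do rewrite col_mxEd; exact: coord_continuous.
Qed.

End joint.

Lemma foldr_dcol (g : 'cV[R]_(m + n) -> R) (x : 'cV[R]_m) s : smooth g ->
  foldr (@pderiv R n) (fun y => g (col_mx x y)) s =
  fun y => foldr (@pderiv R (m + n)) g (map (@rshift m n) s) (col_mx x y).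
Proof.
move=> sg; elim: s => //= j s ->; apply/funext => y; apply: pderivE.
apply: is_derive_dcol; apply: pderiv_is.
by have [_] := sg (map (@rshift m n) s); apply.
Qed.

Lemma smooth_dcol (g : 'cV[R]_(m + n) -> R) (x : 'cV[R]_m) : smooth g ->
  smooth (fun y : 'cV[R]_n => g (col_mx x y)).
Proof.
move=> sg s /=; rewrite foldr_dcol//; have [cg dg] := sg (map (@rshift m n) s); split.
  by move=> y; apply: continuous_comp; [exact: continuous_dcol|exact: cg].
move=> j y; have /pderiv_is/is_derive_dcol[] := dg (rshift m j) (col_mx x y).
by [].
Qed.

Variable f : 'cV[R]_m -> 'cV[R]_n -> R.
Variable sf : smooth (fun z : 'cV[R]_(m + n) => f (usubmx z) (dsubmx z)).
Local Notation g := (fun z : 'cV[R]_(m + n) => f (usubmx z) (dsubmx z)).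

Lemma joint_col x : f x = fun y => g (col_mx x y).
Proof. by apply/funext => y; rewrite col_mxKu col_mxKd. Qed.

Lemma joint_colx y : (f^~ y) = fun x => g (col_mx x y).
Proof. by apply/funext => x; rewrite col_mxKu col_mxKd. Qed.

Lemma smooth_section x : smooth (f x).
Proof. by rewrite joint_col; exact: (smooth_dcol x sf). Qed.

Definition dx j x y := pderiv j (f^~ y) x.

Lemma dxE j x y : dx j x y = pderiv (lshift n j) g (col_mx x y).
Proof.
rewrite /dx joint_colx; apply: pderivE; apply: (@is_derive_ucol g x y j); apply: pderiv_is.
by have [_] := sf [::]; apply.
Qed.

Lemma derivable_section j x y : derivable (f^~ y) x (e_ j).
Proof.
rewrite joint_colx.
by have [_ /(_ (lshift n j) (col_mx x y))/pderiv_is/is_derive_ucol[]] := sf [::].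
Qed.

Lemma smooth_dx j x : smooth (dx j x).
Proof.
rewrite (_ : dx j x = fun y => pderiv (lshift n j) g (col_mx x y)); last first.
  by apply/funext => y; exact: dxE.
by apply: smooth_dcol; exact: smooth_pd.
Qed.

Lemma derivable_dx j k x y : derivable (fun x => dx j x y) x (e_ k).
Proof.
rewrite (_ : (fun x => dx j x y) = fun x => pderiv (lshift n j) g (col_mx x y)); last first.
  by apply/funext => x'; exact: dxE.
by have [_ /(_ (lshift n k) (col_mx x y))/pderiv_is/is_derive_ucol[]] := sf [:: lshift n j].
Qed.

(** The mean value theorem in [x] for a [y]-derivative. Its derivative in [x] is then moved
    innermost by permuting derivatives of the joint function, which turns it into a [y]-derivative
    of [dx]. *)
Lemma foldr_increment s j x y (t : R) : exists th : R,
  foldr (@pderiv R n) (f (t *: e_ j + x)) s y - foldr (@pderiv R n) (f x) s y =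
  t * foldr (@pderiv R n) (dx j ((th * t) *: e_ j + x)) s y.
Proof.
pose G := foldr (@pderiv R (m + n)) g (map (@rshift m n) s).
have [_ dG] := sf (map (@rshift m n) s).
have dGx z : is_derive z (e_ j) (fun x => G (col_mx x y)) (pderiv (lshift n j) G (col_mx z y)).
  by apply: is_derive_ucol; exact: pderiv_is.
have [|th [_ _ h]] := @MVT_line _ _ (fun x => G (col_mx x y)) x (e_ j) t.
  by move=> z; have [] := dGx z.
have E z : foldr (@pderiv R n) (f z) s = fun y => G (col_mx z y).
  by rewrite joint_col; exact: (foldr_dcol z s sf).
exists th; rewrite !E h; congr (_ * _).
have [_ ->] := dGx ((th * t) *: e_ j + x).
rewrite (_ : dx j _ = fun y => pderiv (lshift n j) g (col_mx ((th * t) *: e_ j + x) y)); last first.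
  by apply/funext => z; exact: dxE.
rewrite (foldr_dcol _ s (smooth_pd (lshift n j) sf)).
have := @foldr_pderiv_perm _ _ g (lshift n j :: map (@rshift m n) s) (map (@rshift m n) s ++ [:: lshift n j]) sf.
rewrite foldr_cat /= => <-//.
by rewrite perm_sym perm_catC.
Qed.

(* This vanishes at t = 0, where t^-1 = 0: t may range over all of R. *)
Definition quot j x (t : R) y := t^-1 * (f (t *: e_ j + x) y - f x y).

Lemma smooth_quot j x t : smooth (quot j x t).
Proof. by apply: smooth_lin; exact: smooth_section. Qed.

(** Every [y]-derivative of the quotient is a value of the same derivative of [dx] at an
    intermediate point, so bounds uniform in [x] become bounds uniform in [t]. *)
Lemma quot_MS j x : (forall a, expb (fun x => mderiv a (dx j x))) ->
  forall k, MS k (quot j x).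
Proof.
move=> hd; apply: MS_mderiv => [t|a]; first exact: smooth_quot.
have [C [k [C0 k0 hC]]] := hd a; exists C, k; split => // t y.
rewrite mderiv_foldr foldr_pderiv_lin; [|exact: smooth_section..].
have [th ->] := foldr_increment (flatten [seq nseq (a i) i | i <- enum 'I_n]) j x y t.
have [->|t0] := eqVneq t 0; first by rewrite invr0 mul0r normr0 mulr_ge0// expR_ge0.
by rewrite mulKf// -mderiv_foldr.
Qed.

Lemma quot_dx j x (t : R) y K : t != 0 -> (forall x, `|pderiv j (pderiv j (f^~ y)) x| <= K) ->
  `|quot j x t y - dx j x y| <= K * `|t|.
Proof.
move=> t0 hK; have K0 : 0 <= K := le_trans (normr_ge0 _) (hK x).
have [|th [th0 th1 h]] := @MVT_line _ _ (f^~ y) x (e_ j) t; first by move=> z; exact: derivable_section.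
have -> : quot j x t y = dx j ((th * t) *: e_ j + x) y by rewrite /quot h mulKf.
have [|th' [_ _ ->]] := @MVT_line _ _ (fun x => dx j x y) x (e_ j) (th * t).
  by move=> z; exact: derivable_dx.
rewrite normrM normrM (ger0_norm th0) mulrC ler_pM ?mulr_ge0//; first exact: hK.
by rewrite ler_piMl.
Qed.

End parametric.

(** Dominated convergence is about sequences: the increments 1/(k+1) tend to 0 without meeting
    it. *)
Lemma derivable_seq (R : realType) (U : normedModType R) (F : U -> R) (x v : U) :
  derivable F x v -> (fun k : nat => (k.+1%:R^-1)^-1 * (F (k.+1%:R^-1 *: v + x) - F x)) @ \oo --> 'D_v F x.
Proof.
move=> dF.
have c0 : (fun k : nat => (k.+1%:R^-1 : R)) @ \oo --> (0 : R)^'.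
  move=> A /=; rewrite /dnbhs /within /= => -[e /= e0 hA].
  suff : \forall k \near \oo, A (k.+1%:R^-1 : R) by [].
  near=> k; apply: hA => /=; last by [].
  rewrite sub0r normrN ger0_norm//.
  near: k; exact: near_infty_natSinv_lt (PosNum e0).
exact: (cvg_comp _ _ c0 dF).
Unshelve. all: by end_near. Qed.

(** * The Poisson equation and its dependence on x *)

Section poisson_equation.
Variables (R : realType) (n : nat) (V : 'cV[R]_n -> R).
Local Notation cV := 'cV[R]_n.
Local Notation W := (Wpot V).
Local Notation gs := (ground_state V).
Variables (sV : smooth V) (Voo : V @ at_infty --> +oo) (Woo : W @ at_infty --> +oo).
Variable MV : forall k, sMS k V.

Lemma expNV y : expR (- V y) = gs y * gs y.
Proof. by rewrite -expRD; congr expR; field. Qed.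

Lemma FS_gs (I : Type) (F : I -> cV -> R) : (forall k, MS k F) ->
  forall k, FS k (fun i y => gs y * F i y).
Proof.
move=> hF k; apply: (@Cls_ext _ _ _ _ _ (fun i y => F i y * gs y)).
  by move=> i y; exact: mulrC.
by apply: FSM => //; exact: (FS_reindex (fun _ : I => tt) (sFS_gs sV Voo Woo MV k)).
Qed.

Lemma integrable_gs_exp kappa : integrableRn (fun y => gs y * gs y * expR (kappa * N1 y)).
Proof.
have [_ /(_ kappa)[C /(_ tt)[h _]]] := expL2_gs sV Voo Woo.
by move: h; apply: integrableRn_ext => y; rewrite /wL2 expr2.
Qed.

Lemma integrable_expNV (u : cV -> R) C kappa : continuous u ->
  (forall y, `|u y| <= C * expR (kappa * N1 y)) -> integrableRn (fun y => expR (- V y) * u y).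
Proof.
move=> cu hu.
apply: (@integrableRn_le _ _ _ (fun y => C * (gs y * gs y * expR (kappa * N1 y)))).
- have mg : measurableRn gs by apply: measurable_contRn; exact: continuous_gs.
  have -> : (fun y => expR (- V y) * u y) = fun y => gs y * gs y * u y.
    by apply/funext => y; rewrite expNV.
  exact: measurableRnM (measurableRnM mg mg) (measurable_contRn cu).
- move=> y; rewrite expNV normrM mulrCA ger0_norm ?mulr_ge0 ?expR_ge0//.
  by rewrite ler_wpM2l ?mulr_ge0 ?expR_ge0.
- by apply: integrableRnZ; exact: integrable_gs_exp.
Qed.

Lemma integrable_expNV_poly (u : cV -> R) (D : R) l : smooth u ->
  (forall y, `|u y| <= D * (1 + mnorm y ^+ l)) -> integrableRn (fun y => expR (- V y) * u y).
Proof.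
move=> su hu; have D0 : 0 <= D.
  have := le_trans (normr_ge0 _) (hu 0); rewrite pmulr_lge0//.
  by rewrite ltr_wpDr// exprn_ge0// mnorm_ge0.
have [C [k [C0 k0 h]]] := expb_poly D0 (fun (_ : unit) => hu).
by apply: (@integrable_expNV _ C k); [have [] := su [::]|exact: h tt].
Qed.

Lemma generator_lin (u v : cV -> R) c y : smooth u -> smooth v ->
  generator V (fun z => c * (u z - v z)) y = c * (generator V u y - generator V v y).
Proof.
move=> su sv; rewrite /generator.
have -> : laplacian (fun z => c * (u z - v z)) y = c * (laplacian u y - laplacian v y).
  rewrite /laplacian -sumrB big_distrr; apply: eq_bigr => i _.
  by have /= -> := foldr_pderiv_lin c [:: i; i] su sv.
have -> : dot (grad V y) (grad (fun z => c * (u z - v z)) y) =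
    c * (dot (grad V y) (grad u y) - dot (grad V y) (grad v y)).
  rewrite /dot -sumrB big_distrr; apply: eq_bigr => i _; rewrite !mxE.
  have /= -> := foldr_pderiv_lin c [:: i] su sv.
  by rewrite -mulrBr mulrCA.
have alg (a b d e : R) : c * (a - b) - c * (d - e) = c * (a - d - (b - e)) by ring.
exact: alg.
Qed.

(** The scalar equation at one [x], in a form stable under the linear combinations that make up
    difference quotients. *)
Definition poisson1 (h u : cV -> R) :=
  [/\ smooth u, exists (D : R) l, forall y, `|u y| <= D * (1 + mnorm y ^+ l),
      forall y, - generator V u y = h y & intRn (fun y => expR (- V y) * u y) = 0].

Lemma poisson1_lin c h h' u u' : poisson1 h u -> poisson1 h' u' ->
  poisson1 (fun y => c * (h y - h' y)) (fun y => c * (u y - u' y)).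
Proof.
move=> [su [D [l hu]] eu iu] [su' [D' [l' hu']] eu' iu']; split.
- exact: smooth_lin.
- have pw (r : R) a b : 0 <= r -> 1 + r ^+ a <= 2 * (1 + r ^+ (a + b)).
    move=> r0; have e0 : 0 <= r ^+ (a + b) by exact: exprn_ge0.
    have [r1|r1] := leP r 1.
      by have : r ^+ a <= 1 by [exact: exprn_ile1]; lra.
    have : r ^+ a <= r ^+ (a + b) by rewrite ler_weXn2l ?(ltW r1)// leq_addr.
    lra.
  have pos (a : R) r j (v : cV -> R) y : `|v y| <= a * (1 + r ^+ j) -> 0 <= r -> 0 <= a.
    move=> h0 r0; have := le_trans (normr_ge0 _) h0; rewrite pmulr_lge0//.
    by rewrite ltr_wpDr// exprn_ge0.
  exists (`|c| * (D * 2 + D' * 2)), (l + l')%N => y; have m0 := mnorm_ge0 y.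
  rewrite normrM -mulrA ler_wpM2l// mulrDl; apply: le_trans (ler_normB _ _) _.
  have D0 := pos _ _ _ _ _ (hu y) m0; have D'0 := pos _ _ _ _ _ (hu' y) m0.
  apply: lerD; rewrite -mulrA.
    by apply: le_trans (hu y) _; rewrite ler_wpM2l//; exact: pw.
  by apply: le_trans (hu' y) _; rewrite ler_wpM2l// addnC; exact: pw.
- by move=> y; rewrite generator_lin// -eu -eu' -mulrN; congr (c * _); ring.
- have i1 := integrable_expNV_poly su hu; have i2 := integrable_expNV_poly su' hu'.
  have E y : expR (- V y) * (c * (u y - u' y)) = c * (expR (- V y) * u y - expR (- V y) * u' y).
    by rewrite mulrCA mulrBr.
  by rewrite (intRn_ext E) intRnZ ?intRnB ?iu ?iu' ?subrr ?mulr0//; exact: integrableRnB.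
Qed.

Lemma Hop_poisson1 h u y : poisson1 h u -> Hop W (fun z => gs z * u z) y = gs y * h y.
Proof. by move=> [su _ eu _]; rewrite Hop_gs// eu. Qed.

Lemma poisson1_regularity : exists2 C, 0 <= C & forall (I : Type) (F Phi : I -> cV -> R),
  (forall i, poisson1 (F i) (Phi i)) -> (forall k, MS k F) ->
  (forall k, FS k (fun i y => gs y * Phi i y)) /\
  forall i, intRn (fun y => (gs y * Phi i y) ^+ 2) <= C * intRn (fun y => (gs y * F i y) ^+ 2).
Proof.
have [C C0 hC] := poisson_regularity sV Voo Woo MV; exists C => // I F Phi hP hF.
by apply: (hC I Phi F) => [i|i||i|i]; [have [] := hP i|have [] := hP i|exact: hF|have [] := hP i|have [] := hP i].
Qed.

Variables (S : 'M[R]_n) (mu : cV) (cG : R).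
Variable hS : S \in unitmx.
Variable nrm : intRn (fun y => ef S mu cG (mi0 n) y ^+ 2) = 1.

Variable m : nat.
Variables (phi f : 'cV[R]_m -> cV -> R).
Variable sf : smooth (fun z : 'cV[R]_(m + n) => f (usubmx z) (dsubmx z)).
Variable hP : forall x, poisson1 (f x) (phi x).
Variable hd : forall j a, expb (fun x => mderiv a (dx f j x)).
Variable hK : exists (K : R) l, 0 <= K /\ forall j x y,
  `|pderiv j (pderiv j (f^~ y)) x| <= K * (1 + mnorm y ^+ l).
Local Notation e_ j := (delta_mx j 0 : 'cV[R]_m).

Lemma poisson1_quot j x t : poisson1 (quot f j x t) (quot phi j x t).
Proof. exact: (poisson1_lin _ (hP _) (hP _)). Qed.

Lemma quot_FS j x k : FS k (fun t y => gs y * quot phi j x t y).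
Proof.
have [C _ hC] := poisson1_regularity.
by have [] := hC R _ _ (poisson1_quot j x) (quot_MS sf x (hd j)).
Qed.

(** The Poisson estimate is applied to the family over pairs (t, t'): by [quot_dx] each quotient of
    [f] differs from the derivative by its increment times a bound on second derivatives in [x]. *)
Lemma quot_diff_L2 j x : exists2 N : R, 0 <= N & forall t t', t != 0 -> t' != 0 ->
  intRn (fun y => (gs y * quot phi j x t y - gs y * quot phi j x t' y) ^+ 2) <= (N * (`|t| + `|t'|)) ^+ 2.
Proof.
have [C C0 hC] := poisson1_regularity; have [K [l [K0 hKl]]] := hK.
pose F (p : R * R) y := 1 * (quot f j x p.1 y - quot f j x p.2 y).
pose Phi (p : R * R) y := 1 * (quot phi j x p.1 y - quot phi j x p.2 y).
have MQ := quot_MS sf x (hd j).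
have MF k : MS k F.
  apply: (@Cls_ext _ _ _ _ _ (fun p y => quot f j x p.1 y + (-1) * quot f j x p.2 y)).
    by move=> p y; rewrite /F mul1r mulN1r.
  have re (s : R * R -> R) : MS k (fun p => quot f j x (s p)).
    apply: (@Cls_reindex _ _ R (R * R)%type s _ _ _ _ _ (MQ k)) => v [c [k' [c0 k0 h]]].
    by exists c, k'; split => // p y; exact: h.
  apply: MSD; first exact: re.
  by apply: MSM; [exact: (sMS_MS _ (sMS_cst _ _ (-1 : R)))|exact: re].
have [_ L2] := hC _ F Phi (fun p => poisson1_lin 1 (poisson1_quot j x p.1) (poisson1_quot j x p.2)) MF.
(* The power is doubled because an even power of the Euclidean norm is a polynomial, hence
   smooth. *)
have MP k : sMS k (fun y : cV => 1 + mnorm y ^+ (2 * l)).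
  pose r2 (y : cV) := \sum_i y i 0 * y i 0.
  have hr : sMS k r2 by apply: sMS_sum => i; apply: sMSM; exact: sMS_coord.
  have -> : (fun y : cV => 1 + mnorm y ^+ (2 * l)) = fun y => 1 + r2 y ^+ l.
    apply/funext => y; rewrite exprM mnorm_sq; congr (_ + _ ^+ _); apply: eq_bigr => i _.
    by rewrite big_ord1 expr2.
  apply: sMSD; first exact: sMS_cst.
  elim: l {hKl} => [|l IH]; first exact: sMS_cst.
  have -> : (fun y => r2 y ^+ l.+1) = fun y => r2 y * r2 y ^+ l.
    by apply/funext => y; rewrite exprS.
  exact: sMSM.
pose P y : R := gs y * (1 + mnorm y ^+ (2 * l)).
have sP : sFS 0 P by exact: (FS_gs (fun k => MP k) 0).
pose A := intRn (fun y => P y ^+ 2).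
have A0 : 0 <= A by apply: intRn_ge0 => y; exact: sqr_ge0.
have B0 : 0 <= C * (2 * K) ^+ 2 * A by rewrite !mulr_ge0// sqr_ge0.
exists (C * (2 * K) ^+ 2 * A + 1); first by rewrite addr_ge0.
move=> t t' t0 t'0.
have -> : intRn (fun y => (gs y * quot phi j x t y - gs y * quot phi j x t' y) ^+ 2) =
    intRn (fun y => (gs y * Phi (t, t') y) ^+ 2).
  by apply: intRn_ext => y; rewrite /Phi mul1r mulrBr.
apply: le_trans (L2 (t, t')) _; set T := `|t| + `|t'|.
have T0 : 0 <= T by rewrite addr_ge0.
have hF y : `|F (t, t') y| <= 2 * K * T * (1 + mnorm y ^+ (2 * l)).
  rewrite /F /= mul1r.
  have -> : quot f j x t y - quot f j x t' y =
    (quot f j x t y - dx f j x y) - (quot f j x t' y - dx f j x y) by ring.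
  apply: le_trans (ler_normB _ _) _.
  have hy x' := hKl j x' y.
  apply: le_trans (lerD (quot_dx sf x t0 hy) (quot_dx sf x t'0 hy)) _.
  rewrite -mulrDr -/T mulrAC.
  have -> : 2 * K * T * (1 + mnorm y ^+ (2 * l)) = K * T * (2 * (1 + mnorm y ^+ (2 * l))).
    by move: (mnorm y ^+ _) => a; ring.
  apply: ler_wpM2l; first exact: mulr_ge0.
  have := mnorm_ge0 y; move: (mnorm y) => r r0.
  rewrite [(2 * l)%N]mulnC exprM; have : 0 <= r ^+ l by exact: exprn_ge0.
  by move: (r ^+ l) => a a0; have := sqr_ge0 (a - 1); rewrite sqrrB1; nra.
have iF : intRn (fun y => (gs y * F (t, t') y) ^+ 2) <= (2 * K * T) ^+ 2 * A.
  rewrite -intRnZ; last exact: sFS_sq sP.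
  apply: le_intRn.
  - exact: sFS_sq (FS_sFS (t, t') (FS_gs MF 0)).
  - by apply: integrableRnZ; exact: sFS_sq sP.
  - move=> y; rewrite -exprMn -[leLHS]real_normK ?num_real// lerXn2r ?nnegrE//.
      by rewrite mulr_ge0// ?mulr_ge0// ?addr_ge0// ?exprn_ge0 ?mnorm_ge0// ltW// gs_gt0.
    by rewrite normrM (gtr0_norm (gs_gt0 _ _)) /P mulrCA ler_wpM2l// ltW// gs_gt0.
apply: (le_trans (ler_wpM2l C0 iF)).
have -> : C * ((2 * K * T) ^+ 2 * A) = C * (2 * K) ^+ 2 * A * T ^+ 2 by ring.
move: (C * _ * A) B0 => b b0; rewrite [leRHS]exprMn ler_wpM2r ?sqr_ge0//.
by rewrite sqrrD1; have := sqr_ge0 b; lra.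
Qed.

(* The difference quotients are Cauchy in L2 by the Poisson estimate, hence
   pointwise by [FS_sup]. *)
Lemma derivable_phi j x y : derivable (phi^~ y) x (e_ j).
Proof.
have [N N0 hN] := quot_diff_L2 j x.
pose dPhi (p : R * R) y := gs y * quot phi j x p.1 y - gs y * quot phi j x p.2 y.
have FD k : FS k dPhi.
  apply: (@Cls_ext _ _ _ _ _ (fun p y => gs y * quot phi j x p.1 y + (-1) * (gs y * quot phi j x p.2 y))).
    by move=> p z; rewrite mulN1r.
  apply: FSD; first exact: (FS_reindex fst (quot_FS j x k)).
  by apply: FSM; [exact: (sMS_MS _ (sMS_cst _ _ (-1 : R)))|exact: (FS_reindex snd (quot_FS j x k))].
apply/cauchy_cvgP/cauchy_exP => eps eps0.
have g0 := gs_gt0 V y; have e2 : 0 < eps * gs y / 2 by rewrite divr_gt0// mulr_gt0.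
have [C C0 hC] := FS_sup hS nrm FD e2.
(* For increments up to [d], the L2 part of [FS_sup] is below half of eps gs(y); the error term of
   [FS_sup] is the other half. *)
pose d : R := eps * gs y / 2 / (2 * (C * N) + 1).
have cn : 0 < 2 * (C * N) + 1 by rewrite ltr_wpDl// mulr_ge0// mulr_ge0.
have d0 : 0 < d by rewrite divr_gt0.
have key t t' : t != 0 -> t' != 0 -> `|t| <= d -> `|t'| <= d ->
    `|quot phi j x t y - quot phi j x t' y| < eps.
  move=> t0 t'0 td t'd; rewrite -(ltr_pM2r g0).
  have -> : `|quot phi j x t y - quot phi j x t' y| * gs y = `|dPhi (t, t') y|.
    by rewrite /dPhi -mulrBr normrM (gtr0_norm g0) mulrC.
  have M0 : 0 <= N * (`|t| + `|t'|) by rewrite mulr_ge0// addr_ge0.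
  apply: le_lt_trans (hC (t, t') _ y M0 (hN _ _ t0 t'0)) _.
  rewrite [ltRHS](splitr (eps * gs y)) ltrD2r.
  have h1 : C * (N * (`|t| + `|t'|)) <= 2 * (C * N) * d.
    have -> : 2 * (C * N) * d = C * (N * (2 * d)) by ring.
    rewrite ler_wpM2l// ler_wpM2l//; lra.
  apply: (le_lt_trans h1); rewrite /d [ltLHS]mulrA ltr_pdivrMr// mulrC ltr_pM2l//.
  by rewrite ltrDl.
exists (quot phi j x d y).
suff : \forall t \near (0 : R)^', ball (quot phi j x d y) eps (t^-1 *: (phi (t *: e_ j + x) y - phi x y)) by [].
near=> t; rewrite -ball_normE /ball_ /= distrC; apply: key.
- by near: t; exact: nbhs_dnbhs_neq.
- exact: lt0r_neq0.
- by near: t; exact: dnbhs0_le.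
- by rewrite gtr0_norm.
Unshelve. all: by end_near. Qed.

Lemma quot_phi_bounded j x : exists2 B : R, 0 <= B & forall t y, `|gs y * quot phi j x t y| <= B.
Proof.
have [M M0 hM] := FS_L2_bound (quot_FS j x 0).
have [C C0 hC] := FS_sup hS nrm (quot_FS j x) (ltr01 : 0 < 1 :> R).
exists (C * (M + 1) + 1); first by rewrite addr_ge0// mulr_ge0// addr_ge0.
move=> t y; apply: hC; first by rewrite addr_ge0.
apply: le_trans (hM t) _; clear hM; rewrite sqrrD1; have := sqr_ge0 M; lra.
Qed.

Let tk (k : nat) : R := k.+1%:R^-1.

Lemma quot_cvg (u : 'cV[R]_m -> cV -> R) j x y : derivable (u^~ y) x (e_ j) ->
  (fun k => quot u j x (tk k) y) @ \oo --> dx u j x y.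
Proof. exact: derivable_seq. Qed.

Lemma quot_f_expb j x : exists C kappa, [/\ 0 <= C, 0 <= kappa & forall t y,
  `|quot f j x t y| <= C * expR (kappa * N1 y)].
Proof. by have [C [k [C0 k0 h]]] := Cls0 (quot_MS sf x (hd j) 0); exists C, k; split. Qed.

(** For a quotient, gs times the right-hand side lies in the range of H and is orthogonal to gs
    because H gs = 0; dominated convergence passes to the derivative. *)
Lemma dx_mean0 j x : intRn (fun y => gs y * dx f j x y * gs y) = 0.
Proof.
have [C [k [C0 k0 hC]]] := quot_f_expb j x.
have cQ t : continuous (quot f j x t) by have [] := smooth_quot sf j x t [::].
have cg := continuous_gs sV.
have [i c] : integrableRn (fun y => gs y * dx f j x y * gs y) /\
    (fun l => intRn (fun y => gs y * quot f j x (tk l) y * gs y)) @ \oo -->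
      intRn (fun y => gs y * dx f j x y * gs y).
  apply: (@dominated_intRn _ _ _ _ (fun y => C * (gs y * gs y * expR (k * N1 y)))).
  - move=> l; apply: measurable_contRn => y.
    apply: (@continuousM _ _ (fun y => gs y * quot f j x (tk l) y) gs); last exact: cg.
    by apply: (@continuousM _ _ gs (quot f j x (tk l))); [exact: cg|exact: cQ].
  - move=> y; apply: cvgM; last exact: cvg_cst.
    apply: cvgM; first exact: cvg_cst.
    by apply: quot_cvg; exact: derivable_section.
  - by apply: integrableRnZ; exact: integrable_gs_exp.
  - move=> l y; have g0 := gs_gt0 V y; rewrite 2!normrM (gtr0_norm g0) mulrAC mulrC.
    by rewrite [leRHS]mulrCA mulrC ler_wpM2l// mulr_ge0// ltW.
have z l : intRn (fun y => gs y * quot f j x (tk l) y * gs y) = 0.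
  have [su [D [q hu]] eu _] := poisson1_quot j x (tk l).
  have hs k' : sFS k' (fun y => gs y * quot phi j x (tk l) y) := FS_sFS (tk l) (quot_FS j x k').
  have -> : intRn (fun y => gs y * quot f j x (tk l) y * gs y) =
      intRn (fun y => gs y * Hop W (fun z => gs z * quot phi j x (tk l) z) y).
    by apply: intRn_ext => y; rewrite (Hop_poisson1 _ (poisson1_quot _ _ _)) mulrC.
  have hg := sFS_gs sV Voo Woo MV.
  have [_ <-] := sFS_aform MV (hg 1) (hs 2); rewrite aform_sym.
  have [_ ->] := sFS_aform MV (hs 1) (hg 2).
  rewrite -[RHS](intRn0 R n); apply: intRn_ext => y.
  by rewrite /Hop laplacian_gs// addNr mulr0.
have c0 : (fun _ : nat => (0 : R)) @ \oo --> (0 : R) by exact: cvg_cst.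
by move: c; under eq_fun do rewrite z; move=> c; exact: (cvg_unique _ c c0).
Qed.

(* Self-adjointness of the Schroedinger operator, for difference quotients in x. *)
Lemma dx_symmetry j x (h u : cV -> R) : poisson1 h u ->
  sFS 0 (fun y => gs y * h y) -> (forall k, sFS k (fun y => gs y * u y)) ->
  integrableRn (fun y => gs y * dx phi j x y * (gs y * h y)) /\
  intRn (fun y => gs y * dx phi j x y * (gs y * h y)) =
  intRn (fun y => gs y * dx f j x y * (gs y * u y)).
Proof.
move=> hu Fh Fu.
have [B B0 hB] := quot_phi_bounded j x; have [C [k [C0 k0 hC]]] := quot_f_expb j x.
have Fphi t l : sFS l (fun y => gs y * quot phi j x t y) := FS_sFS t (quot_FS j x l).
have Ff t : sFS 0 (fun y => gs y * quot f j x t y) := FS_sFS t (FS_gs (quot_MS sf x (hd j)) 0).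
have [i1 c1] : integrableRn (fun y => gs y * dx phi j x y * (gs y * h y)) /\
    (fun l => intRn (fun y => gs y * quot phi j x (tk l) y * (gs y * h y))) @ \oo -->
      intRn (fun y => gs y * dx phi j x y * (gs y * h y)).
  apply: (@dominated_intRn _ _ _ _ (fun y => B * `|gs y * h y|)).
  - by move=> l; apply: measurableRnM; [exact: sFS_meas (Fphi _ 0)|exact: sFS_meas Fh].
  - move=> y; apply: cvgM; last exact: cvg_cst.
    apply: cvgM; first exact: cvg_cst.
    by apply: quot_cvg; exact: derivable_phi.
  - by apply: integrableRnZ; apply: integrableRn_norm; exact: sFS_int Fh.
  - by move=> l y; rewrite normrM ler_wpM2r.
split=> //.
have [_ c2] : integrableRn (fun y => gs y * dx f j x y * (gs y * u y)) /\
    (fun l => intRn (fun y => gs y * quot f j x (tk l) y * (gs y * u y))) @ \oo -->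
      intRn (fun y => gs y * dx f j x y * (gs y * u y)).
  (* The product is at most the sum of the squares: the quotients of [f] share one exponential
     bound, and [gs * u] is square integrable. *)
  apply: (@dominated_intRn _ _ _ _ (fun y =>
     C ^+ 2 * (gs y * gs y * expR (2 * k * N1 y)) + (gs y * u y) ^+ 2)).
  - by move=> l; apply: measurableRnM; [exact: sFS_meas (Ff _)|exact: sFS_meas (Fu 0)].
  - move=> y; apply: cvgM; last exact: cvg_cst.
    apply: cvgM; first exact: cvg_cst.
    by apply: quot_cvg; exact: derivable_section.
  - apply: integrableRnD; last exact: sFS_sq (Fu 0).
    by apply: integrableRnZ; exact: integrable_gs_exp.
  - move=> l y; have := hC (tk l) y; have g0 := gs_gt0 V y.
    rewrite -[2 * k * _]mulrA mulr_natl mulr2n expRD.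
    have := expR_gt0 (k * N1 y); move: (expR _) => E E0.
    have nM (a b c : R) : 0 < a -> `|a * b * c| = a * `|b| * `|c|.
      by move=> a0; rewrite 2!normrM (gtr0_norm a0).
    rewrite nM//.
    rewrite -[(gs y * u y) ^+ 2]real_normK ?num_real//.
    have := normr_ge0 (quot f j x (tk l) y).
    move: (`|gs y * u y|) => a; move: (`|quot _ _ _ _ _|) (gs y) g0 => q b b0 q0 hq.
    have h1 : b * q <= b * (C * E) by rewrite ler_wpM2l// ltW.
    have h2 : (b * q) ^+ 2 <= (b * (C * E)) ^+ 2.
      by rewrite lerXn2r ?nnegrE ?mulr_ge0// ltW.
    have -> : C ^+ 2 * (b * b * (E * E)) = (b * (C * E)) ^+ 2 by ring.
    have := sqr_ge0 (b * q - a); rewrite sqrrB; have := sqr_ge0 a.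
    have := sqr_ge0 (b * q); lra.
have E l : intRn (fun y => gs y * quot phi j x (tk l) y * (gs y * h y)) =
    intRn (fun y => gs y * quot f j x (tk l) y * (gs y * u y)).
  transitivity (aform V (fun y => gs y * quot phi j x (tk l) y) (fun y => gs y * u y)).
    have [_ ->] := sFS_aform MV (Fphi (tk l) 1) (Fu 2); apply: intRn_ext => y.
    by rewrite (Hop_poisson1 _ hu).
  rewrite aform_sym; have [_ ->] := sFS_aform MV (Fu 1) (Fphi (tk l) 2); apply: intRn_ext => y.
  by rewrite (Hop_poisson1 _ (poisson1_quot _ _ _)) mulrC.
move: c2; under eq_fun do rewrite -E; move=> c2; exact: (cvg_unique _ c1 c2).
Qed.

End poisson_equation.

(** * The effective coefficients *)

Lemma mnorm_entries (R : realType) p q (M : 'M[R]_(p, q)) (C : 'I_p -> 'I_q -> R) t :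
  (forall i j, `|M i j| <= C i j * t) -> mnorm M <= (\sum_i \sum_j C i j) * t.
Proof.
move=> hM; apply: le_trans (mnorm_le_sum M) _; rewrite big_distrl /=.
by apply: ler_sum => i _; rewrite big_distrl /=; apply: ler_sum => j _; exact: hM.
Qed.

Section coefficients.
Variables (R : realType) (m n p : nat) (V : 'cV[R]_n -> R).
Variables (f : 'cV[R]_m -> 'cV[R]_n -> 'cV[R]_m) (alpha : 'cV[R]_m -> 'cV[R]_n -> 'M[R]_(m, p)).
Variables (hyp : standing_hypotheses V f alpha).
Variables (hA : assumptionA V) (hC : assumptionC f alpha).
Variable phi : 'cV[R]_m -> 'cV[R]_n -> 'cV[R]_m.
Variable hphi : forall x, poisson_solution V (f x) (phi x).
Local Notation cV := 'cV[R]_n.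
Local Notation gs := (ground_state V).
Local Notation fi i := (fun (x : 'cV[R]_m) (y : cV) => f x y i 0).
Local Notation phii i := (fun (x : 'cV[R]_m) (y : cV) => phi x y i 0).

Let sV : smooth V. Proof. by case: hyp => -[[]]. Qed.
Let Voo : V @ at_infty --> +oo. Proof. by case: hyp => -[[]]. Qed.
Let Woo : Wpot V @ at_infty --> +oo. Proof. by case: hyp => -[_ []]. Qed.
Let MV : forall k, sMS k V. Proof. exact: assumptionA_MS. Qed.

Let sf i : smooth (fun z : 'cV[R]_(m + n) => fi i (usubmx z) (dsubmx z)).
Proof. by case: hyp => -[_ _ []]. Qed.

Let expb_f i a : expb (fun x => mderiv a (fi i x)).
Proof.
have [hC1 _] := hC; have [C [l [C0 h]]] := hC1 a.
apply: (@expb_poly _ _ _ _ C l (ltW C0)) => x y; apply: le_trans (h x y).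
have -> : mderiv a (fi i x) y = mxderiv a (f x) y i 0 by rewrite mxE.
by apply: le_trans (entry_le_mnorm _ _ _) _; rewrite lerDl mnorm_ge0.
Qed.

Let dx_gradx i j x : dx (fi i) j x = fun y => gradx f x y i j.
Proof. by apply/funext => y; rewrite mxE. Qed.

Let expb_dxf i j a : expb (fun x => mderiv a (dx (fi i) j x)).
Proof.
have [hC1 _] := hC; have [C [l [C0 h]]] := hC1 a.
apply: (@expb_poly _ _ _ _ C l (ltW C0)) => x y; apply: le_trans (h x y).
have -> : mderiv a (dx (fi i) j x) y = mxderiv a (gradx f x) y i j by rewrite mxE dx_gradx.
by apply: le_trans (entry_le_mnorm _ _ _) _; rewrite lerDr mnorm_ge0.
Qed.

Let dxx_le i : exists (K : R) l, 0 <= K /\ forall j x y,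
  `|pderiv j (pderiv j ((fi i)^~ y)) x| <= K * (1 + mnorm y ^+ l).
Proof.
case: hyp => _ [_ _ [m1 [m2 [m3 [K [[_ _ _ K0] h]]]]]]; exists K, m2; split; first exact: ltW.
move=> j x y; have [_ + _] := h x y; apply: le_trans.
apply: (@le_trans _ _ (norm_gradx2 f x y)); last by rewrite lerDr mnorm_ge0.
rewrite -sqrtr_sqr ler_wsqrtr//.
have le1 (I : finType) (F : I -> R) k : (forall j, 0 <= F j) -> F k <= \sum_j F j.
  by move=> F0; rewrite (bigD1 k)//= lerDl sumr_ge0.
pose G i0 j0 k0 := pderiv k0 (pderiv j0 (fun x' : 'cV[R]_m => f x' y i0 0)) x ^+ 2.
have G0 i0 j0 k0 : 0 <= G i0 j0 k0 := sqr_ge0 _.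
apply: le_trans (le1 _ (G i j) j (G0 i j)) _.
apply: le_trans (le1 _ (fun j0 => \sum_k0 G i j0 k0) j _) _; first by move=> j0; exact: sumr_ge0.
apply: (le1 _ (fun i0 => \sum_j0 \sum_k0 G i0 j0 k0) i) => i0.
by apply: sumr_ge0 => j0 _; exact: sumr_ge0.
Qed.

Let pf i x : poisson1 V (fi i x) (phii i x).
Proof.
have [s1 _ [C [l h]] e1 h2] := hphi x; split => //.
- by exists C, l => y; apply: le_trans (h y); exact: entry_le_mnorm.
- by have := congr1 (fun M : 'cV[R]_m => M i 0) h2; rewrite !mxE => <-; apply: intRn_ext => y; rewrite mxE.
Qed.

Let Mf i : forall k, MS k (fi i).
Proof. by apply: MS_mderiv => [x|a]; [exact: smooth_section (sf i) x|exact: expb_f]. Qed.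

Let Ff i k : FS k (fun x y => gs y * fi i x y).
Proof. exact: FS_gs. Qed.

Let Fdf i j k : FS k (fun x y => gs y * dx (fi i) j x y).
Proof.
apply: FS_gs => //; apply: MS_mderiv => [x|a]; last exact: expb_dxf.
exact: smooth_dx (sf i) j x.
Qed.

Let Fphi i k : FS k (fun x y => gs y * phii i x y).
Proof.
by have [C _ h] := poisson1_regularity sV Voo Woo MV; have [] := h _ _ _ (pf i) (Mf i).
Qed.

Let mean_f i x : intRn (fun y => gs y * fi i x y * gs y) = 0.
Proof.
case: hyp => -[_ _ [_ + _]] _ => /(_ x)/(congr1 (fun M : 'cV[R]_m => M i 0)).
by rewrite !mxE => <-; apply: intRn_ext => y; rewrite mxE expNV mulrAC.
Qed.

Variables (mu : cV) (S : 'M[R]_n) (cG : R).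
Variable hS : S \in unitmx.
Local Notation e := (ef S mu cG).
Variable nrm : intRn (fun y => e (mi0 n) y ^+ 2) = 1.

Let Wle := assumptionA_Wpot sV Woo mu hS hA.

Let fcoefE x b j : fcoef V f e x b j 0 = intRn (fun y => e b y * (gs y * fi j x y)).
Proof. by rewrite mxE; apply: intRn_ext => y; rewrite mxE mulrA. Qed.

(** One scalar entry of either coefficient: [h] is a component of f or of its derivative in [x],
    paired in both cases with a component of phi. *)
Let coefficient_error (h : 'cV[R]_m -> cV -> R) j s :
  (forall k, FS k (fun x y => gs y * h x y)) ->
  (forall x, intRn (fun y => gs y * h x y * gs y) = 0) ->
  exists C, 0 <= C /\ forall x d (c : multi n -> R), galerkin_solution V e d (h x) c ->
    `|\sum_(a <- midx n d) \sum_(b <- midx n d) L2inner (e a) (e b) * (c a * fcoef V f e x b j 0) -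
      intRn (fun y => gs y * h x y * (gs y * phii j x y))| <= C * d.+1%:R ^- s.
Proof.
move=> Fh mh.
have [C C0 hCC] := galerkin_error hS nrm sV Voo Woo MV Wle s Fh mh (Fphi j)
  (fun x y => Hop_poisson1 sV y (pf j x)).
by exists C; split => // x d c gal; apply: hCC => // b; exact: fcoefE.
Qed.

(** The Galerkin limit has the derivative in [x] on f, while the exact drift has it on phi;
    [dx_symmetry] exchanges them entry by entry. *)
Lemma drift_error s : exists C, 0 <= C /\ forall d x (dpsi : multi n -> 'M[R]_m),
  (forall i j, galerkin_solution V e d (fun y => gradx f x y i j) (fun a => dpsi a i j)) ->
  mnorm (drift_approx V f e d dpsi x - drift V f phi x) <= C * d.+1%:R ^- s.
Proof.
have mean_dx i j x := dx_mean0 sV Voo Woo MV (sf i) (pf i) (expb_dxf i) j x.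
have /choice[C hCC] (ij : 'I_m * 'I_m) := coefficient_error ij.2 s
  (Fdf ij.1 ij.2) (mean_dx ij.1 ij.2).
exists (\sum_(i < m) \sum_(k < 1) \sum_j C (i, j)); split.
  by apply: sumr_ge0 => i _; apply: sumr_ge0 => k _; apply: sumr_ge0 => j _; have [] := hCC (i, j).
move=> d x dpsi gal; apply: (mnorm_entries (C := fun i _ => \sum_j C (i, j))) => i k.
rewrite ord1 {k} big_distrl /=.
pose E a b j := L2inner (e a) (e b) * (dpsi a i j * fcoef V f e x b j 0).
have E1 : drift_approx V f e d dpsi x i 0 =
    \sum_j \sum_(a <- midx n d) \sum_(b <- midx n d) E a b j.
  rewrite summxE exchange_big /=; apply: eq_bigr => a _.
  rewrite summxE exchange_big /=; apply: eq_bigr => b _.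
  by rewrite !mxE big_distrr.
have sym j := dx_symmetry sV Voo Woo MV hS nrm (sf i) (pf i) (expb_dxf i) (dxx_le i) j x
  (pf j x) (FS_sFS x (Ff j 0)) (fun k => FS_sFS x (Fphi j k)).
have E2 : drift V f phi x i 0 =
    \sum_j intRn (fun y => gs y * dx (fi i) j x y * (gs y * phii j x y)).
  have <- : \sum_j intRn (fun y => gs y * dx (phii i) j x y * (gs y * fi j x y)) =
     \sum_j intRn (fun y => gs y * dx (fi i) j x y * (gs y * phii j x y)).
    by apply: eq_bigr => j _; have [] := sym j.
  rewrite -intRn_sum; last by move=> j; have [] := sym j.
  rewrite mxE; apply: intRn_ext => y; rewrite !mxE big_distrr; apply: eq_bigr => j _ /=.
  by rewrite expNV mxE -!mulrA; congr (_ * _); rewrite mulrCA.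
rewrite mxE [X in _ + X]mxE E1 E2 -sumrB; apply: le_trans (ler_norm_sum _ _ _) _.
apply: ler_sum => j _; have [_ h] := hCC (i, j); apply: h.
by have := gal i j; rewrite /= dx_gradx.
Qed.

(** Needed to split the exact diffusion into its three integrals, the first of which cancels against
    the approximate one. *)
Lemma integrable_alpha x i j :
  integrableRn (fun y => expR (- V y) * (alpha x y *m (alpha x y)^T) i j).
Proof.
have [_ [K [m3 [K0 _ hK]]]] := hC; case: hyp => _ [ma _ _].
have [C C0 hl] := poly_le_exp R m3.
have -> : (fun y => expR (- V y) * (alpha x y *m (alpha x y)^T) i j) =
   fun y => \sum_k expR (- V y) * (alpha x y i k * alpha x y j k).
  by apply/funext => y; rewrite mxE big_distrr; apply: eq_bigr => k _; rewrite mxE.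
apply: integrableRn_sum => k.
have cE : continuous (fun y => expR (- V y)).
  have -> : (fun y => expR (- V y)) = fun y => gs y * gs y by apply/funext => y; exact: expNV.
  by move=> y; apply: (@continuousM _ _ gs gs); exact: continuous_gs.
apply: (@integrableRn_le _ _ _ (fun y => (K * C) ^+ 2 * (gs y * gs y * expR (2 * N1 y)))).
- by apply: measurableRnM; [exact: measurable_contRn|apply: measurableRnM; exact: ma].
- move=> y.
  have hb i' : `|alpha x y i' k| <= K * C * expR (N1 y).
    apply: le_trans (entry_le_mnorm _ _ _) _; apply: le_trans (hK x y) _.
    rewrite -mulrA ler_wpM2l ?(ltW K0)//; apply: le_trans (hl _ (mnorm_ge0 _)) _.
    by rewrite ler_wpM2l// ler_expR mnorm_le_N1.
  rewrite expNV normrM ger0_norm; last by rewrite mulr_ge0// ltW// gs_gt0.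
  have -> : (K * C) ^+ 2 * (gs y * gs y * expR (2 * N1 y)) =
      gs y * gs y * (K * C * expR (N1 y) * (K * C * expR (N1 y))).
    by rewrite mulr_natl mulr2n expRD; move: (expR _) => E; ring.
  by rewrite ler_wpM2l ?mulr_ge0 ?(ltW (gs_gt0 _ _))// normrM ler_pM.
- by apply: integrableRnZ; exact: integrable_gs_exp.
Qed.

Lemma diffusion_error s : exists C, 0 <= C /\ forall d x (psi : multi n -> 'cV[R]_m),
  (forall i, galerkin_solution V e d (fun y => f x y i 0) (fun a => psi a i 0)) ->
  mnorm (diffusion_approx V f alpha e d psi x - diffusion V f phi alpha x) <= C * d.+1%:R ^- s.
Proof.
have /choice[C hCC] (ij : 'I_m * 'I_m) := coefficient_error ij.2 s (Ff ij.1) (mean_f ij.1).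
have C0 ij : 0 <= C ij by have [] := hCC ij.
exists (\sum_(i < m) \sum_(j < m) (C (i, j) + C (j, i))); split.
  by apply: sumr_ge0 => i _; apply: sumr_ge0 => j _; rewrite addr_ge0.
move=> d x psi gal; apply: (mnorm_entries (C := fun i j => C (i, j) + C (j, i))) => i j.
pose T i j := \sum_(a <- midx n d) \sum_(b <- midx n d)
  L2inner (e a) (e b) * (psi a i 0 * fcoef V f e x b j 0).
pose L i j := intRn (fun y => gs y * fi i x y * (gs y * phii j x y)).
have AE i' j' : A0_approx V f e d psi x i' j' = T i' j'.
  rewrite summxE; apply: eq_bigr => a _; rewrite summxE; apply: eq_bigr => b _.
  by rewrite mxE [X in _ * X]mxE big_ord1 [X in _ * (_ * X)]mxE.
have iL i' j' : integrableRn (fun y => gs y * fi i' x y * (gs y * phii j' x y)).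
  exact: sFS_mul (FS_sFS x (Ff i' 0)) (FS_sFS x (Fphi j' 0)).
(* The terms in [alpha] cancel; what remains is the error of the entry (i, j) and that of its
   transpose. *)
have -> : (diffusion_approx V f alpha e d psi x - diffusion V f phi alpha x) i j =
    (T i j - L i j) + (T j i - L j i).
  rewrite mxE [X in _ + X]mxE.
  have -> : diffusion V f phi alpha x i j =
      intRn (fun y => expR (- V y) * (alpha x y *m (alpha x y)^T) i j) + (L i j + L j i).
    rewrite -intRnD// -intRnD; [|exact: integrable_alpha|exact: integrableRnD].
    rewrite mxE; apply: intRn_ext => y; rewrite !mxE !big_ord1 !mxE expNV.
    move: (\sum_k _) (gs y) => A g; ring.
  rewrite /diffusion_approx mxE mxE [X in _ + X - _]mxE AE AE [X in X + _ + _ - _]mxE.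
  have -> : intRn (fun y => (expR (- V y) *: (alpha x y *m (alpha x y)^T)) i j) =
     intRn (fun y => expR (- V y) * (alpha x y *m (alpha x y)^T) i j).
    by apply: intRn_ext => y; rewrite mxE.
  move: (intRn _) (T i j) (T j i) (L i j) (L j i) => a b c b' c'; ring.
rewrite mulrDl; apply: le_trans (ler_normD _ _) _; apply: lerD.
  by have [_ h] := hCC (i, j); apply: h; exact: gal.
by have [_ h] := hCC (j, i); apply: h; exact: gal.
Qed.

End coefficients.

Theorem theorem4p3 (R : realType) (m n p q q' : nat)
  (V : 'cV[R]_n -> R)
  (f : 'cV[R]_m -> 'cV[R]_n -> 'cV[R]_m)
  (alpha : 'cV[R]_m -> 'cV[R]_n -> 'M[R]_(m, p))
  (hyp : standing_hypotheses V f alpha)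
  (hA : assumptionA V) (hB : assumptionB V f) (hC : assumptionC f alpha)
  (phi : 'cV[R]_m -> 'cV[R]_n -> 'cV[R]_m)
  (hphi : forall x, poisson_solution V (f x) (phi x))
  (A : 'cV[R]_m -> 'M[R]_(m, q))
  (hAx : forall x, A x *m (A x)^T = diffusion V f phi alpha x)
  (mu : 'cV[R]_n) (Sigma Q L : 'M[R]_n)
  (hSigma : is_covariance Sigma Q L)
  (psi : nat -> 'cV[R]_m -> multi n -> 'cV[R]_m)
  (hpsi : forall d x i,
     galerkin_solution V (hermite_fun mu Sigma Q L) d
       (fun y => f x y i 0) (fun a => psi d x a i 0))
  (dpsi : nat -> 'cV[R]_m -> multi n -> 'M[R]_m)
  (hdpsi : forall d x i j,
     galerkin_solution V (hermite_fun mu Sigma Q L) d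
       (fun y => gradx f x y i j) (fun a => dpsi d x a i j))
  (Ad : nat -> 'cV[R]_m -> 'M[R]_(m, q'))
  (hAd : forall d x, Ad d x *m (Ad d x)^T =
     diffusion_approx V f alpha (hermite_fun mu Sigma Q L) d (psi d x) x) :
  forall s : nat, exists Ds : R, forall d : nat, (1 <= d)%N ->
    (ereal_sup (range (fun x : 'cV[R]_m =>
       (Num.max
         (mnorm (drift_approx V f (hermite_fun mu Sigma Q L) d (dpsi d x) x
                 - drift V f phi x))
         (mnorm (Ad d x *m (Ad d x)^T - A x *m (A x)^T)))%:E))
     <= (Ds * d%:R ^- s)%:E)%E.
Proof.
move=> s; have [S [cG [hS hE nrm]]] := hermite_fun_ef mu hSigma.
(* From here on the basis is [ef] in the frame S = Q L^(1/2), with [nrm] as its normalization. *)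
rewrite hE in hpsi hdpsi hAd *.
have [C1 [C10 h1]] := drift_error hyp hA hC hphi hS nrm s.
have [C2 [C20 h2]] := diffusion_error hyp hA hC hphi hS nrm s.
exists (C1 + C2) => d d1; apply: ge_ereal_sup => _ [x _ <-]; rewrite lee_fin.
(* The estimates are in powers of d + 1, which makes sense at d = 0 too; the stated rate is in
   powers of [d], at least 1. *)
have dd : d.+1%:R ^- s <= d%:R ^- s :> R.
  by rewrite lef_pV2 ?posrE ?exprn_gt0 ?ltr0n// lerXn2r ?nnegrE// ler_nat.
have dd0 : 0 <= d%:R ^- s :> R by rewrite invr_ge0 exprn_ge0.
rewrite ge_max mulrDl; apply/andP; split.
  apply: le_trans (h1 d x _ (hdpsi d x)) _.
  by rewrite (le_trans (ler_wpM2l C10 dd))// lerDl mulr_ge0.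
rewrite hAd hAx; apply: le_trans (h2 d x _ (hpsi d x)) _.
by rewrite (le_trans (ler_wpM2l C20 dd))// lerDr mulr_ge0.
Qed.
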